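(* Let $\Omega\subset\mathbb R^N$ be an open domain with a compact (possibly empty) $C^2$ boundary, $T>0$, $Q_T^\Omega=\Omega\times(0,T)$, $\alpha>-1$ and $1<q<q_{\alpha,N}:=1+\frac{2(1+\alpha)}{N}$. Let $u\in C^{2,1}(Q_T^\Omega)$ be a positive solution of $$\partial_tu-\Delta u+t^\alpha|u|^{q-1}u=0\quad\text{in }Q_T^\Omega$$ with initial trace $(\mathcal S,\mu)$. Then for every $a\in\mathcal S$, $$u(x,t)\ge u_{\infty,a}(x,t)\qquad\forall(x,t)\in Q_T^\Omega,$$ where $u_{\infty,a}=\lim_{k\to\infty}u_{k\delta_a}$ and $u_{k\delta_a}$ is the solution of the equation in $Q_T^\Omega$ with initial trace $k\delta_a$ which vanishes on $\partial\Omega\times[0,T]$.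
   Context: Initial trace: a nonnegative $u\in C(Q_T^\Omega)$ has initial trace $(\mathcal S,\mu)$, where $\mathcal S\subset\Omega$ is relatively closed and $\mu$ is a positive Radon measure on $\mathcal R:=\Omega\setminus\mathcal S$, if $\lim_{t\to0}\int_{\mathcal R}u(x,t)\zeta(x)dx=\int_{\mathcal R}\zeta\,d\mu$ for all $\zeta\in C_c(\mathcal R)$, and $\lim_{t\to0}\int_Uu(x,t)dx=\infty$ for every open $U\subset\Omega$ with $U\cap\mathcal S\ne\emptyset$. For $k>0$, $u_{k\delta_a}$ is the unique nonnegative function in $L^q(Q_T^\Omega;t^\alpha dxdt)\cap L^1(Q_T^\Omega)$ such that $\iint_{Q_T^\Omega}\big(-u(\partial_t\zeta+\Delta\zeta)+t^\alpha u^q\zeta\big)dxdt=k\zeta(a)$ for all $\zeta\in C^{1,1;1}(\overline{Q_T^\Omega})$ (i.e. $C^{1,1}$ in $x$, $C^1$ in $t$) vanishing on $\partial\Omega\times[0,T]$ and on $\Omega\times\{T\}$. The family $u_{k\delta_a}$ is increasing in $k$. *)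

(* Defs.v *)
From HB Require Import structures.
From mathcomp Require Import all_boot all_order all_algebra.
From mathcomp Require Import all_classical all_reals all_analysis.
From mathcomp Require Import measurable_realfun.

Set Implicit Arguments.
Unset Strict Implicit.
Unset Printing Implicit Defensive.

Import Order.TTheory GRing.Theory Num.Theory.
Import numFieldNormedType.Exports.

Local Open Scope classical_set_scope.
Local Open Scope ring_scope.

Definition rV_display : measure_display := default_measure_display.

Section rV_borel.
Context {R : realType} {n : nat}.
Let T := 'rV[R]_n.

Let borel0 : <<s @open T >> set0. Proof. exact: sigma_algebra0. Qed.
Let borelC A : <<s @open T >> A -> <<s @open T >> (~` A).
Proof. exact: sigma_algebraC. Qed.
Let borelU (F : (set T)^nat) : (forall i, <<s @open T >> (F i)) ->
  <<s @open T >> (\bigcup_i F i).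
Proof. exact: sigma_algebra_bigcup. Qed.

HB.instance Definition _ := @isMeasurable.Build rV_display 'rV[R]_n
  <<s @open T >> borel0 borelC borelU.
End rV_borel.

Definition open_box (R : realType) n (a b : 'I_n -> R) : set 'rV[R]_n :=
  [set x | forall i, a i < x ord0 i < b i].

Lemma open_bigcup_box (R : realType) n (U : set 'rV[R]_n) : open U ->
  U = \bigcup_(q in [set q : {ffun 'I_n -> rat * rat} |
         open_box (fun i => ratr (q i).1) (fun i => ratr (q i).2) `<=` U])
       open_box (fun i => ratr (q i).1) (fun i => ratr (q i).2).
Proof.
move=> oU; apply/seteqP; split => [x Ux|x [q qU qx]]; last exact: qU.
have /nbhs_ballP[e /= e0 eU] : nbhs x U by exact: open_nbhs_nbhs.
have /choice[f fP] (i : 'I_n) : exists q : rat * rat,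
    x ord0 i - e < ratr q.1 < x ord0 i /\ x ord0 i < ratr q.2 < x ord0 i + e.
  have /rat_in_itvoo[p] : x ord0 i - e < x ord0 i by rewrite ltrBlDr ltrDl.
  have /rat_in_itvoo[q] : x ord0 i < x ord0 i + e by rewrite ltrDl.
  by rewrite !in_itv/= => ? ?; exists (p, q).
exists [ffun i => f i] => [y yP|i]; last first.
  by rewrite !ffunE; have [/andP[_ ->] /andP[->]] := fP i.
apply: eU; split => // k i; rewrite ord1; move: (yP i); rewrite !ffunE.
have [/andP[h1 h2] /andP[h3 h4]] := fP i.
move=> /andP[h5 h6]; rewrite /ball/= ltr_distlC.
by rewrite (lt_trans h1)//= (lt_trans h6).
Qed.

Lemma measurable_coord (R : realType) n (i : 'I_n) :
  measurable_fun [set: 'rV[R]_n]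
    ((fun x => x ord0 i) : 'rV[R]_n -> measurableTypeR R).
Proof.
apply: (measurability (@open R)).
  rewrite /measurable/=; apply/seteqP; split.
    apply: smallest_sub; first exact: smallest_sigma_algebra.
    move=> _ [[a b] _ <-]/=.
    have -> : `]a, b]%classic = ~` (~` `]a, +oo[%classic `|` `]b, +oo[%classic).
      apply/seteqP; split => x /=; rewrite !in_itv/= !andbT.
        move=> /andP[ax xb] [/negP|]; first by rewrite ax.
        by rewrite ltNge xb.
      move=> /not_orP[/contrapT -> /negP]; by rewrite -leNgt.
    apply: sigma_algebraC; rewrite -bigcup2E; apply: sigma_algebra_bigcup.
    case=> [|[|k]]/=.
    - by apply: sigma_algebraC; apply: sub_sigma_algebra; exact: interval_open.
    - by apply: sub_sigma_algebra; exact: interval_open.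
    - exact: sigma_algebra0.
  apply: smallest_sub; first exact: sigma_algebra_measurable.
  exact: open_measurable.
move=> _ [A oA <-]; rewrite setTI; apply: sub_sigma_algebra.
by move/continuousP: (@coord_continuous R 1 n ord0 i); exact.
Qed.

Lemma measurable_open_box (R : realType) n (a b : 'I_n -> R) :
  measurable (open_box a b).
Proof.
rewrite (_ : open_box _ _ = \bigcap_(i in [set: 'I_n])
    ((fun x : 'rV[R]_n => x ord0 i) @^-1` `](a i), (b i)[%classic)); last first.
  apply/seteqP; split => [x xq i _ /=|x xq i]; first by rewrite in_itv/= xq.
  by have := xq i Logic.I; rewrite /= in_itv.
apply: fin_bigcap_measurable => // i _.
by rewrite -[X in measurable X]setTI; apply: measurable_coord.
Qed.

Lemma measurable_fun_rVP d (T : measurableType d) (R : realType) n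
    (f : T -> 'rV[R]_n) :
  (forall i, measurable_fun setT
     ((fun t => f t ord0 i) : T -> measurableTypeR R)) ->
  measurable_fun setT f.
Proof.
move=> mf; apply: (measurability (@open 'rV[R]_n)) => // _ [U oU <-].
rewrite setTI (open_bigcup_box oU) preimage_bigcup bigcup_mkcond.
apply: countable_bigcupT_measurable => [|q]; first exact: countableP.
case: ifPn => // _.
rewrite (_ : _ @^-1` _ = \bigcap_(i in [set: 'I_n]) ((fun t => f t ord0 i) @^-1`
    `](ratr (q i).1), (ratr (q i).2)[%classic)); last first.
  apply/seteqP; split => [t tq i _ /=|t tq i]; first by rewrite in_itv/= tq.
  by have := tq i Logic.I; rewrite /= in_itv.
apply: fin_bigcap_measurable => // i _.
by rewrite -[X in measurable X]setTI; apply: mf => //; exact: measurable_itv.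
Qed.

Definition consrV (R : realType) n (p : measurableTypeR R * 'rV[R]_n) :
    'rV[R]_n.+1 :=
  \row_i (if unlift ord0 i is Some j then p.2 ord0 j else p.1 : R).

Lemma consrV0 (R : realType) n (p : measurableTypeR R * 'rV[R]_n) :
  consrV p ord0 ord0 = p.1.
Proof. by rewrite mxE unlift_none. Qed.

Lemma consrVS (R : realType) n (p : measurableTypeR R * 'rV[R]_n) i :
  consrV p ord0 (lift ord0 i) = p.2 ord0 i.
Proof. by rewrite mxE liftK. Qed.

Lemma measurable_consrV (R : realType) n :
  measurable_fun setT (@consrV R n).
Proof.
apply: measurable_fun_rVP => i; case: (unliftP ord0 i) => [j|] ->.
  under eq_fun do rewrite consrVS.
  exact: (measurableT_comp (measurable_coord j)).
under eq_fun do rewrite consrV0.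
exact: measurable_fst.
Qed.

Definition unconsrV (R : realType) n (x : 'rV[R]_n.+1) :
    measurableTypeR R * 'rV[R]_n := (x ord0 ord0, \row_i x ord0 (lift ord0 i)).

Lemma measurable_unconsrV (R : realType) n :
  measurable_fun setT (@unconsrV R n).
Proof.
apply: measurable_fun_pair; first exact: measurable_coord.
apply: measurable_fun_rVP => i.
by under eq_fun do rewrite mxE; exact: measurable_coord.
Qed.

Lemma consrVK (R : realType) n : cancel (@consrV R n) (@unconsrV R n).
Proof.
move=> [a y]; rewrite /unconsrV consrV0; congr pair.
by apply/rowP => i; rewrite mxE consrVS.
Qed.

Lemma unconsrVK (R : realType) n : cancel (@unconsrV R n) (@consrV R n).
Proof.
move=> x; apply/rowP => i; case: (unliftP ord0 i) => [j|] ->.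
  by rewrite consrVS mxE.
by rewrite consrV0.
Qed.

Section leb_step.
Context {R : realType} {n : nat}.
Variable m : {sigma_finite_measure set 'rV[R]_n -> \bar R}.

Definition leb_step : set 'rV[R]_n.+1 -> \bar R :=
  pushforward (lebesgue_measure \x m)%E (@consrV R n).

Let leb_step0 : leb_step set0 = 0%E.
Proof. by rewrite /leb_step /pushforward preimage_set0 measure0. Qed.

Let leb_step_ge0 A : (0 <= leb_step A)%E.
Proof. by rewrite /leb_step /pushforward measure_ge0. Qed.

Let leb_step_sigma_additive : semi_sigma_additive leb_step.
Proof.
move=> F mF tF mUF; rewrite /leb_step /pushforward preimage_bigcup.
have mc B : measurable B -> measurable (@consrV R n @^-1` B).
  by move=> mB; rewrite -[X in measurable X]setTI; exact: measurable_consrV.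
apply: measure_semi_sigma_additive.
- by move=> k; exact: mc.
- apply/trivIsetP => /= i j _ _ ij; rewrite -preimage_setI.
  by move/trivIsetP : tF => /(_ _ _ _ _ ij) ->//; rewrite preimage_set0.
- by rewrite -preimage_bigcup; exact: mc.
Qed.

HB.instance Definition _ := isMeasure.Build _ _ _ leb_step
  leb_step0 leb_step_ge0 leb_step_sigma_additive.

Let leb_step_sigma_finite : sigma_finite setT leb_step.
Proof.
have /sigma_finiteP[F [TF ndF Foo]] :=
  sigma_finiteT (@lebesgue_measure R).
have /sigma_finiteP[G [TG ndG Goo]] := sigma_finiteT m.
exists (fun k => @unconsrV R n @^-1` (F k `*` G k)) => [|k].
  rewrite -preimage_bigcup (_ : \bigcup_k _ = setT) ?preimage_setT//.
  rewrite -subTset => -[x y] _.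
  have [i _ Fix] : (\bigcup_i F i) x by rewrite -TF.
  have [k _ Gky] : (\bigcup_i G i) y by rewrite -TG.
  exists (maxn i k) => //; split.
  - by move: x Fix; exact/subsetPset/ndF/leq_maxl.
  - by move: y Gky; exact/subsetPset/ndG/leq_maxr.
have [mF Fk] := Foo k; have [mG Gk] := Goo k; split.
  rewrite -[X in measurable X]setTI; apply: measurable_unconsrV => //.
  exact: measurableX.
rewrite /leb_step /pushforward -comp_preimage.
rewrite (_ : _ \o _ = id); last by apply/funext => p /=; rewrite consrVK.
by rewrite preimage_id product_measure1E// lte_mul_pinfty// ge0_fin_numE.
Qed.

HB.instance Definition _ := Measure_isSigmaFinite.Build _ _ _ leb_step
  leb_step_sigma_finite.

End leb_step.

Lemma dirac_sigma_finite (R : realType) n (a : 'rV[R]_n) :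
  sigma_finite setT (@dirac _ _ a R).
Proof.
by apply: fin_num_fun_sigma_finite; rewrite ?measure0// => U mU; exact: fin_num_measure.
Qed.

(* Lebesgue measure on R^n, as the n-fold product of the one-dimensional one;
   `leb_box` characterizes it. *)
Fixpoint leb (R : realType) n : {sigma_finite_measure set 'rV[R]_n -> \bar R} :=
  match n with
  | 0%N => @dirac _ 'rV[R]_0 0 R
  | n'.+1 => leb_step (leb R n')
  end.

Lemma leb_box (R : realType) n (a b : 'I_n -> R) : (forall i, a i <= b i) ->
  leb R n (open_box a b) = (\prod_(i < n) (b i - a i))%:E.
Proof.
elim: n a b => [|n IH] a b ab.
  rewrite big_ord0 /= diracE mem_set//; by case.
rewrite /= /leb_step /pushforward.
rewrite (_ : _ @^-1` _ = `](a ord0), (b ord0)[%classic `*`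
    open_box (fun i => a (lift ord0 i)) (fun i => b (lift ord0 i))); last first.
  apply/seteqP; split => p /=.
    move=> h; rewrite in_itv/=; split; first by have := h ord0; rewrite consrV0.
    by move=> i; have := h (lift ord0 i); rewrite consrVS.
  rewrite in_itv/= => -[h0 h] i; case: (unliftP ord0 i) => [j|] ->.
    by rewrite consrVS; exact: h.
  by rewrite consrV0.
rewrite product_measure1E//=; last first.
  exact: measurable_open_box.
rewrite IH// lebesgue_measure_itv/= lte_fin big_ord_recl EFinM.
have [ab0|] := ltP (a ord0) (b ord0); first by rewrite EFinB.
by move=> ba; rewrite (le_anti (introT andP (conj ba (ab ord0)))) subrr !mul0e.
Qed.

Section domains.
Context {R : realType} {N : nat}.
Implicit Types (Omega A : set 'rV[R]_N) (T : R).

Definition boundary A : set 'rV[R]_N := closure A `\` interior A.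

Definition basis_vec (i : 'I_N) : 'rV[R]_N := delta_mx ord0 i.

Definition partial (i : 'I_N) (f : 'rV[R]_N -> R) : 'rV[R]_N -> R :=
  fun x => 'D_(basis_vec i) f x.

Definition laplacian (f : 'rV[R]_N -> R) : 'rV[R]_N -> R :=
  fun x => \sum_(i < N) partial i (partial i f) x.

Definition cylinder Omega T : set ('rV[R]_N * R) := Omega `*` `]0, T[.

Definition closed_cylinder Omega T : set ('rV[R]_N * R) :=
  closure Omega `*` `[0, T].

Definition spacetime_leb :
    {measure set ('rV[R]_N * measurableTypeR R)%type -> \bar R} :=
  (leb R N \x lebesgue_measure)%E.
End domains.

Definition class_C2 (R : realType) m (g : 'rV[R]_m -> R) : Prop :=
  continuous g /\
  forall i, [/\ forall x, derivable g x (basis_vec i),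
    continuous (partial i g) &
    forall j, (forall x, derivable (partial i g) x (basis_vec j)) /\
      continuous (partial j (partial i g))].

(* Near each boundary point, up to choosing an axis `i` and its orientation,
   the domain lies strictly above the graph of a C^2 function of the other
   coordinates `col' i x`. *)
Definition C2_boundary (R : realType) N (Omega : set 'rV[R]_N) : Prop :=
  forall p, boundary Omega p ->
  exists (i : 'I_N) (s : bool) (g : 'rV[R]_N.-1 -> R), class_C2 g /\
    \forall x \near p, Omega x <-> 0 < (-1) ^+ s * (x ord0 i - g (col' i x)).

Definition class_C21 (R : realType) N (Omega : set 'rV[R]_N) (T : R)
    (u : 'rV[R]_N -> R -> R) : Prop :=
  let Q := cylinder Omega T in
  [/\ {within Q, continuous (fun p => u p.1 p.2)},
      (forall p, Q p -> derivable (u p.1) p.2 1) /\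
        {within Q, continuous (fun p => derive1 (u p.1) p.2)},
      forall i, (forall p, Q p -> derivable (u^~ p.2) p.1 (basis_vec i)) /\
        {within Q, continuous (fun p => partial i (u^~ p.2) p.1)} &
      forall i j,
        (forall p, Q p ->
          derivable (partial i (u^~ p.2)) p.1 (basis_vec j)) /\
        {within Q, continuous (fun p => partial j (partial i (u^~ p.2)) p.1)}].

Definition absorption_heat_eq (R : realType) N (Omega : set 'rV[R]_N)
    (T alpha q : R) (u : 'rV[R]_N -> R -> R) : Prop :=
  forall x t, Omega x -> 0 < t < T ->
  derive1 (u x) t - laplacian (u^~ t) x
    + t `^ alpha * `|u x t| `^ (q - 1) * u x t = 0.

(* A Radon measure on the open set `A`, encoded as a Borel measure on R^N
   carried by `A`. *)
Definition radon_on (R : realType) N (A : set 'rV[R]_N)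
    (mu : {measure set 'rV[R]_N -> \bar R}) : Prop :=
  [/\ forall K, compact K -> K `<=` A -> (mu K < +oo)%E,
      forall B, measurable B -> B `<=` A ->
        mu B = ereal_sup [set mu K | K in [set K | compact K /\ K `<=` B]] &
      mu (~` A) = 0%E].

Definition Cc (R : realType) N (A : set 'rV[R]_N) (z : 'rV[R]_N -> R) : Prop :=
  [/\ continuous z, compact (closure [set x | z x != 0]) &
      closure [set x | z x != 0] `<=` A].

Definition initial_trace (R : realType) N (Omega : set 'rV[R]_N)
    (u : 'rV[R]_N -> R -> R) (S : set 'rV[R]_N)
    (mu : {measure set 'rV[R]_N -> \bar R}) : Prop :=
  let reg := Omega `\` S in
  [/\ exists2 F, closed F & S = Omega `&` F,
      radon_on reg mu,
      forall z, Cc reg z ->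
        (\int[leb R N]_(x in reg) (u x t * z x)%:E)%E @[t --> 0^'+]
          --> (\int[mu]_(x in reg) (z x)%:E)%E &
      forall U, open U -> U `<=` Omega -> U `&` S !=set0 ->
        (\int[leb R N]_(x in U) (u x t)%:E)%E @[t --> 0^'+] --> +oo%E].

(* C^{1,1;1} up to the boundary of the cylinder: `z` is bounded and continuous
   on the closed cylinder and its first derivatives in the open cylinder have
   bounded continuous extensions `G`, `H` to the closed one, with `G` Lipschitz
   in `x` uniformly in `t`.  Second derivatives in `x` then exist and are bounded
   almost everywhere.  The bounds matter only for unbounded domains. *)
Definition class_C11_1 (R : realType) N (Omega : set 'rV[R]_N) (T : R)
    (z : 'rV[R]_N -> R -> R) : Prop :=
  let Q := cylinder Omega T in
  let Qbar := closed_cylinder Omega T in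
  exists (G : 'I_N -> 'rV[R]_N -> R -> R) (H : 'rV[R]_N -> R -> R) (M : R),
  [/\ [/\ {within Qbar, continuous (fun p => z p.1 p.2)},
          {within Qbar, continuous (fun p => H p.1 p.2)} &
          forall i, {within Qbar, continuous (fun p => G i p.1 p.2)}],
      forall p, Q p -> is_derive p.2 1 (z p.1) (H p.1 p.2),
      forall p i, Q p -> is_derive p.1 (basis_vec i) (z^~ p.2) (G i p.1 p.2),
      forall p, Qbar p -> [/\ `|z p.1 p.2| <= M, `|H p.1 p.2| <= M &
        forall i, `|G i p.1 p.2| <= M] &
      forall i t, 0 <= t <= T -> M.-lipschitz_(closure Omega) (G i ^~ t)].

Definition test_function (R : realType) N (Omega : set 'rV[R]_N) (T : R)
    (z : 'rV[R]_N -> R -> R) : Prop :=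
  [/\ class_C11_1 Omega T z,
      forall x t, boundary Omega x -> 0 <= t <= T -> z x t = 0 &
      forall x, Omega x -> z x T = 0].

(* The solution with initial trace `k` times the Dirac mass at `a`, vanishing on
   the lateral boundary.  The continuity clause selects, in the Lebesgue class
   of the solution, the representative whose pointwise values are meant.
   `laplacian` takes junk values on the null set where the second derivatives
   of the test function do not exist. *)
Definition dirac_solution (R : realType) N (Omega : set 'rV[R]_N)
    (T alpha q : R) (a : 'rV[R]_N) (k : R) (v : 'rV[R]_N -> R -> R) : Prop :=
  let Q := cylinder Omega T in
  [/\ forall x t, Omega x -> 0 < t < T -> 0 <= v x t,
      {within Q, continuous (fun p => v p.1 p.2)},
      spacetime_leb.-integrable Q (fun p => (v p.1 p.2)%:E),
      spacetime_leb.-integrable Q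
        (fun p => (p.2 `^ alpha * `|v p.1 p.2| `^ q)%:E) &
      forall z, test_function Omega T z ->
        (\int[spacetime_leb]_(p in Q)
          (- v p.1 p.2 * (derive1 (z p.1) p.2 + laplacian (z^~ p.2) p.1)
            + p.2 `^ alpha * v p.1 p.2 `^ q * z p.1 p.2)%:E)%E
        = (k * z a 0)%:E].

(* The limit as k tends to infinity; it exists in `\bar R` because the solutions
   are nondecreasing in k. *)
Definition u_infty (R : realType) N (v : R -> 'rV[R]_N -> R -> R)
    (x : 'rV[R]_N) (t : R) : \bar R :=
  lim ((v k x t)%:E @[k --> +oo%R]).

(* Main.v *)
(* Fix k, let V be u_{k delta_a} extended by zero and W = (V - u)^+; the point is
   that W = 0 for every k. Testing against backward Gaussians gives
   V <= k G(. - a, .) with G the heat kernel. A Kato inequality makes W a weak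
   subsolution of the heat equation in the domain; it persists for test functions
   that do not vanish near the lateral boundary, because the test functions of V
   need to vanish only on the boundary itself, which forces the integral of V over
   a boundary layer of width e to be o(e). So W = 0 as soon as the mass of W(t)
   tends to 0 with t.

   Away from a this follows from V <= k G. Near a, the maximum principle applied to
   a cutoff times u^(q-1) t gives u^(q-1) <= C t^-(1+alpha). Since
   the mass of u(t0) near a tends to infinity, a multiple f of u(t0), cut off near
   a, has mass k with a factor tending to 0. Its heat flow H starting at time t0,
   damped by exp(- A s^beta - E (1 - t0 / s)) with
   beta = 1 + alpha - N (q - 1) / 2 > 0, is a subsolution of the absorption
   equation below u, while H is close to k G and the damping is close to 1
   for small s. This is where q is required to be subcritical. *)

(* No trace of [V] is ever taken, at the lateral boundary or at a fixed time. The information on [V]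
   is carried by inequalities between space-time integrals against C^{2,1} test functions, and a
   mass at time [t] is read as an average over a window against the density [rise1]. Kato's
   inequality needs a classical function, so [V] is mollified first.

   The damping has two terms because the absorption coefficient [s^alpha H^(q-1)] has two regimes.
   For [s >= 2 t0] the peak of the heat kernel gives [H <= C s^(-N/2)], so the coefficient is at
   most a multiple of [s^(beta-1)], integrable at 0 because [beta > 0]; this is the derivative of
   [A s^beta], with [A] independent of [t0]. For [t0 <= s <= 2 t0] that peak may be useless and only
   the maximum of the datum is left. If [l] is the factor in front of [u(t0)], the interior estimate
   bounds the coefficient by [C l^(q-1) / t0]: its rate [t^-(1+alpha)] is exactly the one that
   leaves [1 / t0]. The derivative of [E (1 - t0 / s)] is at least [E / (4 t0)] there, so [E] may be
   of size [l^(q-1)], which the blow-up of the mass makes arbitrarily small. *)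
Require Import Defs.
From HB Require Import structures.
From mathcomp Require Import all_boot all_order all_algebra.
From mathcomp Require Import all_classical all_reals all_analysis.
From mathcomp Require Import measurable_realfun ring lra.

Set Implicit Arguments.
Unset Strict Implicit.
Unset Printing Implicit Defensive.

Import Order.TTheory GRing.Theory Num.Theory.
Import numFieldNormedType.Exports.

Local Open Scope classical_set_scope.
Local Open Scope ring_scope.

(** * Functions of space and time with their derivatives *)

Section directional.
Context {R : realType} {V : normedModType R}.
Implicit Types (f g : V -> R) (p v : V).

(** Both sides are limits of the same difference quotient. This reduces directional derivatives to
    functions of one real variable, where the chain rule and the mean value theorem apply. *)
Lemma is_derive_lineP f p v (df : R) :
  is_derive p v f df <-> is_derive (0 : R) 1 (fun h : R => f (h *: v + p)) df.
Proof.
have E : (fun h : R => h^-1 *: ((f \o shift p) (h *: v) - f p)) =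
  (fun h : R => h^-1 *: (((fun h : R => f (h *: v + p)) \o shift 0) (h *: 1)
     - f (0 *: v + p))).
  by apply/funext => h; rewrite /= addr0 scale0r add0r [h *: 1]mulr1.
have D : derivable f p v = derivable (fun h : R => f (h *: v + p)) 0 1.
  by rewrite /derivable E.
have D' : 'D_v f p = 'D_1 (fun h : R => f (h *: v + p)) 0.
  by rewrite /derive E.
by split=> -[d1 d2]; split; [rewrite -D|rewrite -D'|rewrite D|rewrite D'].
Qed.

End directional.

Section directional_calculus.
Context {R : realType} {V : normedModType R}.
Implicit Types (f g : V -> R) (p v : V).

Lemma is_derive_line f p v (df : R) (s : R) :
  is_derive (s *: v + p) v f df ->
  is_derive s 1 (fun h : R => f (h *: v + p)) df.
Proof.
move=> /is_derive_lineP H; apply/is_derive_lineP.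
by under eq_fun do [rewrite [_ *: 1]mulr1 scalerDl -addrA].
Qed.

Lemma is_derive_compR (h : R -> R) f p v (dh df : R) :
  is_derive (f p) 1 h dh -> is_derive p v f df ->
  is_derive p v (h \o f) (dh * df).
Proof.
move=> H /is_derive_lineP F; apply/is_derive_lineP.
apply: (@is_derive1_comp _ h) => //.
by rewrite scale0r add0r.
Qed.

Lemma is_derive_mul f g p v (df dg : R) :
  is_derive p v f df -> is_derive p v g dg ->
  is_derive p v (fun x => f x * g x) (df * g p + f p * dg).
Proof.
move=> F G; apply: (@is_derive_eq _ _ _ (fun x => f x * g x)) => //.
by rewrite addrC; congr (_ + _); exact: mulrC.
Qed.

Lemma is_derive_add f g p v (df dg : R) :
  is_derive p v f df -> is_derive p v g dg ->
  is_derive p v (fun x => f x + g x) (df + dg).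
Proof. by move=> F G; exact: is_deriveD. Qed.

Lemma MVT_line f (df : V -> R) p v (a b : R) : a <= b ->
  (forall s, a <= s <= b -> is_derive (s *: v + p) v f (df (s *: v + p))) ->
  exists2 s, a <= s <= b &
    f (b *: v + p) - f (a *: v + p) = df (s *: v + p) * (b - a).
Proof.
move=> ab H.
have D s : s \in `[a, b] ->
    is_derive s 1 (fun h : R => f (h *: v + p)) (df (s *: v + p)).
  by rewrite in_itv /= => sab; apply: is_derive_line; exact: H.
have D' s : s \in `]a, b[ -> is_derive s 1 (fun h : R => f (h *: v + p)) (df (s *: v + p)).
  by move/subset_itv_oo_cc; exact: D.
have cf : {within `[a, b], continuous (fun h : R => f (h *: v + p))}.
  by apply: derivable_within_continuous => s /D [].
have [s sab E] := MVT_segment ab D' cf.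
by exists s => //; move: sab; rewrite in_itv.
Qed.

End directional_calculus.

Section pospow.
Context {R : realType}.

(** Truncated powers are the source of all cutoffs and bumps below: the cube is already C^2, which
    is enough regularity throughout, and its bounds are polynomial inequalities. *)
Definition pospow n (s : R) : R := Num.max s 0 ^+ n.

Lemma pospow_ge0 n s : 0 <= pospow n s.
Proof. by rewrite exprn_ge0// le_max lexx orbT. Qed.

Lemma pospowN n s : s <= 0 -> pospow n.+1 s = 0.
Proof. by move=> s0; rewrite /pospow max_r// expr0n. Qed.

Lemma pospowP n s : 0 <= s -> pospow n s = s ^+ n.
Proof. by move=> s0; rewrite /pospow max_l. Qed.

Lemma continuous_pospow n : continuous (pospow n).
Proof.
move=> s; apply: (@continuous_comp _ _ _ (fun s : R => Num.max s 0) (fun x => x ^+ n)); last exact: exprn_continuous.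
by apply: (@continuous_max _ _ id (cst 0)); [exact: cvg_id|exact: cvg_cst].
Qed.

Lemma is_derive_pospow n (s : R) : is_derive s 1 (pospow n.+2) (n.+2%:R * pospow n.+1 s).
Proof.
have [s0|s0|->] := ltgtP s 0.
- rewrite pospowN ?ltW// mulr0; apply: (@near_eq_is_derive _ _ _ (cst 0)).
    near=> z; rewrite pospowN// ltW//; near: z; exact: lt_nbhsl.
- rewrite pospowP ?ltW//.
  apply: (@near_eq_is_derive _ R R ((@id R) ^+ n.+2)).
    near=> z; rewrite exprfctE pospowP// ltW//; near: z; exact: lt_nbhsr.
  apply: is_derive_eq; exact: mulr1.
- rewrite pospowN// mulr0; apply/is_derive1_caratheodory.
  exists (pospow n.+1); split; [|exact: continuous_pospow|by rewrite pospowN].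
  move=> z; rewrite [pospow _ 0]pospowN// !subr0.
  have [z0|z0] := leP z 0; first by rewrite !pospowN// mul0r.
  by rewrite !pospowP ?ltW// exprSr.
Unshelve. all: end_near. Qed.

End pospow.

Section jets.
Context {R : realType} {N : nat}.
Notation E := ('rV[R]_N * R)%type.
Implicit Types (D : set E) (i j : 'I_N).

Definition dirx i : E := (basis_vec i, 0).
Definition dirt : E := (0, 1).

(* A function of space and time, together with the derivatives that enter
   parabolic C^{2,1} regularity; the derivatives are data, so that formulas for
   them can be manipulated as total functions. *)
Record jet := Jet { j0 : E -> R; jt : E -> R;
  jx : 'I_N -> E -> R; jxx : 'I_N -> 'I_N -> E -> R }.

Record C21 D (J : jet) : Prop := C21Def {
  C21_c0 : forall p, D p -> {for p, continuous (j0 J)};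
  C21_ct : forall p, D p -> {for p, continuous (jt J)};
  C21_cx : forall p, D p -> forall i, {for p, continuous (jx J i)};
  C21_cxx : forall p, D p -> forall i j, {for p, continuous (jxx J i j)};
  C21_dt : forall p, D p -> is_derive p dirt (j0 J) (jt J p);
  C21_dx : forall p, D p -> forall i, is_derive p (dirx i) (j0 J) (jx J i p);
  C21_dxx : forall p, D p -> forall i j,
    is_derive p (dirx j) (jx J i) (jxx J i j p) }.

Definition jlap (J : jet) (p : E) : R := \sum_(i < N) jxx J i i p.
(** Backward and forward heat operators. They are formal adjoints: the backward one falls on test
    functions, the forward one on solutions. *)
Definition jbh (J : jet) (p : E) : R := - jt J p - jlap J p.
Definition jfh (J : jet) (p : E) : R := jt J p - jlap J p.

Definition jcst (c : R) : jet :=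
  Jet (cst c) (cst 0) (fun _ => cst 0) (fun _ _ => cst 0).

Definition jadd (J K : jet) : jet :=
  Jet (fun p => j0 J p + j0 K p) (fun p => jt J p + jt K p)
    (fun i p => jx J i p + jx K i p) (fun i j p => jxx J i j p + jxx K i j p).

Definition jmul (J K : jet) : jet :=
  Jet (fun p => j0 J p * j0 K p) (fun p => jt J p * j0 K p + j0 J p * jt K p)
    (fun i p => jx J i p * j0 K p + j0 J p * jx K i p)
    (fun i j p => (jxx J i j p * j0 K p + jx J i p * jx K j p) +
                  (jx J j p * jx K i p + j0 J p * jxx K i j p)).

Definition jcomp (h h1 h2 : R -> R) (J : jet) : jet :=
  Jet (fun p => h (j0 J p)) (fun p => h1 (j0 J p) * jt J p)
    (fun i p => h1 (j0 J p) * jx J i p)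
    (fun i j p => h2 (j0 J p) * jx J j p * jx J i p + h1 (j0 J p) * jxx J i j p).

Lemma C21W D D' J : D `<=` D' -> C21 D' J -> C21 D J.
Proof. by move=> DD' [*]; split; auto. Qed.

Lemma C21_cst D c : C21 D (jcst c).
Proof.
by split=> p _ *; try exact: cst_continuous; exact: is_derive_cst.
Qed.

Lemma C21_add D J K : C21 D J -> C21 D K -> C21 D (jadd J K).
Proof.
move=> [J1 J2 J3 J4 J5 J6 J7] [K1 K2 K3 K4 K5 K6 K7].
split=> p Dp *.
- by apply: cvgD; [exact: J1|exact: K1].
- by apply: cvgD; [exact: J2|exact: K2].
- by apply: cvgD; [exact: J3|exact: K3].
- by apply: cvgD; [exact: J4|exact: K4].
- by apply: is_derive_add; auto.
- by apply: is_derive_add; auto.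
- by apply: is_derive_add; auto.
Qed.

Lemma C21_mul D J K : C21 D J -> C21 D K -> C21 D (jmul J K).
Proof.
move=> [J1 J2 J3 J4 J5 J6 J7] [K1 K2 K3 K4 K5 K6 K7].
split=> p Dp *.
- by apply: cvgM; [exact: J1|exact: K1].
- apply: cvgD; apply: cvgM;
    by [exact: J1|exact: K1|exact: J2|exact: K2].
- apply: cvgD; apply: cvgM;
    by [exact: J1|exact: K1|exact: J3|exact: K3].
- apply: cvgD; apply: cvgD; apply: cvgM;
    by [exact: J1|exact: K1|exact: J3|exact: K3|exact: J4|exact: K4].
- by apply: is_derive_mul; auto.
- by apply: is_derive_mul; auto.
- by apply: is_derive_add; apply: is_derive_mul; auto.
Qed.

Lemma C21_comp D (h h1 h2 : R -> R) J :
  (forall p, D p -> [/\ {for j0 J p, continuous h}, {for j0 J p, continuous h1},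
     {for j0 J p, continuous h2}, is_derive (j0 J p) 1 h (h1 (j0 J p)) &
     is_derive (j0 J p) 1 h1 (h2 (j0 J p))]) ->
  C21 D J -> C21 D (jcomp h h1 h2 J).
Proof.
move=> H [J1 J2 J3 J4 J5 J6 J7].
have ch p : D p -> {for p, continuous (h \o j0 J)}.
  by move=> Dp; have [? _ _ _ _] := H p Dp; apply: continuous_comp => //; exact: J1.
have ch1 p : D p -> {for p, continuous (h1 \o j0 J)}.
  by move=> Dp; have [_ ? _ _ _] := H p Dp; apply: continuous_comp => //; exact: J1.
have ch2 p : D p -> {for p, continuous (h2 \o j0 J)}.
  by move=> Dp; have [_ _ ? _ _] := H p Dp; apply: continuous_comp => //; exact: J1.
split=> p Dp *; have [_ _ _ d1 d2] := H p Dp.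
- exact: ch.
- by apply: cvgM; [exact: ch1|exact: J2].
- by apply: cvgM; [exact: ch1|exact: J3].
- apply: cvgD; last by apply: cvgM; [exact: ch1|exact: J4].
  by apply: cvgM; [apply: cvgM; [exact: ch2|exact: J3]|exact: J3].
- by apply: is_derive_compR; auto.
- by apply: is_derive_compR; auto.
- apply: (@is_derive_mul _ _ (h1 \o j0 J)); last by auto.
  by apply: is_derive_compR; auto.
Qed.

Lemma jlap_add J K p : jlap (jadd J K) p = jlap J p + jlap K p.
Proof. by rewrite /jlap /= big_split. Qed.

Lemma jlap_mul J K p : jlap (jmul J K) p =
  jlap J p * j0 K p + 2 * (\sum_(i < N) jx J i p * jx K i p) + j0 J p * jlap K p.
Proof.
rewrite /jlap mulr_suml !mulr_sumr -!big_split; apply: eq_bigr => i _ /=; ring.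
Qed.

Lemma jlap_comp h h1 h2 J p : jlap (jcomp h h1 h2 J) p =
  h2 (j0 J p) * (\sum_(i < N) jx J i p ^+ 2) + h1 (j0 J p) * jlap J p.
Proof.
rewrite /jlap !mulr_sumr -big_split; apply: eq_bigr => i _ /=; ring.
Qed.

Lemma C21_local D (J : jet) (C : set E) : open C ->
  C21 D J -> (forall p, C p -> j0 J p = 0) ->
  (forall p, C p -> jt J p = 0) -> (forall p i, C p -> jx J i p = 0) ->
  (forall p i j, C p -> jxx J i j p = 0) -> C21 (D `|` C) J.
Proof.
move=> oC [J1 J2 J3 J4 J5 J6 J7] z0 zt zx zxx.
have cz (f : E -> R) p : C p -> (forall p, C p -> f p = 0) ->
    {for p, continuous f}.
  move=> Cp fz; have E0 : \near p, cst 0 p = f p.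
    by near=> r; rewrite fz//; near: r; exact: open_nbhs_nbhs.
  rewrite /prop_for /continuous_at (fz p)//.
  exact: cvg_trans (near_eq_cvg E0) (cvg_cst _).
have dz (f : E -> R) p v : C p -> (forall p, C p -> f p = 0) ->
    is_derive p v f 0.
  move=> Cp fz; apply: (@near_eq_is_derive _ _ _ (cst 0)).
    by near=> r; rewrite fz//; near: r; exact: open_nbhs_nbhs.
split=> p [Dp|Cp] *; try by auto.
- by rewrite zt//; exact: dz.
- by rewrite zx//; exact: dz.
- by rewrite zxx//; apply: dz => // r Cr; rewrite zx.
Unshelve. all: end_near. Qed.

(** The derivative fields are data of the jet, but uniqueness of derivatives forces them to vanish
    on an open set where the function does. *)
Lemma C21_zero D J (C : set E) : open C -> C `<=` D -> C21 D J ->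
  (forall p, C p -> j0 J p = 0) ->
  [/\ forall p, C p -> jt J p = 0, forall p i, C p -> jx J i p = 0 &
    forall p i j, C p -> jxx J i j p = 0].
Proof.
move=> oC CD [J1 J2 J3 J4 J5 J6 J7] z0.
have dz (f : E -> R) p v df : C p -> (forall p, C p -> f p = 0) ->
    is_derive p v f df -> df = 0.
  move=> Cp fz H; have := @near_eq_is_derive _ _ _ (cst 0) f p v 0.
  move=> /(_ _ (is_derive_cst _ _ _))[|_ <-]; last by apply/esym/derive_val.
  by near=> r; rewrite fz//; near: r; exact: open_nbhs_nbhs.
have zx p i : C p -> jx J i p = 0.
  by move=> Cp; apply: dz (J6 p _ i) => //; exact: CD.
split=> //.
  by move=> p Cp; apply: dz (J5 p _) => //; exact: CD.
by move=> p i j Cp; apply: dz (J7 p _ i j) => //; [move=> r; exact: zx|exact: CD].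
Unshelve. all: end_near. Qed.

Definition jets0 J (C : set E) : Prop :=
  [/\ forall p, C p -> j0 J p = 0, forall p, C p -> jt J p = 0,
    forall p i, C p -> jx J i p = 0 & forall p i j, C p -> jxx J i j p = 0].

Lemma C21_jets0 D J (C : set E) : open C -> C `<=` D -> C21 D J ->
  (forall p, C p -> j0 J p = 0) -> jets0 J C.
Proof. by move=> oC CD HJ z; have [] := C21_zero oC CD HJ z; split. Qed.

Lemma jets0_mull J K C : jets0 J C -> jets0 (jmul J K) C.
Proof.
move=> [z0 zt zx zxx]; split=> [p Cp|p Cp|p i Cp|p i j Cp] /=;
  by rewrite ?z0 ?zt ?zx ?zxx ?(zx _ j)// ?mul0r ?addr0.
Qed.

(** On [C] the product is locally zero, so a cutoff vanishing there absorbs a factor that is regular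
    only on [D]. It is used for backward Gaussians, which are singular at a finite time. *)
Lemma C21_mul_cut D J K (C : set E) : open C -> jets0 J C -> C21 setT J ->
  C21 D K -> D `|` C = setT -> C21 setT (jmul J K).
Proof.
move=> oC HC HJ HK DC; rewrite -DC.
have [z0 zt zx zxx] := @jets0_mull J K C HC.
apply: C21_local => //; apply: C21_mul => //; exact: C21W HJ.
Qed.

End jets.

Section pullback.
Context {R : realType} {V W : normedModType R}.

Lemma is_derive_pull (pi : V -> W) (g : W -> R) (p v : V) (w : W) (d : R) :
  (forall h : R, pi (h *: v + p) = h *: w + pi p) ->
  is_derive (pi p) w g d -> is_derive p v (fun x => g (pi x)) d.
Proof.
move=> H /is_derive_lineP G; apply/is_derive_lineP.
by under eq_fun do rewrite H.
Qed.

Lemma is_derive_bigsum n (f : 'I_n -> V -> R) (p v : V) (df : 'I_n -> R) :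
  (forall i, is_derive p v (f i) (df i)) ->
  is_derive p v (fun x => \sum_(i < n) f i x) (\sum_(i < n) df i).
Proof.
move=> H; rewrite (_ : (fun x => _) = \sum_(i < n) f i).
  exact: is_derive_sum.
by apply/funext => x; rewrite fct_sumE.
Qed.

Lemma is_derive_affine (f : V -> R) (p v : V) (c : R) :
  (forall h : R, f (h *: v + p) = h * c + f p) -> is_derive p v f c.
Proof.
move=> H; apply/is_derive_lineP; under eq_fun do rewrite H.
have D := @is_derive_mul _ R^o _ _ _ _ _ _ (is_derive_id (0 : R) 1)
  (is_derive_cst c (0 : R) 1).
have := @is_derive_add _ R^o _ _ _ _ _ _ D (is_derive_cst (f p) (0 : R) 1).
by move=> /is_derive_eq; apply; rewrite mul1r mulr0 !addr0.
Qed.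

End pullback.

Lemma cvg_fsum (R : realType) (T : Type) (F : set_system T) (FF : Filter F) n
    (f : 'I_n -> T -> R) (l : 'I_n -> R) :
  (forall i, f i x @[x --> F] --> l i) ->
  \sum_(i < n) f i x @[x --> F] --> \sum_(i < n) l i.
Proof.
by move=> fl; apply: cvg_big => [|i _]; [exact: add_continuous|exact: fl].
Qed.

Section basic_jets.
Context {R : realType} {N : nat}.
Notation E := ('rV[R]_N * R)%type.
Implicit Types (D : set E) (i j : 'I_N).

Lemma coord_dirx i j (h : R) (p : E) :
  (h *: dirx i + p).1 ord0 j = h * (i == j)%:R + p.1 ord0 j.
Proof. by rewrite /= !mxE eqxx /= [j == i]eq_sym. Qed.

Lemma coord_dirt j (h : R) (p : E) : (h *: dirt + p).1 ord0 j = p.1 ord0 j.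
Proof. by rewrite /= !mxE mulr0 add0r. Qed.

Lemma snd_dirx i (h : R) (p : E) : (h *: dirx i + p).2 = p.2.
Proof. by rewrite /= scaler0 add0r. Qed.

Lemma continuous_coord j : continuous (fun p : E => p.1 ord0 j).
Proof.
move=> p; apply: (@continuous_comp _ _ _ fst (fun x : 'rV[R]_N => x ord0 j)).
  exact: cvg_fst.
exact: coord_continuous.
Qed.

Lemma continuous_time (h : R -> R) (p : E) : {for p.2, continuous h} ->
  {for p, continuous (fun p : E => h p.2)}.
Proof. by move=> ch; apply: (@continuous_comp _ _ _ snd h p _ ch); exact: cvg_snd. Qed.

Definition jtime (h h1 : R -> R) : jet :=
  Jet (fun p : E => h p.2) (fun p => h1 p.2) (fun _ => cst 0) (fun _ _ => cst 0).

Lemma C21_time D (h h1 : R -> R) :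
  (forall p, D p -> [/\ {for p.2, continuous h}, {for p.2, continuous h1} &
     is_derive p.2 1 h (h1 p.2)]) -> C21 D (jtime h h1).
Proof.
move=> H; split=> p Dp *; have [c0 c1 d] := H p Dp.
- exact: continuous_time.
- exact: continuous_time.
- exact: cst_continuous.
- exact: cst_continuous.
- by apply: (@is_derive_pull _ _ _ snd h p dirt 1).
- apply: is_derive_affine => r; rewrite mulr0 add0r; congr h; exact: snd_dirx.
- exact: is_derive_cst.
Qed.

(** The norm of row vectors is the sup norm, which is not differentiable. Cutoffs and Gaussians use
    the squared Euclidean norm, balls and compactness the sup norm; [norm_sqr_le_sqn] and
    [sqn_le_norm] pass from one to the other. *)
Definition sqn (x : 'rV[R]_N) : R := \sum_(i < N) x ord0 i ^+ 2.

Definition jsq (c : 'rV[R]_N) : jet :=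
  Jet (fun p : E => sqn (p.1 - c)) (cst 0) (fun i p => 2 * (p.1 ord0 i - c ord0 i))
    (fun i j => cst (2 * (j == i)%:R)).

Lemma continuous_sqn c : continuous (fun p : E => sqn (p.1 - c)).
Proof.
move=> p; apply: cvg_fsum => i.
rewrite (_ : (fun x : E => _) = (fun x : E => (x.1 ord0 i - c ord0 i) * (x.1 ord0 i - c ord0 i))); last first.
  by apply/funext => x; rewrite !mxE expr2.
rewrite !mxE expr2; apply: cvgM; apply: cvgB; try exact: cvg_cst;
  exact: continuous_coord.
Qed.

Lemma C21_sq D c : C21 D (jsq c).
Proof.
split=> p _.
- exact: continuous_sqn.
- exact: cst_continuous.
- move=> k; apply: cvgM; first exact: cvg_cst.
  apply: cvgB; last exact: cvg_cst; exact: continuous_coord.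
- by move=> k l; exact: cst_continuous.
- apply: is_derive_affine => h; rewrite mulr0 add0r.
  by apply: eq_bigr => i _; rewrite !mxE mulr0 add0r.
- move=> k.
  have H i : is_derive p (dirx k) (fun x : E => x.1 ord0 i - c ord0 i) ((k == i)%:R).
    by apply: is_derive_affine => h; rewrite coord_dirx addrA.
  rewrite (_ : j0 (jsq c) = fun p : E => \sum_(i < N)
      (p.1 ord0 i - c ord0 i) * (p.1 ord0 i - c ord0 i)); last first.
    by apply/funext => q; apply: eq_bigr => i _; rewrite !mxE expr2.
  rewrite (_ : jx _ _ _ = \sum_(i < N) ((k == i)%:R * (p.1 ord0 i - c ord0 i)
      + (p.1 ord0 i - c ord0 i) * (k == i)%:R)).
    by apply: is_derive_bigsum => i; exact: is_derive_mul.
  rewrite /= (bigD1 k)//= eqxx big1 ?addr0.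
    by rewrite mul1r mulr1 mulr2n mulrDl mul1r.
  by move=> i ik; rewrite eq_sym (negbTE ik) mul0r mulr0 addr0.
- move=> k l; apply: is_derive_affine => h /=.
  by rewrite !mxE eqxx /= [k == l]eq_sym; ring.
Qed.

Lemma jlap_sq c p : jlap (jsq c) p = 2 * N%:R.
Proof.
rewrite /jlap /=; under eq_bigr do rewrite eqxx.
by rewrite sumr_const card_ord mulr1 mulr_natr.
Qed.

Lemma sum_jsq c p : \sum_(i < N) jx (jsq c) i p ^+ 2 = 4 * sqn (p.1 - c).
Proof.
rewrite /sqn mulr_sumr; apply: eq_bigr => i _ /=; rewrite !mxE; ring.
Qed.

Lemma sqn_ge0 x : 0 <= sqn x.
Proof. by apply: sumr_ge0 => i _; exact: sqr_ge0. Qed.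

Lemma coord_le_norm (x : 'rV[R]_N) i : `|x ord0 i| <= `|x|.
Proof. by rewrite -[leRHS]/(mx_norm x) mx_normrE; apply: (le_trans _ (le_bigmax _ _ (ord0, i))). Qed.

Lemma norm_sqr_le_sqn (x : 'rV[R]_N) : `|x| ^+ 2 <= sqn x.
Proof.
rewrite -[`|x|]/(mx_norm x) mx_normrE.
elim/big_ind: _ => [|a b ha hb|[i j] _ /=].
- by rewrite expr0n /= sqn_ge0.
- by rewrite /Num.max; case: ifP.
rewrite ord1 /sqn (bigD1 j)//= real_normK ?num_real// lerDl.
by apply: sumr_ge0 => l _; exact: sqr_ge0.
Qed.

Lemma sqn_le_norm (x : 'rV[R]_N) : sqn x <= N%:R * `|x| ^+ 2.
Proof.
rewrite mulr_natl -[X in _ *+ X]card_ord -sumr_const.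
apply: ler_sum => i _; rewrite -[x _ _ ^+ 2]real_normK ?num_real//.
by rewrite lerXn2r ?nnegrE// coord_le_norm.
Qed.

End basic_jets.

Section bounded_jets.
Context {R : realType} {N : nat}.
Notation E := ('rV[R]_N * R)%type.

Definition slab (b t0 t1 : R) : set E := [set p | `|p.1| <= b /\ t0 <= p.2 <= t1].

Lemma compact_ball_rV (b : R) : compact [set x : 'rV[R]_N | `|x| <= b].
Proof.
have [->|N0] := eqVneq [set x : 'rV[R]_N | `|x| <= b] set0; first exact: compact0.
apply: bounded_closed_compact.
  by exists b; split; [exact: num_real|move=> M bM x /= /le_trans; apply; exact: ltW].
apply: (@preimage_closed 'rV[R]_N R (fun x => `|x|) [set r : R | r <= b]).
  by move=> x _; exact: norm_continuous.
exact: closed_le.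
Qed.

Lemma compact_slab b t0 t1 : compact (slab b t0 t1).
Proof.
rewrite (_ : slab b t0 t1 = [set x : 'rV[R]_N | `|x| <= b] `*` `[t0, t1]).
  by apply: compact_setX; [exact: compact_ball_rV|exact: segment_compact].
by apply/seteqP; split => p /=; rewrite in_itv.
Qed.

Lemma compact_bounded (T : topologicalType) (f : T -> R) (K : set T) :
  compact K -> {within K, continuous f} ->
  exists2 M : R, 0 <= M & forall p, K p -> `|f p| <= M.
Proof.
move=> cK cf; have [->|/set0P K0] := eqVneq K set0; first by exists 0.
have cf' : {within K, continuous (fun x => `|f x|)}.
  by move=> x; apply: continuous_comp; [exact: cf|exact: norm_continuous].
have [c _ H] := compact_EVT_max K0 cK cf'.
by exists `|f c| => // p Kp; apply: H; rewrite inE.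
Qed.

(** Changing one coordinate at a time, each of the [N] steps from [x] to [y] is the mean value
    theorem on a coordinate line; the intermediate point [z k] has the first [k] coordinates of
    [y]. *)
Lemma coord_lipschitz (f : E -> R) (df : 'I_N -> E -> R) (M t : R) (x y : 'rV[R]_N) :
  0 <= M ->
  (forall z i, is_derive (z, t) (dirx i) f (df i (z, t))) ->
  (forall z i, `|df i (z, t)| <= M) ->
  `|f (y, t) - f (x, t)| <= N%:R * M * `|y - x|.
Proof.
move=> M0 Hd HM.
pose z k : 'rV[R]_N := \row_i (if (i < k)%N then y ord0 i else x ord0 i).
have step k : (k < N)%N -> `|f (z k.+1, t) - f (z k, t)| <= M * `|y - x|.
  move=> kN; pose i := Ordinal kN.
  pose w : 'rV[R]_N := \row_j (if j == i then 0 else z k ord0 j).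
  have zE (r : R) : ((r *: dirx i + (w, t)) : E) =
      (\row_j (if j == i then r else z k ord0 j), t).
    congr pair; last by rewrite /= scaler0 add0r.
    by apply/rowP => j; rewrite !mxE eqxx /=; case: eqP => _; rewrite ?mulr1 ?addr0 ?mulr0 ?add0r.
  have z1 : (z k, t) = x ord0 i *: dirx i + (w, t) :> E.
    rewrite zE; congr pair; apply/rowP => j; rewrite !mxE.
    by case: eqP => [->|//]; rewrite /= ltnn.
  have z2 : (z k.+1, t) = y ord0 i *: dirx i + (w, t) :> E.
    rewrite zE; congr pair; apply/rowP => j; rewrite !mxE ltnS leq_eqVlt.
    by case: (j =P i) => [->|/eqP ji]; rewrite ?eqxx// (negbTE (_ : j != k :> nat)).
  have Hline (s : R) : is_derive (s *: dirx i + (w, t)) (dirx i) f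
      (df i (s *: dirx i + (w, t))) by rewrite zE.
  have main (a b : R) : a <= b ->
      `|f (b *: dirx i + (w, t)) - f (a *: dirx i + (w, t))| <= M * `|b - a|.
    move=> ab; have [s _ ->] := MVT_line ab (fun s _ => Hline s).
    by rewrite normrM ler_wpM2r// zE.
  rewrite z1 z2; apply: (@le_trans _ _ (M * `|y ord0 i - x ord0 i|)).
    have [xy|/ltW yx] := leP (x ord0 i) (y ord0 i); first exact: main.
    by rewrite distrC [X in _ * X]distrC; exact: main.
  by rewrite ler_wpM2l//; have := coord_le_norm (y - x) i; rewrite !mxE.
have zN : z N = y by apply/rowP => j; rewrite mxE ltn_ord.
have z0 : z 0%N = x by apply/rowP => j; rewrite mxE.
rewrite -zN -z0 -mulrA mulr_natl.
have : forall k, (k <= N)%N -> `|f (z k, t) - f (z 0%N, t)| <= (M * `|y - x|) *+ k.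
  elim=> [|k IH] kN; first by rewrite subrr normr0 mulr0n.
  rewrite -(subrK (f (z k, t)) (f (z k.+1, t))) -addrA.
  rewrite (le_trans (ler_normD _ _))// mulrS lerD//; first exact: step.
  by apply: IH; exact: ltnW.
by move/(_ N (leqnn N)); rewrite zN z0.
Qed.

Lemma open_far (b : R) : open [set p : E | b < `|p.1|].
Proof.
apply: (@open_comp _ _ (fun p : E => `|p.1|) [set r : R | b < r]); last exact: open_gt.
move=> p _; apply: (@continuous_comp E 'rV[R]_N R fst (fun x => `|x|)); first exact: cvg_fst.
exact: norm_continuous.
Qed.

Definition jnorm (J : @jet R N) (p : E) : R :=
  `|j0 J p| + `|jt J p| + \sum_(i < N) `|jx J i p| +
  \sum_(i < N) \sum_(j < N) `|jxx J i j p|.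

Lemma jnormP J p : [/\ `|j0 J p| <= jnorm J p, `|jt J p| <= jnorm J p,
  forall i, `|jx J i p| <= jnorm J p & forall i j, `|jxx J i j p| <= jnorm J p].
Proof.
have s1 : 0 <= \sum_(i < N) `|jx J i p| by apply: sumr_ge0 => *.
have s2 : 0 <= \sum_(i < N) \sum_(j < N) `|jxx J i j p|.
  by apply: sumr_ge0 => * ; apply: sumr_ge0 => *.
have a0 := normr_ge0 (j0 J p); have at0 := normr_ge0 (jt J p).
rewrite /jnorm; split; [lra|lra|move=> i|move=> i j].
  have : `|jx J i p| <= \sum_(i < N) `|jx J i p|.
    by rewrite (bigD1 i)//= lerDl; apply: sumr_ge0 => *.
  lra.
have : `|jxx J i j p| <= \sum_(i < N) \sum_(j < N) `|jxx J i j p|.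
  rewrite (bigD1 i)//= (bigD1 j)//= -addrA lerDl addr_ge0//.
    by apply: sumr_ge0 => *.
  by apply: sumr_ge0 => *; apply: sumr_ge0 => *.
lra.
Qed.

Lemma continuous_jnorm D J p : C21 D J -> D p -> {for p, continuous (jnorm J)}.
Proof.
have cn (f : E -> R) : {for p, continuous f} -> {for p, continuous (fun p => `|f p|)}.
  by move=> cf; apply: (@continuous_comp _ _ _ f Num.norm p cf); exact: norm_continuous.
move=> [J1 J2 J3 J4 _ _ _] Dp; apply: cvgD; last first.
  by apply: cvg_fsum => i; apply: cvg_fsum => j; apply: cn; exact: J4.
apply: cvgD; last by apply: cvg_fsum => i; apply: cn; exact: J3.
by apply: cvgD; apply: cn; [exact: J1|exact: J2].
Qed.

Lemma C21_bounded J b t0 t1 : C21 setT J ->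
  (forall p, b < `|p.1| -> j0 J p = 0) ->
  exists2 M, 0 <= M & forall p, t0 <= p.2 <= t1 -> jnorm J p <= M.
Proof.
move=> HJ Hb.
have [z0 zt zx zxx] : jets0 J [set p | b < `|p.1|].
  by apply: C21_jets0 HJ _ => //; exact: open_far.
have cj : {within slab b t0 t1, continuous (jnorm J)}.
  by apply: continuous_subspaceT => p; exact: continuous_jnorm HJ _.
have [M M0 H] := compact_bounded (@compact_slab b t0 t1) cj.
exists M => // p pt; have [pb|pb] := leP `|p.1| b.
  by rewrite (le_trans (ler_norm _))// H.
rewrite /jnorm z0// zt// !big1 ?normr0 ?addr0// => i _; last by rewrite zx// normr0.
by rewrite big1// => j _; rewrite zxx// normr0.
Qed.

(** Bounded support in space bounds all derivatives on [[0, T]], and the bound on the second ones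
    makes the gradient Lipschitz, so C^{2,1} jets are admissible in the weak formulation. *)
Lemma test_of_jet (Omega : set 'rV[R]_N) (T b : R) J : open Omega -> C21 setT J ->
  (forall p, b < `|p.1| -> j0 J p = 0) ->
  (forall x t, boundary Omega x -> 0 <= t <= T -> j0 J (x, t) = 0) ->
  (forall x, Omega x -> j0 J (x, T) = 0) ->
  test_function Omega T (fun x t => j0 J (x, t)).
Proof.
move=> oO HJ Hb Hbd HT; split=> //.
have [M M0 HM] := @C21_bounded J b 0 T HJ Hb.
have HM' p : 0 <= p.2 <= T -> jnorm J p <= N%:R * M + M.
  by move=> /HM /le_trans; apply; rewrite lerDr mulr_ge0.
(* A single constant bounds the function and its first derivatives and is a Lipschitz constant of
   the gradient, hence the sum. *)
exists (fun i x t => jx J i (x, t)), (fun x t => jt J (x, t)), (N%:R * M + M).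
have su (f : E -> R) : (fun p : E => f (p.1, p.2)) = f by apply/funext => -[].
case: (HJ) => J1 J2 J3 J4 J5 J6 J7.
split.
- split=> [||i]; rewrite su; apply: continuous_subspaceT => p.
  + exact: J1.
  + exact: J2.
  + exact: J3.
- move=> [x t] _ /=.
  have := J5 (x, t) Logic.I => /is_derive_lineP H; apply/is_derive_lineP.
  by move: H; under eq_fun do rewrite /GRing.scale /GRing.add /= /scale_pair /add_pair /= scaler0 add0r.
- move=> [x t] i _ /=.
  have := J6 (x, t) Logic.I i => /is_derive_lineP H; apply/is_derive_lineP.
  by move: H; under eq_fun do rewrite /GRing.scale /GRing.add /= /scale_pair /add_pair /= scaler0 add0r.
- move=> [x t] [_]; rewrite /= in_itv /= => tT.
  have [h0 ht hx _] := jnormP J (x, t).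
  by split=> [||i]; rewrite (le_trans _ (HM' (x, t) tT)).
- move=> i t tT [x y] _ /=.
  rewrite (le_trans (@coord_lipschitz (jx J i) (jxx J i) M t y x M0 _ _))//.
  + by move=> z j; exact: J7.
  + move=> z j; have [_ _ _ /(_ i j) h] := jnormP J (z, t).
    by rewrite (le_trans h)// HM.
  + by rewrite ler_wpM2r// lerDl.
Qed.

End bounded_jets.

(** * Integration on space-time *)

Section borel.
Context {R : realType} {N : nat}.
Notation E := ('rV[R]_N * R)%type.
Notation EM := ('rV[R]_N * measurableTypeR R)%type.

Lemma open_measurable_rV (U : set 'rV[R]_N) : open U -> measurable U.
Proof. by move=> oU; exact: sub_sigma_algebra. Qed.

(** An open set is a countable union of products of rational boxes with rational intervals, so the
    product sigma-algebra contains the topology of space-time. *)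
Lemma open_measurable_E (U : set E) : open U -> measurable (U : set EM).
Proof.
move=> oU.
pose B (c : {ffun 'I_N -> rat * rat} * (rat * rat)) : set EM :=
  open_box (fun i => ratr (c.1 i).1) (fun i => ratr (c.1 i).2) `*`
  `](ratr c.2.1), (ratr c.2.2)[%classic.
have -> : (U : set EM) = \bigcup_(c in [set c | B c `<=` U]) B c.
  apply/seteqP; split => [[x t] Uxt|p [c cU cp]]; last exact: cU.
  have [[V W] /= [nV nW] VW] : nbhs (x, t) U by exact: open_nbhs_nbhs.
  have [G oG [Gx GV]] : exists2 G, open G & G x /\ G `<=` V.
    by move: nV; rewrite nbhsE /= => -[G [oG Gx] GV]; exists G.
  have := Gx; rewrite [X in X x](open_bigcup_box oG) => -[c cG cx].
  have /nbhs_ballP[e /= e0 eW] : nbhs t W by [].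
  have /rat_in_itvoo[r1] : t - e < t by rewrite ltrBlDr ltrDl.
  rewrite in_itv /= => /andP[r1a r1b].
  have /rat_in_itvoo[r2] : t < t + e by rewrite ltrDl.
  rewrite in_itv /= => /andP[r2a r2b].
  exists (c, (r1, r2)); last first.
    by split => //=; rewrite in_itv /= r1b r2a.
  move=> [y s] [/= yc]; rewrite in_itv /= => /andP[s1 s2]; apply: VW; split => /=.
    by apply: GV; apply: cG.
  apply: eW; rewrite /ball /= ltr_distlC.
  by rewrite (lt_trans r1a s1) (lt_trans s2).
rewrite bigcup_mkcond.
apply: countable_bigcupT_measurable => [|c]; first exact: countableP.
case: ifPn => // _; apply: measurableX; first exact: measurable_open_box.
exact: measurable_itv.
Qed.

(** In the applications [phi] is the identity between two copies of one space, the first carrying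
    the sigma-algebra and the second the topology. *)
Lemma continuous_measurable_gen d (T : topologicalType) (M : measurableType d)
    (phi : M -> T) (D : set T) (f : T -> R) :
  (forall U : set T, open U -> measurable (phi @^-1` U)) -> open D ->
  (forall p, D p -> {for p, continuous f}) ->
  measurable_fun (phi @^-1` D) (f \o phi).
Proof.
move=> om oD cf; apply: (measurability _ (RGenOpens.measurableE R)).
move=> _ [_ [a [b ->] <-]]; apply: (om (D `&` f @^-1` `]a, b[%classic)).
rewrite openE => p [Dp fp]; rewrite /interior.
apply: filterI; first exact: open_nbhs_nbhs.
by apply: (cf p Dp); apply: open_nbhs_nbhs; split => //; exact: interval_open.
Qed.

Lemma continuous_measurable_E (D : set E) (f : E -> R) : open D ->
  (forall p, D p -> {for p, continuous f}) ->
  measurable_fun (D : set EM) (f : EM -> R).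
Proof.
exact: (@continuous_measurable_gen _ E EM id D f open_measurable_E).
Qed.

Lemma continuous_measurable_rV (D : set 'rV[R]_N) (f : 'rV[R]_N -> R) : open D ->
  (forall p, D p -> {for p, continuous f}) -> measurable_fun D f.
Proof.
exact: (@continuous_measurable_gen _ _ 'rV[R]_N id D f open_measurable_rV).
Qed.

End borel.

(** * Translation invariance of Lebesgue measure *)

Section invariance.
Context {R : realType}.

(** The pushforward of the product measure agrees with it on rectangles, and a product measure is
    determined by its values there. *)
Lemma prod_invariant d1 d2 (T1 : measurableType d1) (T2 : measurableType d2)
  (m1 : {sigma_finite_measure set T1 -> \bar R})
  (m2 : {sigma_finite_measure set T2 -> \bar R}) (f1 : T1 -> T1) (f2 : T2 -> T2) :
  measurable_fun setT f1 -> measurable_fun setT f2 ->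
  (forall A, measurable A -> m1 (f1 @^-1` A) = m1 A) ->
  (forall A, measurable A -> m2 (f2 @^-1` A) = m2 A) ->
  forall A, measurable A ->
  (m1 \x m2)%E ((fun p => (f1 p.1, f2 p.2)) @^-1` A) = (m1 \x m2)%E A.
Proof.
move=> mf1 mf2 i1 i2 A mA.
pose g (p : T1 * T2) := (f1 p.1, f2 p.2).
have mg : measurable_fun setT g.
  apply: measurable_fun_pair; first exact: measurableT_comp.
  exact: measurableT_comp.
pose gm : {mfun (T1 * T2)%type >-> (T1 * T2)%type} :=
  HB.pack g (isMeasurableFun.Build _ _ _ _ g mg).
rewrite [RHS](@product_measure_unique _ _ _ _ _ _ _
  (pushforward (m1 \x m2)%E gm))// => B C mB mC.
rewrite -[LHS]/((m1 \x m2)%E ((f1 @^-1` B) `*` (f2 @^-1` C))).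
have mB' : measurable (f1 @^-1` B) by rewrite -[X in measurable X]setTI; exact: mf1.
have mC' : measurable (f2 @^-1` C) by rewrite -[X in measurable X]setTI; exact: mf2.
rewrite product_measure1E//; congr (_ * _)%E; [exact: i1|exact: i2].
Qed.

Lemma measurable_addr (c : R) :
  measurable_fun setT (fun x : measurableTypeR R => (x + c : measurableTypeR R)).
Proof. by apply: measurable_funD. Qed.

Lemma lebesgue_measure_shift (c : R) (A : set (measurableTypeR R)) : measurable A ->
  lebesgue_measure ((fun x : measurableTypeR R => x + c : measurableTypeR R) @^-1` A)
  = lebesgue_measure A.
Proof.
move=> mA; pose gm : {mfun (measurableTypeR R) >-> (measurableTypeR R)} :=
  HB.pack (fun x : measurableTypeR R => x + c : measurableTypeR R)
  (isMeasurableFun.Build _ _ _ _ _ (measurable_addr c)).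
rewrite [RHS](@lebesgue_measure_unique R (pushforward lebesgue_measure gm))//.
move=> _ [[a b] _ <-] /=; rewrite /pushforward /=.
rewrite (_ : _ @^-1` _ = `](a - c), (b - c)]%classic); last first.
  by apply/seteqP; split => x /=; rewrite !in_itv /= ltrBlDr lerBrDr.
rewrite !lebesgue_measure_itv /= !lte_fin ltrD2r; case: ifP => // _.
by rewrite -!EFinD; congr EFin; ring.
Qed.

Lemma measurable_addr_rV n (c : 'rV[R]_n) : measurable_fun setT (fun x : 'rV[R]_n => x + c).
Proof.
apply: measurable_fun_rVP => i; under eq_fun do rewrite mxE.
apply: measurable_funD => //; exact: measurable_coord.
Qed.

(** Induction along the recursive construction of [leb]: under [consrV] a translation splits into
    one of the first coordinate and one of the remaining ones. *)
Lemma leb_shift n (c : 'rV[R]_n) (A : set 'rV[R]_n) : measurable A ->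
  leb R n ((fun x : 'rV[R]_n => x + c) @^-1` A) = leb R n A.
Proof.
elim: n c A => [|n IH] c A mA.
  congr (_ _); apply/seteqP; split => x /=; rewrite (_ : x + c = x)//;
    by apply/rowP => -[].
rewrite /= /leb_step /pushforward.
pose c' : 'rV[R]_n := \row_i c ord0 (lift ord0 i).
have mcA : measurable (@consrV R n @^-1` A).
  by rewrite -[X in measurable X]setTI; exact: measurable_consrV.
rewrite -[RHS](@prod_invariant _ _ _ _ lebesgue_measure (leb R n)
  (fun r : measurableTypeR R => r + c ord0 ord0 : measurableTypeR R)
  (fun y : 'rV[R]_n => y + c'))//.
- congr (_ _); apply/seteqP; split => -[r y] /=; rewrite /preimage /=;
  rewrite (_ : consrV (r + c ord0 ord0 : measurableTypeR R, y + c') = consrV (r, y) + c)//;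
  apply/rowP => i; case: (unliftP ord0 i) => [j|] ->;
  by rewrite !mxE ?liftK ?unlift_none //= !mxE.
- exact: measurable_addr.
- exact: measurable_addr_rV.
- by move=> B mB; exact: lebesgue_measure_shift.
- by move=> B mB; exact: IH.
Qed.

Lemma spacetime_shift n (c : 'rV[R]_n * R) (A : set ('rV[R]_n * measurableTypeR R)) :
  measurable A ->
  spacetime_leb ((fun p => (p.1 + c.1, p.2 + c.2 : measurableTypeR R)) @^-1` A)
   = @spacetime_leb R n A.
Proof.
apply: (@prod_invariant _ _ _ _ (leb R n) lebesgue_measure (fun y : 'rV[R]_n => y + c.1)
  (fun r : measurableTypeR R => r + c.2 : measurableTypeR R)).
- exact: measurable_addr_rV.
- exact: measurable_addr.
- by move=> B mB; exact: leb_shift.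
- by move=> B mB; exact: lebesgue_measure_shift.
Qed.

End invariance.

Section real_integral.
Context d (T : measurableType d) (R : realType) (mu : {measure set T -> \bar R}).
Implicit Types f g : T -> R.

Definition intg f := mu.-integrable setT (EFin \o f).
Definition Int f : R := \int[mu]_x f x.

Lemma intg_measurable f : intg f -> measurable_fun setT f.
Proof. by move=> /integrableP[/measurable_EFinP]. Qed.

Lemma intg_le f g : measurable_fun setT f -> (forall x, `|f x| <= g x) ->
  intg g -> intg f.
Proof.
move=> mf fg; apply: le_integrable => //; first exact/measurable_EFinP.
by move=> x _ /=; rewrite lee_fin (le_trans (fg x))// ler_norm.
Qed.

Lemma intgD f g : intg f -> intg g -> intg (fun x => f x + g x).
Proof.
move=> If Ig; have := integrableD measurableT If Ig.
by apply: eq_integrable.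
Qed.

Lemma intgZ (k : R) f : intg f -> intg (fun x => k * f x).
Proof.
move=> If; have := integrableZl measurableT k If.
by apply: eq_integrable.
Qed.

Lemma intgN f : intg f -> intg (fun x => - f x).
Proof.
by move=> /(intgZ (-1)); apply: eq_integrable => // x _ /=; rewrite mulN1r.
Qed.

Lemma intgB f g : intg f -> intg g -> intg (fun x => f x - g x).
Proof. by move=> If /intgN; exact: intgD. Qed.

Lemma intg_abs f : intg f -> intg (fun x => `|f x|).
Proof. exact: integrable_norm. Qed.

Lemma intg0 : intg (fun _ => 0). Proof. exact: integrable0. Qed.

Lemma intg_sum n (f : 'I_n -> T -> R) : (forall i, intg (f i)) ->
  intg (fun x => \sum_(i < n) f i x).
Proof.
elim: n f => [|n IH] f Hf.
  by under eq_fun do rewrite big_ord0; exact: intg0.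
by under eq_fun do rewrite big_ord_recl; apply: intgD => //; apply: IH.
Qed.

Lemma intgM f g (M : R) : intg f -> measurable_fun setT g ->
  (forall x, `|g x| <= M) -> intg (fun x => f x * g x).
Proof.
move=> If mg gM; apply: (@intg_le _ (fun x => M * `|f x|)).
- by apply: measurable_funM => //; exact: intg_measurable.
- by move=> x; rewrite normrM mulrC ler_wpM2r.
- exact/intgZ/intg_abs.
Qed.

Lemma Int_le f g : intg f -> intg g -> (forall x, f x <= g x) -> Int f <= Int g.
Proof. by move=> If Ig fg; exact: le_Rintegral. Qed.

Lemma Int_ge0 f : (forall x, 0 <= f x) -> 0 <= Int f.
Proof. by move=> f0; exact: Rintegral_ge0. Qed.

Lemma IntD f g : intg f -> intg g -> Int (fun x => f x + g x) = Int f + Int g.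
Proof. by move=> If Ig; exact: RintegralD. Qed.

Lemma IntB f g : intg f -> intg g -> Int (fun x => f x - g x) = Int f - Int g.
Proof. by move=> If Ig; exact: RintegralB. Qed.

Lemma IntZ (k : R) f : intg f -> Int (fun x => k * f x) = k * Int f.
Proof. by move=> If; exact: RintegralZl. Qed.

Lemma IntN f : intg f -> Int (fun x => - f x) = - Int f.
Proof.
by move=> If; rewrite -mulN1r -IntZ//; apply: eq_Rintegral => x _; rewrite mulN1r.
Qed.

Lemma Int_sum n (f : 'I_n -> T -> R) : (forall i, intg (f i)) ->
  Int (fun x => \sum_(i < n) f i x) = \sum_(i < n) Int (f i).
Proof.
elim: n f => [|n IH] f Hf.
  by rewrite big_ord0 /Int; under eq_Rintegral do rewrite big_ord0; rewrite /Rintegral integral0.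
rewrite big_ord_recl -IH// -IntD//; last exact: intg_sum.
by apply: eq_Rintegral => x _; rewrite big_ord_recl.
Qed.

Lemma Int_abs f : intg f -> `|Int f| <= Int (fun x => `|f x|).
Proof. by move=> If; exact: le_normr_Rintegral. Qed.

Lemma eq_Int f g : f =1 g -> Int f = Int g.
Proof. by move=> fg; apply: eq_Rintegral => x _; exact: fg. Qed.

Lemma Int_dct (F : nat -> T -> R) f g : (forall n, measurable_fun setT (F n)) ->
  (forall x, F n x @[n --> \oo] --> f x) -> intg g ->
  (forall n x, `|F n x| <= g x) -> intg f /\ Int (F n) @[n --> \oo] --> Int f.
Proof.
move=> mF Ff Ig Fg.
have mf : measurable_fun setT f.
  by apply: measurable_fun_cvg => // x _; exact: Ff.
have fg x : `|f x| <= g x.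
  have : `|F n x| @[n --> \oo] --> `|f x| by apply: cvg_norm; exact: Ff.
  move=> h; rewrite -(cvg_lim _ h)//; apply: limr_le; first by apply/cvg_ex; exists `|f x|.
  by apply: nearW => n.
have If : intg f by exact: intg_le Ig.
split => //.
have [] := @dominated_convergence _ _ _ mu setT measurableT
  (fun n x => (F n x)%:E) (fun x => (f x)%:E) (fun x => (g x)%:E).
- by move=> n; exact/measurable_EFinP.
- exact/measurable_EFinP.
- by apply/aeW => x _; apply: cvg_EFin; [exact: nearW|exact: Ff].
- exact: Ig.
- by apply/aeW => x n _; rewrite lee_fin.
move=> _ _ H; rewrite /Int /Rintegral; apply: fine_cvg.
by rewrite fineK//; exact: integrable_fin_num.
Qed.

Lemma Int_invariant (phi : T -> T) f : measurable_fun setT phi ->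
  (forall A, measurable A -> mu (phi @^-1` A) = mu A) ->
  intg f -> intg (f \o phi) /\ Int (f \o phi) = Int f.
Proof.
move=> mphi iphi If.
have mf : measurable_fun setT (EFin \o f) by exact/measurable_EFinP/intg_measurable.
pose gm : {mfun T >-> T} := HB.pack phi (isMeasurableFun.Build _ _ _ _ _ mphi).
have E (h : T -> \bar R) : (\int[pushforward mu gm]_x h x = \int[mu]_x h x)%E.
  by apply: eq_measure_integral => A mA _; exact: iphi.
have If' : mu.-integrable setT ((EFin \o f) \o phi).
  apply/integrableP; split; first exact: measurableT_comp.
  move/integrableP : If => [_]; rewrite -(E (fun x => `|(EFin \o f) x|%E)).
  rewrite ge0_integral_pushforward//.
  exact: measurableT_comp.
split => //; rewrite /Int /Rintegral; congr fine.
by rewrite -(E (EFin \o f)) integral_pushforward// preimage_setT.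
Qed.

End real_integral.

Section spacetime.
Context {R : realType} {N : nat}.
Notation E := ('rV[R]_N * R)%type.
Notation EM := ('rV[R]_N * measurableTypeR R)%type.
Notation mu := (@spacetime_leb R N).
Implicit Types f F : E -> R.

Lemma measurable_E_continuous f : continuous f -> measurable_fun setT (f : EM -> R).
Proof. by move=> cf; exact: (@continuous_measurable_E R N setT f openT (fun p _ => cf p)). Qed.

Definition cube (b : R) : set E := [set p | `|p.1| < b /\ `|p.2| < b].

Lemma open_cube b : open (cube b).
Proof.
apply: openI.
  apply: (@open_comp E R (fun p => `|p.1|) [set r : R | r < b]); last exact: open_lt.
  move=> p _; apply: (@continuous_comp E 'rV[R]_N R fst (fun x => `|x|)).
    exact: cvg_fst.
  exact: norm_continuous.
apply: (@open_comp E R (fun p => `|p.2|) [set r : R | r < b]); last exact: open_lt.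
move=> p _; apply: (@continuous_comp E R R snd (fun x => `|x|)); first exact: cvg_snd.
exact: norm_continuous.
Qed.

Lemma leb_ball_lty (b : R) : (leb R N [set x : 'rV[R]_N | (`|x| < b)%R] < +oo)%E.
Proof.
have [b0|b0] := leP b 0.
  rewrite (_ : [set x | _] = set0) ?measure0//.
  apply/seteqP; split => x //= xb; have := normr_ge0 x; lra.
apply: (@le_lt_trans _ _ (leb R N (open_box (fun _ : 'I_N => - b) (fun _ => b)))).
  apply: le_measure.
  - rewrite inE; apply: open_measurable_rV.
    apply: (@open_comp 'rV[R]_N R (fun p => `|p|) [set r : R | r < b]); last exact: open_lt.
    by move=> x _; exact: norm_continuous.
  - by rewrite inE; exact: measurable_open_box.
  - move=> x /= xb i; rewrite -ltr_norml.
    by apply: le_lt_trans xb; exact: coord_le_norm.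
rewrite leb_box; first exact: ltry.
by move=> i; lra.
Qed.

Lemma spacetime_rect (A : set 'rV[R]_N) (B : set (measurableTypeR R)) :
  measurable A -> measurable B -> mu (A `*` B) = (leb R N A * lebesgue_measure B)%E.
Proof. by move=> mA mB; exact: (@product_measure1E _ _ _ _ _ (leb R N) lebesgue_measure). Qed.

Lemma spacetime_cube_lty b : (mu (cube b : set EM) < +oo)%E.
Proof.
have mA : measurable [set x : 'rV[R]_N | `|x| < b].
  apply: open_measurable_rV.
  apply: (@open_comp 'rV[R]_N R (fun p => `|p|) [set r : R | r < b]); last exact: open_lt.
  by move=> x _; exact: norm_continuous.
have BE : [set x : R | `|x| < b] = `](- b), b[%classic.
  by apply/seteqP; split => x /=; rewrite in_itv /= ltr_norml.
have mB : measurable ([set x : R | `|x| < b] : set (measurableTypeR R)).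
  by rewrite BE; exact: measurable_itv.
rewrite (_ : cube b = [set x : 'rV[R]_N | `|x| < b] `*` [set x : R | `|x| < b]) //.
rewrite spacetime_rect//; apply: lte_mul_pinfty => //.
  by rewrite ge0_fin_numE//; exact: leb_ball_lty.
by rewrite BE lebesgue_measure_itv /=; case: ifP => _; rewrite -?EFinD ?ltry.
Qed.

Lemma measurable_cube b : measurable (cube b : set EM).
Proof. by apply: (@open_measurable_E R N); exact: open_cube. Qed.

Lemma intg_bounded f b (M : R) : measurable_fun setT (f : EM -> R) ->
  (forall p, `|f p| <= M) -> (forall p, ~ cube b p -> f p = 0) -> intg mu f.
Proof.
move=> mf fM f0.
have mb : measurable (cube b : set EM) by exact: measurable_cube.
have H : mu.-integrable (cube b) (EFin \o f).
  apply: measurable_bounded_integrable => //; first exact: spacetime_cube_lty.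
    exact: measurable_funTS.
  exists M; split; first exact: num_real.
  by move=> M' /ltW MM' x _ /=; rewrite (le_trans (fM x)).
rewrite /intg; move/integrable_mkcond : H => /(_ mb).
apply: eq_integrable => // p _; rewrite /patch /=; case: ifPn => //.
by rewrite notin_setE => /f0 ->.
Qed.

Lemma compact_sub_cube (K : set E) : compact K -> exists b, K `<=` cube b.
Proof.
move=> cK; have [] := @compact_bounded R E (fun p => `|p.1| + `|p.2|) K cK.
  apply: continuous_subspaceT => p; apply: cvgD.
    apply: (@continuous_comp E 'rV[R]_N R fst (fun x => `|x|)); first exact: cvg_fst.
    exact: norm_continuous.
  apply: (@continuous_comp E R R snd (fun x => `|x|)); first exact: cvg_snd.
  exact: norm_continuous.
move=> M M0 H; exists (M + 1) => p /H.
have a0 := normr_ge0 p.1; have b0 := normr_ge0 p.2.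
by rewrite ger0_norm ?addr_ge0// => h; split; lra.
Qed.

Lemma intg_compact f (K : set E) : compact K -> continuous f ->
  (forall p, ~ K p -> f p = 0) -> intg mu f.
Proof.
move=> cK cf f0; have [b Kb] := compact_sub_cube cK.
have [M M0 HM] := compact_bounded cK (continuous_subspaceT cf).
apply: (@intg_bounded _ b M); first exact: measurable_E_continuous.
  by move=> p; have [/HM//|/f0 ->] := pselect (K p); rewrite normr0.
by move=> p Kp; apply: f0 => /Kb.
Qed.

Lemma measurable_shiftE (c : E) : measurable_fun setT (fun p : EM => (p + c : EM)).
Proof.
apply: measurable_fun_pair.
  by apply: (measurableT_comp (measurable_addr_rV c.1)); exact: measurable_fst.
by apply: (measurableT_comp (measurable_addr c.2)); exact: measurable_snd.
Qed.

Lemma Int_shift f (c : E) : intg mu f ->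
  intg mu (fun p => f (p + c)) /\ Int mu (fun p => f (p + c)) = Int mu f.
Proof.
move=> If; apply: (@Int_invariant _ _ _ mu (fun p : EM => (p + c : EM)) f) => //.
  exact: measurable_shiftE.
by move=> A mA; exact: spacetime_shift.
Qed.

(* The integral of [F] is invariant under translation along [c], and the
   derivative of that constant function is the integral of the derivative. *)
Lemma Int_derive0 F F' (c : E) (K : set E) : compact K ->
  continuous F -> continuous F' -> (forall p, is_derive p c F (F' p)) ->
  (forall p, ~ K p -> F p = 0) -> (forall p, ~ K p -> F' p = 0) -> Int mu F' = 0.
Proof.
move=> cK cF cF' dF F0 F'0.
have IF : intg mu F by exact: intg_compact F0.
have [b Kb] := compact_sub_cube cK.
have [M M0 HM] := compact_bounded cK (continuous_subspaceT cF').
have HM' p : `|F' p| <= M.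
  by have [/HM//|/F'0 ->] := pselect (K p); rewrite normr0.
(* For [|h| <= 1] a point [p] with [p + h *: c] in [K] lies in this larger cube, which gives a
   dominating function independent of [h]. *)
pose b' := b + `|c.1| + `|c.2|.
pose G (p : EM) : R := M * \1_(cube b') p.
have mb' : measurable (cube b' : set EM) by exact: measurable_cube.
have IG : intg mu G.
  apply: intgZ; apply: (@intg_bounded _ b' 1).
  - exact: measurable_indic.
  - by move=> p; rewrite indicE; case: (_ \in _); rewrite /= ?normr1 ?normr0.
  - by move=> p pb; rewrite indicE memNset.
have line p (h : R) : is_derive h 1 (fun h : R => F (p + h *: c)) (F' (p + h *: c)).
  by have := is_derive_line (dF (h *: c + p)); rewrite addrC; under eq_fun do rewrite addrC.
have dE p (h : R) : partial1of2 (fun (h : R) (p : EM) => F (p + h *: c)) h p = F' (p + h *: c).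
  by rewrite partial1of2E; exact: (@derive_val _ _ _ _ _ _ _ (line p h)).
have := @differentiation_under_integral R _ EM mu
  (fun (h : R) (p : EM) => F (p + h *: c)) setT measurableT 0 (-1) 1.
rewrite /= in_itv /= ltrN10 ltr01 => /(_ isT _ _ G _ IG) H.
have -> : Int mu F' = derive1 (fun h : R => Int mu (fun p => F (p + h *: c))) 0.
  rewrite [RHS]H; first by apply: eq_Int => p; rewrite dE scale0r addr0.
  - by move=> h _; have [] := Int_shift (h *: c) IF.
  - by move=> h p _ _; have [] := line p h.
  - by move=> p; rewrite mulr_ge0.
  move=> h p; rewrite in_itv /= => /andP[h1 h2] _; rewrite dE /G indicE.
  have [pb|pb] := boolP (p \in _); first by rewrite mulr1.
  rewrite F'0 ?normr0 ?mulr0// => /Kb [q1 q2]; move: pb; apply/negP; rewrite negbK inE.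
  have hn : `|h| <= 1 by rewrite ler_norml; lra.
  split.
    have -> : p.1 = (p + h *: c).1 - h *: c.1 by rewrite /= addrK.
    apply: (le_lt_trans (ler_normB _ _)); rewrite normrZ /b'.
    have := ler_wpM2r (normr_ge0 c.1) hn; have := normr_ge0 c.2; lra.
  have -> : p.2 = (p + h *: c).2 - h * c.2 by rewrite /= addrK.
  apply: (le_lt_trans (ler_normB _ _)); rewrite normrM /b'.
  have := ler_wpM2r (normr_ge0 c.2) hn; have := normr_ge0 c.1; lra.
rewrite (_ : (fun h : R => _) = cst (Int mu F)); first exact: derive1_cst.
by apply/funext => h; have [] := Int_shift (h *: c) IF.
Qed.

End spacetime.

(** * Kato's inequality *)

Section scalar.
Context {R : realType}.
Implicit Types s : R.

Definition pos s : R := Num.max s 0.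

Lemma pos_ge0 s : 0 <= pos s. Proof. by rewrite /pos le_max lexx orbT. Qed.
Lemma posP s : 0 <= s -> pos s = s. Proof. by move=> s0; rewrite /pos max_l. Qed.
Lemma posN s : s <= 0 -> pos s = 0. Proof. by move=> s0; rewrite /pos max_r. Qed.
Lemma ge_pos s : s <= pos s. Proof. by rewrite /pos le_max lexx. Qed.

Lemma pospow1 s : pospow 1 s = pos s. Proof. by rewrite /pospow expr1. Qed.

Lemma pos_cases s : (s <= 0 /\ pos s = 0) \/ (0 <= s /\ pos s = s).
Proof. by have [s0|/ltW s0] := leP s 0; [left; rewrite posN|right; rewrite posP]. Qed.

(* A C^2 convex function vanishing on the negative half-line and equal to [s - 1]
   for [s >= 2]: the second difference of the truncated cube. *)
Definition hinge s : R := (pospow 3 s - 2 * pospow 3 (s - 1) + pospow 3 (s - 2)) / 6.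
Definition hinge1 s : R := (pospow 2 s - 2 * pospow 2 (s - 1) + pospow 2 (s - 2)) / 2.
Definition hinge2 s : R := pospow 1 s - 2 * pospow 1 (s - 1) + pospow 1 (s - 2).

Lemma hinge_le0 s : s <= 0 -> [/\ hinge s = 0, hinge1 s = 0 & hinge2 s = 0].
Proof.
move=> s0; have h1 : s - 1 <= 0 by lra.
have h2 : s - 2 <= 0 by lra.
by rewrite /hinge /hinge1 /hinge2 !pospowN//; split; lra.
Qed.

Lemma hinge1_bounds s : 0 <= hinge1 s <= 1.
Proof.
rewrite /hinge1 /pospow -!/(pos _).
by have [[h1 ->]|[h1 ->]] := pos_cases s; have [[h2 ->]|[h2 ->]] := pos_cases (s - 1);
  have [[h3 ->]|[h3 ->]] := pos_cases (s - 2); nra.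
Qed.

Lemma hinge2_bounds s : 0 <= hinge2 s <= 1.
Proof.
rewrite /hinge2 !pospow1.
by have [[h1 ->]|[h1 ->]] := pos_cases s; have [[h2 ->]|[h2 ->]] := pos_cases (s - 1);
  have [[h3 ->]|[h3 ->]] := pos_cases (s - 2); lra.
Qed.

Lemma hinge2_ge2 s : 2 <= s -> hinge2 s = 0.
Proof. by move=> s2; rewrite /hinge2 !pospow1 !posP; lra. Qed.

Lemma hinge_bounds s : pos s - 1 <= hinge s <= pos s.
Proof.
have [s0|s0] := leP s 0.
  by have [-> _ _] := hinge_le0 s0; rewrite posN//; lra.
rewrite /hinge (posP (ltW s0)) [pospow 3 s]pospowP ?(ltW s0)//.
have [s1|s1] := leP s 1.
  have a1 : s - 1 <= 0 by lra.
  have a2 : s - 2 <= 0 by lra.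
  rewrite !pospowN//; have b0 : 0 <= s ^+ 3 by rewrite exprn_ge0// ltW.
  have b1 : s ^+ 3 <= s by rewrite -[leRHS]expr1 ler_wiXn2l// ltW.
  lra.
have a1 : 0 <= s - 1 by lra.
rewrite [pospow 3 (s - 1)]pospowP//.
have [s2|s2] := leP s 2.
  have a2 : s - 2 <= 0 by lra.
  rewrite pospowN//.
  have b0 : 0 <= (2 - s) ^+ 3 by rewrite exprn_ge0//; lra.
  have b1 : 0 <= (s - 1) ^+ 3 by rewrite exprn_ge0//; lra.
  have b2 : 0 <= (s - 1) * (2 - s) by rewrite mulr_ge0//; lra.
  apply/andP; split; nra.
rewrite pospowP; last lra.
rewrite (_ : (s ^+ 3 - 2 * (s - 1) ^+ 3 + (s - 2) ^+ 3) / 6 = s - 1); last by field.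
lra.
Qed.

End scalar.

Section sc2.
Context {R : realType}.
Implicit Types h k : R -> R.

Record sc2 h h1 h2 : Prop := Sc2 {
  sc2_c0 : continuous h; sc2_c1 : continuous h1; sc2_c2 : continuous h2;
  sc2_d1 : forall s : R, is_derive s 1 h (h1 s);
  sc2_d2 : forall s : R, is_derive s 1 h1 (h2 s) }.

Lemma sc2_ext h h1 h2 k k1 k2 : h =1 k -> h1 =1 k1 -> h2 =1 k2 ->
  sc2 h h1 h2 -> sc2 k k1 k2.
Proof. by move=> /funext -> /funext -> /funext ->. Qed.

Lemma sc2_cst (c : R) : sc2 (cst c) (cst 0) (cst 0).
Proof. by split; try exact: cst_continuous; move=> s; exact: is_derive_cst. Qed.

Lemma is_derive_mulR h k (s a b : R) : is_derive s 1 h a -> is_derive s 1 k b ->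
  is_derive s 1 (fun s => h s * k s) (a * k s + h s * b).
Proof. exact: (@is_derive_mul _ R^o). Qed.

Lemma is_derive_addR h k (s a b : R) : is_derive s 1 h a -> is_derive s 1 k b ->
  is_derive s 1 (fun s => h s + k s) (a + b).
Proof. exact: (@is_derive_add _ R^o). Qed.

Lemma is_derive_eqR h (s a b : R) : is_derive s 1 h a -> a = b -> is_derive s 1 h b.
Proof. by move=> ? <-. Qed.

Lemma is_derive_affR (a c s : R) : is_derive s 1 (fun s => a * s + c) a.
Proof.
apply: (@is_derive_affine _ R^o) => r.
by rewrite /= [r *: _]mulr1; ring.
Qed.

Lemma sc2_mul h h1 h2 k k1 k2 : sc2 h h1 h2 -> sc2 k k1 k2 ->
  sc2 (fun s => h s * k s) (fun s => h1 s * k s + h s * k1 s)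
      (fun s => (h2 s * k s + h1 s * k1 s) + (h1 s * k1 s + h s * k2 s)).
Proof.
move=> [a0 a1 a2 a3 a4] [b0 b1 b2 b3 b4]; split.
- by move=> s; apply: cvgM; [exact: a0|exact: b0].
- by move=> s; apply: cvgD; apply: cvgM;
    by [exact: a0|exact: b0|exact: a1|exact: b1].
- by move=> s; apply: cvgD; apply: cvgD; apply: cvgM;
    by [exact: a0|exact: b0|exact: a1|exact: b1|exact: a2|exact: b2].
- by move=> s; exact: is_derive_mulR.
- by move=> s; apply: is_derive_addR; exact: is_derive_mulR.
Qed.

Lemma sc2_add h h1 h2 k k1 k2 : sc2 h h1 h2 -> sc2 k k1 k2 ->
  sc2 (fun s => h s + k s) (fun s => h1 s + k1 s) (fun s => h2 s + k2 s).
Proof.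
move=> [a0 a1 a2 a3 a4] [b0 b1 b2 b3 b4]; split.
- by move=> s; apply: cvgD; [exact: a0|exact: b0].
- by move=> s; apply: cvgD; [exact: a1|exact: b1].
- by move=> s; apply: cvgD; [exact: a2|exact: b2].
- by move=> s; exact: is_derive_addR.
- by move=> s; exact: is_derive_addR.
Qed.

Lemma sc2_scale (c : R) h h1 h2 : sc2 h h1 h2 ->
  sc2 (fun s => c * h s) (fun s => c * h1 s) (fun s => c * h2 s).
Proof.
move=> H; have := sc2_mul (sc2_cst c) H.
by apply: sc2_ext => s /=; rewrite ?mul0r ?add0r.
Qed.

Lemma sc2_comp h h1 h2 k k1 k2 : sc2 h h1 h2 -> sc2 k k1 k2 ->
  sc2 (fun s => h (k s)) (fun s => h1 (k s) * k1 s)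
      (fun s => h2 (k s) * k1 s * k1 s + h1 (k s) * k2 s).
Proof.
move=> [a0 a1 a2 a3 a4] [b0 b1 b2 b3 b4].
have c0 : continuous (h \o k) by move=> s; apply: continuous_comp; [exact: b0|exact: a0].
have c1 : continuous (h1 \o k) by move=> s; apply: continuous_comp; [exact: b0|exact: a1].
have c2 : continuous (h2 \o k) by move=> s; apply: continuous_comp; [exact: b0|exact: a2].
split.
- exact: c0.
- by move=> s; apply: cvgM; [exact: c1|exact: b1].
- move=> s; apply: cvgD; last by apply: cvgM; [exact: c1|exact: b2].
  by apply: cvgM; [apply: cvgM; [exact: c2|exact: b1]|exact: b1].
- by move=> s; apply: (@is_derive1_comp _ h k).
- by move=> s; apply: (@is_derive_mulR (h1 \o k)).
Qed.

Lemma sc2_aff (a c : R) : sc2 (fun s => a * s + c) (cst a) (cst 0).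
Proof.
split; try exact: cst_continuous.
- by move=> s; apply: cvgD; [apply: cvgM; [exact: cvg_cst|exact: cvg_id]|exact: cvg_cst].
- by move=> s; exact: is_derive_affR.
- by move=> s; exact: is_derive_cst.
Qed.

Lemma sc2_preaff (a c : R) h h1 h2 : sc2 h h1 h2 ->
  sc2 (fun s => h (a * s + c)) (fun s => a * h1 (a * s + c))
      (fun s => a ^+ 2 * h2 (a * s + c)).
Proof.
move=> H; have := sc2_comp H (sc2_aff a c).
by apply: sc2_ext => s //=; ring.
Qed.

Lemma sc2_pospow3 : sc2 (pospow 3) (fun s : R => 3 * pospow 2 s) (fun s => 6 * pospow 1 s).
Proof.
split; try exact: continuous_pospow.
- by move=> s; apply: cvgM; [exact: cvg_cst|exact: continuous_pospow].
- by move=> s; apply: cvgM; [exact: cvg_cst|exact: continuous_pospow].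
- by move=> s; exact: is_derive_pospow.
- move=> s; have := @is_derive_mulR (cst 3) (pospow 2) s _ _ (is_derive_cst _ _ _) (is_derive_pospow _ _).
  by move=> /is_derive_eqR; apply; rewrite /=; ring.
Qed.

Lemma sc2_hinge : sc2 hinge hinge1 (@hinge2 R).
Proof.
have := sc2_scale (6^-1) (sc2_add (sc2_add sc2_pospow3
  (sc2_scale (-2) (sc2_preaff 1 (-1) sc2_pospow3))) (sc2_preaff 1 (-2) sc2_pospow3)).
by apply: sc2_ext => s; rewrite /hinge /hinge1 /hinge2 !mul1r; field.
Qed.

(** A convex C^2 regularisation of the positive part, uniformly within [e] of it, whose derivative
    vanishes on the negative half-line. *)
Definition shinge (e s : R) := e * hinge (s / e).
Definition shinge1 (e s : R) := hinge1 (s / e).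
Definition shinge2 (e s : R) := hinge2 (s / e) / e.

Lemma sc2_shinge (e : R) : 0 < e -> sc2 (shinge e) (shinge1 e) (shinge2 e).
Proof.
move=> e0; have en0 : e != 0 by rewrite gt_eqF.
have := sc2_scale e (sc2_preaff (e^-1) 0 sc2_hinge).
by apply: sc2_ext => s; rewrite /shinge /shinge1 /shinge2 addr0 [e^-1 * s]mulrC; field.
Qed.

Lemma shinge_bounds (e s : R) : 0 < e -> `|pos s - shinge e s| <= e.
Proof.
move=> e0; have /andP[h1 h2] := hinge_bounds (s / e).
have E : pos s = e * pos (s / e).
  have [[s0 ->]|[s0 ->]] := pos_cases s.
    by rewrite posN ?mulr0// pmulr_lle0// invr_gt0.
  have se0 : 0 <= s / e by apply: divr_ge0 => //; exact: ltW.
  by rewrite (posP se0); field; rewrite gt_eqF.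
rewrite E /shinge -mulrBr normrM gtr0_norm// -[leRHS]mulr1 (ler_wpM2l (ltW e0))//.
by rewrite ler_norml; lra.
Qed.

End sc2.

Section kato.
Context {R : realType} {N : nat}.
Notation E := ('rV[R]_N * R)%type.
Notation mu := (@spacetime_leb R N).
Implicit Types (D K : set E) (J w z : @jet R N).

Lemma C21_sc2 D J h h1 h2 : sc2 h h1 h2 -> C21 D J -> C21 D (jcomp h h1 h2 J).
Proof.
move=> [a0 a1 a2 a3 a4]; apply: C21_comp => p Dp.
by split; [exact: a0|exact: a1|exact: a2|exact: a3|exact: a4].
Qed.

Lemma open_setC_compact K : compact K -> open (~` K).
Proof. by move=> cK; rewrite openC; apply: compact_closed => //; exact: norm_hausdorff. Qed.

Lemma cut_continuous D K (f : E -> R) : compact K -> K `<=` D ->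
  (forall p, D p -> {for p, continuous f}) -> (forall p, ~ K p -> f p = 0) ->
  continuous f.
Proof.
move=> cK KD cf f0 p; have [Kp|Kp] := pselect (K p); first exact/cf/KD.
rewrite /continuous_at (f0 p)//; apply: cvg_trans (near_eq_cvg _) (cvg_cst (0 : R)).
near=> r; rewrite f0//; near: r; apply: (@open_nbhs_nbhs _ p (~` K)).
by split => //; exact: open_setC_compact.
Unshelve. all: end_near. Qed.

Lemma cut_derive D K (f f' : E -> R) v : compact K -> K `<=` D ->
  (forall p, D p -> is_derive p v f (f' p)) -> (forall p, ~ K p -> f p = 0) ->
  (forall p, ~ K p -> f' p = 0) -> forall p, is_derive p v f (f' p).
Proof.
move=> cK KD df f0 f'0 p; have [Kp|Kp] := pselect (K p); first exact/df/KD.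
rewrite f'0//; apply: (@near_eq_is_derive _ _ _ (cst 0)).
near=> r; rewrite f0//; near: r; apply: (@open_nbhs_nbhs _ p (~` K)).
by split => //; exact: open_setC_compact.
Unshelve. all: end_near. Qed.

Lemma intg_cut D K (f : E -> R) : compact K -> K `<=` D ->
  (forall p, D p -> {for p, continuous f}) -> (forall p, ~ K p -> f p = 0) ->
  intg mu f.
Proof.
move=> cK KD cf f0; apply: (intg_compact cK) => //; exact: cut_continuous cf f0.
Qed.

Lemma continuous_jlap D J p : C21 D J -> D p -> {for p, continuous (jlap J)}.
Proof. by move=> HJ Dp; apply: cvg_fsum => i; exact: C21_cxx HJ _ Dp _ _. Qed.

(** The difference of the two integrands is the time derivative of [Y z] minus the divergence of
    [z grad Y - Y grad z]. Each term is a derivative of a function supported in [K], so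
    [Int_derive0] applies. *)
Lemma green D K Y z : compact K -> K `<=` D -> C21 D Y -> C21 setT z ->
  (forall p, ~ K p -> j0 z p = 0) ->
  Int mu (fun p => j0 Y p * jbh z p) = Int mu (fun p => j0 z p * jfh Y p).
Proof.
move=> cK KD HY Hz z0; have HzD : C21 D z by exact: C21W Hz.
have [_ zt zx zxx] : jets0 z (~` K).
  by apply: C21_jets0 Hz _ => //; exact: open_setC_compact.
have [Y0 Yt Yx Yxx Ydt Ydx Ydxx] := HY.
have [Z0 Zt Zx Zxx Zdt Zdx Zdxx] := HzD.
have zlap p : ~ K p -> jlap z p = 0.
  by move=> Kp; rewrite /jlap big1// => i _; exact: zxx.
pose f1 p := jt Y p * j0 z p + j0 Y p * jt z p.
have If1 : Int mu f1 = 0.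
  apply: (@Int_derive0 _ _ (fun p => j0 Y p * j0 z p) f1 dirt K) => //.
  - apply: (cut_continuous cK KD) => p Dp; last by rewrite z0 ?mulr0.
    by apply: cvgM; [exact: Y0|exact: Z0].
  - apply: (cut_continuous cK KD) => p Dp; last by rewrite /f1 z0// zt// !mulr0 addr0.
    by apply: cvgD; apply: cvgM; by [exact: Y0|exact: Z0|exact: Yt|exact: Zt].
  - apply: (cut_derive cK KD) => p Dp; first by apply: is_derive_mul; auto.
      by rewrite z0 ?mulr0.
    by rewrite /f1 z0// zt// !mulr0 addr0.
  - by move=> p Kp; rewrite z0 ?mulr0.
  - by move=> p Kp; rewrite /f1 z0// zt// !mulr0 addr0.
pose f2 i p := jxx Y i i p * j0 z p - j0 Y p * jxx z i i p.
have f20 i p : ~ K p -> f2 i p = 0 by move=> Kp; rewrite /f2 z0// zxx// !mulr0 subrr.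
have cf2 i : continuous (f2 i).
  apply: (cut_continuous cK KD) => p Dp; last exact: f20.
  apply: cvgB; apply: cvgM; by [exact: Y0|exact: Z0|exact: Yxx|exact: Zxx].
have If2 i : Int mu (f2 i) = 0.
  apply: (@Int_derive0 _ _ (fun p => jx Y i p * j0 z p - j0 Y p * jx z i p)
    (f2 i) (dirx i) K) => //.
  - apply: (cut_continuous cK KD) => p Dp; last by rewrite z0// zx// !mulr0 subrr.
    apply: cvgB; apply: cvgM; by [exact: Y0|exact: Z0|exact: Yx|exact: Zx].
  - apply: (cut_derive cK KD) => p Dp; last exact: f20.
      rewrite (_ : f2 i p = (jxx Y i i p * j0 z p + jx Y i p * jx z i p) +
        - (jx Y i p * jx z i p + j0 Y p * jxx z i i p)); last by rewrite /f2; ring.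
      apply: is_derive_add; first by apply: is_derive_mul; auto.
      apply: (@is_deriveN _ _ _ (fun p => j0 Y p * jx z i p)).
      by apply: is_derive_mul; auto.
    by rewrite z0// zx// !mulr0 subrr.
  - by move=> p Kp; rewrite z0// zx// !mulr0 subrr.
  - by move=> p; exact: f20.
have g1 : intg mu f1.
  apply: (intg_cut cK KD) => p Dp; last by rewrite /f1 z0// zt// !mulr0 addr0.
  by apply: cvgD; apply: cvgM; by [exact: Y0|exact: Z0|exact: Yt|exact: Zt].
have g2 i : intg mu (f2 i) by apply: (intg_compact cK (cf2 i)) => p; exact: f20.
have g3 : intg mu (fun p => j0 Y p * jbh z p).
  apply: (intg_cut cK KD) => p Dp; last by rewrite /jbh zt// zlap// subr0 oppr0 mulr0.
  apply: cvgM; first exact: Y0.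
  by apply: cvgB; [apply: cvgN; exact: Zt|exact: (continuous_jlap HzD)].
have g4 : intg mu (fun p => j0 z p * jfh Y p).
  apply: (intg_cut cK KD) => p Dp; last by rewrite z0 ?mul0r.
  apply: cvgM; first exact: Z0.
  by apply: cvgB; [exact: Yt|exact: (continuous_jlap HY)].
apply/eqP; rewrite eq_sym -subr_eq0 -IntB//; apply/eqP.
transitivity (Int mu (fun p => f1 p - \sum_(i < N) f2 i p)); last first.
  by rewrite IntB ?Int_sum//; [rewrite If1 big1 ?subrr|exact: intg_sum].
apply: eq_Int => p; rewrite /f1 /f2 sumrB -mulr_suml -mulr_sumr -/(jlap _ _) -/(jlap _ _).
by rewrite /jfh /jbh; ring.
Qed.

(** For a convex C^2 function [h] the forward operator applied to [h(w)] is
    [h'(w) jfh w - h''(w) |grad w|^2]. With [h] a regularised positive part this is nonpositive,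
    since [h'] vanishes where [w <= 0]; Green's identity moves the operator onto [z], and the
    regularisation is then removed. *)
Lemma kato D K w z : compact K -> K `<=` D -> C21 D w -> C21 setT z ->
  (forall p, ~ K p -> j0 z p = 0) -> (forall p, 0 <= j0 z p) ->
  (forall p, K p -> 0 < j0 w p -> jfh w p <= 0) ->
  Int mu (fun p => pos (j0 w p) * jbh z p) <= 0.
Proof.
move=> cK KD Hw Hz z0 zge wneg.
have [_ zt zx zxx] : jets0 z (~` K).
  by apply: C21_jets0 Hz _ => //; exact: open_setC_compact.
have bz p : ~ K p -> jbh z p = 0.
  move=> Kp; rewrite /jbh zt// /jlap big1 ?subr0 ?oppr0// => i _; exact: zxx.
have HzD : C21 D z by exact: C21W Hz.
have cbz p : D p -> {for p, continuous (jbh z)}.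
  move=> Dp; apply: cvgB; last exact: (continuous_jlap HzD).
  by apply: cvgN; exact: (C21_ct HzD).
have Ibz : intg mu (fun p => `|jbh z p|).
  by apply/intg_abs; apply: (intg_cut cK KD) => p; [exact: cbz|exact: bz].
have Iw : intg mu (fun p => pos (j0 w p) * jbh z p).
  apply: (intg_cut cK KD) => p Dp; last by rewrite bz ?mulr0.
  apply: cvgM; last exact: cbz.
  apply: (@continuous_comp _ _ _ (j0 w) pos); first exact: (C21_c0 Hw).
  by rewrite (_ : pos = pospow 1) ; [exact: continuous_pospow|apply/funext => s; rewrite pospow1].
apply/ler_addgt0Pl => e e0; rewrite addr0.
pose M := Int mu (fun p => `|jbh z p|).
have M0 : 0 <= M by apply: Int_ge0.
(* Replacing [pos] by its regularisation changes the integral by at most [c * M <= e]; the [+ 1]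
   covers [M = 0]. *)
pose c := e / (M + 1).
have M1 : 0 < M + 1 by lra.
have c0 : 0 < c by rewrite divr_gt0.
pose Y := jcomp (shinge c) (shinge1 c) (shinge2 c) w.
have HY : C21 D Y by apply: C21_sc2 Hw; exact: sc2_shinge.
have := green cK KD HY Hz z0.
set L := Int _ _ => G.
have IY : intg mu (fun p => j0 Y p * jbh z p).
  apply: (intg_cut cK KD) => p Dp; last by rewrite bz ?mulr0.
  by apply: cvgM; [exact: (C21_c0 HY)|exact: cbz].
have L0 : L <= 0.
  rewrite G -oppr_ge0 -IntN; last first.
    apply: (intg_cut cK KD) => p Dp; last by rewrite z0 ?mul0r.
    apply: cvgM; first exact: (C21_c0 HzD).
    by apply: cvgB; [exact: (C21_ct HY)|exact: (continuous_jlap HY)].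
  apply: Int_ge0 => p; have [Kp|Kp] := pselect (K p); last by rewrite z0// mul0r oppr0.
  rewrite -mulrN mulr_ge0// oppr_ge0 /jfh jlap_comp /=.
  have s0 : 0 <= \sum_(i < N) jx w i p ^+ 2 by apply: sumr_ge0 => i _; exact: sqr_ge0.
  have h2 : 0 <= shinge2 c (j0 w p).
    by rewrite divr_ge0 ?(ltW c0)//; have /andP[] := hinge2_bounds (j0 w p / c).
  have h1 : shinge1 c (j0 w p) * jfh w p <= 0.
    have [w0|w0] := leP (j0 w p) 0.
      rewrite /shinge1; have [|_ -> _] := @hinge_le0 _ (j0 w p / c).
        by rewrite pmulr_lle0// invr_gt0.
      by rewrite mul0r.
    rewrite mulr_ge0_le0//; last exact: wneg.
    by have /andP[] := hinge1_bounds (j0 w p / c).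
  have := mulr_ge0 h2 s0; move: h1; rewrite /jfh; nra.
have : Int mu (fun p => pos (j0 w p) * jbh z p - j0 Y p * jbh z p) <= c * M.
  rewrite -IntZ//; apply: Int_le; [exact: intgB|exact: intgZ|move=> p].
  rewrite -mulrBl (le_trans (ler_norm _))// normrM ler_wpM2r//.
  exact: shinge_bounds.
rewrite IntB// -/L => H.
have : c * M <= e.
  by rewrite /c mulrAC ler_pdivrMr// ler_wpM2l ?(ltW e0)//; lra.
lra.
Qed.

End kato.

(** * Mollification *)

Section kernel_integral.
Context {R : realType} {N : nat}.
Notation E := ('rV[R]_N * R)%type.
Notation EM := ('rV[R]_N * measurableTypeR R)%type.

(** Dominated convergence works along sequences, so continuity of parameter integrals is tested
    along sequences. As [D] is open, those staying in [D] suffice. *)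
Lemma continuous_seq (D : set E) (f : E -> R) (e : E) : open D -> D e ->
  (forall u : nat -> E, (forall n, D (u n)) -> u n @[n --> \oo] --> e ->
     f (u n) @[n --> \oo] --> f e) -> {for e, continuous f}.
Proof.
move=> oD De H; apply: contrapT => nc.
have [eps eps0 {nc}nc] : exists2 eps : R, 0 < eps &
    ~ (\forall x \near e, `|f e - f x| < eps).
  apply: contrapT => h; apply: nc; apply/cvgrPdist_lt => eps eps0.
  by apply: contrapT => h2; apply: h; exists eps.
have /nbhs_ballP[r /= r0 rD] : nbhs e D by exact: open_nbhs_nbhs.
have /choice[u Hu] (n : nat) : exists x, [/\ D x, ball e n.+1%:R^-1 x &
    eps <= `|f e - f x|].
  apply: contrapT => h; apply: nc; apply/nbhs_ballP.
  exists (Num.min r n.+1%:R^-1) => /=; first by rewrite lt_min r0 invr_gt0 ltr0n.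
  move=> x xb; rewrite ltNge; apply/negP => ex; apply: h; exists x; split => //.
    by apply: rD; apply: le_ball xb; rewrite ge_min lexx.
  by apply: le_ball xb; rewrite ge_min lexx orbT.
have ue : u n @[n --> \oo] --> e.
  apply/cvg_ballP => d d0.
  have [m dm] : exists m : nat, m.+1%:R^-1 <= d.
    have [m _ hm] := near_infty_natSinv_lt (PosNum d0).
    by exists m; apply: ltW; exact: (hm m (leqnn m)).
  exists m => // n /= mn; have [_ h _] := Hu n; apply: le_ball h.
  by apply: le_trans dm; rewrite lef_pV2 ?posrE ?ltr0n// ler_nat ltnS.
have uD n : D (u n) by have [] := Hu n.
have /cvgrPdist_lt/(_ eps eps0)[m _ hm] := H u uD ue.
have := hm m (leqnn m); have [_ _] := Hu m; rewrite /=.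
by move=> h1 h2; move: (le_lt_trans h1 h2); rewrite ltxx.
Qed.

Context d (P : measurableType d) (nu : {measure set P -> \bar R}).
Variables (sigma : P -> E) (phi : P -> R) (D : set E).
Hypothesis msigma : measurable_fun setT (sigma : P -> EM).
Hypothesis Iphi : intg nu phi.
Hypothesis oD : open D.
Hypothesis Dsigma : forall e p, D e -> D (e - sigma p).

(** The density [phi] is merely integrable and [f] carries the regularity. Two convolutions are
    covered: [sigma := id] over space-time is a mollification of [phi], and [sigma y := (y, 0)] over
    space is the heat flow of the datum [phi]. *)
Definition ker (f : E -> R) (e : E) : R := Int nu (fun p => phi p * f (e - sigma p)).

Lemma measurable_ker (f : E -> R) e : (forall x, D x -> {for x, continuous f}) -> D e ->
  measurable_fun setT (fun p => f (e - sigma p)).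
Proof.
move=> cf De.
have mf : measurable_fun (D : set EM) (f : EM -> R) by exact: continuous_measurable_E.
apply: (@measurable_comp _ _ _ _ _ _ (D : set EM) (f : EM -> R) setT
  (fun p => e - sigma p : EM)).
- exact: open_measurable_E.
- by move=> _ [p _ <-]; exact: Dsigma.
- exact: mf.
rewrite (_ : (fun p => _) = (fun p => ((e.1 - (sigma p).1, e.2 - (sigma p).2) : EM))) //.
have m1 : measurable_fun setT (fun p => (sigma p).1).
  by apply: (measurableT_comp measurable_fst msigma).
have m2 : measurable_fun setT (fun p => ((sigma p).2 : measurableTypeR R)).
  by apply: (measurableT_comp measurable_snd msigma).
apply: measurable_fun_pair; last first.
  apply: (@measurable_funB _ _ R setT (cst e.2) (fun p => (sigma p).2)) => //.
apply: measurable_fun_rVP => i; under eq_fun do rewrite !mxE.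
apply: measurable_funB => //.
by apply: (measurableT_comp (measurable_coord i) m1).
Qed.

Lemma intg_ker (f : E -> R) e (M : R) : (forall x, D x -> {for x, continuous f}) -> D e ->
  (forall x, D x -> `|f x| <= M) -> intg nu (fun p => phi p * f (e - sigma p)).
Proof.
move=> cf De fM; apply: (@intgM _ _ _ _ _ _ M) => //; first exact: measurable_ker.
by move=> p; apply: fM; exact: Dsigma.
Qed.

Lemma continuous_ker (f : E -> R) (M : R) : (forall x, D x -> {for x, continuous f}) ->
  (forall x, D x -> `|f x| <= M) -> forall e, D e -> {for e, continuous (ker f)}.
Proof.
move=> cf fM e De; apply: (continuous_seq oD De) => u uD ue.
have [] := @Int_dct _ _ _ nu (fun n p => phi p * f (u n - sigma p))
  (fun p => phi p * f (e - sigma p)) (fun p => M * `|phi p|).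
- move=> n; apply: measurable_funM; first exact: (intg_measurable Iphi).
  exact: measurable_ker.
- move=> p; apply: cvgM; first exact: cvg_cst.
  have cc : {for e - sigma p, continuous f} by apply: cf; exact: Dsigma.
  apply: (@cvg_comp _ _ _ (fun n => u n - sigma p) f _ _ _ _ cc).
  by apply: cvgB => //; exact: cvg_cst.
- exact/intgZ/intg_abs.
- move=> n p; rewrite normrM mulrC ler_wpM2r//; apply: fM; exact: Dsigma.
by [].
Qed.

Lemma is_derive_ker (f f' : E -> R) v (M : R) : (forall x, D x -> {for x, continuous f}) ->
  (forall x, D x -> is_derive x v f (f' x)) ->
  (forall x, D x -> `|f x| <= M) -> (forall x, D x -> `|f' x| <= M) ->
  forall e, D e -> is_derive e v (ker f) (ker f' e).
Proof.
move=> cf df fM f'M e De; apply/is_derive_lineP.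
have [r r0 rD] : exists2 r : R, 0 < r & forall h : R, `|h| < r -> D (h *: v + e).
  have : \forall h \near (0 : R), D (h *: v + e).
    have cl : {for (0 : R), continuous (fun h : R => h *: v + e)}.
      apply: cvgD; last exact: cvg_cst; apply: cvgZr_tmp; exact: cvg_id.
    by apply: cl; rewrite scale0r add0r; exact: open_nbhs_nbhs.
  move=> /nbhs_ballP[r /= r0 H]; exists r => // h hr; apply: H.
  by rewrite /ball /= sub0r normrN.
have I0 : `]- r, r[%classic (0 : R) by rewrite /= in_itv /= oppr_lt0 r0.
have line p (h : R) : `]- r, r[%classic h ->
    is_derive h 1 (fun h : R => f (h *: v + e - sigma p)) (f' (h *: v + e - sigma p)).
  rewrite /= in_itv /= -ltr_norml => hr.
  have := df _ (Dsigma p (rD h hr)); rewrite -addrA => /is_derive_line.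
  by under eq_fun do rewrite addrA.
have dE p (h : R) : `]- r, r[%classic h ->
    partial1of2 (fun (h : R) p => phi p * f (h *: v + e - sigma p)) h p
    = phi p * f' (h *: v + e - sigma p).
  move=> Ih; rewrite partial1of2E.
  have := is_derive_mulR (is_derive_cst (phi p) h 1) (line p h Ih).
  by move=> /(@derive_val _ _ _ _ _ _ _) /= ->; rewrite mul0r add0r.
have A1 : forall x : R, `]- r, r[%classic x ->
    nu.-integrable setT (EFin \o (fun p => phi p * f (x *: v + e - sigma p))).
  move=> h; rewrite /= in_itv /= -ltr_norml => hr.
  by apply: intg_ker fM => //; exact: rD.
have A2 : forall (x : R) (p : P), `]- r, r[%classic x -> [set: P] p ->
    derivable (fun h : R => phi p * f (h *: v + e - sigma p)) x 1.
  move=> h p Ih _; have := is_derive_mulR (is_derive_cst (phi p) h 1) (line p h Ih).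
  by case.
have A3 : forall p : P, 0 <= `|M| * `|phi p| by move=> p; rewrite mulr_ge0.
have A4 : nu.-integrable setT (EFin \o (fun p => `|M| * `|phi p|)).
  exact/intgZ/intg_abs.
have A5 : forall (x : R) (p : P), `]- r, r[%classic x -> [set: P] p ->
   `|partial1of2 (fun (h : R) p => phi p * f (h *: v + e - sigma p)) x p| <= `|M| * `|phi p|.
  move=> h p Ih _; rewrite dE// normrM mulrC ler_wpM2r//.
  rewrite (le_trans _ (ler_norm M))//; apply: f'M; apply: Dsigma; apply: rD.
  by move: Ih; rewrite /= in_itv /= -ltr_norml.
split; first exact: (derivable_under_integral measurableT I0 A1 A2 A3 A4 A5).
have := differentiation_under_integral measurableT I0 A1 A2 A3 A4 A5.
rewrite derive1E => ->; apply: eq_Int => p.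
by rewrite dE//= scale0r add0r.
Qed.

Definition jker (k : @jet R N) : jet :=
  Jet (ker (j0 k)) (ker (jt k)) (fun i => ker (jx k i)) (fun i j => ker (jxx k i j)).

Lemma C21_ker k M : C21 D k -> (forall x, D x -> jnorm k x <= M) -> C21 D (jker k).
Proof.
move=> [K0 Kt Kx Kxx Kdt Kdx Kdxx] kM.
have b0 x : D x -> `|j0 k x| <= M.
  by move=> Dx; have [h _ _ _] := jnormP k x; rewrite (le_trans h)// kM.
have bt x : D x -> `|jt k x| <= M.
  by move=> Dx; have [_ h _ _] := jnormP k x; rewrite (le_trans h)// kM.
have bx i x : D x -> `|jx k i x| <= M.
  by move=> Dx; have [_ _ h _] := jnormP k x; rewrite (le_trans (h i))// kM.
have bxx i j x : D x -> `|jxx k i j x| <= M.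
  by move=> Dx; have [_ _ _ h] := jnormP k x; rewrite (le_trans (h i j))// kM.
split=> e De *.
- exact: (@continuous_ker _ M).
- exact: (@continuous_ker _ M).
- by apply: (@continuous_ker _ M) => // x Dx; [exact: Kx|exact: bx].
- by apply: (@continuous_ker _ M) => // x Dx; [exact: Kxx|exact: bxx].
- exact: (@is_derive_ker _ _ _ M).
- by apply: (@is_derive_ker _ _ _ M) => // x Dx; [exact: Kdx|exact: bx].
- by apply: (@is_derive_ker _ _ _ M) => // x Dx;
    [exact: Kx|exact: Kdxx|exact: bx|exact: bxx].
Qed.

End kernel_integral.

Section mollifier.
Context {R : realType} {N : nat}.
Notation E := ('rV[R]_N * R)%type.
Notation EM := ('rV[R]_N * measurableTypeR R)%type.
Notation mu := (@spacetime_leb R N).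

Definition jshift (c : E) (k : @jet R N) : jet :=
  Jet (fun p => j0 k (p - c)) (fun p => jt k (p - c))
    (fun i p => jx k i (p - c)) (fun i j p => jxx k i j (p - c)).

Lemma C21_shift (c : E) (D : set E) (k : jet) :
  C21 D k -> C21 [set p | D (p - c)] (jshift c k).
Proof.
move=> [K0 Kt Kx Kxx Kdt Kdx Kdxx].
have cs (f : E -> R) (p : E) : {for p - c, continuous f} -> {for p, continuous (fun p : E => f (p - c))}.
  move=> cf; apply: (@continuous_comp _ _ _ (fun p : E => p - c) f p _ cf).
  by apply: cvgB; [exact: cvg_id|exact: cvg_cst].
have ds (f : E -> R) (p v : E) (df : R) : is_derive (p - c) v f df ->
    is_derive p v (fun p : E => f (p - c)) df.
  by move=> H; apply: (@is_derive_pull _ _ _ (fun p : E => p - c) f p v v df) => // h; rewrite addrA.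
by split=> p /= Dp *; by [apply: cs; auto|apply: ds; auto].
Qed.

(** By continuity [f] exceeds half of [f e] on a box around [e], whose measure is explicit and
    positive. *)
Lemma Int_gt0 (f : E -> R) (e : E) : intg mu f -> (forall p, 0 <= f p) ->
  {for e, continuous f} -> 0 < f e -> 0 < Int mu f.
Proof.
move=> If f0 cf fe.
have : \forall p \near e, f e / 2 < f p.
  by move/cvgr_gt : cf; apply; lra.
move=> /nbhs_ballP[r /= r0 H].
pose B : set EM := open_box (fun i => e.1 ord0 i - r) (fun i => e.1 ord0 i + r) `*`
  `](e.2 - r), (e.2 + r)[%classic.
have mB : measurable B.
  by apply: measurableX; [exact: measurable_open_box|exact: measurable_itv].
have muB : mu B = ((\prod_(i < N) (2 * r)) * (2 * r))%:E.
  rewrite spacetime_rect; [|exact: measurable_open_box|exact: measurable_itv].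
  rewrite leb_box; last by move=> i; lra.
  rewrite lebesgue_measure_itv /= lte_fin ifT; last by lra.
  rewrite -EFinD -EFinM; congr (_ * _)%:E; last by ring.
  by apply: eq_bigr => i _; ring.
have m0 : 0 < (\prod_(i < N) (2 * r)) * (2 * r).
  by apply: mulr_gt0; [apply: prodr_gt0 => i _|]; lra.
have IB : intg mu (fun p : EM => (f e / 2) * \1_B p).
  apply: intgZ; apply/integrableP; split; first exact/measurable_EFinP/measurable_indic.
  under eq_integral do rewrite /= ger0_norm//.
  by rewrite integral_indic// setIT muB ltry.
have : Int mu (fun p : EM => (f e / 2) * \1_B p) <= Int mu f.
  apply: Int_le => // p; rewrite indicE; have [|] := boolP (p \in B); last by rewrite mulr0.
  rewrite inE mulr1 => -[p1 p2]; apply/ltW/H; split.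
    split => // i j; rewrite ord1 /ball /= ltr_distlC.
    by have := p1 j; lra.
  by move: p2; rewrite /= in_itv /= /ball /= ltr_distlC; lra.
apply: lt_le_trans; rewrite /Int RintegralZl//; last first.
  apply/integrableP; split; first exact/measurable_EFinP/measurable_indic.
  under eq_integral do rewrite /= ger0_norm//.
  by rewrite integral_indic// setIT muB ltry.
rewrite mulr_gt0//; first lra.
by rewrite /Rintegral integral_indic// setIT muB.
Qed.

Definition jrad : @jet R N := jadd (jsq 0) (jtime (fun s => s ^+ 2) (fun s => 2 * s)).

Lemma sc2_sqr : sc2 (fun s : R => s ^+ 2) (fun s => 2 * s) (cst 2).
Proof.
have := sc2_mul (sc2_aff 1 0) (sc2_aff (1 : R) 0).
by apply: sc2_ext => s /=; ring.
Qed.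

Lemma C21_sc2_time D (h h1 h2 : R -> R) : sc2 h h1 h2 -> C21 D (@jtime R N h h1).
Proof.
by move=> [a0 a1 a2 a3 a4]; apply: C21_time => p _; split;
  [exact: a0|exact: a1|exact: a3].
Qed.

Lemma C21_rad : C21 setT jrad.
Proof. apply: C21_add; [exact: C21_sq|exact: C21_sc2_time sc2_sqr]. Qed.

(** The polynomial bump [(d^2 - |x|^2 - t^2)_+^3]. It depends on squares only, hence is even. *)
Definition jbump0 (d : R) : @jet R N := jcomp (fun s => pospow 3 ((-1) * s + d ^+ 2))
  (fun s => (-1) * (3 * pospow 2 ((-1) * s + d ^+ 2)))
  (fun s => (-1) ^+ 2 * (6 * pospow 1 ((-1) * s + d ^+ 2))) jrad.

Lemma C21_bump0 d : C21 setT (jbump0 d).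
Proof. apply: C21_sc2 C21_rad; exact: sc2_preaff sc2_pospow3. Qed.

Lemma bump0_ge0 d p : 0 <= j0 (jbump0 d) p. Proof. exact: pospow_ge0. Qed.

Lemma bump0_supp d p : 0 < d -> ~ (`|p.1| <= d /\ - d <= p.2 <= d) -> j0 (jbump0 d) p = 0.
Proof.
move=> d0 H; rewrite /= pospowN// subr0.
have a1 := norm_sqr_le_sqn p.1; have b1 := sqn_ge0 p.1; have b2 := sqr_ge0 p.2.
have a0 := normr_ge0 p.1.
have [p1|p1] := leP `|p.1| d; last by nra.
have [p2|p2] := leP `|p.2| d.
  by exfalso; apply: H; split => //; rewrite -ler_norml.
have : `|p.2| ^+ 2 = p.2 ^+ 2 by rewrite real_normK// num_real.
have := normr_ge0 p.2; nra.
Qed.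

Lemma jnorm_compact (J : @jet R N) (K : set E) : C21 setT J -> compact K ->
  (forall p, ~ K p -> j0 J p = 0) -> exists2 M, 0 <= M & forall p, jnorm J p <= M.
Proof.
move=> HJ cK J0.
have [z0 zt zx zxx] : jets0 J (~` K).
  by apply: C21_jets0 HJ _ => //; exact: open_setC_compact.
have cj : {within K, continuous (jnorm J)}.
  by apply: continuous_subspaceT => p; exact: continuous_jnorm HJ _.
have [M M0 H] := compact_bounded cK cj.
exists M => // p; have [pK|pK] := pselect (K p).
  by rewrite (le_trans (ler_norm _))// H.
rewrite /jnorm z0// zt// !big1 ?normr0 ?addr0// => i _; last by rewrite zx// normr0.
by rewrite big1// => j _; rewrite zxx// normr0.
Qed.

(** A convolution involves [k (e - p)] while the corresponding test function of [p] is [k (p - e)].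
    Evenness identifies them, and the sign change of the time derivative turns the backward operator
    on the test function into the forward one on the mollification. *)
Definition jeven (k : @jet R N) : Prop :=
  [/\ forall p, j0 k (- p) = j0 k p, forall p, jt k (- p) = - jt k p &
   forall i p, jxx k i i (- p) = jxx k i i p].

Lemma sqnN (x : 'rV[R]_N) : sqn (- x) = sqn x.
Proof. by apply: eq_bigr => i _; rewrite mxE sqrrN. Qed.

Lemma bump0_even d : jeven (jbump0 d).
Proof.
have E0 p : j0 jrad (- p) = j0 jrad p by rewrite /= !subr0 sqnN sqrrN.
split=> [p|p|i p]; rewrite /= -/(j0 jrad _) -/(j0 jrad p).
- by have := E0 p; rewrite /= => ->.
- by have := E0 p; rewrite /= => ->; ring.
- by have := E0 p; rewrite /= => ->; rewrite !mxE; ring.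
Qed.

Lemma Int_bump0_gt0 d : 0 < d -> intg mu (j0 (jbump0 d)) /\ 0 < Int mu (j0 (jbump0 d)).
Proof.
move=> d0.
have I0 : intg mu (j0 (jbump0 d)).
  apply: (@intg_compact _ _ _ (slab d (- d) d)); first exact: compact_slab.
    by move=> p; exact: (C21_c0 (C21_bump0 d)).
  by move=> p; exact: bump0_supp.
split => //; apply: (@Int_gt0 _ 0) => //.
- exact: bump0_ge0.
- exact: (C21_c0 (C21_bump0 d)).
rewrite /= subr0 /sqn big1; last by move=> i _; rewrite !mxE expr0n.
rewrite pospowP; first by rewrite !exprn_gt0//; rewrite expr0n /=; nra.
by rewrite expr0n /=; nra.
Qed.

Definition jscl (c : R) (J : @jet R N) : jet :=
  Jet (fun p => c * j0 J p) (fun p => c * jt J p) (fun i p => c * jx J i p)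
    (fun i j p => c * jxx J i j p).

Lemma jsclE c J : jscl c J = jmul (jcst c) J.
Proof.
rewrite /jscl /jmul /jcst /cst /=; congr Jet.
- by apply/funext => p; rewrite mul0r add0r.
- by apply/funext => i; apply/funext => p; rewrite mul0r add0r.
- by apply/funext => i; apply/funext => j; apply/funext => p; rewrite !mul0r !add0r.
Qed.

Lemma C21_scl D c J : C21 D J -> C21 D (jscl c J).
Proof. by move=> HJ; rewrite jsclE; apply: C21_mul => //; exact: C21_cst. Qed.

Definition jbump (d : R) : @jet R N := jscl (Int mu (j0 (jbump0 d)))^-1 (jbump0 d).

Lemma bumpP d : 0 < d -> [/\ C21 setT (jbump d), forall p, 0 <= j0 (jbump d) p,
  forall p, ~ slab d (- d) d p -> j0 (jbump d) p = 0, jeven (jbump d) &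
  intg mu (j0 (jbump d)) /\ Int mu (j0 (jbump d)) = 1].
Proof.
move=> d0; have [I0 P0] := Int_bump0_gt0 d0; split.
- by apply: C21_scl; exact: C21_bump0.
- by move=> p; rewrite mulr_ge0 ?bump0_ge0// invr_ge0 ltW.
- by move=> p Hp; rewrite -[LHS]/(_ * j0 (jbump0 d) p) bump0_supp ?mulr0.
- have [e0 et exx] := bump0_even d; split=> [p|p|i p].
  + by rewrite -[LHS]/(_ * j0 (jbump0 d) (- p)) e0.
  + by rewrite -[LHS]/(_ * jt (jbump0 d) (- p)) et mulrN.
  + by rewrite -[LHS]/(_ * jxx (jbump0 d) i i (- p)) exx.
- split; first exact: intgZ.
  by rewrite IntZ// mulVf// gt_eqF.
Qed.

End mollifier.

(** * Weak solutions and their excess over a classical one *)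

Section weak.
Context {R : realType} {N : nat}.
Notation E := ('rV[R]_N * R)%type.
Notation EM := ('rV[R]_N * measurableTypeR R)%type.
Notation mu := (@spacetime_leb R N).

Lemma open_cylinder (Omega : set 'rV[R]_N) T : open Omega -> open (cylinder Omega T : set E).
Proof.
move=> oO; rewrite (_ : cylinder Omega T = fst @^-1` Omega `&` snd @^-1` `]0, T[).
  apply: openI; apply: open_comp => //.
  - by move=> p _; exact: cvg_fst.
  - by move=> p _; exact: cvg_snd.
by apply/seteqP; split.
Qed.

(* The data of a weak solution, extended by zero: [V] is the solution and [A]
   the absorption term. *)
Record weak (Omega : set 'rV[R]_N) (T k : R) (a : 'rV[R]_N) (V A : E -> R) : Prop :=
  Weak {
  wk_open : open Omega;
  wk_IV : intg mu V;
  wk_IA : intg mu A;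
  wk_V0 : forall p, 0 <= V p;
  wk_A0 : forall p, 0 <= A p;
  wk_VQ : forall p, ~ cylinder Omega T p -> V p = 0;
  wk_AQ : forall p, ~ cylinder Omega T p -> A p = 0;
  wk_cV : forall p, cylinder Omega T p -> {for p, continuous V};
  wk_cA : forall p, cylinder Omega T p -> {for p, continuous A};
  wk_k : 0 <= k;
  wk_a : Omega a;
  wk_eq : forall (J : @jet R N) (b : R), C21 setT J ->
    (forall p, b < `|p.1| -> j0 J p = 0) ->
    (forall x t, boundary Omega x -> 0 <= t <= T -> j0 J (x, t) = 0) ->
    (forall x, Omega x -> j0 J (x, T) = 0) ->
    Int mu (fun p => V p * jbh J p + A p * j0 J p) = k * j0 J (a, 0) }.

Lemma patchE0 (D : set E) (f : E -> R) p : ~ D p -> (f \_ D) p = 0.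
Proof. by move=> Dp; rewrite patchE memNset. Qed.

Lemma patchE1 (D : set E) (f : E -> R) p : D p -> (f \_ D) p = f p.
Proof. by move=> Dp; rewrite patchE mem_set. Qed.

Lemma near_eq_continuous (D : set E) (f g : E -> R) p : open D -> D p ->
  (forall r, D r -> f r = g r) -> {for p, continuous f} -> {for p, continuous g}.
Proof.
move=> oD Dp fg cf; rewrite /prop_for /continuous_at -fg//.
have E0 : \near p, f p = g p by near=> r; apply: fg; near: r; exact: open_nbhs_nbhs.
exact: cvg_trans (near_eq_cvg E0) cf.
Unshelve. all: end_near. Qed.

Lemma continuous_patch (D : set E) (f : E -> R) p : open D -> D p ->
  {for p, continuous f} -> {for p, continuous (f \_ D)}.
Proof.
move=> oD Dp cf; apply: (near_eq_continuous oD Dp _ cf) => r Dr.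
by rewrite patchE1.
Qed.

Lemma within_open_continuous (D : set E) (f : E -> R) : open D ->
  {within D, continuous f} -> forall p, D p -> {for p, continuous f}.
Proof.
move=> oD cf p Dp; have := continuous_open_subspace f oD.
by move=> H; move: cf; rewrite H => /(_ p); apply; rewrite inE.
Qed.

Lemma laplacian_jet (J : @jet R N) x t : C21 setT J ->
  laplacian (fun x => j0 J (x, t)) x = jlap J (x, t).
Proof.
move=> [_ _ _ _ _ Jx Jxx]; apply: eq_bigr => i _.
have slice (f : E -> R) y j df : is_derive (y, t) (dirx j) f df ->
    is_derive y (basis_vec j) (fun x => f (x, t)) df.
  move=> /is_derive_lineP H; apply/is_derive_lineP.
  by move: H; under eq_fun do rewrite /GRing.scale /GRing.add /= /scale_pair /add_pair /= scaler0 add0r.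
have -> : partial i (fun x => j0 J (x, t)) = fun x => jx J i (x, t).
  by apply/funext => y; have [_ <-] := slice _ _ _ _ (Jx (y, t) Logic.I i).
by have [_ <-] := slice _ _ _ _ (Jxx (x, t) Logic.I i i).
Qed.

Lemma derive1_jet (J : @jet R N) x t : C21 setT J ->
  derive1 (fun t => j0 J (x, t)) t = jt J (x, t).
Proof.
move=> [_ _ _ _ Jt _ _]; rewrite derive1E.
have : is_derive t 1 (fun t => j0 J (x, t)) (jt J (x, t)).
  have := Jt (x, t) Logic.I => /is_derive_lineP H; apply/is_derive_lineP.
  by move: H; under eq_fun do rewrite /GRing.scale /GRing.add /= /scale_pair /add_pair /= scaler0 add0r.
by case.
Qed.

Lemma continuous_powR_at (b s : R) : 0 < s -> {for s, continuous (fun s => s `^ b)}.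
Proof.
move=> s0; apply: differentiable_continuous; apply/derivable1_diffP.
by have [] := is_derive1_powR b s0.
Qed.

Lemma continuous_pos : continuous (@pos R).
Proof.
by rewrite (_ : pos = pospow 1); [exact: continuous_pospow|apply/funext => s; rewrite pospow1].
Qed.

Lemma continuous_pos_powR (q s : R) : 1 <= q -> {for s, continuous (fun s => pos s `^ q)}.
Proof.
move=> q1; have q0 : q != 0 by rewrite gt_eqF//; lra.
have [s0|s0] := ltP 0 s.
  apply: (@continuous_comp _ _ _ pos (fun s => s `^ q)); first exact: continuous_pos.
  by apply: continuous_powR_at; rewrite posP// ltW.
rewrite /prop_for /continuous_at (posN s0) powR0//.
have pc : pos r @[r --> s] --> (0 : R) by rewrite -(posN s0); exact: continuous_pos.
apply: (@squeeze_cvgr _ _ _ _ (cst 0) pos); [|exact: cvg_cst|exact: pc].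
near=> r; rewrite powR_ge0 /=.
have r1 : pos r <= 1.
  near: r; move/cvgr_lt : pc => /(_ 1 ltr01); apply: filterS => r; exact: ltW.
have := pos_ge0 r; rewrite le_eqVlt => /predU1P[<-|r0]; first by rewrite powR0.
by apply: ge1r_powR => //; rewrite r0.
Unshelve. all: end_near. Qed.

(** Extension by zero makes every integral one over the whole of space-time, so that translations
    and mollifications need no domain. *)
Lemma weak_of_dirac (Omega : set 'rV[R]_N) (T alpha q k : R) (a : 'rV[R]_N)
    (v : 'rV[R]_N -> R -> R) : open Omega -> Omega a -> 0 <= k -> 1 <= q ->
  dirac_solution Omega T alpha q a k v ->
  weak Omega T k a ((fun p => v p.1 p.2) \_ (cylinder Omega T))
    ((fun p => p.2 `^ alpha * v p.1 p.2 `^ q) \_ (cylinder Omega T)).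
Proof.
move=> oO Oa k0 q1 [vge0 cv Iv Ivq eqv]; set Q := cylinder Omega T.
have oQ : open Q by exact: open_cylinder.
have mQ : measurable (Q : set EM) by exact: open_measurable_E.
have cv' := within_open_continuous oQ cv.
have Qv p : Q p -> 0 <= v p.1 p.2 /\ 0 < p.2.
  by move=> [p1]; rewrite /= in_itv /= => /andP[p2 p3]; split => //; apply: vge0 => //; rewrite p2.
have IV : intg mu ((fun p => v p.1 p.2) \_ Q).
  rewrite /intg; have /integrable_mkcond := Iv; move=> /(_ mQ).
  by apply: eq_integrable => // p _; rewrite /= !patchE; case: ifP.
have IA : intg mu ((fun p => p.2 `^ alpha * v p.1 p.2 `^ q) \_ Q).
  rewrite /intg; have /integrable_mkcond := Ivq; move=> /(_ mQ).
  apply: eq_integrable => // p _; rewrite /= !patchE; case: ifPn => // pQ.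
  by rewrite ger0_norm//; have [] := Qv p (set_mem pQ).
split => //.
- by move=> p; have [Qp|Qp] := pselect (Q p); [rewrite patchE1//; case: (Qv p Qp)|rewrite patchE0].
- move=> p; have [Qp|Qp] := pselect (Q p); last by rewrite patchE0.
  by rewrite patchE1// mulr_ge0// powR_ge0.
- by move=> p Qp; rewrite patchE0.
- by move=> p Qp; rewrite patchE0.
- by move=> p Qp; apply: continuous_patch => //; exact: cv'.
- move=> p Qp; apply: continuous_patch => //; have [v0 p20] := Qv p Qp.
  (* [v] may vanish at [p]. Inserting [pos] gives a power continuous on the whole line, and nothing
     changes on the cylinder, where [v] is nonnegative. *)
  have cA : {for p, continuous (fun p : E => p.2 `^ alpha * pos (v p.1 p.2) `^ q)}.
    apply: cvgM.
      apply: (@continuous_comp _ _ _ snd (fun s => s `^ alpha)); first exact: cvg_snd.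
      exact: continuous_powR_at.
    apply: (@continuous_comp _ _ _ (fun p : E => v p.1 p.2) (fun s => pos s `^ q)).
      exact: cv'.
    exact: continuous_pos_powR.
  by apply: (near_eq_continuous oQ Qp _ cA) => r /Qv[? _]; rewrite posP.
- move=> J b HJ Jb Jbd JT.
  have HT : test_function Omega T (fun x t => j0 J (x, t)) by exact: test_of_jet Jb Jbd JT.
  have := eqv _ HT; rewrite /= => H.
  rewrite /Int /Rintegral (_ : k * j0 J (a, 0) = fine (k * j0 J (a, 0))%:E)//.
  congr fine; rewrite -H [RHS]integral_mkcond; apply: eq_integral => p _ /=.
  rewrite !patchE; case: ifPn => pQ; last by rewrite !mul0r addr0.
  rewrite derive1_jet// laplacian_jet//; congr EFin.
  by rewrite /jbh; case: p {pQ} => x t /=; ring.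
Qed.

End weak.

Lemma pos_lipschitz (R : realType) (x y c : R) :
  `|x - y| <= c -> `|pos x - pos y| <= c.
Proof.
rewrite !ler_norml => /andP[h1 h2].
by have [[x1 ->]|[x1 ->]] := pos_cases x; have [[y1 ->]|[y1 ->]] := pos_cases y; lra.
Qed.

Lemma mulr_div_add1_le (R : realType) (e M : R) : 0 <= e -> 0 <= M -> M * (e / (M + 1)) <= e.
Proof.
move=> e0 M0; have M1 : 0 < M + 1 by rewrite ltr_wpDl.
by rewrite mulrCA ler_piMr// ler_pdivrMr// mul1r lerDl.
Qed.

(** * Comparison in the interior of the cylinder *)

Section interior.
Context {R : realType} {N : nat}.
Notation E := ('rV[R]_N * R)%type.
Notation EM := ('rV[R]_N * measurableTypeR R)%type.
Notation mu := (@spacetime_leb R N).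

Lemma jlap_scl c (J : @jet R N) p : jlap (jscl c J) p = c * jlap J p.
Proof. by rewrite /jlap mulr_sumr. Qed.

Lemma jlap_time h h1 p : jlap (@jtime R N h h1) p = 0.
Proof. by rewrite /jlap big1. Qed.

Lemma jfh_add (J K : @jet R N) p : jfh (jadd J K) p = jfh J p + jfh K p.
Proof. by rewrite /jfh jlap_add [jt _ _]/=; ring. Qed.

Lemma jfh_scl c (J : @jet R N) p : jfh (jscl c J) p = c * jfh J p.
Proof. by rewrite /jfh jlap_scl [jt _ _]/=; ring. Qed.

Lemma jfh_time h h1 p : jfh (@jtime R N h h1) p = h1 p.2.
Proof. by rewrite /jfh jlap_time subr0. Qed.

Lemma slabE (d : R) (p : E) : slab d (- d) d p <-> `|p.1| <= d /\ `|p.2| <= d.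
Proof. by rewrite /slab /= ler_norml. Qed.

(** A Lebesgue number argument: only the base point [e] is restricted to [K], while [p] may leave it
    as long as it is close, which is what averages around points of [K] require. *)
Lemma uniform_near (D K : set E) (f : E -> R) (eps : R) : open D -> compact K ->
  K `<=` D -> (forall p, D p -> {for p, continuous f}) -> 0 < eps ->
  exists2 r : R, 0 < r & forall d, 0 < d -> d < r -> forall e p, K e ->
    slab d (- d) d (p - e) -> D p /\ `|f p - f e| <= eps.
Proof.
move=> oD cK KD cf eps0.
pose P (d : R) (e : E) := forall p, slab d (- d) d (p - e) -> D p /\ `|f p - f e| <= eps.
have : \forall d \near (0 : R)^'+, K `<=` P d.
  apply: (compact_near_coveringP K).1 => // e Ke.
  have De := KD _ Ke.
  have eps2 : 0 < eps / 2 by lra.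
  have : \forall p \near e, D p /\ `|f e - f p| < eps / 2.
    near=> p; split; first by near: p; exact: open_nbhs_nbhs.
    by near: p; move/cvgrPdist_lt : (cf _ De); apply.
  move=> /nbhs_ballP[r /= r0 H].
  have r2 : 0 < r / 2 by lra.
  exists (ball e (r / 2), [set d : R | 0 < d < r / 2]) => /=.
    split; first exact: nbhsx_ballx.
    by near=> d => /=; apply/andP; split; near: d; [exact: nbhs_right_gt|exact: nbhs_right_lt].
  move=> [e' d] [/= ee' /andP[d0 dr]] p /slabE[p1 p2].
  have b0 : ball e' (r / 2) p.
    split => /=.
      rewrite -ball_normE /ball_ /= distrC; exact: le_lt_trans p1 dr.
    by rewrite /ball /= distrC; exact: le_lt_trans p2 dr.
  have b1 : ball e r p by rewrite [r]splitr; exact: ball_triangle ee' b0.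
  have [Dp fp] := H _ b1.
  have [De' fe'] : D e' /\ `|f e - f e'| < eps / 2.
    by apply: H; apply: le_ball ee'; lra.
  split => //; rewrite (_ : f p - f e' = - (f e - f p) + (f e - f e')); last by ring.
  by rewrite (le_trans (ler_normD _ _))// normrN; lra.
move=> /nbhs_ballP[r /= r0 H]; exists r => // d d0 dr e p Ke; apply: H => //.
by rewrite /ball /= sub0r normrN gtr0_norm.
Unshelve. all: end_near. Qed.

Variables (Omega : set 'rV[R]_N) (T k : R) (a : 'rV[R]_N) (V A : E -> R).
Hypothesis HW : weak Omega T k a V A.
Notation Q := (cylinder Omega T).

Let msig : measurable_fun setT (id : EM -> EM). Proof. exact: measurable_id. Qed.

Definition molV (d : R) : @jet R N := jker mu id V (jbump d).
Definition molA (d : R) : E -> R := ker mu id A (j0 (jbump d)).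

Lemma C21_molV d : 0 < d -> C21 setT (molV d).
Proof.
move=> d0; have [B0 B1 B2 B3 [B4 B5]] := @bumpP R N d d0.
have [M M0 HM] := jnorm_compact B0 (@compact_slab R N d (- d) d) B2.
have DT : forall e p : E, [set: E] e -> [set: E] (e - id p) by [].
apply: (C21_ker msig (wk_IV HW) openT DT B0) => p _; exact: HM.
Qed.

Lemma boundary_cylinder x t : boundary Omega x -> ~ Q (x, t).
Proof.
move=> [_ nx] [/= Ox _]; apply: nx.
by rewrite /interior; apply: open_nbhs_nbhs; split => //; exact: (wk_open HW).
Qed.

(** The bump centred at [e] is itself a test function: it vanishes off the cylinder, in particular
    on the lateral boundary and at both end times, so the Dirac mass does not contribute. *)
Lemma mol_pde d e : 0 < d -> (forall p, slab d (- d) d (p - e) -> Q p) ->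
  jfh (molV d) e = - molA d e.
Proof.
move=> d0 He; have [B0 B1 B2 [B3 B3t B3x] [B4 B5]] := @bumpP R N d d0.
set k0 := jbump d in B0 B1 B2 B3 B3t B3x B4 B5 *.
pose Z := jshift e k0.
have HZ : C21 setT Z by exact: (C21_shift e B0).
have Z0 p : ~ Q p -> j0 Z p = 0 by move=> Qp; apply: B2 => h; apply: Qp; exact: He.
have far p : `|e.1| + d < `|p.1| -> j0 Z p = 0.
  move=> h; apply: B2 => -[/= h1 _]; have := lerB_dist p.1 e.1; lra.
have := wk_eq HW HZ far _ _.
have Zbd x t : boundary Omega x -> 0 <= t <= T -> j0 Z (x, t) = 0.
  by move=> bx _; apply: Z0; exact: boundary_cylinder.
have ZT x : Omega x -> j0 Z (x, T) = 0.
  by move=> _; apply: Z0 => -[_]; rewrite /= in_itv /= ltxx andbF.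
move=> /(_ Zbd ZT); rewrite (Z0 (a, 0)); last first.
  by move=> -[_]; rewrite /= in_itv /= ltxx.
rewrite mulr0 => H.
have [M M0 HM] := jnorm_compact B0 (@compact_slab R N d (- d) d) B2.
have IK (f : E -> R) (g : E -> R) : (forall p, {for p, continuous f}) ->
    (forall p, `|f p| <= M) -> intg mu g -> intg mu (fun p => g p * f (e - p)).
  move=> cf fM Ig; have DT : forall e p : E, [set: E] e -> [set: E] (e - id p) by [].
  by apply: (intg_ker msig Ig openT DT) => // p _; exact: fM.
have b0 p : `|j0 k0 p| <= M by have [h _ _ _] := jnormP k0 p; rewrite (le_trans h).
have bt p : `|jt k0 p| <= M by have [_ h _ _] := jnormP k0 p; rewrite (le_trans h).
have bxx i p : `|jxx k0 i i p| <= M.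
  by have [_ _ _ h] := jnormP k0 p; rewrite (le_trans (h i i)).
have I1 : intg mu (fun p => V p * jt k0 (e - p)).
  by apply: IK => //; [move=> p; exact: (C21_ct B0)|exact: (wk_IV HW)].
have I2 i : intg mu (fun p => V p * jxx k0 i i (e - p)).
  by apply: IK => //; [move=> p; exact: (C21_cxx B0)|exact: (wk_IV HW)].
have I3 : intg mu (fun p => A p * j0 k0 (e - p)).
  by apply: IK => //; [move=> p; exact: (C21_c0 B0)|exact: (wk_IA HW)].
have E1 : jfh (molV d) e = Int mu (fun p => V p * jt k0 (e - p) -
    \sum_(i < N) V p * jxx k0 i i (e - p)).
  rewrite IntB//; last exact: intg_sum.
  by rewrite Int_sum.
rewrite E1; apply/eqP; rewrite -addr_eq0; apply/eqP.
rewrite /molA /ker -IntD//; last by apply: intgB => //; exact: intg_sum.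
rewrite -[RHS]H; apply: eq_Int => p.
transitivity (V p * (jt k0 (e - p) - \sum_(i < N) jxx k0 i i (e - p))
    + A p * j0 k0 (e - p)); first by rewrite mulrBr mulr_sumr.
have E0 : p - e = - (e - p) by rewrite opprB.
rewrite -[RHS]/(V p * (- jt k0 (p - e) - \sum_(i < N) jxx k0 i i (p - e))
  + A p * j0 k0 (p - e)) E0 B3 B3t opprK.
by under [in RHS]eq_bigr do rewrite B3x.
Qed.

(** The bump has integral 1 and lives in the slab around [e], so the convolution averages values
    that are all within [eps] of [f e]. *)
Lemma mol_close (f : E -> R) e d eps : 0 < d -> intg mu f ->
  (forall p, slab d (- d) d (p - e) -> `|f p - f e| <= eps) ->
  `|ker mu id f (j0 (jbump d)) e - f e| <= eps.
Proof.
move=> d0 If H; have [B0 B1 B2 [B3 B3t B3x] [B4 B5]] := @bumpP R N d d0.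
set k0 := jbump d in B0 B1 B2 B3 B3t B3x B4 B5 *.
have eps0 : 0 <= eps.
  have := H e; rewrite !subrr normr0; apply; split; rewrite /= ?normr0 ?(ltW d0)//.
  by rewrite oppr_le0 (ltW d0).
have [M M0 HM] := jnorm_compact B0 (@compact_slab R N d (- d) d) B2.
have b0 p : `|j0 k0 p| <= M by have [h _ _ _] := jnormP k0 p; rewrite (le_trans h).
have I3 : intg mu (fun p => f p * j0 k0 (e - p)).
  have DT : forall e p : E, [set: E] e -> [set: E] (e - id p) by [].
  apply: (intg_ker msig If openT DT) => [p _||p _]; last exact: b0.
    exact: (C21_c0 B0).
  by [].
have [Ik Ek] : intg mu (fun p => j0 k0 (e - p)) /\ Int mu (fun p => j0 k0 (e - p)) = 1.
  have [i1 i2] := Int_shift (- e) B4.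
  rewrite (_ : (fun p => j0 k0 (e - p)) = (fun p => j0 k0 (p - e))) ?i2//.
  by apply/funext => p; rewrite -[p - e]opprB B3.
rewrite /ker (_ : f e = Int mu (fun p => f e * j0 k0 (e - p))); last by rewrite IntZ// Ek mulr1.
rewrite -IntB//; last exact: intgZ.
apply: le_trans (Int_abs _) _; first by apply: intgB => //; exact: intgZ.
rewrite -[leRHS]mulr1 -Ek -IntZ//; apply: Int_le.
- by apply/intg_abs; apply: intgB => //; exact: intgZ.
- exact: intgZ.
move=> p; rewrite -mulrBl normrM [X in _ * X]ger0_norm//.
have [pd|pd] := pselect (slab d (- d) d (p - e)).
  by rewrite ler_wpM2r// H.
by rewrite -[e - p]opprB B3 B2// !mulr0.
Qed.

Variables (alpha q : R) (U : @jet R N).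
Hypothesis q1 : 1 <= q.
Hypothesis AE : forall p, Q p -> A p = p.2 `^ alpha * V p `^ q.
Hypothesis HU : C21 Q U.
Hypothesis U0 : forall p, Q p -> 0 < j0 U p.
Hypothesis Ueq : forall p, Q p -> jfh U p = - (p.2 `^ alpha * j0 U p `^ q).

Definition excess : E -> R := (fun p => pos (V p - j0 U p)) \_ Q.

(** Where [V >= U] the absorption of [V] dominates that of [U], so [V - U] is formally a subsolution
    of the heat equation there. Since [V] solves its equation only weakly, [kato] is applied to a
    mollification with a small correction, and the error is sent to 0. *)
Lemma excess_interior (K : set E) (z : @jet R N) : compact K -> K `<=` Q ->
  C21 setT z -> (forall p, ~ K p -> j0 z p = 0) -> (forall p, 0 <= j0 z p) ->
  Int mu (fun p => excess p * jbh z p) <= 0.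
Proof.
move=> cK KQ Hz z0 zge.
have oQ : open Q by apply: open_cylinder; exact: (wk_open HW).
have [_ zt zx zxx] : jets0 z (~` K).
  by apply: C21_jets0 Hz _ => //; exact: open_setC_compact.
have bz p : ~ K p -> jbh z p = 0.
  move=> Kp; rewrite /jbh zt// /jlap big1 ?subr0 ?oppr0// => i _; exact: zxx.
have HzQ : C21 Q z by exact: C21W Hz.
have cbz p : Q p -> {for p, continuous (jbh z)}.
  move=> Qp; apply: cvgB; last exact: (continuous_jlap HzQ).
  by apply: cvgN; exact: (C21_ct HzQ).
have Ibz : intg mu (fun p => `|jbh z p|).
  by apply/intg_abs; apply: (intg_cut cK KQ) => p; [exact: cbz|exact: bz].
have Iw (f : E -> R) : (forall p, Q p -> {for p, continuous f}) ->
    intg mu (fun p => pos (f p) * jbh z p).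
  move=> cf; apply: (intg_cut cK KQ) => p Qp; last by rewrite bz ?mulr0.
  apply: cvgM; last exact: cbz.
  by apply: (@continuous_comp _ _ _ f pos); [exact: cf|exact: continuous_pos].
have EE p : excess p * jbh z p = pos (V p - j0 U p) * jbh z p.
  have [Kp|Kp] := pselect (K p); last by rewrite bz// !mulr0.
  by rewrite /excess patchE1//; exact: KQ.
have cVU p : Q p -> {for p, continuous (fun p => V p - j0 U p)}.
  by move=> Qp; apply: cvgB; [exact: (wk_cV HW)|exact: (C21_c0 HU)].
rewrite (_ : Int mu _ = Int mu (fun p => pos (V p - j0 U p) * jbh z p)); last exact: eq_Int.
have [T0|T0] := ltP T 0.
  rewrite (_ : Int mu _ = Int mu (fun p : EM => 0 : R)); last first.
    apply: eq_Int => p; rewrite bz ?mulr0// => /KQ[_]; rewrite /= in_itv /=; lra.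
  by rewrite /Int /Rintegral integral0.
apply/ler_addgt0Pl => e e0; rewrite addr0.
pose M := Int mu (fun p => `|jbh z p|).
have M0 : 0 <= M by apply: Int_ge0.
(* [w] below differs from [V - U] on [K] by at most [c * (2 + T)]: one [c] from the mollification
   and [c * (1 + T)] from the correction. *)
pose c := e / ((2 + T) * (M + 1)).
have M1 : 0 < M + 1 by rewrite ltr_wpDl.
have T2 : 0 < 2 + T by rewrite ltr_wpDr.
have c0 : 0 < c by rewrite divr_gt0// mulr_gt0.
have [r1 r10 H1] := uniform_near oQ cK KQ (wk_cV HW) c0.
have [r2 r20 H2] := uniform_near oQ cK KQ (wk_cA HW) c0.
pose d := Num.min r1 r2 / 2.
have d0 : 0 < d by rewrite divr_gt0// lt_min r10.
have dm : d < Num.min r1 r2 by rewrite /d ltr_pdivrMr// ltr_pMr ?ltr1n// lt_min r10.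
have [dr1 dr2] : d < r1 /\ d < r2 by move: dm; rewrite lt_min => /andP[].
(* Two corrections of size [c]: the constant makes [w > 0] imply [V >= U] despite the mollification
   of [V], and the linear term lowers [jfh w] by [c], which pays for the mollification of the
   absorption. *)
pose w := jadd (molV d) (jadd (jscl (-1) U) (jtime (fun s => (- c) * s + (- c)) (cst (- c)))).
have Hw : C21 Q w.
  apply: C21_add; first exact: C21W (C21_molV d0).
  apply: C21_add; first exact: C21_scl.
  exact: (@C21_sc2_time _ _ _ _ _ (cst 0) (sc2_aff (- c) (- c))).
have closeV p : K p -> `|j0 (molV d) p - V p| <= c.
  move=> Kp; apply: mol_close => //; first exact: (wk_IV HW).
  by move=> r rp; have [] := H1 d d0 dr1 p r Kp rp.
have closeA p : K p -> `|molA d p - A p| <= c.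
  move=> Kp; apply: mol_close => //; first exact: (wk_IA HW).
  by move=> r rp; have [] := H2 d d0 dr2 p r Kp rp.
have wE p : j0 w p = j0 (molV d) p - j0 U p - c * p.2 - c by rewrite /w /=; ring.
have Kt p : K p -> 0 < p.2 < T by move=> /KQ[_]; rewrite /= in_itv.
have wneg p : K p -> 0 < j0 w p -> jfh w p <= 0.
  move=> Kp; rewrite wE => w0.
  have /andP[t0 tT] := Kt p Kp.
  have : jfh w p = jfh (molV d) p - jfh U p - c.
    by rewrite !jfh_add jfh_scl jfh_time /cst; ring.
  move=> ->; rewrite (mol_pde d0); last first.
    by move=> r rp; have [] := H1 d d0 dr1 p r Kp rp.
  rewrite Ueq; last exact: KQ.
  have := closeA p Kp; rewrite (AE (KQ _ Kp)) ler_norml => /andP[h1 h2].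
  have := closeV p Kp; rewrite ler_norml => /andP[h3 h4].
  have ct : 0 <= c * p.2 by rewrite mulr_ge0 ?ltW.
  have UV : j0 U p <= V p by lra.
  have : p.2 `^ alpha * j0 U p `^ q <= p.2 `^ alpha * V p `^ q.
    have u0 := ltW (U0 (KQ _ Kp)).
    have q0 : 0 <= q by exact: le_trans ler01 q1.
    rewrite ler_wpM2l ?powR_ge0//; apply: (ge0_ler_powR q0) => //.
    by rewrite nnegrE; exact: (wk_V0 HW).
  lra.
have Kw := kato cK KQ Hw Hz z0 zge wneg.
have : Int mu (fun p => pos (V p - j0 U p) * jbh z p - pos (j0 w p) * jbh z p) <= c * (2 + T) * M.
  rewrite -IntZ//; apply: Int_le.
  - by apply: intgB; apply: Iw => // p Qp; exact: (C21_c0 Hw).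
  - exact: intgZ.
  move=> p; have [Kp|Kp] := pselect (K p); last by rewrite bz// !mulr0 subrr normr0 mulr0.
  rewrite -mulrBl (le_trans (ler_norm _))// normrM ler_wpM2r//.
  have /andP[t0 tT] := Kt p Kp.
  have := closeV p Kp; rewrite ler_norml => /andP[h3 h4].
  have cT : c * p.2 <= c * T by rewrite ler_wpM2l ?ltW.
  have ct : 0 <= c * p.2 by rewrite mulr_ge0 ?ltW.
  apply: pos_lipschitz; rewrite ler_norml wE.
  have cT2 : c * (2 + T) = c + c + c * T by ring.
  by apply/andP; split; lra.
rewrite IntB; [|by apply: Iw|by apply: Iw => p Qp; exact: (C21_c0 Hw)].
have : c * (2 + T) * M <= e.
  have -> : c * (2 + T) * M = M * (e / (M + 1)).
    by rewrite /c; field; rewrite !gt_eqF.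
  exact: mulr_div_add1_le (ltW e0) M0.
lra.
Qed.

End interior.

(** * Boundary charts and boundary layers *)

Section graph.
Context {R : realType} {N : nat}.
Notation E := ('rV[R]_N * R)%type.
Variables (i : 'I_N) (sg : bool) (g : 'rV[R]_N.-1 -> R).
Hypothesis Cg : class_C2 g.

Let gd (j : 'I_N) (p : E) : R :=
  if unlift i j is Some j' then partial j' g (col' i p.1) else 0.
Let gdd (j l : 'I_N) (p : E) : R :=
  if unlift i j is Some j' then
    if unlift i l is Some l' then partial l' (partial j' g) (col' i p.1) else 0
  else 0.

Let jg : @jet R N := Jet (fun p => g (col' i p.1)) (cst 0) gd gdd.

Let continuous_col' : continuous (fun p : E => col' i p.1 : 'rV[R]_N.-1).
Proof.
move=> p; apply/cvg_ballP => e e0.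
have : \forall r \near p, ball p e r by exact: nbhsx_ballx.
apply: filterS => r [[_ br] _]; split => // k l.
by rewrite !mxE; exact: br.
Qed.

Let col'_dirx j (h : R) (p : E) : col' i (h *: dirx j + p).1 =
  h *: (if unlift i j is Some j' then basis_vec j' else 0) + col' i p.1 :> 'rV[R]_N.-1.
Proof.
apply/rowP => l; rewrite !mxE /=; congr (_ * _ + _).
case: (unliftP i j) => [j'|] ->; rewrite /basis_vec !mxE ?eqxx /=.
  by rewrite (inj_eq (@lift_inj _ i)).
by rewrite eq_sym (negbTE (neq_lift i l)).
Qed.

Let col'_dirt (h : R) (p : E) : col' i (h *: dirt + p).1 = h *: 0 + col' i p.1 :> 'rV[R]_N.-1.
Proof. by apply/rowP => l; rewrite !mxE. Qed.

Let C21_g : C21 setT jg.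
Proof.
have [cg Hg] := Cg.
have cc (f : 'rV[R]_N.-1 -> R) : continuous f -> continuous (fun p : E => f (col' i p.1)).
  by move=> cf p; apply: continuous_comp; [exact: continuous_col'|exact: cf].
have dd (f : 'rV[R]_N.-1 -> R) (p : E) j :
    (forall j', derivable f (col' i p.1) (basis_vec j')) ->
    is_derive p (dirx j) (fun p : E => f (col' i p.1))
    (if unlift i j is Some j' then partial j' f (col' i p.1) else 0).
  move=> df; apply: (@is_derive_pull _ _ _ (fun p : E => col' i p.1) f p (dirx j)
    (if unlift i j is Some j' then basis_vec j' else 0)).
    by move=> h; exact: col'_dirx.
  by case: (unlift i j) => [j'|]; [split; [exact: df|]|exact: is_derive0].
split=> p _.
- exact: cc.
- exact: cst_continuous.
- move=> j; rewrite /= /gd; case: (unlift i j) => [j'|]; last exact: cst_continuous.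
  by have [_ h _] := Hg j'; exact: cc.
- move=> j l; rewrite /= /gdd; case: (unlift i j) => [j'|]; last exact: cst_continuous.
  case: (unlift i l) => [l'|]; last exact: cst_continuous.
  by have [_ _ h] := Hg j'; have [_ h'] := h l'; exact: cc.
- apply: (@is_derive_pull _ _ _ (fun p : E => col' i p.1) g p dirt 0).
    by move=> h; exact: col'_dirt.
  exact: is_derive0.
- by move=> j; apply: dd => j'; have [h _ _] := Hg j'; exact: h.
- move=> j l; rewrite /= /gd /gdd; case: (unlift i j) => [j'|].
    by apply: dd => l'; have [_ _ h] := Hg j'; have [h' _] := h l'; exact: h'.
  exact: is_derive_cst.
Qed.

Let jcoord : @jet R N := Jet (fun p => p.1 ord0 i) (cst 0)
  (fun j => cst (j == i)%:R) (fun _ _ => cst 0).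

Let C21_coord : C21 setT jcoord.
Proof.
split=> p _; try by [move=> *; exact: cst_continuous].
- exact: continuous_coord.
- by apply: is_derive_affine => h; rewrite mulr0 add0r; exact: coord_dirt.
- by move=> j; apply: is_derive_affine => h; exact: coord_dirx.
- by move=> j l; exact: is_derive_cst.
Qed.

(** The signed height over the graph, extended to a function independent of time; its sign tells the
    two sides of the boundary apart. *)
Definition jgraph : @jet R N := jscl ((-1) ^+ sg) (jadd jcoord (jscl (-1) jg)).

Lemma C21_graph : C21 setT jgraph.
Proof. by apply/C21_scl/C21_add; [exact: C21_coord|exact/C21_scl/C21_g]. Qed.

Lemma graph0 p : j0 jgraph p = (-1) ^+ sg * (p.1 ord0 i - g (col' i p.1)).
Proof. by rewrite /= mulN1r. Qed.

Lemma grapht p : jt jgraph p = 0.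
Proof. by rewrite /= /cst mulr0 addr0 mulr0. Qed.

(** The axis direction alone contributes 1, because [g] does not depend on that coordinate. *)
Lemma graph_grad p : 1 <= \sum_(j < N) jx jgraph j p ^+ 2.
Proof.
rewrite (bigD1 i)//= /cst eqxx /gd unlift_none mulr0 addr0 mulr1 sqrr_sign lerDl.
by apply: sumr_ge0 => j _; exact: sqr_ge0.
Qed.

End graph.

(** A defining function that replaces the distance to the boundary: it is C^2 across the boundary
    and its gradient never degenerates. All later arguments at the boundary use only these
    fields. *)
Record chart (R : realType) (N : nat) (Omega : set 'rV[R]_N) (p0 : 'rV[R]_N) (r : R)
    (phi : @jet R N) : Prop := Chart {
  chart_r : 0 < r;
  chart_C21 : C21 setT phi;
  chart_time : forall x t t', j0 phi (x, t) = j0 phi (x, t');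
  chart_t : forall p, jt phi p = 0;
  chart_grad : forall p, 1 <= \sum_(j < N) jx phi j p ^+ 2;
  chart_in : forall x t, `|x - p0| <= r -> (Omega x <-> 0 < j0 phi (x, t)) }.

Lemma exists_chart (R : realType) (N : nat) (Omega : set 'rV[R]_N) (p0 : 'rV[R]_N) :
  C2_boundary Omega -> boundary Omega p0 -> exists r phi, chart Omega p0 r phi.
Proof.
move=> H /H[i [s [g [Cg /nbhs_ballP[r /= r0 Hr]]]]].
exists (r / 2), (jgraph i s g); split.
- lra.
- exact: C21_graph.
- by move=> x t t'; rewrite !graph0.
- exact: grapht.
- exact: graph_grad.
- move=> x t xp; rewrite graph0; apply: (Hr x).
  by rewrite -ball_normE /ball_ /= distrC; lra.
Qed.

Section chart_boundary.
Context {R : realType} {N : nat}.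

Lemma continuous_slice (x : 'rV[R]_N) (t : R) :
  ((y, t) : 'rV[R]_N * R) @[y --> x] --> ((x, t) : 'rV[R]_N * R).
Proof.
have FF : Filter (nbhs x) by exact: nbhs_filter.
apply/cvg_ballP => e e0; have : \forall y \near x, ball x e y by exact: nbhsx_ballx.
by apply: filterS => y xy; split => //=; exact: ballxx.
Qed.

(** An open set misses its boundary, so [phi <= 0] there; a negative value would persist nearby and
    keep [Omega] away from [x]. *)
Lemma chart_boundary (Omega : set 'rV[R]_N) p0 r phi x t : open Omega ->
  chart Omega p0 r phi -> `|x - p0| < r -> boundary Omega x -> j0 phi (x, t) = 0.
Proof.
move=> oO C xr [clx nx]; have xr' := ltW xr.
have nO : ~ Omega x by move=> Ox; apply: nx; exact: open_nbhs_nbhs.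
have le0 : j0 phi (x, t) <= 0.
  by rewrite leNgt; apply/negP => /(chart_in C t xr').
apply/eqP; rewrite eq_le le0 /= leNgt; apply/negP => lt0.
have cs : {for x, continuous (fun y => j0 phi (y, t))}.
  apply: (@continuous_comp _ _ _ (fun y => (y, t)) (j0 phi)).
    exact: continuous_slice.
  exact: (C21_c0 (chart_C21 C)).
have : \forall y \near x, j0 phi (y, t) < 0 /\ `|y - p0| < r.
  near=> y; split; first by near: y; move/cvgr_lt : cs; apply.
  have yx : ball x (r - `|x - p0|) y.
    by near: y; apply: nbhsx_ballx; rewrite subr_gt0.
  move: yx; rewrite -ball_normE /ball_ /= => yx.
  rewrite (_ : y - p0 = (x - p0) - (x - y)); last by rewrite opprB [RHS]addrC addrA subrK.
  by rewrite (le_lt_trans (ler_normB _ _))// -ltrBrDl.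
move=> /clx [y [Oy [y1 y2]]].
by have /(chart_in C t (ltW y2)) := Oy; rewrite ltNge (ltW y1).
Unshelve. all: end_near. Qed.

End chart_boundary.

Section ramp.
Context {R : realType}.

Lemma pospow_le1 n (s : R) : s <= 1 -> pospow n s <= 1.
Proof.
move=> s1; have m0 : 0 <= Num.max s 0 by rewrite le_max lexx orbT.
by rewrite /pospow exprn_ile1// ge_max s1 ler01.
Qed.

(** A concave profile of width [e]. Its second derivative is of size [e^-2] inside the layer
    [s < e], against [e^-1] for the first, and this gap is what makes the layer estimate work. *)
Definition ramp (e s : R) := 1 - pospow 3 (1 - s / e).
Definition ramp1 (e s : R) := 3 / e * pospow 2 (1 - s / e).
Definition ramp2 (e s : R) := - (6 / e ^+ 2 * pospow 1 (1 - s / e)).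

Lemma sc2_ramp (e : R) : e != 0 -> sc2 (ramp e) (ramp1 e) (ramp2 e).
Proof.
move=> e0; have := sc2_add (sc2_cst 1) (sc2_scale (-1) (sc2_preaff (- e^-1) 1 sc2_pospow3)).
apply: sc2_ext => s; rewrite /ramp /ramp1 /ramp2 /cst.
- by rewrite mulN1r; congr (1 - pospow _ _); ring.
- by rewrite add0r (_ : - e^-1 * s + 1 = 1 - s / e); [field|ring].
- by rewrite add0r (_ : - e^-1 * s + 1 = 1 - s / e); [field|ring].
Qed.

Lemma ramp0 (e : R) : ramp e 0 = 0.
Proof. by rewrite /ramp mul0r subr0 pospowP// expr1n subrr. Qed.

Lemma ramp_big (e s : R) : 0 < e -> e <= s ->
  [/\ ramp e s = 1, ramp1 e s = 0 & ramp2 e s = 0].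
Proof.
move=> e0 es; rewrite /ramp /ramp1 /ramp2 !pospowN ?mulr0 ?subr0 ?oppr0//;
  by rewrite subr_le0 ler_pdivlMr// mul1r.
Qed.

Lemma ramp_bounds (e s : R) : 0 < e -> 0 <= s ->
  [/\ 0 <= ramp e s <= 1, 0 <= ramp1 e s <= 3 / e & ramp2 e s <= 0].
Proof.
move=> e0 s0; have [es|se] := leP e s.
  have [-> -> ->] := ramp_big e0 es.
  by rewrite !lexx ler01 divr_ge0 ?(ltW e0)// ler0n.
have h0 : 0 <= 1 - s / e by rewrite subr_ge0 ler_pdivrMr// mul1r ltW.
have h1 : 1 - s / e <= 1 by rewrite gerBl divr_ge0// ltW.
have c0 : 0 <= 3 / e by rewrite divr_ge0 ?(ltW e0)// ler0n.
have c1 : 0 <= 6 / e ^+ 2 by rewrite divr_ge0 ?exprn_ge0 ?(ltW e0)// ler0n.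
rewrite /ramp /ramp1 /ramp2 !pospowP//.
have p2 : 0 <= (1 - s / e) ^+ 2 <= 1 by rewrite exprn_ge0//= exprn_ile1.
have p3 : 0 <= (1 - s / e) ^+ 3 <= 1 by rewrite exprn_ge0//= exprn_ile1.
split; [lra| |by rewrite oppr_le0 mulr_ge0].
by case/andP: p2 => p20 p21; rewrite mulr_ge0//= -[leRHS]mulr1 ler_wpM2l.
Qed.

End ramp.

Section layer.
Context {R : realType} {N : nat}.
Notation E := ('rV[R]_N * R)%type.
Notation EM := ('rV[R]_N * measurableTypeR R)%type.
Notation mu := (@spacetime_leb R N).
Implicit Types (z J phi : @jet R N).

Lemma jbh_mul_comp z (h h1 h2 : R -> R) phi p : jt phi p = 0 ->
  jbh (jmul z (jcomp h h1 h2 phi)) p =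
  h (j0 phi p) * jbh z p - h1 (j0 phi p) * (2 * \sum_(i < N) jx z i p * jx phi i p)
  - j0 z p * (h2 (j0 phi p) * \sum_(i < N) jx phi i p ^+ 2 + h1 (j0 phi p) * jlap phi p).
Proof.
move=> pt; rewrite /jbh jlap_mul jlap_comp [jt _ _]/= pt.
rewrite (_ : \sum_(i < N) jx z i p * jx (jcomp h h1 h2 phi) i p =
  h1 (j0 phi p) * \sum_(i < N) jx z i p * jx phi i p).
  by rewrite [j0 (jcomp _ _ _ _) _]/=; ring.
by rewrite mulr_sumr; apply: eq_bigr => i _ /=; ring.
Qed.

Variables (Omega : set 'rV[R]_N) (T k : R) (a : 'rV[R]_N) (V A : E -> R).
Hypothesis HW : weak Omega T k a V A.
Notation Q := (cylinder Omega T).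

Lemma intg_cyl (g f : E -> R) b : intg mu g -> (forall p, ~ Q p -> g p = 0) ->
  continuous f -> (forall p, b < `|p.1| -> f p = 0) -> intg mu (fun p => g p * f p).
Proof.
move=> Ig g0 cf f0.
have [M M0 HM] := compact_bounded (@compact_slab R N b 0 T) (continuous_subspaceT cf).
apply: (@intg_le _ _ _ mu _ (fun p => M * `|g p|)).
- apply: measurable_funM; first exact: (intg_measurable Ig).
  exact: measurable_E_continuous.
- move=> p; rewrite normrM mulrC.
  have [[_ Qp]|Qp] := pselect (Q p); last by rewrite g0// normr0 !mulr0.
  rewrite ler_wpM2r//; have [pb|pb] := leP `|p.1| b; last by rewrite f0// normr0.
  by apply: HM; split => //; move: Qp; rewrite /= in_itv /= => /andP[/ltW -> /ltW ->].
- exact/intgZ/intg_abs.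
Qed.

Variables (p0 : 'rV[R]_N) (r : R) (phi : @jet R N).
Hypothesis HC : chart Omega p0 r phi.

Let cphi : continuous (j0 phi).
Proof. by move=> p; exact: (C21_c0 (chart_C21 HC)). Qed.

Let Sphi (p : E) : R := \sum_(i < N) jx phi i p ^+ 2.
Let cS : continuous Sphi.
Proof.
move=> p; apply: cvg_fsum => i; under eq_cvg do rewrite expr2.
by rewrite expr2; apply: cvgM; exact: (C21_cx (chart_C21 HC)).
Qed.

Variable z : @jet R N.
Hypothesis Hz : C21 setT z.
Hypothesis z0 : forall p, 0 <= j0 z p.
Hypothesis zfar : forall p, r / 2 < `|p.1 - p0| -> j0 z p = 0.
Hypothesis zT : forall x, j0 z (x, T) = 0.

(** The weight [(1 - phi / e)_+] is the one produced by the second derivative of [ramp e]. *)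
Definition layer (e : R) : R :=
  Int mu (fun p => V p * (j0 z p * pospow 1 (1 - j0 phi p / e))).

Let sigma (p : E) : R := \sum_(i < N) jx z i p * jx phi i p.
Let csigma : continuous sigma.
Proof.
move=> p; apply: cvg_fsum => i.
by apply: cvgM; [exact: (C21_cx Hz)|exact: (C21_cx (chart_C21 HC))].
Qed.

Let open_far0 : open [set p : E | r / 2 < `|p.1 - p0|].
Proof.
apply: (@open_comp E R (fun p => `|p.1 - p0|) [set s : R | r / 2 < s]); last exact: open_gt.
move=> p _; apply: (@continuous_comp E 'rV[R]_N R (fun p => p.1 - p0) (fun x => `|x|)).
  by apply: cvgB; [exact: cvg_fst|exact: cvg_cst].
exact: norm_continuous.
Qed.

Let zjets : jets0 z [set p | r / 2 < `|p.1 - p0|].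
Proof. by apply: C21_jets0 Hz _. Qed.

Let bfar : R := `|p0| + r / 2.
Let farP (p : E) : bfar < `|p.1| -> r / 2 < `|p.1 - p0|.
Proof. by rewrite /bfar => h; have := lerB_dist p.1 p0; lra. Qed.

Let cpp (e : R) n : continuous (fun p => pospow n (1 - j0 phi p / e)).
Proof.
move=> p; apply: (@continuous_comp _ _ _ (fun p => 1 - j0 phi p / e) (pospow n)).
  apply: cvgB; first exact: cvg_cst.
  by apply: cvgM; [exact: cphi|exact: cvg_cst].
exact: continuous_pospow.
Qed.

Let cz : continuous (j0 z). Proof. by move=> p; exact: (C21_c0 Hz). Qed.

Lemma intg_layer e : intg mu (fun p => V p * (j0 z p * pospow 1 (1 - j0 phi p / e))).
Proof.
apply: (@intg_cyl _ _ bfar (wk_IV HW) (wk_VQ HW)) => p.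
  by apply: cvgM; [exact: cz|exact: cpp].
by move=> /farP h; rewrite zfar ?mul0r.
Qed.

(** The product of [z] with [ramp e] of [phi] vanishes on the lateral boundary, so it may be tested
    against [V]. Multiplied by [e], the weak equation contains [6 / e] times the integral of
    [V z (1 - phi / e)_+ |grad phi|^2], which controls the layer since the gradient is at least 1.
    All other terms tend to 0: those with [e * ramp] by smallness, those with [e * ramp1] because
    they are bounded and live in a layer shrinking to the empty set. *)
Lemma layer_cvg : n.+1%:R * layer n.+1%:R^-1 @[n --> \oo] --> (0 : R).
Proof.
have r0 := chart_r HC.
have [_ zt zx zxx] := zjets.
have bz (p : E) : r / 2 < `|p.1 - p0| -> jbh z p = 0.
  move=> h; rewrite /jbh zt// /jlap big1 ?subr0 ?oppr0// => i _; exact: zxx.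
have sz (p : E) : r / 2 < `|p.1 - p0| -> sigma p = 0.
  by move=> h; rewrite /sigma big1// => i _; rewrite zx// mul0r.
have phi_pos (p : E) : Q p -> `|p.1 - p0| <= r / 2 -> 0 < j0 phi p.
  case: p => x t [/= Ox _] xr; apply/(chart_in HC) => //; lra.
have cjbh : continuous (jbh z).
  move=> p; apply: cvgB; last exact: (continuous_jlap Hz).
  by apply: cvgN; exact: (C21_ct Hz).
pose X p := A p * j0 z p + V p * jbh z p.
pose Y p := V p * (2 * sigma p + j0 z p * jlap phi p).
have IX : intg mu X.
  apply: intgD.
    apply: (@intg_cyl _ _ bfar (wk_IA HW) (wk_AQ HW) cz) => p /farP; exact: zfar.
  by apply: (@intg_cyl _ _ bfar (wk_IV HW) (wk_VQ HW) cjbh) => p /farP; exact: bz.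
have IY : intg mu Y.
  apply: (@intg_cyl _ _ bfar (wk_IV HW) (wk_VQ HW)).
    move=> p; apply: cvgD; apply: cvgM.
    - exact: cvg_cst.
    - exact: csigma.
    - exact: cz.
    - exact: (continuous_jlap (chart_C21 HC)).
  by move=> p /farP h; rewrite sz// zfar// mulr0 mul0r addr0.
have X0 p : ~ (Q p /\ `|p.1 - p0| <= r / 2) -> X p = 0.
  move=> H; rewrite /X; have [Qp|Qp] := pselect (Q p); last first.
    by rewrite (wk_VQ HW)// (wk_AQ HW)// !mul0r addr0.
  have [h|h] := leP `|p.1 - p0| (r / 2); first by exfalso; exact: H.
  by rewrite zfar// bz// !mulr0 addr0.
have Y0 p : ~ (Q p /\ `|p.1 - p0| <= r / 2) -> Y p = 0.
  move=> H; rewrite /Y; have [Qp|Qp] := pselect (Q p); last first.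
    by rewrite (wk_VQ HW)// !mul0r.
  have [h|h] := leP `|p.1 - p0| (r / 2); first by exfalso; exact: H.
  by rewrite zfar// sz// !mulr0 mul0r addr0 mulr0.
pose e n : R := n.+1%:R^-1.
have e0 n : 0 < e n by rewrite invr_gt0 ltr0n.
have e1 n : e n <= 1 by rewrite invf_le1 ?ltr0n// ler1n.
have en n : n.+1%:R = (e n)^-1 :> R by rewrite invrK.
(* [e n] times the integrand of the weak equation, without the term containing the second derivative
   of the ramp. *)
pose Dn n p := e n * ramp (e n) (j0 phi p) * X p
   - 3 * pospow 2 (1 - j0 phi p / e n) * Y p.
have cramp n : continuous (fun p => ramp (e n) (j0 phi p)).
  by move=> p; apply: cvgB; [exact: cvg_cst|exact: cpp].
have mD n : measurable_fun setT (Dn n : EM -> R).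
  apply: measurable_funB; apply: measurable_funM.
  - apply: measurable_E_continuous => p; apply: cvgM; first exact: cvg_cst.
    exact: cramp.
  - exact: (intg_measurable IX).
  - apply: measurable_E_continuous => p; apply: cvgM; first exact: cvg_cst.
    exact: cpp.
  - exact: (intg_measurable IY).
(* At a point of the cylinder [phi] is positive, so the ramp is eventually flat there and only
   [e n * X p] survives. *)
have D0 p : Dn n p @[n --> \oo] --> (0 : R).
  have [H|H] := pselect (Q p /\ `|p.1 - p0| <= r / 2); last first.
    rewrite /Dn X0// Y0//; under eq_cvg do rewrite !mulr0 subrr.
    exact: cvg_cst.
  have fp : 0 < j0 phi p by case: H => *; exact: phi_pos.
  have e_cvg : e n @[n --> \oo] --> (0 : R) by exact: cvg_harmonic.
  rewrite -[X in _ --> X](mul0r (X p)).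
  have : e n * X p @[n --> \oo] --> 0 * X p by apply: cvgM => //; exact: cvg_cst.
  apply: cvg_trans; apply: near_eq_cvg; near=> n.
  have le : e n <= j0 phi p.
    by apply: ltW; near: n; move/cvgr_lt : e_cvg; apply.
  have [rE _ _] := ramp_big (e0 n) le.
  rewrite /Dn rE mulr1 pospowN ?mulr0 ?mul0r ?subr0//.
  by rewrite subr_le0 ler_pdivlMr// mul1r.
have Db n p : `|Dn n p| <= `|X p| + 3 * `|Y p|.
  have [H|H] := pselect (Q p /\ `|p.1 - p0| <= r / 2); last first.
    by rewrite /Dn X0// Y0// !mulr0 subrr normr0 mulr0 addr0.
  have fp : 0 < j0 phi p by case: H => *; exact: phi_pos.
  have [/andP[b1 b2] _ _] := ramp_bounds (e0 n) (ltW fp).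
  rewrite (le_trans (ler_normB _ _))// lerD//.
    rewrite normrM -[leRHS]mul1r ler_wpM2r// ger0_norm ?mulr_ge0 ?(ltW (e0 n))//.
    by rewrite mulr_ile1// ltW.
  have c3 : 0 <= 3 * pospow 2 (1 - j0 phi p / e n).
    by apply: mulr_ge0; [rewrite ler0n|exact: pospow_ge0].
  rewrite normrM ler_wpM2r// ger0_norm//.
  rewrite -[leRHS]mulr1 ler_wpM2l ?ler0n//; apply: pospow_le1.
  by rewrite gerBl divr_ge0 ?(ltW fp) ?(ltW (e0 n)).
have [_ ID] := Int_dct mD D0 (intgD (intg_abs IX) (intgZ 3 (intg_abs IY))) Db.
have Int0 : Int mu (fun _ : EM => 0 : R) = 0 by rewrite /Int /Rintegral integral0.
rewrite Int0 in ID.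
have IDn n : intg mu (Dn n).
  exact: (intg_le (mD n) (Db n) (intgD (intg_abs IX) (intgZ 3 (intg_abs IY)))).
pose B n := k * j0 z (a, 0) * e n + `|Int mu (Dn n)|.
have B_cvg : B n @[n --> \oo] --> (0 : R).
  rewrite -[X in _ --> X](addr0 0); apply: cvgD.
    rewrite -[X in _ --> X](mulr0 (k * j0 z (a, 0))); apply: cvgM; first exact: cvg_cst.
    exact: cvg_harmonic.
  by rewrite -[X in _ --> X](@normr0 _ R); apply: cvg_norm.
apply: (@squeeze_cvgr _ _ _ _ (cst 0) B); [|exact: cvg_cst|exact: B_cvg].
apply: nearW => n; rewrite /=; apply/andP; split.
  apply: mulr_ge0 => //; apply: Int_ge0 => p.
  by rewrite mulr_ge0 ?(wk_V0 HW)// mulr_ge0// pospow_ge0.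
pose J := jmul z (jcomp (ramp (e n)) (ramp1 (e n)) (ramp2 (e n)) phi).
have en0 : e n != 0 by rewrite gt_eqF.
have HJ : C21 setT J.
  by apply: C21_mul => //; apply: C21_sc2 (chart_C21 HC); exact: sc2_ramp.
have J0 p : j0 J p = j0 z p * ramp (e n) (j0 phi p) by [].
have Jfar p : bfar < `|p.1| -> j0 J p = 0 by move=> /farP h; rewrite J0 zfar// mul0r.
have Jbd x t : boundary Omega x -> 0 <= t <= T -> j0 J (x, t) = 0.
  move=> bx _; rewrite J0; have [h|h] := leP `|x - p0| (r / 2).
    have xr : `|x - p0| < r by lra.
    by rewrite (chart_boundary t (wk_open HW) HC xr bx) ramp0 mulr0.
  by rewrite zfar// mul0r.
have JT x : Omega x -> j0 J (x, T) = 0 by move=> _; rewrite J0 zT mul0r.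
have := wk_eq HW HJ Jfar Jbd JT.
pose L p := V p * (j0 z p * pospow 1 (1 - j0 phi p / e n) * Sphi p).
have IL : intg mu L.
  apply: (@intg_cyl _ _ bfar (wk_IV HW) (wk_VQ HW)).
    move=> p; apply: cvgM; last exact: cS.
    by apply: cvgM; [exact: cz|exact: cpp].
  by move=> p /farP h; rewrite zfar// !mul0r.
rewrite (_ : Int mu _ = Int mu (fun p => (e n)^-1 * Dn n p + 6 / e n ^+ 2 * L p)); last first.
  apply: eq_Int => p; rewrite J0 /J jbh_mul_comp; last exact: (chart_t HC).
  rewrite -/(sigma p) -/(Sphi p) /L /Dn /X /Y /ramp1 /ramp2.
  by field.
rewrite IntD ?IntZ//; [|exact: intgZ|exact: intgZ].
rewrite J0 => H.
have Ln : layer (e n) <= Int mu L.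
  apply: Int_le => //; first exact: intg_layer.
  move=> p; rewrite /L ler_wpM2l ?(wk_V0 HW)//.
  rewrite ler_peMr ?mulr_ge0 ?pospow_ge0//; exact: (chart_grad HC).
have rz : k * (j0 z (a, 0) * ramp (e n) (j0 phi (a, 0))) <= k * j0 z (a, 0).
  rewrite ler_wpM2l ?(wk_k HW)//.
  have [h|h] := leP `|a - p0| (r / 2); last by rewrite zfar// mul0r.
  rewrite -[leRHS]mulr1 ler_wpM2l//.
  have fa : 0 < j0 phi (a, 0) by apply/(chart_in HC); [lra|exact: (wk_a HW)].
  by have [/andP[]] := ramp_bounds (e0 n) (ltW fa).
have hD := ler_norm (- Int mu (Dn n)); rewrite normrN in hD.
have HL : 6 * ((e n)^-1 * Int mu L) = k * (j0 z (a, 0) * ramp (e n) (j0 phi (a, 0))) * e n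
    - Int mu (Dn n).
  by rewrite -H; field.
have K1 : k * (j0 z (a, 0) * ramp (e n) (j0 phi (a, 0))) * e n <= k * j0 z (a, 0) * e n.
  by rewrite ler_wpM2r// ltW.
have K2 : (e n)^-1 * layer (e n) <= (e n)^-1 * Int mu L by rewrite ler_wpM2l// invr_ge0 ltW.
have K3 : 0 <= (e n)^-1 * layer (e n).
  rewrite mulr_ge0 ?invr_ge0 ?(ltW (e0 n))//; apply: Int_ge0 => p.
  by rewrite mulr_ge0 ?(wk_V0 HW)// mulr_ge0// pospow_ge0.
rewrite -[layer _]/(layer (e n)) en /B; move: K1 K2 K3 HL hD.
move: ((e n)^-1 * layer _) ((e n)^-1 * Int _ _) (Int mu (Dn n)) (k * _ * e n) (k * _ * e n).
move=> u1 u2 u3 u4 u5 *; lra.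
Unshelve. all: end_near. Qed.

End layer.

(** * Removing the cutoff at the lateral boundary *)

Section cutoffs.
Context {R : realType}.

(** Nesting two truncated cubes gives a C^2 transition across the unit interval that is flat at both
    ends. *)
Definition step (s : R) := 1 - pospow 3 (1 - pospow 3 s).
Definition step1 (s : R) := 9 * pospow 2 (1 - pospow 3 s) * pospow 2 s.
Definition step2 (s : R) := 18 * pospow 2 (1 - pospow 3 s) * pospow 1 s
  - 54 * pospow 1 (1 - pospow 3 s) * pospow 2 s ^+ 2.

Lemma sc2_step : sc2 step step1 step2.
Proof.
have := sc2_add (sc2_cst (1 : R)) (sc2_scale (-1) (sc2_comp (sc2_preaff (-1) 1 sc2_pospow3) sc2_pospow3)).
apply: sc2_ext => s; rewrite /step /step1 /step2 /cst
  (_ : -1 * pospow 3 s + 1 = 1 - pospow 3 s); ring.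
Qed.

Lemma step_le0 s : s <= 0 -> step s = 0 /\ step1 s = 0.
Proof.
move=> s0; rewrite /step /step1 !(pospowN _ s0) subr0 mulr0 pospowP//.
by rewrite expr1n subrr.
Qed.

Lemma step_ge1 s : 1 <= s -> step s = 1 /\ step1 s = 0.
Proof.
move=> s1; have h : 1 - pospow 3 s <= 0.
  by rewrite subr_le0 pospowP ?(le_trans ler01)// exprn_ege1.
by rewrite /step /step1 !(pospowN _ h) subr0 mulr0 mul0r.
Qed.

Lemma step_bounds s : 0 <= step s <= 1 /\ 0 <= step1 s <= 9.
Proof.
have p0 := pospow_ge0 3 s.
have h1 : 1 - pospow 3 s <= 1 by lra.
have := pospow_le1 3 h1; have := pospow_ge0 3 (1 - pospow 3 s).
rewrite /step /step1 => a0 a1; split; first lra.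
have b0 := pospow_ge0 2 (1 - pospow 3 s); have b1 := pospow_ge0 2 s.
have [s1|/ltW s1] := leP s 1; last first.
  by have [_] := step_ge1 s1; rewrite /step1 => ->; rewrite lexx ler0n.
have c1 := pospow_le1 2 h1; have c2 := pospow_le1 2 s1.
move: (pospow 2 (1 - pospow 3 s)) (pospow 2 s) b0 b1 c1 c2 => x y x0 y0 x1 y1.
by have := mulr_ge0 x0 y0; have := ler_pM x0 y0 x1 y1; rewrite mulr1; lra.
Qed.

End cutoffs.

Section plateau.
Context {R : realType} {N : nat}.
Notation E := ('rV[R]_N * R)%type.

(** A spatial plateau: the argument of [step] is [(s1 - s) / (s1 - s0)] at [s = |x - c|^2], expanded
    into the affine form expected by [sc2_preaff]. *)
Definition jplat (c : 'rV[R]_N) (s0 s1 : R) : @jet R N :=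
  jcomp (fun s => step (- (s1 - s0)^-1 * s + s1 / (s1 - s0)))
   (fun s => - (s1 - s0)^-1 * step1 (- (s1 - s0)^-1 * s + s1 / (s1 - s0)))
   (fun s => (- (s1 - s0)^-1) ^+ 2 * step2 (- (s1 - s0)^-1 * s + s1 / (s1 - s0)))
   (jsq c).

Lemma plateauP c (s0 s1 : R) : s0 < s1 -> [/\ C21 setT (jplat c s0 s1),
  forall p, 0 <= j0 (jplat c s0 s1) p <= 1,
  forall p, sqn (p.1 - c) <= s0 -> j0 (jplat c s0 s1) p = 1,
  forall p, s1 <= sqn (p.1 - c) -> j0 (jplat c s0 s1) p = 0 &
  forall p, jt (jplat c s0 s1) p = 0].
Proof.
move=> s01; have d0 : 0 < s1 - s0 by rewrite subr_gt0.
have dn : s1 - s0 != 0 by rewrite gt_eqF.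
have E0 s : - (s1 - s0)^-1 * s + s1 / (s1 - s0) = (s1 - s) / (s1 - s0) by ring.
split.
- by apply: C21_sc2; [exact: sc2_preaff sc2_step|exact: C21_sq].
- by move=> p /=; have [] := step_bounds (- (s1 - s0)^-1 * sqn (p.1 - c) + s1 / (s1 - s0)).
- move=> p h; rewrite /= E0; have [] // := @step_ge1 _ ((s1 - sqn (p.1 - c)) / (s1 - s0)).
  by rewrite ler_pdivlMr// mul1r lerD2l lerN2.
- move=> p h; rewrite /= E0; have [] // := @step_le0 _ ((s1 - sqn (p.1 - c)) / (s1 - s0)).
  by rewrite pmulr_lle0 ?invr_gt0// subr_le0.
- by move=> p; rewrite /= /cst mulr0.
Qed.

End plateau.

Section boundary_cut.
Context {R : realType}.

(* Vanishes for [s <= d], equals 1 for [2 e <= s]; its convexity is confined to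
   [s < 3 d]. *)
Definition bcut (e d s : R) := ramp e (shinge d (s - d)).
Definition bcut1 (e d s : R) := ramp1 e (shinge d (s - d)) * shinge1 d (s - d).
Definition bcut2 (e d s : R) := ramp2 e (shinge d (s - d)) * shinge1 d (s - d) ^+ 2
  + ramp1 e (shinge d (s - d)) * shinge2 d (s - d).

Lemma sc2_bcut (e d : R) : 0 < e -> 0 < d -> sc2 (bcut e d) (bcut1 e d) (bcut2 e d).
Proof.
move=> e0 d0; have en : e != 0 by rewrite gt_eqF.
have := sc2_comp (sc2_ramp en) (sc2_preaff 1 (- d) (sc2_shinge d0)).
by apply: sc2_ext => s; rewrite /bcut /bcut1 /bcut2 !mul1r //; ring.
Qed.

Lemma shinge_ge0 (d s : R) : 0 < d -> 0 <= shinge d s.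
Proof.
move=> d0; rewrite /shinge mulr_ge0 ?(ltW d0)//.
have /andP[h _] := hinge_bounds (s / d).
have [x0|x0] := leP (s / d) 1.
  have [y0|y0] := leP (s / d) 0; first by have [-> _ _] := hinge_le0 y0.
  have z1 : s / d - 1 <= 0 by lra.
  have z2 : s / d - 2 <= 0 by lra.
  rewrite /hinge (pospowN _ z1) (pospowN _ z2) mulr0 subr0 addr0.
  by rewrite divr_ge0 ?pospow_ge0// ler0n.
by move: h; rewrite posP; lra.
Qed.

Lemma bcut_low (e d s : R) : 0 < d -> s <= d -> bcut e d s = 0.
Proof.
move=> d0 sd; rewrite /bcut /shinge; have [|-> _ _] := @hinge_le0 _ ((s - d) / d).
  by rewrite pmulr_lle0 ?invr_gt0// subr_le0.
by rewrite mulr0 ramp0.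
Qed.

Lemma bcut_high (e d s : R) : 0 < e -> 0 < d -> d <= e / 2 -> 2 * e <= s ->
  bcut e d s = 1 /\ bcut1 e d s = 0.
Proof.
move=> e0 d0 de se; have h : e <= shinge d (s - d).
  have := shinge_bounds (s - d) d0; rewrite posP; last lra.
  by rewrite ler_norml => /andP[_]; lra.
by rewrite /bcut /bcut1; have [-> -> _] := ramp_big e0 h; rewrite mul0r.
Qed.

Lemma bcut_bounds (e d s : R) : 0 < e -> 0 < d ->
  [/\ 0 <= bcut e d s <= 1, 0 <= bcut1 e d s <= 3 / e,
   bcut2 e d s <= 3 / e / d & 3 * d <= s -> bcut2 e d s <= 0].
Proof.
move=> e0 d0; have k0 := shinge_ge0 (s - d) d0.
have [a1 /andP[a2 a3] a4] := ramp_bounds e0 k0.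
have /andP[b1 b2] := hinge1_bounds ((s - d) / d).
have /andP[c1 c2] := hinge2_bounds ((s - d) / d).
have di : 0 < d^-1 by rewrite invr_gt0.
have u0 : ramp2 e (shinge d (s - d)) * shinge1 d (s - d) ^+ 2 <= 0.
  by rewrite mulr_le0_ge0// sqr_ge0.
split => //.
- rewrite /bcut1 mulr_ge0//= -[leRHS]mulr1 ler_pM//.
- rewrite /bcut2; have : ramp1 e (shinge d (s - d)) * shinge2 d (s - d) <= 3 / e / d.
    rewrite /shinge2 ler_pM// ?divr_ge0 ?(ltW d0)//.
    by rewrite -[leRHS]mul1r ler_wpM2r// ltW.
  lra.
- move=> sd; rewrite /bcut2 /shinge2 hinge2_ge2 ?mul0r ?mulr0 ?addr0//.
  by rewrite ler_pdivlMr//; lra.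
Qed.

End boundary_cut.

Lemma continuous_dist (R : realType) (T : normedModType R) (x0 : T) :
  continuous (fun x : T => `|x - x0|).
Proof.
by move=> x; apply: cvg_norm; apply: cvgB; [exact: cvg_id|exact: cvg_cst].
Qed.

Section thresholds.
Context {R : realType}.
Implicit Types s c : R.

Lemma lt3_le_half6 s c : s < 3 * c -> s <= 6 * c / 2. Proof. lra. Qed.
Lemma lt2_le_half4 s c : s < 2 * c -> s <= 4 * c / 2. Proof. lra. Qed.

Lemma lt34_le_sixth s c : s < c * (3 / 4) -> s / 6 <= c / 4 / 2. Proof. lra. Qed.

Lemma le_summands4 (a b c d M : R) : 0 <= a -> 0 <= b -> 0 <= c -> 0 <= d ->
  a + b + c + d <= M -> [/\ a <= M, b <= M, c <= M & d <= M].
Proof. by move=> *; split; lra. Qed.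

Lemma mulr_half_share_le (eta C : R) : 0 <= eta -> 0 <= C ->
  C * (eta / (2 * (C + 1))) <= eta / 2.
Proof.
move=> eta0 C0; rewrite invfM [eta * _]mulrA.
by apply: mulr_div_add1_le => //; rewrite divr_ge0.
Qed.

End thresholds.

Section extension.
Context {R : realType} {N : nat}.
Notation E := ('rV[R]_N * R)%type.
Notation EM := ('rV[R]_N * measurableTypeR R)%type.
Notation mu := (@spacetime_leb R N).
Implicit Types (z J phi : @jet R N).

Variables (Omega : set 'rV[R]_N) (T k : R) (a : 'rV[R]_N) (V A : E -> R).
Hypothesis HW : weak Omega T k a V A.
Notation Q := (cylinder Omega T).

Variables (m : E -> R) (c t1 t2 : R).
Hypothesis mm : measurable_fun setT (m : EM -> R).
Hypothesis m0 : forall p, 0 <= m p.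
Hypothesis mV : forall p, m p <= V p.
Hypothesis t2T : t2 < T.
Hypothesis c0 : 0 <= c.

Definition time_supp z := forall p : E, ~ (t1 <= p.2 <= t2) -> j0 z p = 0.

Hypothesis Hint : forall (K' : set 'rV[R]_N) z, compact K' -> K' `<=` Omega ->
  C21 setT z -> (forall p, 0 <= j0 z p) -> (forall p : E, ~ K' p.1 -> j0 z p = 0) ->
  time_supp z -> Int mu (fun p => m p * jbh z p) <= c * j0 z (a, 0).

Lemma intg_m : intg mu m.
Proof.
apply: (intg_le mm _ (wk_IV HW)) => p; rewrite ger0_norm//.
Qed.

Lemma mQ p : ~ Q p -> m p = 0.
Proof. by move=> Qp; apply/eqP; rewrite eq_le m0 andbT -(wk_VQ HW Qp) mV. Qed.

Lemma continuous_jbh z : C21 setT z -> continuous (jbh z).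
Proof.
move=> Hz p; apply: cvgB; last exact: (continuous_jlap Hz).
by apply: cvgN; exact: (C21_ct Hz).
Qed.

Lemma jets0_jbh z (C : set E) p : jets0 z C -> C p -> jbh z p = 0.
Proof.
move=> [_ zt _ zxx] Cp; rewrite /jbh zt// /jlap big1 ?subr0 ?oppr0// => i _.
exact: zxx.
Qed.

Lemma intg_m_jbh z b : C21 setT z -> (forall p, b < `|p.1| -> j0 z p = 0) ->
  intg mu (fun p => m p * jbh z p).
Proof.
move=> Hz zb; apply: (intg_cyl (Omega := Omega) (T := T) (b := b)).
- exact: intg_m.
- exact: mQ.
- exact: continuous_jbh.
- move=> p pb; apply: (jets0_jbh _ pb).
  by apply: C21_jets0 Hz zb => //; exact: open_far.
Qed.

(** [m] will be [V] with [c = k], and the excess with [c = 0]. Multiplying [z] by [bcut e d] of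
    [phi] makes it compactly supported in [Omega]. The price is [1 / e] times the mass of [m <= V]
    in a layer of width [2 e], plus [1 / (e d)] times its mass in a layer of width [3 d], where the
    cut is not concave. Both are killed by [layer_cvg] if [e] is chosen first and [d] afterwards. A
    single scale would not do: a concave ramp does not vanish near the boundary. *)
Lemma ext_chart (p0 : 'rV[R]_N) (r : R) phi z : chart Omega p0 r phi ->
  C21 setT z -> (forall p, 0 <= j0 z p) ->
  (forall p, (r / 4) ^+ 2 < sqn (p.1 - p0) -> j0 z p = 0) -> time_supp z ->
  Int mu (fun p => m p * jbh z p) <= c * j0 z (a, 0).
Proof.
move=> HC Hz z0 zfar zt.
have r0 := chart_r HC.
have Hphi := chart_C21 HC.
pose s0 := (r / 4) ^+ 2; pose s1 := (r / 2) ^+ 2.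
have s01 : s0 < s1 by rewrite /s0 /s1 !expr2; nra.
have [P1 P2 P3 P4 P5] := plateauP p0 s01.
(* The layers are measured by a fixed function [Z] that has to vanish at time [T]; the factor
   [(T - t)^2] does so and stays above [kap = (T - t2)^2] on the time support of [z]. *)
pose tau : @jet R N := jtime (fun s => (-1 * s + T) ^+ 2) (fun s => -1 * (2 * (-1 * s + T))).
have Htau : C21 setT tau by apply: C21_sc2_time (sc2_preaff (-1) T sc2_sqr).
pose Z := jmul (jplat p0 s0 s1) tau.
have HZ : C21 setT Z by exact: C21_mul.
have ZE p : j0 Z p = j0 (jplat p0 s0 s1) p * (-1 * p.2 + T) ^+ 2 by [].
have Z0 p : 0 <= j0 Z p by rewrite ZE mulr_ge0 ?sqr_ge0//; have /andP[] := P2 p.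
have ns (p : E) : r / 2 < `|p.1 - p0| -> s1 <= sqn (p.1 - p0).
  move=> h; rewrite (le_trans _ (norm_sqr_le_sqn _))// lerXn2r ?nnegrE ?normr_ge0//.
    lra.
  exact: ltW.
have Zfar p : r / 2 < `|p.1 - p0| -> j0 Z p = 0 by move=> /ns /P4 h; rewrite ZE h mul0r.
have ZT x : j0 Z (x, T) = 0 by rewrite ZE /= mulN1r addNr expr0n mulr0.
have zfar2 (p : E) : r / 2 < `|p.1 - p0| -> j0 z p = 0.
  by move=> /ns h; apply: zfar; exact: lt_le_trans h.
have Lc := layer_cvg HW HC HZ Z0 Zfar ZT.
set Lay := layer V phi Z in Lc.
have Lay0 e : 0 <= Lay e.
  apply: Int_ge0 => p; rewrite mulr_ge0 ?(wk_V0 HW)// mulr_ge0//; exact: pospow_ge0.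
pose kap := (T - t2) ^+ 2.
have kap0 : 0 < kap by rewrite exprn_gt0// subr_gt0.
pose Sz (p : E) := Q p /\ sqn (p.1 - p0) <= s0 /\ t1 <= p.2 <= t2.
have phi_pos p : Sz p -> 0 < j0 phi p.
  case: p => x t [[/= Ox _] [xs _]]; apply/(chart_in HC) => //.
  have [//|h] := leP `|x - p0| (r / 2); first lra.
  by have := ns (x, t) h => /=; move: xs s01 => /=; lra.
(* In the inner half of the layer the weight is at least [1 / 2] and [Z] at least [kap]. *)
have dom e p : 0 < e -> Sz p -> j0 phi p <= e / 2 ->
    V p <= 2 / kap * (V p * (j0 Z p * pospow 1 (1 - j0 phi p / e))).
  move=> e0 Hp pe; have [_ [ps pt]] := Hp.
  have h1 : 2^-1 <= pospow 1 (1 - j0 phi p / e).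
    rewrite pospow1 (le_trans _ (ge_pos _))// lerBrDr -lerBrDl ler_pdivrMr//; lra.
  have h2 : kap <= j0 Z p.
    have /andP[pt1 pt2] := pt; have tT := t2T.
    by rewrite ZE P3// mul1r /kap mulN1r addrC lerXn2r ?nnegrE//; lra.
  rewrite mulrCA -[leLHS]mulr1 ler_wpM2l ?(wk_V0 HW)//.
  have h3 : kap / 2 <= j0 Z p * pospow 1 (1 - j0 phi p / e).
    by rewrite ler_pM ?invr_ge0 ?(ltW kap0).
  rewrite -[leLHS](@mulfV _ (kap / 2)); last by rewrite gt_eqF// divr_gt0.
  by rewrite mulrC invf_div ler_wpM2l// divr_ge0 ?(ltW kap0).
pose sig p := \sum_(i < N) jx z i p * jx phi i p.
pose S p := \sum_(i < N) jx phi i p ^+ 2.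
pose F p := `|jbh z p| + `|2 * sig p| + j0 z p * S p + `|j0 z p * jlap phi p|.
have S0 p : 0 <= S p by apply: sumr_ge0 => i _; exact: sqr_ge0.
have cabs (f : E -> R) : continuous f -> continuous (fun p => `|f p|).
  by move=> cf p; apply: (@continuous_comp _ _ _ f Num.norm); [exact: cf|exact: norm_continuous].
have cz : continuous (j0 z) by move=> p; exact: (C21_c0 Hz).
have cF : continuous F.
  have csig : continuous sig.
    move=> p; apply: cvg_fsum => i.
    by apply: cvgM; [exact: (C21_cx Hz)|exact: (C21_cx Hphi)].
  have cS : continuous S.
    move=> p; apply: cvg_fsum => i; under eq_cvg do rewrite expr2.
    by rewrite expr2; apply: cvgM; exact: (C21_cx Hphi).
  move=> p; apply: cvgD; first apply: cvgD; first apply: cvgD.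
  - by apply: cabs; exact: continuous_jbh.
  - by apply: cabs => r'; apply: cvgM; [exact: cvg_cst|exact: csig].
  - by apply: cvgM; [exact: cz|exact: cS].
  - by apply: cabs => r'; apply: cvgM; [exact: cz|exact: (continuous_jlap Hphi)].
pose b := `|p0| + r.
have [M M0 HM] := compact_bounded (@compact_slab R N b 0 T) (continuous_subspaceT cF).
have HF p : Sz p -> F p <= M.
  move=> [[_]]; rewrite /= in_itv /= => /andP[h1 h2] [h3 _].
  rewrite (le_trans (ler_norm _))// HM//; split; last by rewrite !ltW.
  rewrite /b; have [//|h] := leP `|p.1 - p0| (r / 2).
    move=> h; have := lerB_dist p.1 p0; lra.
  by have := ns p h; move: s01; lra.
have open_sq : open [set p : E | s0 < sqn (p.1 - p0)].
  apply: (@open_comp E R (fun p => sqn (p.1 - p0)) [set s : R | s0 < s]); last exact: open_gt.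
  by move=> p _; exact: continuous_sqn.
have open_t : open [set p : E | ~ (t1 <= p.2 <= t2)].
  rewrite (_ : [set p : E | _] = snd @^-1` (~` `[t1, t2])).
    apply: open_comp; first by move=> p _; exact: cvg_snd.
    by rewrite openC; exact: interval_closed.
  by apply/seteqP; split => p /=; rewrite in_itv.
have J1 : jets0 z [set p | s0 < sqn (p.1 - p0)] by apply: C21_jets0 Hz zfar.
have J2 : jets0 z [set p | ~ (t1 <= p.2 <= t2)] by apply: C21_jets0 Hz zt.
have off p : ~ Sz p -> Q p -> [/\ j0 z p = 0, jbh z p = 0 & sig p = 0].
  move=> H Qp; have [h|h] := leP (sqn (p.1 - p0)) s0.
    have h' : ~ (t1 <= p.2 <= t2) by move=> ht; apply: H.
    have [a1 _ a3 _] := J2; split; [exact: a1|exact: jets0_jbh J2 h'|].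
    by rewrite /sig big1// => i _; rewrite a3// mul0r.
  have [a1 _ a3 _] := J1; split; [exact: a1|exact: jets0_jbh J1 h|].
  by rewrite /sig big1// => i _; rewrite a3// mul0r.
have zb (p : E) : b < `|p.1| -> j0 z p = 0.
  by rewrite /b => h; apply: zfar2; have := lerB_dist p.1 p0; lra.
have Iz := intg_m_jbh Hz zb.
(* The regions [phi < 2 e] and [phi < 3 d] are the inner halves of the layers of widths [4 e] and
   [6 d]. The factor [6 / e] collects two terms with the first derivative of the cut, each bounded
   through [3 / e]. *)
have main e d : 0 < e -> 0 < d -> d <= e / 2 ->
   Int mu (fun p => m p * jbh z p) <= c * j0 z (a, 0) +
     ((M + 6 / e * M) * (2 / kap)) * Lay (4 * e) + (M * (3 / e / d) * (2 / kap)) * Lay (6 * d).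
  move=> e0 d0 de.
  have Hs2 := sc2_bcut e0 d0.
  pose y := jmul z (jcomp (bcut e d) (bcut1 e d) (bcut2 e d) phi).
  have Hy : C21 setT y by apply: C21_mul => //; exact: C21_sc2 Hs2 Hphi.
  have yE p : j0 y p = j0 z p * bcut e d (j0 phi p) by [].
  have th p : Sz p -> [/\ 0 <= bcut e d (j0 phi p) <= 1,
      0 <= bcut1 e d (j0 phi p) <= 3 / e, bcut2 e d (j0 phi p) <= 3 / e / d &
      3 * d <= j0 phi p -> bcut2 e d (j0 phi p) <= 0].
    by move=> Hp; exact: bcut_bounds.
  pose K' := [set x : 'rV[R]_N | `|x - p0| <= r / 2 /\ d <= j0 phi (x, 0)].
  have K'O : K' `<=` Omega.
    move=> x [x1 x2]; have h : `|x - p0| <= r by lra.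
    by apply/(chart_in HC 0 h); exact: lt_le_trans x2.
  have cK' : compact K'.
    apply: bounded_closed_compact.
      exists b; split; first exact: num_real.
      move=> M' bM x [xr _] /=; rewrite (le_trans _ (ltW bM))// /b.
      by have := lerB_dist x p0; lra.
    apply: closedI.
      apply: (@preimage_closed 'rV[R]_N R (fun x => `|x - p0|) [set s : R | s <= r / 2]).
        by move=> x _; exact: continuous_dist.
      exact: closed_le.
    apply: (@preimage_closed 'rV[R]_N R (fun x => j0 phi (x, 0)) [set s : R | d <= s]).
      move=> x _; apply: (@continuous_comp _ _ _ (fun y => (y, 0)) (j0 phi)).
        exact: continuous_slice.
      exact: (C21_c0 Hphi).
    exact: closed_ge.
  have y0 p : 0 <= j0 y p.
    rewrite yE; have [h|h] := leP (j0 phi p) d; first by rewrite bcut_low// mulr0.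
    by rewrite mulr_ge0//; have [/andP[]] := @bcut_bounds R e d (j0 phi p) e0 d0.
  have yK p : ~ K' p.1 -> j0 y p = 0.
    move=> H; rewrite yE; have [h|h] := leP `|p.1 - p0| (r / 2); last by rewrite zfar2 ?mul0r.
    rewrite bcut_low ?mulr0//; case: p H h => x t /= H h.
    by rewrite (chart_time HC x t 0) leNgt; apply/negP => h2; apply: H; split => //; exact: ltW.
  have yt : time_supp y by move=> p Hp; rewrite yE zt ?mul0r.
  have I1 := Hint cK' K'O Hy y0 yK yt.
  have ya : c * j0 y (a, 0) <= c * j0 z (a, 0).
    rewrite ler_wpM2l// yE.
    have [h|h] := leP (j0 phi (a, 0)) d; first by rewrite bcut_low ?mulr0.
    by have [/andP[h1 h2] _ _ _] := @bcut_bounds R e d (j0 phi (a, 0)) e0 d0; rewrite ler_piMr.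
  have yb (p : E) : b < `|p.1| -> j0 y p = 0 by move=> h; rewrite yE zb ?mul0r.
  have Iy := intg_m_jbh Hy yb.
  pose G e p := V p * (j0 Z p * pospow 1 (1 - j0 phi p / e)).
  have IG e' : intg mu (G e') by exact: (intg_layer HW HC HZ Zfar).
  have G0 e' p : 0 <= G e' p.
    by rewrite mulr_ge0 ?(wk_V0 HW)// mulr_ge0//; exact: pospow_ge0.
  have C1 : 0 <= (M + 6 / e * M) * (2 / kap).
    apply: mulr_ge0; last by rewrite divr_ge0 ?ler0n ?(ltW kap0).
    by rewrite addr_ge0// mulr_ge0// divr_ge0 ?ler0n ?(ltW e0).
  have C2 : 0 <= M * (3 / e / d) * (2 / kap).
    apply: mulr_ge0; last by rewrite divr_ge0 ?ler0n ?(ltW kap0).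
    by rewrite mulr_ge0// !divr_ge0 ?ler0n ?(ltW e0) ?(ltW d0).
  have pw p : m p * jbh z p <= m p * jbh y p +
     (((M + 6 / e * M) * (2 / kap)) * G (4 * e) p + (M * (3 / e / d) * (2 / kap)) * G (6 * d) p).
    have R0 : 0 <= (M + 6 / e * M) * (2 / kap) * G (4 * e) p + M * (3 / e / d) * (2 / kap) * G (6 * d) p.
      by rewrite addr_ge0// mulr_ge0.
    have [Qp|Qp] := pselect (Q p); last by rewrite mQ// !mul0r add0r.
    have yJ : jbh y p = bcut e d (j0 phi p) * jbh z p - bcut1 e d (j0 phi p) * (2 * sig p)
       - j0 z p * (bcut2 e d (j0 phi p) * S p + bcut1 e d (j0 phi p) * jlap phi p).
      by rewrite jbh_mul_comp//; exact: (chart_t HC).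
    have [Hp|Hp] := pselect (Sz p); last first.
      have [q1 q2 q3] := off p Hp Qp.
      by rewrite yJ q1 q2 q3 !mulr0 mul0r !subr0 mulr0 add0r.
    have [/andP[a1 a2] /andP[a3 a4] a5 a6] := th p Hp.
    have := HF p Hp; rewrite /F => Fp.
    have n3 := mulr_ge0 (z0 p) (S0 p).
    have [f1 f2 f3 f4] := le_summands4 (normr_ge0 _) (normr_ge0 _) n3 (normr_ge0 _) Fp.
    have e4 : 0 < 4 * e by rewrite mulr_gt0.
    have d6 : 0 < 6 * d by rewrite mulr_gt0.
    have V0 := wk_V0 HW p.
    have b2 : bcut2 e d (j0 phi p) * (j0 z p * S p) * m p <=
        M * (3 / e / d) * (2 / kap) * G (6 * d) p.
      have [h|h] := leP (3 * d) (j0 phi p).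
        apply: (@le_trans _ _ 0); last by rewrite mulr_ge0.
        by rewrite mulr_le0_ge0// mulr_le0_ge0// a6.
      have D := dom (6 * d) p d6 Hp (lt3_le_half6 h).
      apply: (@le_trans _ _ (3 / e / d * M * V p)).
        apply: (@le_trans _ _ (3 / e / d * (j0 z p * S p) * m p)).
          by rewrite ler_wpM2r// ler_wpM2r.
        have ed0 : 0 <= 3 / e / d by rewrite !divr_ge0 ?ler0n ?(ltW e0) ?(ltW d0).
        by apply: ler_pM => //; [exact: mulr_ge0|exact: ler_wpM2l].
      have -> : M * (3 / e / d) * (2 / kap) * G (6 * d) p = 3 / e / d * M * (2 / kap * G (6 * d) p).
        by ring.
      rewrite ler_wpM2l//.
      by rewrite mulr_ge0// !divr_ge0 ?ler0n ?(ltW e0) ?(ltW d0).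
    have b1 : ((1 - bcut e d (j0 phi p)) * jbh z p + bcut1 e d (j0 phi p) * (2 * sig p)
         + bcut1 e d (j0 phi p) * (j0 z p * jlap phi p)) * m p <=
        (M + 6 / e * M) * (2 / kap) * G (4 * e) p.
      have [h|h] := leP (2 * e) (j0 phi p).
        have [-> ->] := bcut_high e0 d0 de h.
        by rewrite subrr !mul0r !addr0 mul0r mulr_ge0.
      have D := dom (4 * e) p e4 Hp (lt2_le_half4 h).
      apply: (@le_trans _ _ ((M + 6 / e * M) * V p)); last first.
        rewrite -(mulrA _ (2 / kap)) ler_wpM2l//.
        by rewrite addr_ge0// mulr_ge0// divr_ge0 ?ler0n ?(ltW e0).
      apply: (@le_trans _ _ ((M + 6 / e * M) * m p)); last first.
        rewrite ler_wpM2l// addr_ge0// mulr_ge0// divr_ge0 ?ler0n ?(ltW e0)//.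
      rewrite ler_wpM2r//.
      have u1 : (1 - bcut e d (j0 phi p)) * jbh z p <= M.
        rewrite (le_trans (ler_norm _))// normrM ger0_norm ?subr_ge0//.
        by rewrite -[leRHS]mul1r; apply: ler_pM => //; [rewrite subr_ge0|rewrite gerBl].
      have u2 : bcut1 e d (j0 phi p) * (2 * sig p) <= 3 / e * M.
        by rewrite (le_trans (ler_norm _))// normrM ger0_norm// ler_pM.
      have u3 : bcut1 e d (j0 phi p) * (j0 z p * jlap phi p) <= 3 / e * M.
        by rewrite (le_trans (ler_norm _))// normrM ger0_norm// ler_pM.
      have -> : 6 / e * M = 3 / e * M + 3 / e * M by ring.
      by rewrite addrA; apply: lerD => //; apply: lerD.
    have -> : m p * jbh z p = m p * jbh y p +
      ((((1 - bcut e d (j0 phi p)) * jbh z p + bcut1 e d (j0 phi p) * (2 * sig p)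
         + bcut1 e d (j0 phi p) * (j0 z p * jlap phi p)) * m p) +
       bcut2 e d (j0 phi p) * (j0 z p * S p) * m p) by rewrite yJ; ring.
    by rewrite lerD2l lerD.
  apply: (@le_trans _ _ (Int mu (fun p => m p * jbh y p +
     (((M + 6 / e * M) * (2 / kap)) * G (4 * e) p + (M * (3 / e / d) * (2 / kap)) * G (6 * d) p)))).
    apply: Int_le => //; apply: intgD => //; apply: intgD; exact: intgZ.
  rewrite IntD//; last by apply: intgD; exact: intgZ.
  rewrite IntD; [|exact: intgZ|exact: intgZ].
  rewrite !IntZ// -addrA lerD//; exact: (le_trans I1).
apply/ler_addgt0Pl => eta eta0.
pose e n : R := n.+1%:R^-1.
have e_gt0 n : 0 < e n by rewrite invr_gt0 ltr0n.
have en n : n.+1%:R = (e n)^-1 :> R by rewrite invrK.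
have Ln (eps : R) : 0 < eps -> exists n0, forall n, (n0 <= n)%N -> (e n)^-1 * Lay (e n) < eps.
  move=> eps0; have /cvgr_lt := Lc; move=> /(_ eps eps0)[n0 _ h].
  by exists n0 => n /h /=; rewrite -/(e n) en.
(* With [e := e1 / 4] and [e1 <= 1], the coefficient of [Lay e1] in [main] is at most [C1 / e1]. *)
pose C1 := (M + 24 * M) * (2 / kap).
have C10 : 0 <= C1.
  by apply: mulr_ge0; [lra|rewrite divr_ge0 ?(ltW kap0)].
have eta1 : 0 < eta / (2 * (C1 + 1)) by rewrite divr_gt0// mulr_gt0// ltr_wpDl.
have [n0 /(_ n0 (leqnn n0))] := Ln _ eta1; set e1 := e n0 => H1.
have e10 : 0 < e1 by exact: e_gt0.
have e11 : e1 <= 1 by rewrite invf_le1 ?ltr0n// ler1n.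
(* With [d := e2 / 6] the coefficient of [Lay e2] is [C2 / e2]. It depends on [e1], which is
   therefore frozen before [e2] is chosen. *)
pose C2 := M * (3 / (e1 / 4)) * (2 / kap) * 6.
have C20 : 0 <= C2.
  have q1 : 0 <= 3 / (e1 / 4) by rewrite divr_ge0 ?ler0n// divr_ge0 ?ler0n ?(ltW e10).
  have q2 : 0 <= 2 / kap by rewrite divr_ge0 ?ler0n ?(ltW kap0).
  by apply: mulr_ge0; [apply: mulr_ge0; [exact: mulr_ge0|]|].
have eta2 : 0 < eta / (2 * (C2 + 1)) by rewrite divr_gt0// mulr_gt0// ltr_wpDl.
have [n1 Hn1] := Ln _ eta2.
have [n2 Hn2] : exists n2, forall n, (n2 <= n)%N -> e n < e1 * (3 / 4).
  have : e n @[n --> \oo] --> (0 : R) by exact: cvg_harmonic.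
  move/cvgr_lt => /(_ (e1 * (3 / 4)))[|n2 _ h]; first lra.
  by exists n2.
pose n3 := maxn n1 n2.
have H2 := Hn1 n3 (leq_maxl _ _); have H3 := Hn2 n3 (leq_maxr _ _).
set e2 := e n3 in H2 H3.
have e20 : 0 < e2 by exact: e_gt0.
have := main (e1 / 4) (e2 / 6) _ _ _.
rewrite (_ : 4 * (e1 / 4) = e1); last by field.
rewrite (_ : 6 * (e2 / 6) = e2); last by field.
move=> H; apply: le_trans (H _ _ _) _.
- by rewrite divr_gt0.
- by rewrite divr_gt0.
- exact: lt34_le_sixth.
rewrite [leRHS]addrC -addrA lerD2l.
have K1 : (M + 6 / (e1 / 4) * M) * (2 / kap) * Lay e1 <= eta / 2.
  apply: (@le_trans _ _ (C1 * (e1^-1 * Lay e1))).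
    have -> : (M + 6 / (e1 / 4) * M) * (2 / kap) * Lay e1 =
       (e1 * M + 24 * M) * (2 / kap * (e1^-1 * Lay e1)) by field; rewrite !gt_eqF.
    have -> : C1 * (e1^-1 * Lay e1) = (M + 24 * M) * (2 / kap * (e1^-1 * Lay e1)).
      by rewrite /C1; ring.
    rewrite ler_wpM2r//.
      by rewrite !mulr_ge0 ?divr_ge0 ?ler0n ?invr_ge0 ?(ltW kap0) ?(ltW e10).
    by rewrite lerD2r -[leRHS]mul1r ler_wpM2r.
  apply: le_trans (mulr_half_share_le (ltW eta0) C10).
  by rewrite ler_wpM2l// ltW.
have K2 : M * (3 / (e1 / 4) / (e2 / 6)) * (2 / kap) * Lay e2 <= eta / 2.
  have -> : M * (3 / (e1 / 4) / (e2 / 6)) * (2 / kap) * Lay e2 = C2 * (e2^-1 * Lay e2).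
    by rewrite /C2; field; rewrite !gt_eqF.
  apply: le_trans (mulr_half_share_le (ltW eta0) C20).
  by rewrite ler_wpM2l// ltW.
by rewrite [leRHS]splitr lerD.
Qed.

End extension.

Lemma Int_eq0 d (T : measurableType d) (R : realType)
  (mu : {measure set T -> \bar R}) (f : T -> R) : (forall x, f x = 0) -> Int mu f = 0.
Proof.
move=> f0; rewrite /Int /Rintegral (_ : (\int[mu]_(_ in _) _)%E = 0%E)//.
by apply: integral0_eq => x _; rewrite f0.
Qed.

(** * Globalisation by a finite cover *)

Section covering.
Context {R : realType} {N : nat}.
Notation E := ('rV[R]_N * R)%type.
Notation EM := ('rV[R]_N * measurableTypeR R)%type.
Notation mu := (@spacetime_leb R N).
Implicit Types (z J phi : @jet R N).

Section cover.
Variables (Omega : set 'rV[R]_N) (T k : R) (a : 'rV[R]_N) (V A : E -> R).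
Hypothesis HW : weak Omega T k a V A.
Hypothesis hC2 : C2_boundary Omega.
Variables (m : E -> R) (c t1 t2 : R).
Hypothesis mm : measurable_fun setT (m : EM -> R).
Hypothesis m0 : forall p, 0 <= m p.
Hypothesis mV : forall p, m p <= V p.
Hypothesis t2T : t2 < T.
Hypothesis c0 : 0 <= c.
Hypothesis Hint : forall (K' : set 'rV[R]_N) z, compact K' -> K' `<=` Omega ->
  C21 setT z -> (forall p, 0 <= j0 z p) -> (forall p : E, ~ K' p.1 -> j0 z p = 0) ->
  time_supp t1 t2 z -> Int mu (fun p => m p * jbh z p) <= c * j0 z (a, 0).

Let good (x0 : 'rV[R]_N) (s : R) := 0 < s /\ forall z, C21 setT z ->
  (forall p, 0 <= j0 z p) -> time_supp t1 t2 z ->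
  (forall p : E, s < sqn (p.1 - x0) -> j0 z p = 0) ->
  Int mu (fun p => m p * jbh z p) <= c * j0 z (a, 0).

Let far_sqn (x : 'rV[R]_N) (e : R) : 0 < e -> ~ (`|x| <= e) -> e ^+ 2 < sqn x.
Proof.
move=> e0 /negP; rewrite -ltNge => h; rewrite (lt_le_trans _ (norm_sqr_le_sqn _))//.
by rewrite ltrXn2r ?nnegrE ?normr_ge0 ?(ltW e0).
Qed.

(** Three cases: near a point of [Omega] the hypothesis applies directly, near a boundary point
    [ext_chart] does, and near a point outside the closure [m] vanishes. *)
Lemma exists_good x0 : exists s, good x0 s.
Proof.
have oO := wk_open HW.
have [Ox|nOx] := pselect (Omega x0).
  have /nbhs_ballP[e /= e0 eO] : nbhs x0 Omega by exact: open_nbhs_nbhs.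
  have e2 : 0 < e / 2 by lra.
  exists ((e / 2) ^+ 2); split=> [|z Hz z0 zt zs]; first by rewrite exprn_gt0.
  apply: (Hint (K' := [set x | `|x - x0| <= e / 2])) => //.
  - apply: bounded_closed_compact.
      exists (e / 2 + `|x0|); split; first exact: num_real.
      move=> M' bM x /= xr; rewrite (le_trans _ (ltW bM))//.
      by have := lerB_dist x x0; lra.
    apply: (@preimage_closed 'rV[R]_N R (fun x => `|x - x0|) [set s : R | s <= e / 2]).
      by move=> x _; exact: (@continuous_dist R 'rV[R]_N).
    exact: closed_le.
  - move=> x /= h; apply: eO; rewrite -ball_normE /= distrC.
    by rewrite (le_lt_trans h)// ltr_pdivrMr// ltr_pMr// ltr1n.
  - by move=> p /= h; apply: zs; exact: far_sqn.
have [cx|ncx] := pselect (closure Omega x0).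
  have [r [phi HC]] : exists r phi, chart Omega x0 r phi.
    apply: exists_chart => //; split => //.
    by move=> /interior_subset.
  exists ((r / 4) ^+ 2); split=> [|z Hz z0 zt zs].
    by rewrite exprn_gt0// divr_gt0//; exact: (chart_r HC).
  exact: (ext_chart HW mm m0 mV t2T c0 Hint HC).
have : nbhs x0 (~` closure Omega).
  apply: open_nbhs_nbhs; split => //; rewrite openC; exact: closed_closure.
move=> /nbhs_ballP[e /= e0 eO].
have e2 : 0 < e / 2 by lra.
exists ((e / 2) ^+ 2); split=> [|z Hz z0 zt zs]; first by rewrite exprn_gt0.
have J1 : jets0 z [set p | (e / 2) ^+ 2 < sqn (p.1 - x0)].
  apply: C21_jets0 Hz zs => //.
  apply: (@open_comp E R (fun p => sqn (p.1 - x0)) [set s : R | (e / 2) ^+ 2 < s]); last exact: open_gt.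
  by move=> p _; exact: continuous_sqn.
rewrite (_ : Int _ _ = 0); first by rewrite mulr_ge0.
apply: Int_eq0 => p.
have [h|h] := leP (sqn (p.1 - x0)) ((e / 2) ^+ 2); last first.
  by rewrite (jets0_jbh J1)// mulr0.
rewrite (mQ HW m0 mV) ?mul0r// => -[Op _].
apply: (eO p.1); last exact: subset_closure.
rewrite -ball_normE /= distrC; have [h1|h1] := ltP `|p.1 - x0| e => //.
have : ~ (`|p.1 - x0| <= e / 2) by apply/negP; rewrite -ltNge; lra.
by move=> H; have := far_sqn e2 H; rewrite ltNge h.
Qed.

(** Instead of a partition of unity, the plateaus of a finite cover are peeled off one by one: [z]
    splits into [z chi], supported in a good ball, and [z (1 - chi)], which needs one ball less.
    Both inequality and right-hand side are additive in [z]. *)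
Lemma extension z b : C21 setT z -> (forall p, 0 <= j0 z p) ->
  (forall p, b < `|p.1| -> j0 z p = 0) -> time_supp t1 t2 z ->
  Int mu (fun p => m p * jbh z p) <= c * j0 z (a, 0).
Proof.
have [rad Hrad] := choice exists_good.
(* The list contains centres whose half-size balls still cover the support of [z]; each plateau
   equals 1 on the half-size ball. *)
have step (l : seq 'rV[R]_N) : forall z, C21 setT z -> (forall p, 0 <= j0 z p) ->
    (forall p, b < `|p.1| -> j0 z p = 0) -> time_supp t1 t2 z ->
    (forall p : E, (forall x, x \in l -> rad x / 2 <= sqn (p.1 - x)) -> j0 z p = 0) ->
    Int mu (fun p => m p * jbh z p) <= c * j0 z (a, 0).
  elim: l => [|x l IH] {}z Hz z0 zb zt zl.
    have J1 : jets0 z setT by apply: C21_jets0 Hz _; [exact: openT|by []|move=> p _; exact: zl].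
    rewrite (_ : Int _ _ = 0); first by rewrite mulr_ge0.
    by apply: Int_eq0 => p; rewrite (jets0_jbh J1)// mulr0.
  have [r0 Hx] := Hrad x.
  have s01 : rad x / 2 < rad x by lra.
  have [P1 P2 P3 P4 P5] := plateauP x s01.
  pose z1 := jmul z (jplat x (rad x / 2) (rad x)).
  have Hz1 : C21 setT z1 by exact: C21_mul.
  have z1E p : j0 z1 p = j0 z p * j0 (jplat x (rad x / 2) (rad x)) p by [].
  pose z2 := jadd z (jscl (-1) z1).
  have Hz2 : C21 setT z2 by apply: C21_add => //; exact: C21_scl.
  have z2E p : j0 z2 p = j0 z p * (1 - j0 (jplat x (rad x / 2) (rad x)) p).
    by rewrite -[LHS]/(j0 z p + -1 * j0 z1 p) z1E; ring.
  have B1 : Int mu (fun p => m p * jbh z1 p) <= c * j0 z1 (a, 0).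
    apply: Hx => // p; rewrite z1E.
    - by rewrite mulr_ge0//; have /andP[] := P2 p.
    - by move=> /zt ->; rewrite mul0r.
    - by move=> h; rewrite P4 ?mulr0// ltW.
  have B2 : Int mu (fun p => m p * jbh z2 p) <= c * j0 z2 (a, 0).
    apply: IH => // p; rewrite z2E.
    - by rewrite mulr_ge0// subr_ge0; have /andP[] := P2 p.
    - by move=> /zb ->; rewrite mul0r.
    - by move=> /zt ->; rewrite mul0r.
    - move=> h; have [h1|h1] := leP (rad x / 2) (sqn (p.1 - x)).
        rewrite zl ?mul0r// => y; rewrite inE => /orP[/eqP -> //|]; exact: h.
      by rewrite P3 ?subrr ?mulr0// ltW.
  have E1 p : m p * jbh z p = m p * jbh z1 p + m p * jbh z2 p.
    rewrite /jbh -[jt z2 p]/(jt z p + -1 * jt z1 p) jlap_add jlap_scl; ring.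
  have zb1 p : b < `|p.1| -> j0 z1 p = 0 by move=> /zb h; rewrite z1E h mul0r.
  have zb2 p : b < `|p.1| -> j0 z2 p = 0 by move=> /zb h; rewrite z2E h mul0r.
  rewrite (_ : Int mu _ = Int mu (fun p => m p * jbh z1 p + m p * jbh z2 p)); last exact: eq_Int.
  rewrite IntD.
  - apply: (le_trans (lerD B1 B2)); rewrite -mulrDr ler_wpM2l// z1E z2E; lra.
  - exact: (intg_m_jbh HW mm m0 mV Hz1 zb1).
  - exact: (intg_m_jbh HW mm m0 mV Hz2 zb2).
move=> Hz z0 zb zt.
have := @compact_ball_rV R N b; rewrite compact_cover.
move=> /(_ _ setT (fun x => [set y | sqn (y - x) < rad x / 2]))[].
- move=> x _; have cs : continuous (fun y : 'rV[R]_N => sqn (y - x)).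
    move=> y; apply: (@continuous_comp 'rV[R]_N E R (fun y => (y, 0)) (fun p : E => sqn (p.1 - x))).
      exact: continuous_slice.
    exact: continuous_sqn.
  apply: (@open_comp _ R (fun y : 'rV[R]_N => sqn (y - x)) [set s : R | s < rad x / 2]); last exact: open_lt.
  by move=> y _; exact: cs.
- move=> y _; exists y => //=; have [r0 _] := Hrad y.
  have -> : sqn (y - y) = 0 by rewrite /sqn big1// => i _; rewrite !mxE subrr expr0n.
  lra.
move=> D _ HD; apply: (step (finmap.enum_fset D)) => // p Hp.
have [h|] := ltP b `|p.1|; first exact: zb.
by move=> /HD[x /= xD]; rewrite ltNge Hp.
Qed.

End cover.
End covering.

(** * Integral inequalities without lateral boundary condition on the test function *)

Section inequalities.
Context {R : realType} {N : nat}.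
Notation E := ('rV[R]_N * R)%type.
Notation EM := ('rV[R]_N * measurableTypeR R)%type.
Notation mu := (@spacetime_leb R N).
Implicit Types (z J : @jet R N).
Variables (Omega : set 'rV[R]_N) (T k : R) (a : 'rV[R]_N) (V A : E -> R).
Hypothesis HW : weak Omega T k a V A.
Hypothesis hC2 : C2_boundary Omega.
Notation Q := (cylinder Omega T).

Lemma compact_sub_norm (K : set 'rV[R]_N) : compact K -> exists b, forall x, K x -> `|x| <= b.
Proof.
move=> cK; have cn : continuous (fun x : 'rV[R]_N => `|x|) by exact: norm_continuous.
have [b _ Hb] := compact_bounded cK (continuous_subspaceT cn).
by exists b => x /Hb; rewrite normr_id.
Qed.

Lemma jbh_mul_time z (h h1 : R -> R) p :
  jbh (jmul z (jtime h h1)) p = jbh z p * h p.2 - j0 z p * h1 p.2.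
Proof.
rewrite /jbh jlap_mul jlap_time big1 => [|i _]; last by rewrite -[jx _ _ _ in X in _ * X]/(0 : R) mulr0.
rewrite -[jt _ _ in LHS]/(jt z p * h p.2 + j0 z p * h1 p.2) -[j0 (jtime _ _) p]/(h p.2); ring.
Qed.

(** For tests compactly supported in [Omega] this is the weak equation with the nonnegative
    absorption term dropped; [extension] then admits tests that do not vanish on the lateral
    boundary. *)
Lemma weak_ineq z b t2 : t2 < T -> C21 setT z -> (forall p, 0 <= j0 z p) ->
  (forall p, b < `|p.1| -> j0 z p = 0) -> (forall p, t2 < p.2 -> j0 z p = 0) ->
  Int mu (fun p => V p * jbh z p) <= k * j0 z (a, 0).
Proof.
move=> t2T Hz z0 zb zt.
(* [extension] wants a bounded time support, so [z] is cut off between times -1 and 0. Neither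
   integral nor right-hand side changes, as [V] vanishes before time 0. *)
pose y := jmul z (@jtime R N (fun s => step (1 * s + 1)) (fun s => 1 * step1 (1 * s + 1))).
have Hy : C21 setT y.
  by apply: C21_mul => //; apply: C21_sc2_time (sc2_preaff 1 1 sc2_step).
have yE p : j0 y p = j0 z p * step (1 * p.2 + 1) by [].
have st (s : R) : 0 <= s -> step (1 * s + 1) = 1 /\ step1 (1 * s + 1) = 0.
  by move=> s0; apply: step_ge1; rewrite mul1r lerDr.
have IV := wk_IV HW.
have : Int mu (fun p => V p * jbh y p) <= k * j0 y (a, 0).
  apply: (extension HW hC2 (intg_measurable IV) (wk_V0 HW) (fun p => lexx _) t2T (wk_k HW) (t1 := -1) _ Hy (b := b)).
  - move=> K' {z y Hz z0 zb zt Hy yE}z cK' K'O Hz z0 zK zt.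
    have [b' Hb'] := compact_sub_norm cK'.
    have zb (p : E) : b' < `|p.1| -> j0 z p = 0.
      by move=> h; apply: zK => /Hb'; rewrite leNgt h.
    rewrite -(wk_eq HW (b := b') Hz zb) => [|x s [_ Ox] _|x Ox].
    - apply: Int_le => [||p].
      + exact: (intg_m_jbh HW (intg_measurable IV) (wk_V0 HW) (fun p => lexx _) Hz zb).
      + apply: intgD; first exact: (intg_m_jbh HW (intg_measurable IV) (wk_V0 HW) (fun p => lexx _) Hz zb).
        apply: (intg_cyl (wk_IA HW) (wk_AQ HW) _ zb) => p; exact: (C21_c0 Hz).
      + by rewrite lerDl mulr_ge0// (wk_A0 HW).
    - by apply: zK => /= /K'O Ox'; apply: Ox; rewrite /interior; apply: open_nbhs_nbhs; split => //; exact: (wk_open HW).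
    - by apply: zt => /= /andP[_]; rewrite leNgt t2T.
  - by move=> p; rewrite yE mulr_ge0//; have [/andP[]] := step_bounds (1 * p.2 + 1).
  - by move=> p /zb h; rewrite yE h mul0r.
  - move=> p; rewrite yE; have [h|h] := ltP t2 p.2; first by rewrite zt ?mul0r.
    have [h1|h1] := leP (-1) p.2; first by case.
    have h2 : 1 * p.2 + 1 <= 0 by lra.
    by move=> _; have [-> _] := step_le0 h2; rewrite mulr0.
rewrite yE (st 0 _).1// mulr1; apply: le_trans; rewrite le_eqVlt; apply/orP; left; apply/eqP.
apply: eq_Int => p; have [Qp|Qp] := pselect (Q p); last by rewrite (wk_VQ HW) ?mul0r.
have p20 : 0 <= p.2 by case: Qp => _; rewrite /= in_itv /= => /andP[/ltW].
have [s1 s2] := st _ p20.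
congr (_ * _).
by rewrite jbh_mul_time s1 s2; ring.
Qed.

Variables (alpha q : R) (U : @jet R N).
Hypothesis q1 : 1 <= q.
Hypothesis AE : forall p, Q p -> A p = p.2 `^ alpha * V p `^ q.
Hypothesis HU : C21 Q U.
Hypothesis U0 : forall p, Q p -> 0 < j0 U p.
Hypothesis Ueq : forall p, Q p -> jfh U p = - (p.2 `^ alpha * j0 U p `^ q).
Notation W := (excess Omega T V U).

Lemma excess_ge0 p : 0 <= W p.
Proof.
rewrite /excess; have [Qp|Qp] := pselect (Q p); last by rewrite patchE0.
by rewrite patchE1// pos_ge0.
Qed.

Lemma excess_le p : W p <= V p.
Proof.
rewrite /excess; have [Qp|Qp] := pselect (Q p); last by rewrite patchE0// (wk_V0 HW).
by rewrite patchE1// /pos ge_max (wk_V0 HW) andbT gerBl ltW// U0.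
Qed.

Lemma continuous_excess p : Q p -> {for p, continuous W}.
Proof.
move=> Qp; apply: continuous_patch => //; first by apply: open_cylinder; exact: (wk_open HW).
apply: (@continuous_comp E R R (fun p => V p - j0 U p) (@pos R)).
  by apply: cvgB; [exact: (wk_cV HW)|exact: (C21_c0 HU)].
exact: continuous_pos.
Qed.

Lemma measurable_excess : measurable_fun setT (W : EM -> R).
Proof.
have oQ : open (Q : set E) by apply: open_cylinder; exact: (wk_open HW).
have mQ' : measurable (Q : set EM) by exact: open_measurable_E.
rewrite /excess; apply/(measurable_restrictT _ mQ').
apply: (@continuous_measurable_E R N Q _ oQ) => p Qp.
apply: (@continuous_comp E R R (fun p => V p - j0 U p) (@pos R)).
  by apply: cvgB; [exact: (wk_cV HW)|exact: (C21_c0 HU)].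
exact: continuous_pos.
Qed.

Lemma intg_excess : intg mu W.
Proof. exact: (intg_m HW measurable_excess excess_ge0 excess_le). Qed.

(** The interior inequality has no Dirac term, because the test starts at [t1 > 0]; hence
    [extension] is used with [c = 0]. This is where the excess becomes a subsolution up to the
    lateral boundary. *)
Lemma excess_ineq z b t1 t2 : 0 < t1 -> t2 < T -> C21 setT z ->
  (forall p, 0 <= j0 z p) -> (forall p, b < `|p.1| -> j0 z p = 0) ->
  (forall p, p.2 < t1 -> j0 z p = 0) -> (forall p, t2 < p.2 -> j0 z p = 0) ->
  Int mu (fun p => W p * jbh z p) <= 0.
Proof.
move=> t1_0 t2T Hz z0 zb zt1 zt2.
rewrite -(mul0r (j0 z (a, 0))).
apply: (extension HW hC2 measurable_excess excess_ge0 excess_le t2T (lexx 0) (t1 := t1) _ Hz z0 zb).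
  move=> K' {z Hz z0 zb zt1 zt2}z cK' K'O Hz z0 zK zt.
  rewrite mul0r; apply: (@excess_interior _ _ _ _ _ _ _ _ HW alpha q U q1 AE HU U0 Ueq (K' `*` `[t1, t2]) z) => //.
  - by apply: compact_setX => //; exact: segment_compact.
  - move=> p [/K'O Op]; rewrite /= in_itv /= => /andP[h1 h2]; split => //=.
    by rewrite in_itv /= (lt_le_trans t1_0)// (le_lt_trans h2).
  - move=> p Kp; have [K'p|/zK//] := pselect (K' p.1).
    by apply: zt => pt; apply: Kp; split => //=; rewrite in_itv.
move=> p H; have [h1|h1] := ltP p.2 t1; first exact: zt1.
by have [h2|h2] := ltP t2 p.2; [exact: zt2|case: H; rewrite h1 h2].
Qed.

End inequalities.

(** * Gaussian kernels *)

Section scalar_derivatives.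
Context {R : realType}.

Lemma is_derive_invR (f : R -> R) x df : f x != 0 -> is_derive x 1 f df ->
  is_derive x 1 (fun y => (f y)^-1) (- df / f x ^+ 2).
Proof.
move=> fx D; apply: is_derive_eqR (is_deriveV fx D) _.
by rewrite /GRing.scale /=; field.
Qed.

Lemma is_derive_lnR (f : R -> R) x df : 0 < f x -> is_derive x 1 f df ->
  is_derive x 1 (fun y => ln (f y)) (df / f x).
Proof.
move=> fx D; rewrite mulrC.
have := @is_derive_compR R R^o (@ln R) f x 1 (f x)^-1 df.
by apply => //; exact: is_derive1_ln.
Qed.

Lemma mulr_expRN_le1 (x : R) : 0 <= x -> x * expR (- x) <= 1.
Proof.
move=> x0; rewrite expRN -ler_pdivlMr ?invr_gt0 ?expR_gt0// mul1r invrK.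
by apply: le_trans (expR_ge1Dx x); rewrite lerDr.
Qed.

End scalar_derivatives.

Section gaussian.
Context {R : realType} {N : nat}.
Notation E := ('rV[R]_N * R)%type.
Notation EM := ('rV[R]_N * measurableTypeR R)%type.
Notation mu := (@spacetime_leb R N).
Implicit Types (x y : 'rV[R]_N) (c e t : R).

(** The kernel [(4 pi t)^(-N/2) exp(-|x|^2 / 4 t)] with its prefactor moved into the exponent, so
    that it is one exponential of a jet and powers of [t] are handled through logarithms. *)
Definition heat t x : R := expR (- (4 * t)^-1 * sqn x + - (N%:R / 2) * ln (4 * pi * t)).

Definition jgexp y e c : @jet R N :=
  jadd (jmul (jtime (fun s => - (4 * (e * s + c))^-1)
          (fun s => (4 * e) / (4 * (e * s + c)) ^+ 2)) (jsq y))
    (jtime (fun s => - (N%:R / 2) * ln (4 * pi * (e * s + c)))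
       (fun s => - (N%:R / 2) * (e / (e * s + c)))).

(* Heat kernel centred at [y] with the clock [e * s + c]: it solves the forward
   equation for [e = 1] and the backward one for [e = -1]. *)
Definition jgauss y e c : @jet R N := jcomp expR expR expR (jgexp y e c).

Lemma gaussE y e c p : j0 (jgauss y e c) p = heat (e * p.2 + c) (p.1 - y).
Proof. by []. Qed.

Lemma heat_gt0 t x : 0 < heat t x. Proof. exact: expR_gt0. Qed.

Lemma C21_gauss y e c : C21 [set p : E | 0 < e * p.2 + c] (jgauss y e c).
Proof.
apply: C21_comp.
  by move=> p _; split; try exact: continuous_expR; exact: is_derive_expR.
have cth (s : R) : {for s, continuous (fun s : R => e * s + c)}.
  by have [h _ _ _ _] := sc2_aff e c; exact: h.
have dth (s : R) : is_derive s 1 (fun s : R => e * s + c) e := is_derive_affR e c s.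
apply: C21_add.
  apply: C21_mul; last exact: C21_sq.
  apply: C21_time => p /= p0.
  have q0 : 4 * (e * p.2 + c) != 0 by rewrite mulf_neq0// gt_eqF.
  have c4 : {for p.2, continuous (fun s : R => 4 * (e * s + c))}.
    by apply: cvgM; [exact: cvg_cst|exact: cth].
  split.
  - by apply: cvgN; apply: cvgV.
  - apply: cvgM; first exact: cvg_cst.
    apply: cvgV; first by rewrite expf_neq0.
    by under eq_cvg do rewrite expr2; rewrite expr2; apply: cvgM.
  - have D4 : is_derive p.2 1 (fun s : R => 4 * (e * s + c)) (4 * e).
      apply: is_derive_eqR (is_derive_mulR (is_derive_cst (4 : R) _ _) (dth _)) _.
      by rewrite /cst; ring.
    have := @is_derive_mulR R (cst (-1)) _ _ _ _ (is_derive_cst (-1 : R) _ _) (is_derive_invR (f := fun s : R => 4 * (e * s + c)) q0 D4).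
    rewrite (_ : (fun s => _ * _) = (fun s => - (4 * (e * s + c))^-1)); last first.
      by apply/funext => s; rewrite /cst mulN1r.
    by move=> /is_derive_eqR; apply; rewrite /cst; ring.
apply: C21_time => p /= p0.
have q0 : 0 < 4 * pi * (e * p.2 + c) by rewrite !mulr_gt0 ?pi_gt0.
have c4 : {for p.2, continuous (fun s : R => 4 * pi * (e * s + c))}.
  by apply: cvgM; [exact: cvg_cst|exact: cth].
have D4 : is_derive p.2 1 (fun s : R => 4 * pi * (e * s + c)) (4 * pi * e).
  apply: is_derive_eqR (is_derive_mulR (is_derive_cst (4 * pi : R) _ _) (dth _)) _.
  by rewrite /cst; ring.
split.
- apply: cvgM; first exact: cvg_cst.
  by apply: (@continuous_comp R R R (fun s => 4 * pi * (e * s + c)) (@ln R) p.2 c4); exact: continuous_ln.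
- apply: cvgM; first exact: cvg_cst.
  by apply: cvgM; [exact: cvg_cst|apply: cvgV; [rewrite gt_eqF|exact: cth]].
- have := is_derive_mulR (is_derive_cst (- (N%:R / 2) : R) _ _) (is_derive_lnR (f := fun s : R => 4 * pi * (e * s + c)) q0 D4).
  move=> /is_derive_eqR; apply; rewrite /cst mul0r add0r; congr (_ * _).
  by rewrite -mulf_div divff ?mul1r// gt_eqF// mulr_gt0 ?pi_gt0.
Qed.

Lemma jx_gauss y e c i p :
  jx (jgauss y e c) i p = - heat (e * p.2 + c) (p.1 - y) *
    ((p.1 ord0 i - y ord0 i) / (2 * (e * p.2 + c))).
Proof.
rewrite -[LHS]/(heat (e * p.2 + c) (p.1 - y) * (0 * sqn (p.1 - y) +
  - (4 * (e * p.2 + c))^-1 * (2 * (p.1 ord0 i - y ord0 i)) + 0)).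
have -> : (4 * (e * p.2 + c))^-1 = (2 * (e * p.2 + c))^-1 / 2.
  by rewrite -invfM; congr (_^-1); ring.
by move: ((2 * (e * p.2 + c))^-1) => b; field.
Qed.

Lemma jxx_gauss y e c i j p :
  jxx (jgauss y e c) i j p = heat (e * p.2 + c) (p.1 - y) *
    ((p.1 ord0 i - y ord0 i) / (2 * (e * p.2 + c)) *
     ((p.1 ord0 j - y ord0 j) / (2 * (e * p.2 + c))) - (j == i)%:R / (2 * (e * p.2 + c))).
Proof.
set g := heat _ _; set a := (4 * (e * p.2 + c))^-1.
rewrite -[LHS]/(g * (0 * sqn (p.1 - y) + - a * (2 * (p.1 ord0 j - y ord0 j)) + 0)
  * (0 * sqn (p.1 - y) + - a * (2 * (p.1 ord0 i - y ord0 i)) + 0)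
  + g * ((0 * sqn (p.1 - y) + 0 * (2 * (p.1 ord0 j - y ord0 j))) + (0 * (2 * (p.1 ord0 i - y ord0 i))
     + - a * (2 * (j == i)%:R)) + 0)).
have -> : a = (2 * (e * p.2 + c))^-1 / 2.
  by rewrite /a -invfM; congr (_^-1); ring.
by move: ((2 * (e * p.2 + c))^-1) => b; field.
Qed.

Lemma jt_gauss y e c p : 0 < e * p.2 + c ->
  jt (jgauss y e c) p = e * jlap (jgauss y e c) p.
Proof.
move=> p0; rewrite jlap_comp.
set g := j0 _ _; rewrite -[LHS]/(expR g * jt (jgexp y e c) p) -mulrDr mulrCA; congr (_ * _).
have -> : jlap (jgexp y e c) p = - (4 * (e * p.2 + c))^-1 * (2 * N%:R).
  rewrite jlap_add jlap_time addr0 jlap_mul jlap_time jlap_sq mul0r add0r big1 ?mulr0 ?add0r//.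
  by move=> i _; rewrite -[jx _ _ _]/(0 : R) mul0r.
have -> : \sum_(i < N) jx (jgexp y e c) i p ^+ 2 = (4 * (e * p.2 + c))^-1 ^+ 2 * (4 * sqn (p.1 - y)).
  rewrite -(sum_jsq y p) mulr_sumr; apply: eq_bigr => i _.
  rewrite -[jx (jgexp _ _ _) _ _]/(0 * sqn (p.1 - y) + - (4 * (e * p.2 + c))^-1 * jx (jsq y) i p + 0).
  ring.
rewrite -[LHS]/(((4 * e) / (4 * (e * p.2 + c)) ^+ 2 * sqn (p.1 - y) + - (4 * (e * p.2 + c))^-1 * 0) +
    - (N%:R / 2) * (e / (e * p.2 + c))).
by field; rewrite gt_eqF.
Qed.

Lemma heat_le t0 t x : 0 < t0 <= t -> heat t x <= expR (- (N%:R / 2) * ln (4 * pi * t0)) * expR (- (sqn x / (4 * t))).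
Proof.
move=> /andP[t00 tt]; have t_0 := lt_le_trans t00 tt.
rewrite /heat -expRD ler_expR [leRHS]addrC mulNr (mulrC (4 * t)^-1) lerD2l.
rewrite !mulNr lerN2 ler_wpM2l ?divr_ge0 ?ler0n// ler_ln ?posrE ?mulr_gt0 ?pi_gt0//.
by rewrite ler_wpM2l// mulr_ge0 ?pi_ge0.
Qed.

(** Derivatives are the Gaussian times polynomials in [w i] and inverse powers of the clock. The
    elementary bound [x exp(-x) <= 1] absorbs the quadratic factors, and [|w| <= 1 + w^2] the linear
    ones. *)
Lemma gauss_bounded y e c t0 : 0 < t0 -> exists2 M, 0 <= M &
  forall p, t0 <= e * p.2 + c -> jnorm (jgauss y e c) p <= M.
Proof.
move=> t00; pose P := expR (- (N%:R / 2) * ln (4 * pi * t0)).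
have P0 : 0 <= P by exact: expR_ge0.
have i0 : 0 <= t0^-1 by rewrite invr_ge0 ltW.
exists (P + `|e| * (N%:R * (2 * P * t0^-1)) + N%:R * (P * (1 + t0^-1)) + N%:R * (N%:R * (2 * P * t0^-1))).
  by rewrite !addr_ge0// !mulr_ge0// addr_ge0.
move=> p pt; set th := e * p.2 + c in pt.
have th0 : 0 < th by exact: lt_le_trans pt.
have hle : heat th (p.1 - y) <= P * expR (- (sqn (p.1 - y) / (4 * th))).
  by apply: heat_le; rewrite t00.
set g := heat th (p.1 - y) in hle.
have g0 : 0 <= g by rewrite ltW// heat_gt0.
have A0 : 0 <= sqn (p.1 - y) / (4 * th) by rewrite divr_ge0 ?sqn_ge0// mulr_ge0 ?ltW.
have gP : g <= P.
  rewrite (le_trans hle)// -[leRHS]mulr1 ler_wpM2l// -[leRHS]expR0 ler_expR.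
  by rewrite oppr_le0.
have gA : g * (sqn (p.1 - y) / (4 * th)) <= P.
  apply: (le_trans (ler_wpM2r A0 hle)); rewrite -mulrA -[leRHS]mulr1 ler_wpM2l//.
  by rewrite mulrC mulr_expRN_le1.
pose w i := (p.1 ord0 i - y ord0 i) / (2 * th).
have wi i : g * w i ^+ 2 <= P * t0^-1.
  have -> : g * w i ^+ 2 = g * ((p.1 ord0 i - y ord0 i) ^+ 2 / (4 * th)) * th^-1.
    by rewrite /w; field; rewrite gt_eqF.
  apply: ler_pM => //; first by rewrite mulr_ge0// divr_ge0 ?sqr_ge0// mulr_ge0 ?ltW.
  - by rewrite invr_ge0 ltW.
  - apply: le_trans gA; rewrite ler_wpM2l// ler_wpM2r ?invr_ge0 ?mulr_ge0 ?(ltW th0)//.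
    rewrite /sqn (bigD1 i)//= !mxE lerDl; apply: sumr_ge0 => j _; exact: sqr_ge0.
  - by rewrite lef_pV2 ?posrE.
have wabs i : `|w i| <= 1 + w i ^+ 2.
  by have := sqr_ge0 (`|w i| - 1); rewrite -[w i ^+ 2](@real_normK _ (w i)) ?num_real//; nra.
have gx i : `|jx (jgauss y e c) i p| <= P * (1 + t0^-1).
  rewrite jx_gauss -/th -/g -/(w i) normrM normrN (ger0_norm g0).
  by rewrite (le_trans (ler_wpM2l g0 (wabs i)))// !mulrDr !mulr1 lerD.
have gxx i j : `|jxx (jgauss y e c) i j p| <= 2 * P * t0^-1.
  rewrite jxx_gauss -/th -/g -/(w i) -/(w j) normrM (ger0_norm g0).
  apply: (@le_trans _ _ (g * (w i ^+ 2 + w j ^+ 2) / 2 + g * th^-1 / 2)).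
    rewrite -mulrDl -mulrDr -mulrA ler_wpM2l// (le_trans (ler_normB _ _))// mulrDl lerD//.
      rewrite normrM -[w i ^+ 2](@real_normK _ (w i)) ?num_real// -[w j ^+ 2](@real_normK _ (w j)) ?num_real//.
      by rewrite ler_pdivlMr//; have := sqr_ge0 (`|w i| - `|w j|); nra.
    have h2 : (2 * th)^-1 = th^-1 / 2 by rewrite invfM mulrC.
    have h3 : 0 <= th^-1 / 2 by rewrite divr_ge0 ?invr_ge0 ?ltW.
    by case: (j == i); rewrite h2 ?mul1r ?mul0r ?normr0// ger0_norm.
  have gth : g * th^-1 <= P * t0^-1 by apply: ler_pM => //; rewrite ?invr_ge0 ?lef_pV2 ?posrE// ltW.
  have := wi i; have := wi j; rewrite mulrDr; have := mulr_ge0 P0 i0; lra.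
have glap : `|jlap (jgauss y e c) p| <= N%:R * (2 * P * t0^-1).
  rewrite (le_trans (ler_norm_sum _ _ _))// mulr_natl -[X in _ *+ X]card_ord -sumr_const.
  by apply: ler_sum => i _; exact: gxx.
rewrite /jnorm; apply: lerD; first apply: lerD; first apply: lerD.
- by rewrite gaussE ger0_norm.
- by rewrite jt_gauss// normrM ler_wpM2l.
- rewrite mulr_natl -[X in _ *+ X]card_ord -sumr_const.
  by apply: ler_sum => i _; exact: gx.
- rewrite mulr_natl -[X in _ *+ X]card_ord -sumr_const.
  apply: ler_sum => i _; rewrite mulr_natl -[X in _ *+ X]card_ord -sumr_const.
  by apply: ler_sum => j _; exact: gxx.
Qed.

End gaussian.

(** * Mass of the heat kernel, time windows and tails *)

Section product_integral.
Context {R : realType}.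

Lemma integral_leb_prod n (h : 'I_n -> R -> R) :
  (forall i, measurable_fun setT (h i : measurableTypeR R -> R)) ->
  (forall i r, 0 <= h i r) ->
  (forall i, (\int[lebesgue_measure]_(r in [set: measurableTypeR R]) (h i r)%:E = 1)%E) ->
  (\int[leb R n]_x (\prod_(i < n) h i (x ord0 i))%:E = 1)%E.
Proof.
elim: n h => [|n IH] h mh h0 h1.
  rewrite integral_dirac//; last first.
    by apply/measurable_EFinP; under eq_fun do rewrite big_ord0; exact: measurable_cst.
  by rewrite big_ord0 diracT mule1.
have mprod m (g : 'I_m -> R -> R) : (forall i, measurable_fun setT (g i : measurableTypeR R -> R)) ->
    measurable_fun setT (fun x : 'rV[R]_m => \prod_(i < m) g i (x ord0 i)).
  move=> mg; apply: measurable_prod => i _.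
  exact: (measurableT_comp (mg i) (@measurable_coord R m i)).
rewrite /= /leb_step ge0_integral_pushforward//=; last 3 first.
- exact: measurable_consrV.
- by apply/measurable_EFinP; exact: mprod.
- by move=> x _; rewrite lee_fin; apply: prodr_ge0.
rewrite preimage_setT.
rewrite (eq_integral (fun p : measurableTypeR R * 'rV[R]_n =>
    (h ord0 p.1 * \prod_(i < n) h (lift ord0 i) (p.2 ord0 i))%:E)); last first.
  move=> p _ /=; rewrite big_ord_recl consrV0; congr (_ * _)%:E.
  by apply: eq_bigr => i _; rewrite consrVS.
rewrite fubini_tonelli1/=; last 2 first.
- apply/measurable_EFinP; apply: measurable_funM.
    exact: (measurableT_comp (mh ord0) measurable_fst).
  exact: (measurableT_comp (mprod n (fun i => h (lift ord0 i)) _) measurable_snd).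
- by move=> p; rewrite lee_fin mulr_ge0// prodr_ge0.
rewrite /fubini_F -[RHS](h1 ord0); apply: eq_integral => r _ /=.
under eq_integral do rewrite EFinM.
rewrite ge0_integralZl//=.
- by rewrite (IH (fun i => h (lift ord0 i)))// mule1.
- by apply/measurable_EFinP; apply: (mprod n (fun i => h (lift ord0 i))) => i; exact: mh.
- by move=> x _; rewrite lee_fin prodr_ge0.
- by rewrite lee_fin.
Qed.

End product_integral.

Section heat_integrals.
Context {R : realType} {N : nat}.
Notation E := ('rV[R]_N * R)%type.
Notation EM := ('rV[R]_N * measurableTypeR R)%type.
Notation mu := (@spacetime_leb R N).
Implicit Types (x y : 'rV[R]_N).

(** The kernel factors into one-dimensional normal densities of variance [2 t], which yields its
    total mass. *)
Lemma heat_pdf (t : R) x y : 0 < t ->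
  heat t (x - y) = \prod_(i < N) normal_pdf (y ord0 i) (Num.sqrt (2 * t)) (x ord0 i).
Proof.
move=> t0.
have t2 : 0 < 2 * t by rewrite mulr_gt0.
have s0 : Num.sqrt (2 * t) != 0 by rewrite gt_eqF// sqrtr_gt0.
have c0 : 0 < 4 * pi * t by rewrite !mulr_gt0 ?pi_gt0.
rewrite /heat expRD mulrC.
transitivity (\prod_(i < N) (expR (- (ln (4 * pi * t) / 2)) *
   expR (- (4 * t)^-1 * (x ord0 i - y ord0 i) ^+ 2))).
  rewrite big_split /= -expR_sum -expR_sum; congr (expR _ * expR _).
    by rewrite sumr_const card_ord -mulr_natl; ring.
  by rewrite -mulr_sumr; congr (_ * _); apply: eq_bigr => i _; rewrite !mxE.
apply: eq_bigr => i _; rewrite normal_pdfE// /normal_peak /normal_fun sqr_sqrtr ?(ltW t2)//.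
congr (_ * _).
  rewrite expRN; congr (_^-1).
  have -> : 2 * t * pi *+ 2 = 4 * pi * t by rewrite -mulr_natr; ring.
  apply/eqP; rewrite -(eqrXn2 (n := 2)) ?expR_ge0 ?sqrtr_ge0// sqr_sqrtr ?(ltW c0)//.
  by rewrite -expRM_natl mulrC divfK ?lnK ?posrE.
congr expR; rewrite -mulr_natr; field; by rewrite gt_eqF.
Qed.

Lemma integral_heat (t : R) y : 0 < t -> (\int[leb R N]_x (heat t (x - y))%:E = 1)%E.
Proof.
move=> t0; rewrite -(@integral_leb_prod R N (fun i => normal_pdf (y ord0 i) (Num.sqrt (2 * t)))).
- by apply: eq_integral => x _; rewrite heat_pdf.
- by move=> i; exact: measurable_normal_pdf.
- by move=> i r; exact: normal_pdf_ge0.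
- by move=> i; exact: integral_normal_pdf.
Qed.

Lemma heatN (t : R) x : heat t (- x) = heat t x.
Proof. by rewrite /heat sqnN. Qed.

Lemma measurable_sqn y : measurable_fun setT (fun x : 'rV[R]_N => sqn (x - y)).
Proof.
apply: measurable_sum => i; apply: measurable_funX.
under eq_fun do rewrite !mxE.
by apply: measurable_funB => //; exact: measurable_coord.
Qed.

Lemma measurable_heat_time (om sig : R -> R) y :
  measurable_fun setT (om : measurableTypeR R -> R) ->
  measurable_fun setT (sig : measurableTypeR R -> R) ->
  (forall s, om s != 0 -> 0 < sig s) ->
  measurable_fun setT (fun p : EM => om p.2 * heat (sig p.2) (p.1 - y)).
Proof.
move=> mom msig H.
have ms : measurable_fun setT (fun p : EM => sig p.2) by exact: (measurableT_comp msig measurable_snd).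
(* The inverse of [4 * sig] is written as [exp (- ln (4 * sig))], a composition of measurable
   functions; this is legitimate where [sig > 0], and elsewhere [om] vanishes. *)
rewrite (_ : (fun p => _) = fun p : EM => om p.2 *
   expR (- expR (- ln (4 * sig p.2)) * sqn (p.1 - y) + - (N%:R / 2) * ln (4 * pi * sig p.2))).
  apply: measurable_funM; first exact: (measurableT_comp mom measurable_snd).
  apply: measurableT_comp; first exact: measurable_expR.
  have mln c : measurable_fun setT (fun p : EM => ln (c * sig p.2)).
    by apply: measurableT_comp; [exact: measurable_ln|apply: measurable_funM].
  apply: measurable_funD; last by apply: measurable_funM.
  apply: measurable_funM; last exact: (measurableT_comp (measurable_sqn y) measurable_fst).
  apply: measurableT_comp => //; apply: measurableT_comp; first exact: measurable_expR.
  exact: measurableT_comp.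
apply/funext => p; have [->|h] := eqVneq (om p.2) 0; first by rewrite !mul0r.
by rewrite expRN lnK// posrE mulr_gt0// H.
Qed.

Lemma heat_time_int (om sig : R -> R) y :
  measurable_fun setT (sig : measurableTypeR R -> R) ->
  (forall s, 0 <= om s) -> (forall s, om s != 0 -> 0 < sig s) ->
  intg (@lebesgue_measure R) om ->
  let f := fun p : E => om p.2 * heat (sig p.2) (p.1 - y) in
  intg mu f /\ Int mu f = Int lebesgue_measure om.
Proof.
move=> msig om0 H Iom f.
have mom := intg_measurable Iom.
have mf := measurable_heat_time y mom msig H.
have f0 p : 0 <= f p by rewrite mulr_ge0// ltW// heat_gt0.
have key : (\int[mu]_p (f p)%:E = \int[lebesgue_measure]_(s in [set: measurableTypeR R]) (om s)%:E)%E.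
  rewrite fubini_tonelli2//=; last by apply/measurable_EFinP.
  apply: eq_integral => s _; rewrite /fubini_G /=.
  have [h|h] := eqVneq (om s) 0.
    by rewrite integral0_eq ?h// => x _; rewrite /f /= h mul0r.
  under eq_integral do rewrite /f /= EFinM.
  rewrite ge0_integralZl//=; first by rewrite integral_heat ?mule1// H.
  - apply/measurable_EFinP; rewrite /heat.
    apply: measurableT_comp; first exact: measurable_expR.
    by apply: measurable_funD => //; apply: measurable_funM => //; exact: measurable_sqn.
  - by move=> x _; rewrite lee_fin ltW// heat_gt0.
  - by rewrite lee_fin.
split; last by rewrite /Int /Rintegral key.
apply/integrableP; split; first exact/measurable_EFinP.
have /integrableP[_] := Iom; rewrite /comp.
under eq_integral do rewrite gee0_abs ?lee_fin//.
by under [X in _ -> (X < _)%E]eq_integral do rewrite gee0_abs ?lee_fin//; rewrite key.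
Qed.

End heat_integrals.

Section windows.
Context {R : realType}.

Lemma Int_window (h h1 h2 : R -> R) (a b : R) : a < b -> sc2 h h1 h2 ->
  (forall s, 0 <= h1 s) -> (forall s, ~ (a <= s <= b) -> h1 s = 0) ->
  intg lebesgue_measure h1 /\ Int lebesgue_measure h1 = h b - h a.
Proof.
move=> ab [c0 c1 c2 d0 d1] h10 hz.
have key : (\int[lebesgue_measure]_s (h1 s)%:E = (h b - h a)%:E)%E.
  rewrite EFinB -(@continuous_FTC2 R h1 h a b ab).
  - rewrite [RHS]integral_mkcond; apply: eq_integral => s _; rewrite /= patchE.
    by case: ifPn => // /negP; rewrite inE /= in_itv /= => /hz ->.
  - exact: continuous_subspaceT.
  - split=> [s _||]; first by have [] := d0 s.
    + by apply: cvg_at_right_filter; exact: c0.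
    + by apply: cvg_at_left_filter; exact: c0.
  - by move=> s _; rewrite derive1E; have [_] := d0 s.
split; last by rewrite /Int /Rintegral key.
apply/integrableP; split.
  by apply/measurable_EFinP; exact: continuous_measurable_fun.
under eq_integral do rewrite /= ger0_norm//.
by rewrite key ltry.
Qed.

Definition rise (t d s : R) := step (d^-1 * s + - (t / d)).
Definition rise1 (t d s : R) := d^-1 * step1 (d^-1 * s + - (t / d)).
Definition rise2 (t d s : R) := d^-1 ^+ 2 * step2 (d^-1 * s + - (t / d)).

Lemma sc2_rise (t d : R) : sc2 (rise t d) (rise1 t d) (rise2 t d).
Proof. exact: sc2_preaff sc2_step. Qed.

Lemma riseE (t d s : R) : d^-1 * s + - (t / d) = (s - t) / d.
Proof. by ring. Qed.

Lemma riseP (t d : R) : 0 < d -> [/\ forall s, s <= t -> rise t d s = 0 /\ rise1 t d s = 0,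
  forall s, t + d <= s -> rise t d s = 1 /\ rise1 t d s = 0,
  forall s, 0 <= rise t d s <= 1,
  forall s, 0 <= rise1 t d s <= 9 / d &
  forall s, t < s < t + d -> 0 < rise1 t d s].
Proof.
move=> d0; have i0 : 0 <= d^-1 by rewrite invr_ge0 ltW.
split=> s.
- move=> st; rewrite /rise /rise1 riseE; have [|-> ->] := @step_le0 _ ((s - t) / d).
    by rewrite ler_pdivrMr// mul0r subr_le0.
  by rewrite mulr0.
- move=> st; rewrite /rise /rise1 riseE; have [|-> ->] := @step_ge1 _ ((s - t) / d).
    by rewrite ler_pdivlMr// mul1r lerBrDl.
  by rewrite mulr0.
- by have [] := step_bounds (d^-1 * s + - (t / d)).
- have [_ /andP[h1 h2]] := step_bounds (d^-1 * s + - (t / d)).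
  by rewrite /rise1 mulr_ge0//= mulrC ler_wpM2r.
- move=> /andP[h1 h2]; rewrite /rise1 riseE mulr_gt0 ?invr_gt0// /step1.
  have q0 : 0 < (s - t) / d by rewrite divr_gt0// subr_gt0.
  have q1 : (s - t) / d < 1 by rewrite ltr_pdivrMr// mul1r ltrBlDl.
  move: q0 q1; set q := (s - t) / d => q0 q1.
  have q3 : 0 < 1 - pospow 3 q by rewrite subr_gt0 (pospowP _ (ltW q0)) exprn_ilt1 ?ltW.
  rewrite (pospowP _ (ltW q3)) (pospowP 2 (ltW q0)).
  by rewrite mulr_gt0 ?exprn_gt0// mulr_gt0 ?exprn_gt0.
Qed.

Lemma Int_rise (t d : R) : 0 < d -> intg lebesgue_measure (rise1 t d) /\
  Int lebesgue_measure (rise1 t d) = 1.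
Proof.
move=> d0; have [P1 P2 P3 P4 P5] := riseP t d0.
have td : t < t + d by rewrite ltrDl.
have h10 s : 0 <= rise1 t d s by have /andP[] := P4 s.
have hz s : ~ (t <= s <= t + d) -> rise1 t d s = 0.
  move=> H; have [/P1[]//|h] := leP s t; apply: (P2 s _).2; rewrite leNgt; apply/negP => h2.
  by apply: H; rewrite !ltW.
have [I0 ->] := Int_window td (sc2_rise t d) h10 hz; split => //.
by rewrite (P2 _ (lexx _)).1 (P1 _ (lexx _)).1 subr0.
Qed.

Lemma step2_bound (s : R) : `|step2 s| <= 72 /\ (~ (0 <= s <= 1) -> step2 s = 0).
Proof.
have z : ~ (0 <= s <= 1) -> step2 s = 0.
  rewrite /step2 => H; have [s0|s0] := leP s 0.
    by rewrite !(pospowN _ s0) expr0n /= !mulr0 subr0.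
  have h : 1 - pospow 3 s <= 0.
    rewrite subr_le0 pospowP ?(ltW s0)// exprn_ege1// leNgt; apply/negP => s1.
    by apply: H; rewrite !ltW.
  by rewrite !(pospowN _ h) !mulr0 !mul0r subr0.
split => //; have [/andP[s0 s1]|/z ->] := pselect (0 <= s <= 1); last by rewrite normr0.
have p0 := pospow_ge0 3 s; have h1 : 1 - pospow 3 s <= 1 by lra.
rewrite /step2.
have a0 := pospow_ge0 2 (1 - pospow 3 s); have a1 := pospow_le1 2 h1.
have b0 := pospow_ge0 1 (1 - pospow 3 s); have b1 := pospow_le1 1 h1.
have c0 := pospow_ge0 1 s; have c1 := pospow_le1 1 s1.
have d0 := pospow_ge0 2 s; have d1 := pospow_le1 2 s1.
have e0 : 0 <= pospow 2 s ^+ 2 by exact: sqr_ge0.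
have e1 : pospow 2 s ^+ 2 <= 1 by rewrite exprn_ile1.
move: (pospow 2 (1 - pospow 3 s)) (pospow 1 (1 - pospow 3 s)) (pospow 1 s) (pospow 2 s ^+ 2) a0 a1 b0 b1 c0 c1 e0 e1.
move=> x y w z' x0 x1 y0 y1 w0 w1 z0 z1.
have := mulr_ge0 x0 w0; have := mulr_ge0 y0 z0.
have := ler_pM x0 w0 x1 w1; have := ler_pM y0 z0 y1 z1; rewrite !mulr1.
move=> k1 k2 k3 k4; rewrite -!mulrA; case: (ler0P (18 * (x * w) - 54 * (y * z'))) => _; lra.
Qed.

End windows.

Section plateau_bounds.
Context {R : realType} {N : nat}.
Notation E := ('rV[R]_N * R)%type.

(** Derivatives live where [|x - c|^2 <= 2 r^2] and scale like [1 / r], the second ones like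
    [1 / r^2 <= 1 / r]. Letting [r] grow removes the cutoff at infinity, which matters for unbounded
    domains. *)
Lemma wide_plateau (c : 'rV[R]_N) : exists2 M : R, 0 <= M & forall r (p : E), 1 <= r ->
  `|jlap (jplat c (r ^+ 2) (2 * r ^+ 2)) p| <= M / r /\
  forall i, `|jx (jplat c (r ^+ 2) (2 * r ^+ 2)) i p| <= M / r.
Proof.
pose A : R := 72 * 4 * 2; pose B : R := 9 * 4; pose C : R := 9 * 2 * N%:R.
have A0 : 0 <= A by rewrite /A !mulr_ge0.
have B0 : 0 <= B by rewrite /B !mulr_ge0.
have C0 : 0 <= C by rewrite /C !mulr_ge0.
exists (A + B + C); first by rewrite !addr_ge0.
move=> r p r1; have r0 : 0 < r by lra.
have r2 : 0 < r ^+ 2 by rewrite exprn_gt0.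
have rr : r <= r ^+ 2 by rewrite expr2 -[leLHS]mulr1 ler_wpM2l// ltW.
have d1 : 2 * r ^+ 2 - r ^+ 2 = r ^+ 2 by ring.
have q0 := sqn_ge0 (p.1 - c).
set a := - (2 * r ^+ 2 - r ^+ 2)^-1 * sqn (p.1 - c) + 2 * r ^+ 2 / (2 * r ^+ 2 - r ^+ 2).
have aE : a = 2 - sqn (p.1 - c) / r ^+ 2 by rewrite /a d1; field; rewrite gt_eqF.
have far : 2 * r ^+ 2 < sqn (p.1 - c) -> step1 a = 0 /\ step2 a = 0.
  move=> h; have a0 : a < 0 by rewrite aE subr_lt0 ltr_pdivlMr.
  split; first by have [] := step_le0 (ltW a0).
  by have [_] := step2_bound a; apply; rewrite leNgt a0.
have [_ /andP[s1 s1']] := step_bounds a; have [s2 _] := step2_bound a.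
have NN : 0 <= N%:R :> R by [].
have ir : (r ^+ 2)^-1 <= r^-1 by rewrite lef_pV2 ?posrE.
have ir0 : 0 <= (r ^+ 2)^-1 by rewrite invr_ge0 ltW.
split.
  rewrite jlap_comp sum_jsq jlap_sq -[j0 _ _]/(sqn (p.1 - c)) -/a d1.
  have [h|h] := ltP (2 * r ^+ 2) (sqn (p.1 - c)).
    have [-> ->] := far h; rewrite !mulr0 !mul0r addr0 normr0.
    by rewrite divr_ge0 ?(ltW r0)// !addr_ge0.
  apply: (@le_trans _ _ ((A + C) / r ^+ 2)); last first.
    by apply: ler_pM => //; [rewrite addr_ge0|rewrite lerD2r lerDl].
  rewrite (le_trans (ler_normD _ _))// [leRHS]mulrDl; apply: lerD.
    have -> : (- (r ^+ 2)^-1) ^+ 2 * step2 a * (4 * sqn (p.1 - c)) =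
      step2 a * (4 * (sqn (p.1 - c) / r ^+ 2)) * (r ^+ 2)^-1 by ring.
    have u0 : 0 <= 4 * (sqn (p.1 - c) / r ^+ 2) by rewrite mulr_ge0// divr_ge0 ?(ltW r2).
    rewrite normrM (ger0_norm ir0) ler_wpM2r// normrM (ger0_norm u0) /A -mulrA.
    by apply: ler_pM => //; rewrite ler_wpM2l// ler_pdivrMr.
  have -> : - (r ^+ 2)^-1 * step1 a * (2 * N%:R) = - (step1 a * (2 * N%:R) * (r ^+ 2)^-1) by ring.
  have u0 : 0 <= 2 * N%:R :> R by rewrite mulr_ge0.
  rewrite normrN ger0_norm; last by apply: mulr_ge0 => //; exact: mulr_ge0.
  by rewrite ler_wpM2r// /C -mulrA ler_wpM2r.
move=> i; rewrite -[jx _ _ _]/(- (2 * r ^+ 2 - r ^+ 2)^-1 * step1 a * (2 * (p.1 ord0 i - c ord0 i))) d1.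
have [h|h] := ltP (2 * r ^+ 2) (sqn (p.1 - c)).
  have [-> _] := far h; rewrite mulr0 mul0r normr0.
  by rewrite divr_ge0 ?(ltW r0)// !addr_ge0.
have xi : `|p.1 ord0 i - c ord0 i| <= 2 * r.
  rewrite -(@ler_pXn2r _ 2) ?nnegrE ?mulr_ge0 ?(ltW r0)//.
  rewrite real_normK ?num_real// (@le_trans _ _ (sqn (p.1 - c)))//.
    by rewrite /sqn (bigD1 i)//= !mxE lerDl; apply: sumr_ge0 => j _; exact: sqr_ge0.
  by rewrite (le_trans h)// exprMn ler_wpM2r ?(ltW r2)// -natrX ler_nat.
have -> : - (r ^+ 2)^-1 * step1 a * (2 * (p.1 ord0 i - c ord0 i)) =
  - ((r ^+ 2)^-1 * (step1 a * 2) * (p.1 ord0 i - c ord0 i)) by ring.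
have u0 : 0 <= (r ^+ 2)^-1 * (step1 a * 2) by apply: mulr_ge0 => //; exact: mulr_ge0.
rewrite normrN normrM (ger0_norm u0).
have -> : (A + B + C) / r = (r ^+ 2)^-1 * (9 * (2 * (2 * r))) + (A + C) / r.
  by rewrite /B; field; rewrite gt_eqF.
rewrite -[leLHS]addr0; apply: lerD; last by rewrite divr_ge0 ?(ltW r0)// addr_ge0.
rewrite -mulrA ler_wpM2l// mulrA; apply: ler_pM => //; first exact: mulr_ge0.
by rewrite ler_wpM2r.
Qed.

End plateau_bounds.

Section heat_tail.
Context {R : realType} {N : nat}.
Implicit Types (x : 'rV[R]_N).

(** The Gaussian factor splits into two equal halves [exp(-|x|^2 / 8 t)]: the first is at most
    [8 t / r^2], the second rebuilds the kernel at time [2 t] up to the factor [2^(N/2)]. The bound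
    is again a kernel, hence integrable in [x]. *)
Lemma heat_tail (t r : R) x : 0 < t -> 0 < r -> r ^+ 2 <= sqn x ->
  heat t x <= 8 * t / r ^+ 2 * expR (N%:R / 2 * ln 2) * heat (2 * t) x.
Proof.
move=> t0 r0 rx.
have E1 : heat t x = expR (- (sqn x / (8 * t))) * (expR (N%:R / 2 * ln 2) * heat (2 * t) x).
  rewrite /heat -!expRD; congr expR.
  have -> : 4 * pi * (2 * t) = 2 * (4 * pi * t) by ring.
  have p4 : 0 < 4 * pi * t by rewrite !mulr_gt0 ?pi_gt0.
  have -> : ln (2 * (4 * pi * t)) = ln 2 + ln (4 * pi * t) by rewrite lnM ?posrE.
  by move: (ln (4 * pi * t)) (ln 2) => l l2; field; rewrite gt_eqF.
rewrite E1 -[leRHS]mulrA ler_wpM2r ?mulr_ge0 ?expR_ge0//.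
have A0 : 0 < sqn x / (8 * t).
  by rewrite divr_gt0 ?mulr_gt0// (lt_le_trans _ rx)// exprn_gt0.
have := mulr_expRN_le1 (ltW A0); rewrite mulrC -ler_pdivlMr// mul1r => /le_trans; apply.
by rewrite invf_div ler_pM2l ?mulr_gt0// lef_pV2 ?posrE ?exprn_gt0// (lt_le_trans _ rx)// exprn_gt0.
Qed.

(** The exponent is at least twice [r^2 / (8 t)]: one half gives the factor [t], the other absorbs
    [t^(-N/2)]. The bound is uniform in [t]. *)
Lemma heat_far (r : R) : 0 < r -> exists2 M, 0 <= M &
  forall t x, 0 < t -> r ^+ 2 <= sqn x -> heat t x <= M * t.
Proof.
(* Chosen so that [N / 2 * (b / (4 pi t))] is at most [r^2 / (8 t)]; this quantity controls the
   logarithm of the prefactor through [ln x <= x]. *)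
move=> r0; pose b := pi * r ^+ 2 / N.+1%:R.
have r2 : 0 < r ^+ 2 by rewrite exprn_gt0.
have b0 : 0 < b by rewrite divr_gt0 ?mulr_gt0 ?pi_gt0.
exists (8 / r ^+ 2 * expR (- (N%:R / 2) * ln b)).
  by rewrite mulr_ge0 ?expR_ge0// divr_ge0 ?(ltW r2).
move=> t x t0 rx.
have A0 : 0 < r ^+ 2 / (8 * t) by rewrite divr_gt0 ?mulr_gt0.
have hA : expR (- (r ^+ 2 / (8 * t))) <= 8 / r ^+ 2 * t.
  have := mulr_expRN_le1 (ltW A0); rewrite mulrC -ler_pdivlMr// mul1r => /le_trans; apply.
  by rewrite invf_div mulrAC.
rewrite mulrAC (le_trans _ (ler_wpM2r (expR_ge0 _) hA))// /heat -expRD ler_expR.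
have p4 : 0 < 4 * pi * t by rewrite !mulr_gt0 ?pi_gt0.
have bt : 0 < b / (4 * pi * t) by rewrite divr_gt0.
have h1 : ln (b / (4 * pi * t)) <= b / (4 * pi * t).
  by have := expR_ge1Dx (ln (b / (4 * pi * t))); rewrite lnK ?posrE//; lra.
have h2 : ln (b / (4 * pi * t)) = ln b - ln (4 * pi * t) by rewrite ln_div ?posrE.
have h3 : N%:R / 2 * (b / (4 * pi * t)) <= r ^+ 2 / (8 * t).
  have -> : N%:R / 2 * (b / (4 * pi * t)) = N%:R / N.+1%:R * (r ^+ 2 / (8 * t)).
    have nn : N.+1%:R != 0 :> R by [].
    have pn : pi != 0 :> R by rewrite gt_eqF// pi_gt0.
    have tn : t != 0 by rewrite gt_eqF.
    rewrite /b; move: (N.+1%:R : R) (pi : R) (N%:R : R) nn pn => n1 p n nn pn.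
    by field; rewrite nn pn tn.
  by rewrite ler_piMl ?(ltW A0)// ler_pdivrMr// mul1r ler_nat.
have h4 : (4 * t)^-1 * sqn x >= r ^+ 2 / (8 * t) + r ^+ 2 / (8 * t).
  have -> : r ^+ 2 / (8 * t) + r ^+ 2 / (8 * t) = (4 * t)^-1 * r ^+ 2 by field; rewrite gt_eqF.
  by rewrite ler_wpM2l// invr_ge0 mulr_ge0// ltW.
have n0 : 0 <= N%:R / 2 :> R by rewrite divr_ge0.
have := ler_wpM2l n0 h1; rewrite h2 !mulNr mulrBr; lra.
Qed.

End heat_tail.

(** * Domination by the heat kernel *)

Section heat_bound.
Context {R : realType} {N : nat}.
Notation E := ('rV[R]_N * R)%type.
Notation EM := ('rV[R]_N * measurableTypeR R)%type.
Notation mu := (@spacetime_leb R N).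
Implicit Types (z J : @jet R N).

Lemma jbh_mul J (K : @jet R N) p : jbh (jmul J K) p =
  jbh J p * j0 K p + j0 J p * jbh K p - 2 * \sum_(i < N) jx J i p * jx K i p.
Proof.
rewrite /jbh jlap_mul -[jt (jmul _ _) _]/(jt J p * j0 K p + j0 J p * jt K p); ring.
Qed.

Lemma sum_le_bound (f : 'I_N -> R) (M : R) : (forall i, `|f i| <= M) -> `|\sum_(i < N) f i| <= N%:R * M.
Proof.
move=> H; rewrite (le_trans (ler_norm_sum _ _ _))// mulr_natl -[X in _ *+ X]card_ord -sumr_const.
by apply: ler_sum => i _; exact: H.
Qed.

Variables (Omega : set 'rV[R]_N) (T k : R) (a : 'rV[R]_N) (V A : E -> R).
Hypothesis HW : weak Omega T k a V A.
Hypothesis hC2 : C2_boundary Omega.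
Notation Q := (cylinder Omega T).

(** The test function is a Gaussian solving the backward equation, singular only at time [t0 + d],
    times a time cutoff falling on [[t0, t0 + h]] and a wide plateau. The backward operator then
    leaves [rise1] times the Gaussian, a weighted average of [V] near [(y, t0)], and errors of order
    [1 / r] from the plateau. *)
Lemma weak_heat_window (y : 'rV[R]_N) (t0 d h : R) : 0 < h -> h < d -> t0 + h < T ->
  exists2 C : R, 0 <= C & forall r, 1 <= r ->
  let f := fun p => V p * (rise1 t0 h p.2 * heat (t0 + d - p.2) (p.1 - y) *
     j0 (jplat a (r ^+ 2) (2 * r ^+ 2)) p) in
  intg mu f /\ Int mu f <= k * heat (t0 + d) (a - y) + C / r.
Proof.
move=> h0 hd hT.
have [r1 r2 r3 r4 r5] := riseP t0 h0.
have dh : 0 < d - h by rewrite subr_gt0.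
have [M M0 HM] := @wide_plateau R N a.
have [B B0 HB] := @gauss_bounded R N y (-1) (t0 + d) (d - h) dh.
have IV := wk_IV HW.
have IV0 : 0 <= Int mu V by apply: Int_ge0; exact: (wk_V0 HW).
pose C := M * B * (1 + 2 * N%:R).
have C0 : 0 <= C by rewrite !mulr_ge0// addr_ge0// mulr_ge0.
exists (C * Int mu V) => [|r rge1 f]; first exact: mulr_ge0.
have r0 : 0 < r by rewrite (lt_le_trans ltr01).
set chi := jplat a (r ^+ 2) (2 * r ^+ 2).
have s01 : r ^+ 2 < 2 * r ^+ 2 by rewrite ltr_pMl ?exprn_gt0// ltr1n.
have [P1 P2 P3 P4 P5] := plateauP a s01.
pose eta (s : R) := cst 1 s + -1 * rise t0 h s.
pose eta1 (s : R) := cst 0 s + -1 * rise1 t0 h s.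
have Hs : sc2 eta eta1 _ := sc2_add (sc2_cst (1 : R)) (sc2_scale (-1) (sc2_rise t0 h)).
pose tau : @jet R N := jtime eta eta1.
have Htau : C21 setT tau by exact: C21_sc2_time Hs.
pose J := jmul chi tau.
have HJ : C21 setT J by exact: C21_mul.
pose G := jgauss y (-1) (t0 + d).
have late (p : E) : t0 + h < p.2 -> eta p.2 = 0 /\ rise1 t0 h p.2 = 0.
  by move=> /ltW /r2[h1 h2]; rewrite /eta h1 h2 /cst mulN1r subrr.
have eta01 s : 0 <= eta s <= 1 by have := r3 s; rewrite /eta /cst; lra.
pose C1 : set E := [set p | t0 + h < p.2].
have oC1 : open C1.
  apply: (@open_comp E R snd [set s : R | t0 + h < s]); last exact: open_gt.
  by move=> p _; exact: cvg_snd.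
have JC : jets0 J C1.
  apply: C21_jets0 HJ _ => // p /late[h1 _].
  by rewrite -[LHS]/(j0 chi p * eta p.2) h1 mulr0.
pose z := jmul J G.
have Hz : C21 setT z.
  apply: (C21_mul_cut oC1 JC HJ (C21_gauss y (-1) (t0 + d))).
  apply/seteqP; split => // p _; have [h1|h1] := leP p.2 (t0 + h); last by right.
  left => /=; move: dh; lra.
have zE p : j0 z p = j0 chi p * eta p.2 * heat (-1 * p.2 + (t0 + d)) (p.1 - y) by [].
have z0 p : 0 <= j0 z p.
  rewrite zE mulr_ge0//; last by rewrite ltW// heat_gt0.
  by rewrite mulr_ge0//; [have /andP[] := P2 p|have /andP[] := eta01 p.2].
pose b := `|a| + 2 * r.
have zb p : b < `|p.1| -> j0 z p = 0.
  move=> hb; rewrite zE P4 ?mul0r//.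
  apply: le_trans (norm_sqr_le_sqn _).
  have h1 : 2 * r <= `|p.1 - a| by have := lerB_dist p.1 a; rewrite /b in hb; lra.
  have : (2 * r) ^+ 2 <= `|p.1 - a| ^+ 2 by rewrite lerXn2r ?nnegrE ?mulr_ge0 ?(ltW r0).
  by apply: le_trans; rewrite exprMn ler_wpM2r ?exprn_ge0 ?(ltW r0)// -natrX ler_nat.
have zt p : t0 + h < p.2 -> j0 z p = 0 by move=> /late[h1 _]; rewrite zE h1 mulr0 mul0r.
have main := weak_ineq HW hC2 hT Hz z0 zb zt.
have Iz := intg_m_jbh HW (intg_measurable IV) (wk_V0 HW) (fun p => lexx _) Hz zb.
have Gt0 s : -1 * s + (t0 + d) = t0 + d - s by ring.
have jb p : p.2 <= t0 + h -> jbh z p = - jlap chi p * eta p.2 * j0 G p +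
    rise1 t0 h p.2 * heat (t0 + d - p.2) (p.1 - y) * j0 chi p
    - 2 * \sum_(i < N) jx chi i p * eta p.2 * jx G i p.
  move=> pt; rewrite jbh_mul jbh_mul_time.
  have -> : jbh G p = 0.
    by rewrite /jbh jt_gauss ?Gt0; [ring|move: dh; lra].
  have -> : jbh chi p = - jlap chi p by rewrite /jbh P5 oppr0 sub0r.
  rewrite gaussE Gt0 mulr0 addr0 /eta1 /cst.
  congr (_ - 2 * _); first ring.
  apply: eq_bigr => i _; congr (_ * _).
  by rewrite -[LHS]/(jx chi i p * eta p.2 + j0 chi p * 0) mulr0 addr0.
have pw p : V p * (rise1 t0 h p.2 * heat (t0 + d - p.2) (p.1 - y) * j0 chi p) <=
    V p * jbh z p + C / r * V p.
  have V0 := wk_V0 HW p.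
  have CV : 0 <= C / r * V p by rewrite mulr_ge0// divr_ge0// ltW.
  have [h1|h1] := ltP (t0 + h) p.2.
    have [_ ->] := late _ h1; have jz : jets0 z C1 by exact: jets0_mull.
    by rewrite !mul0r mulr0 (jets0_jbh jz)// mulr0 add0r.
  rewrite jb// (mulrC (C / r)) -mulrDr ler_wpM2l//.
  have Gp : jnorm G p <= B by apply: HB; rewrite Gt0; lra.
  have [Gb _ Gxb _] := jnormP G p.
  have [Ml Mx] := HM r p rge1.
  have /andP[e0 e1] := eta01 p.2.
  have Mr0 : 0 <= M / r by rewrite divr_ge0// ltW.
  have t1 : jlap chi p * eta p.2 * j0 G p <= M * B / r.
    rewrite (le_trans (ler_norm _))// !normrM (ger0_norm e0) [leRHS]mulrAC.
    apply: ler_pM; rewrite ?mulr_ge0//; last exact: le_trans Gb Gp.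
    by rewrite -[leRHS]mulr1; apply: ler_pM.
  have t2 : \sum_(i < N) jx chi i p * eta p.2 * jx G i p <= N%:R * (M * B / r).
    rewrite (le_trans (ler_norm _))// sum_le_bound// => i.
    rewrite (normrM _ (jx G i p)) (normrM (jx chi i p)) (ger0_norm e0) [leRHS]mulrAC.
    apply: ler_pM; rewrite ?mulr_ge0//; last exact: le_trans (Gxb i) Gp.
    by rewrite -[leRHS]mulr1; apply: ler_pM.
  have -> : C / r = M * B / r + 2 * (N%:R * (M * B / r)) by rewrite /C; ring.
  move: t1 t2; lra.
have mL : intg mu (fun p => V p * (rise1 t0 h p.2 * heat (t0 + d - p.2) (p.1 - y) * j0 chi p)).
  have L0 p : 0 <= V p * (rise1 t0 h p.2 * heat (t0 + d - p.2) (p.1 - y) * j0 chi p).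
    rewrite mulr_ge0 ?(wk_V0 HW)// mulr_ge0//; last by have /andP[] := P2 p.
    by rewrite mulr_ge0//; [have /andP[] := r4 p.2|rewrite ltW// heat_gt0].
  apply: (@intg_le _ _ _ mu _ (fun p => V p * jbh z p + C / r * V p)).
  - apply: measurable_funM; first exact: (intg_measurable IV).
    apply: measurable_funM; last by apply: measurable_E_continuous => p; exact: (C21_c0 P1).
    apply: (@measurable_heat_time R N (rise1 t0 h) (fun s => t0 + d - s) y).
    + by apply: continuous_measurable_fun; have [_ c1 _ _ _] := sc2_rise t0 h.
    + by apply: measurable_funB.
    + move=> s rs; rewrite subr_gt0 ltNge; apply/negP => h1; move/eqP: rs; apply.
      by apply: (r2 s _).2; lra.
  - by move=> p; rewrite ger0_norm// L0.
  - by apply: intgD => //; exact: intgZ.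
split; first exact: mL.
apply: (@le_trans _ _ (Int mu (fun p => V p * jbh z p + C / r * V p))).
  by apply: Int_le => //; apply: intgD => //; exact: intgZ.
rewrite IntD//; last exact: intgZ.
rewrite IntZ// mulrAC lerD2r (le_trans main)// ler_wpM2l ?(wk_k HW)//.
rewrite zE Gt0 subr0 ler_piMl ?(ltW (heat_gt0 _ _))//.
by have /andP[] := P2 (a, 0); have /andP[] := eta01 0 => *; rewrite mulr_ile1.
Qed.

Lemma continuous_heat_time (x : 'rV[R]_N) (t0 : R) : 0 < t0 ->
  {for t0, continuous (fun t => heat t x)}.
Proof.
move=> t00.
have H := @C21_gauss R N 0 1 0.
have c0 : {for (x, t0), continuous (j0 (jgauss (0 : 'rV[R]_N) 1 0))}.
  by apply: (C21_c0 H) => /=; rewrite mul1r addr0.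
have ct : {for t0, continuous (fun t : R => (x, t) : E)}.
  apply/cvg_ballP => e e0; have : \forall t \near t0, ball t0 e t by exact: nbhsx_ballx.
  by apply: filterS => t tt; split => //=; exact: ballxx.
have := @continuous_comp R E R (fun t : R => (x, t) : E) (j0 (jgauss (0 : 'rV[R]_N) 1 0)) t0 ct c0.
rewrite (_ : _ \o _ = fun t => heat t x)//.
by apply/funext => t; rewrite /comp gaussE /= mul1r addr0 subr0.
Qed.

(** If it failed at [(y, t0)], [V] would exceed a larger value on a neighbourhood. For small [d] the
    backward Gaussian concentrates there, so the average in [weak_heat_window] would exceed its
    upper bound. *)
Lemma weak_le_heat p : Q p -> V p <= k * heat p.2 (p.1 - a).
Proof.
move=> Qp; case: p Qp => y t0 Qp /=; rewrite leNgt -opprB heatN; apply/negP => HV.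
have [/= Oy] := Qp; rewrite /= in_itv /= => /andP[t00 t0T].
have oQ : open (Q : set E) by apply: open_cylinder; exact: (wk_open HW).
set V0 := V (y, t0) in HV; set h0 := k * heat t0 (a - y) in HV.
have h00 : 0 <= h0 by rewrite mulr_ge0 ?(wk_k HW)// ltW// heat_gt0.
(* The margin [v - v1] is a quarter of the gap [V0 - h0]; an eighth is spent on the Gaussian tail
   and a sixteenth on the plateau. *)
pose v := h0 + (V0 - h0) * (3 / 4); pose v1 := h0 + (V0 - h0) / 2.
have v0 : 0 < v by rewrite /v; lra.
have [e e0 He] : exists2 e : R, 0 < e & forall p : E, ball (y, t0) e p -> Q p /\ v < V p.
  have /nbhs_ballP[e /= e0 He] : \forall p \near ((y, t0) : E), Q p /\ v < V p.
    near=> p; split; near: p; first exact: open_nbhs_nbhs.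
    by apply: (cvgr_gt V0); [exact: (wk_cV HW)|rewrite /v; lra].
  by exists e.
pose rho := e / 2; have rho0 : 0 < rho by rewrite divr_gt0.
have ee : rho < e by rewrite /rho; lra.
have [d1 d10 Hd1] : exists2 d1 : R, 0 < d1 & forall d, 0 < d < d1 -> k * heat (t0 + d) (a - y) < v1.
  have cc : {for t0, continuous (fun t => k * heat t (a - y))}.
    by apply: cvgM; [exact: cvg_cst|exact: continuous_heat_time].
  have /nbhs_ballP[d1 /= d10 H] : \forall t \near t0, k * heat t (a - y) < v1.
    by move/cvgr_lt : cc; apply; rewrite -/h0 /v1; lra.
  exists d1 => // d /andP[dp dd]; apply: H; rewrite /ball /= opprD addrA subrr sub0r normrN gtr0_norm//.
pose c := expR (N%:R / 2 * ln 2) : R; have c0 : 0 < c by exact: expR_gt0.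
have q0 : 0 < 8 * c / rho ^+ 2 by rewrite divr_gt0 ?exprn_gt0 ?mulr_gt0.
have [d /andP[dp dd] dk] : exists2 d : R, 0 < d < d1 & v * (8 * c / rho ^+ 2 * d) <= (V0 - h0) / 8.
  have q1 : 0 < v * (8 * c / rho ^+ 2) by rewrite mulr_gt0.
  exists (Num.min (d1 / 2) ((V0 - h0) / 8 / (v * (8 * c / rho ^+ 2)))).
    rewrite lt_min divr_gt0//= gt_min; apply/andP; split; last by apply/orP; left; lra.
    by rewrite !divr_gt0//; lra.
  by rewrite mulrA mulrC -ler_pdivlMr// ge_min lexx orbT.
pose h := Num.min (d / 2) (Num.min (e / 2) ((T - t0) / 2)).
have h_gt0 : 0 < h by rewrite !lt_min !divr_gt0//; lra.
have hd : h < d by rewrite gt_min; apply/orP; left; lra.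
have he : h < e by rewrite !gt_min; apply/orP; right; apply/orP; left; lra.
have hT : t0 + h < T by rewrite -ltrBrDl !gt_min; apply/orP; right; apply/orP; right; lra.
have [C C0 HC] := weak_heat_window y h_gt0 hd hT.
have [r1 r2 r3 r4 r5] := riseP t0 h_gt0.
(* Large enough for the plateau to be 1 on the ball around [y] and for [C / r] to be at most a
   sixteenth of the gap; [N + 1] pays for the passage from the sup norm to the Euclidean one. *)
pose r := (N%:R + 1) * (`|y - a| + e) + 1 + C / ((V0 - h0) / 16).
have gap : 0 < (V0 - h0) / 16 by rewrite divr_gt0 ?subr_gt0.
have rA : (N%:R + 1) * (`|y - a| + e) + 1 <= r by rewrite /r lerDl divr_ge0 ?(ltW gap).
have ya : 0 <= `|y - a| + e by rewrite addr_ge0 ?(ltW e0).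
have rge1 : 1 <= r by rewrite (le_trans _ rA)// lerDr mulr_ge0// addr_ge0.
have Cr : C / r <= (V0 - h0) / 16.
  rewrite ler_pdivrMr ?(lt_le_trans ltr01)// mulrC -ler_pdivrMr// /r lerDr addr_ge0//.
  by rewrite mulr_ge0// addr_ge0.
have Hd := Hd1 d _; rewrite dp dd in Hd; have {}Hd := Hd erefl.
have := HC r rge1; set chi := jplat a (r ^+ 2) (2 * r ^+ 2) => -[IL main].
have s01 : r ^+ 2 < 2 * r ^+ 2 by rewrite ltr_pMl ?exprn_gt0// ?ltr1n// (lt_le_trans ltr01).
have [P1 P2 P3 P4 P5] := plateauP a s01.
have [Iom Eom] := Int_rise t0 h_gt0.
have sg s : rise1 t0 h s != 0 -> 0 < t0 + d - s.
  move=> rs; rewrite subr_gt0 ltNge; apply/negP => h1; move/eqP: rs; apply.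
  by apply: (r2 s _).2; lra.
have om0 s : 0 <= rise1 t0 h s by have /andP[] := r4 s.
have m1 : measurable_fun setT ((fun s => t0 + d - s) : measurableTypeR R -> R) by exact: measurable_funB.
have m2 : measurable_fun setT ((fun s => 2 * (t0 + d - s)) : measurableTypeR R -> R).
  exact: measurable_funM.
have sg2 s : rise1 t0 h s != 0 -> 0 < 2 * (t0 + d - s) by move=> /sg ?; rewrite mulr_gt0.
have [I1 E1] := heat_time_int y m1 om0 sg Iom.
have [I2 E2] := heat_time_int y m2 om0 sg2 Iom.
rewrite Eom in E1; rewrite Eom in E2.
pose kap := 8 * c / rho ^+ 2 * d.
have kap0 : 0 <= kap by rewrite mulr_ge0 ?ltW.
have F0 p : 0 <= rise1 t0 h p.2 * heat (t0 + d - p.2) (p.1 - y).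
  by rewrite mulr_ge0// ltW// heat_gt0.
have F2 p : 0 <= kap * (rise1 t0 h p.2 * heat (2 * (t0 + d - p.2)) (p.1 - y)).
  by rewrite mulr_ge0// mulr_ge0// ltW// heat_gt0.
have pw p : v * (rise1 t0 h p.2 * heat (t0 + d - p.2) (p.1 - y)
     - kap * (rise1 t0 h p.2 * heat (2 * (t0 + d - p.2)) (p.1 - y))) <=
    V p * (rise1 t0 h p.2 * heat (t0 + d - p.2) (p.1 - y) * j0 chi p).
  have R0 : 0 <= V p * (rise1 t0 h p.2 * heat (t0 + d - p.2) (p.1 - y) * j0 chi p).
    by rewrite mulr_ge0 ?(wk_V0 HW)// mulr_ge0//; have /andP[] := P2 p.
  have [z0|nz] := eqVneq (rise1 t0 h p.2) 0; first by rewrite z0 !(mul0r, mulr0) subr0 mulr0.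
  have sg0 := sg _ nz.
  have pt : t0 < p.2 < t0 + h.
    apply/andP; split; rewrite ltNge; apply/negP => H; move/eqP: nz; apply.
      exact: (r1 _ H).2.
    exact: (r2 _ H).2.
  (* Far from [y] nothing is known about [V] but its sign: there [heat_tail] makes the left-hand
     side nonpositive. Close to [y] the plateau is 1 and [V > v]. *)
  have [far|near] := leP (rho ^+ 2) (sqn (p.1 - y)).
    apply: le_trans R0; rewrite mulr_ge0_le0 ?(ltW v0)// subr_le0 mulrCA ler_wpM2l//.
    apply: (le_trans (heat_tail sg0 rho0 far)); rewrite ler_wpM2r ?(ltW (heat_gt0 _ _))//.
    rewrite /kap -/c.
    have -> : 8 * (t0 + d - p.2) / rho ^+ 2 * c = 8 * c / rho ^+ 2 * (t0 + d - p.2) by ring.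
    by rewrite ler_wpM2l ?(ltW q0)//; clear -pt; lra.
  have nr : `|p.1 - y| < rho.
    rewrite -(@ltr_pXn2r _ 2) ?nnegrE ?(ltW rho0)//.
    exact: le_lt_trans (norm_sqr_le_sqn _) near.
  have bp : ball ((y, t0) : E) e p.
    split; rewrite /= -ball_normE /= distrC; first exact: lt_trans nr ee.
    by rewrite ltr_norml; clear -pt he; lra.
  have [_ vV] := He p bp.
  have -> : j0 chi p = 1.
    apply: P3; rewrite (le_trans (sqn_le_norm _))//.
    have n1 : `|p.1 - a| <= `|y - a| + e.
      have -> : p.1 - a = (p.1 - y) + (y - a) by rewrite addrA subrK.
      rewrite (le_trans (ler_normD _ _))// addrC lerD2l ltW//; exact: lt_trans nr ee.
    apply: (@le_trans _ _ (((N%:R + 1) * (`|y - a| + e)) ^+ 2)).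
      rewrite exprMn; apply: ler_pM => //.
        rewrite expr2 -[leLHS]mul1r; apply: ler_pM => //; rewrite ?lerDl ?lerDr//.
      by rewrite lerXn2r ?nnegrE.
    have h1 : (N%:R + 1) * (`|y - a| + e) <= r by apply: le_trans rA; rewrite lerDl.
    have h2 : 0 <= (N%:R + 1) * (`|y - a| + e) by rewrite mulr_ge0// addr_ge0.
    by rewrite lerXn2r ?nnegrE// (le_trans h2).
  rewrite mulr1; apply: (@le_trans _ _ (v * (rise1 t0 h p.2 * heat (t0 + d - p.2) (p.1 - y)))).
    by rewrite ler_wpM2l ?(ltW v0)// gerBl.
  by rewrite ler_wpM2r// ltW.
have IR : intg mu (fun p => v * (rise1 t0 h p.2 * heat (t0 + d - p.2) (p.1 - y)
     - kap * (rise1 t0 h p.2 * heat (2 * (t0 + d - p.2)) (p.1 - y)))).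
  by apply: intgZ; apply: intgB => //; exact: intgZ.
have := Int_le IR IL pw; rewrite IntZ; last by apply: intgB => //; exact: intgZ.
rewrite IntB//; last exact: intgZ.
rewrite IntZ// E1 E2 mulr1 mulrBr mulr1 => H.
have := le_trans H main; rewrite /kap.
by move: dk Hd Cr gap; rewrite /v /v1; clear; lra.
Unshelve. all: by end_near. Qed.

End heat_bound.

(** * The interior estimate *)

Section interior_maximum.
Context {R : realType} {N : nat}.
Notation E := ('rV[R]_N * R)%type.
Implicit Types (J X : @jet R N).

Lemma line_near (P : set E) (p v : E) : nbhs p P ->
  exists2 d : R, 0 < d & forall s, `|s| <= d -> P (s *: v + p).
Proof.
move=> /nbhs_ballP[e /= e0 He].
pose b := `|v.1| + `|v.2| + 1.
have b0 : 0 < b by rewrite ltr_wpDl// addr_ge0.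
exists (e / 2 / b); first by rewrite !divr_gt0.
move=> s sd; apply: He.
have h (w : R) : 0 <= w -> w <= b -> `|s| * w < e.
  move=> w0 wb; apply: (@le_lt_trans _ _ (e / 2)); last by lra.
  by rewrite (le_trans (ler_wpM2l (normr_ge0 _) wb))// -ler_pdivlMr.
split; rewrite /= -ball_normE /= distrC addrK.
  by rewrite normrZ h// /b -addrA lerDl addr_ge0.
by rewrite normrM h// /b addrAC lerDr addr_ge0.
Qed.

(** Maximality is assumed only along the line through [p]. This suits the estimate below, whose
    spatial tests must not change the time. *)
Lemma derive_line_max (f df : E -> R) p v :
  (\forall q \near p, is_derive q v f (df q)) -> {for p, continuous df} ->
  (\forall q \near p, (exists s : R, q = s *: v + p) -> f q <= f p) -> df p = 0.
Proof.
move=> Hf cdf Hmax.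
have key (s0 : R) : s0 = 1 \/ s0 = -1 -> ~ 0 < s0 * df p.
  move=> hs pos0.
  have Hpos : \forall q \near p, 0 < s0 * df q.
    have c1 : {for p, continuous (fun q => s0 * df q)}.
      by apply: cvgM; [exact: cvg_cst|exact: cdf].
    by move/cvgr_gt : c1; apply.
  have [d d0 Hd] := line_near v (filterI Hf (filterI Hpos Hmax)).
  case: hs => hs; subst s0.
    have [||s /andP[s1 s2]] := @MVT_line R _ f df p v 0 d; first exact: ltW.
      move=> s /andP[s1 s2]; have [|h _] // := Hd s _; by rewrite ger0_norm.
    rewrite scale0r add0r subr0 => H.
    have [|_ [h1 _]] := Hd s _; first by rewrite ger0_norm.
    have [|_ [_ h2]] := Hd d _; first by rewrite gtr0_norm.
    have : 0 < df (s *: v + p) * d by rewrite mulr_gt0// -[X in _ < X]mul1r.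
    by rewrite -H subr_gt0 ltNge h2//; exists d.
  have [||s /andP[s1 s2]] := @MVT_line R _ f df p v (- d) 0; first by rewrite oppr_le0 ltW.
    move=> s /andP[s1 s2]; have [|h _] // := Hd s _; by rewrite ler0_norm// lerNl.
  rewrite scale0r add0r sub0r opprK => H.
  have [|_ [h1 _]] := Hd s _; first by rewrite ler0_norm// lerNl.
  have [|_ [_ h2]] := Hd (- d) _; first by rewrite normrN gtr0_norm.
  have : df (s *: v + p) * d < 0.
    by rewrite nmulr_rlt0// -oppr_gt0 -mulN1r.
  by rewrite -H subr_lt0 ltNge h2//; exists (- d).
apply/eqP; rewrite eq_le; apply/andP; split; rewrite leNgt; apply/negP => h.
  by apply: (key 1); [left|rewrite mul1r].
by apply: (key (-1)); [right|rewrite mulN1r oppr_gt0].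
Qed.

Lemma derive2_line_max (f df ddf : E -> R) p v :
  (\forall q \near p, is_derive q v f (df q)) ->
  (\forall q \near p, is_derive q v df (ddf q)) ->
  {for p, continuous df} -> {for p, continuous ddf} ->
  (\forall q \near p, (exists s : R, q = s *: v + p) -> f q <= f p) -> ddf p <= 0.
Proof.
move=> Hf Hdf cdf cddf Hmax; rewrite leNgt; apply/negP => pos0.
have z := derive_line_max Hf cdf Hmax.
have Hpos : \forall q \near p, 0 < ddf q by move/cvgr_gt : cddf; apply.
have [d d0 Hd] := line_near v (filterI (filterI Hf Hdf) (filterI Hpos Hmax)).
have dpos s : 0 < s <= d -> 0 < df (s *: v + p).
  move=> /andP[s0 sd].
  have [||s' /andP[s1 s2]] := @MVT_line R _ df ddf p v 0 s; first exact: ltW.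
    move=> s' /andP[s1 s2]; have [|[_ h] _] // := Hd s' _.
    by rewrite ger0_norm// (le_trans s2).
  rewrite scale0r add0r subr0 z subr0 => ->.
  have [|_ [h1 _]] := Hd s' _; first by rewrite ger0_norm// (le_trans s2).
  by rewrite mulr_gt0.
have d2 : 0 < d / 2 by rewrite divr_gt0.
have d2d : d / 2 < d by lra.
have mvt a b : 0 <= a -> a < b -> b <= d -> exists2 s, a <= s <= b &
    f (b *: v + p) - f (a *: v + p) = df (s *: v + p) * (b - a).
  move=> a0 ab bd; apply: MVT_line; first exact: ltW.
  move=> s /andP[s1 s2]; have [|[h _] _] // := Hd s _.
  by rewrite ger0_norm ?(le_trans s2)// (le_trans a0).
have [s1 /andP[a1 a2] e1] := mvt (d / 2) d (ltW d2) d2d (lexx d).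
have [s2 /andP[b1 b2] e2] := mvt 0 (d / 2) (lexx 0) d2 (ltW d2d).
have p1 : 0 < df (s1 *: v + p) by apply: dpos; rewrite (lt_le_trans d2 a1).
have p2 : 0 <= df (s2 *: v + p).
  have [->|s0] := eqVneq s2 0; first by rewrite scale0r add0r z.
  by rewrite ltW// dpos// lt_neqAle eq_sym s0 b1/= (le_trans b2 (ltW d2d)).
have [|_ [_ h2]] := Hd d _; first by rewrite gtr0_norm.
have q1 : 0 < df (s1 *: v + p) * (d - d / 2) by rewrite mulr_gt0// subr_gt0.
have q2 : 0 <= df (s2 *: v + p) * (d / 2 - 0) by rewrite mulr_ge0// subr0 ltW.
rewrite scale0r add0r in e2; have := h2 (ex_intro _ d erefl); rewrite leNgt => /negP; apply.
lra.
Qed.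

(** The maximum may be attained at the final time, so only earlier times are compared and just a
    sign survives. *)
Lemma derive_left_max (f df : E -> R) p v :
  (\forall q \near p, is_derive q v f (df q)) -> {for p, continuous df} ->
  (exists2 d : R, 0 < d & forall s, - d <= s <= 0 -> f (s *: v + p) <= f p) -> 0 <= df p.
Proof.
move=> Hf cdf [e e0 He]; rewrite leNgt; apply/negP => neg.
have Hneg : \forall q \near p, df q < 0 by move/cvgr_lt : cdf; apply.
have [d' d'0 Hd] := line_near v (filterI Hf Hneg).
pose d := Num.min d' e.
have d0 : 0 < d by rewrite lt_min d'0.
have ds s : - d <= s <= 0 -> `|s| <= d'.
  move=> /andP[s1 s2]; rewrite ler0_norm// lerNl (le_trans _ s1)// lerN2.
  by rewrite ge_min lexx.
have [||s hs] := @MVT_line R _ f df p v (- d) 0; first by rewrite oppr_le0 ltW.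
  by move=> s hs; have [|h _] // := Hd s _; exact: ds.
rewrite scale0r add0r sub0r opprK => H.
have [|_ h1] := Hd s _; first exact: ds.
have := He (- d); rewrite oppr_le0 (ltW d0) lerN2 ge_min lexx orbT => /(_ erefl).
by rewrite -subr_ge0 H pmulr_lge0// leNgt h1.
Qed.

End interior_maximum.

(** * A universal bound for the absorption equation *)

Section interior_estimate.
Context {R : realType} {N : nat}.
Notation E := ('rV[R]_N * R)%type.
Variables (Omega : set 'rV[R]_N) (T alpha q : R) (U : @jet R N).
Notation Q := (cylinder Omega T).
Hypothesis oO : open Omega.
Hypothesis q1 : 1 < q.
Hypothesis HU : C21 Q U.
Hypothesis U0 : forall p, Q p -> 0 < j0 U p.
Hypothesis Ueq : forall p, Q p -> jfh U p = - (p.2 `^ alpha * j0 U p `^ q).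

Definition jln (J : @jet R N) : jet := jcomp (@ln R) GRing.inv (fun s => - (s ^+ 2)^-1) J.

Lemma C21_ln D (J : @jet R N) : C21 D J -> (forall p, D p -> 0 < j0 J p) -> C21 D (jln J).
Proof.
move=> HJ J0; apply: C21_comp => // p /J0 Jp.
have n0 : j0 J p != 0 by rewrite gt_eqF.
split.
- exact: continuous_ln.
- by apply: cvgV.
- apply: cvgN; apply: cvgV; first by rewrite expf_neq0.
  by under eq_cvg do rewrite expr2; rewrite expr2; apply: cvgM; exact: cvg_id.
- exact: is_derive1_ln.
- apply: is_derive_eqR (is_derive_invR (f := id) n0 (is_derive_id _ _)) _.
  by rewrite mulN1r.
Qed.

Lemma jlap_ln (J : @jet R N) p : jlap (jln J) p =
  - (j0 J p ^+ 2)^-1 * (\sum_(i < N) jx J i p ^+ 2) + (j0 J p)^-1 * jlap J p.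
Proof. exact: jlap_comp. Qed.

(** On a dyadic window a power varies by a bounded factor: [c = 1] if it increases, [c = 2^alpha] if
    it decreases. *)
Lemma powR_window : exists2 c : R, 0 < c &
  forall t s, 0 < t -> t <= s <= 2 * t -> c * t `^ alpha <= s `^ alpha.
Proof.
have [a0|a0] := leP 0 alpha.
  exists 1 => // t s t0 /andP[ts _]; rewrite mul1r; apply: ge0_ler_powR => //.
    by rewrite nnegrE ltW.
  by rewrite nnegrE ltW// (lt_le_trans t0).
exists (2 `^ alpha); first exact: powR_gt0.
move=> t s t0 /andP[ts st]; rewrite -powRM ?(ltW t0)//.
have s0 : 0 < s by exact: lt_le_trans ts.
have t2 : 0 < 2 * t by rewrite mulr_gt0.
rewrite -[alpha]opprK !(powRN _ (- alpha)) lef_pV2 ?posrE ?powR_gt0//.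
by apply: ge0_ler_powR => //; rewrite ?nnegrE ?oppr_ge0 (ltW s0, ltW t2, ltW a0).
Qed.

(** At a maximum of [P = (s - t) (r^2 - |x - x0|^2)^2 u^(q-1)] over the cylinder, [ln P] has zero
    gradient, nonpositive Laplacian and nonnegative time derivative. Through the equation this
    bounds [s^alpha u^(q-1)], hence [P], at that point by the cutoff alone, and [P] at the centre is
    no larger. The value of [u] at the bottom is irrelevant, since [P] vanishes there. *)
Lemma local_bound (c r t : R) (x0 : 'rV[R]_N) : 0 < c ->
  (forall t s, 0 < t -> t <= s <= 2 * t -> c * t `^ alpha <= s `^ alpha) ->
  0 < r <= 1 -> 0 < t <= 1 -> 2 * t < T ->
  (forall x, sqn (x - x0) <= r ^+ 2 -> Omega x) ->
  (q - 1) * c * (t `^ alpha * (t * r ^+ 4 * j0 U (x0, 2 * t) `^ (q - 1))) <=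
   16 / (q - 1) + 9 + 4 * N%:R.
Proof.
move=> c0 Hc /andP[r0 r1] /andP[t0 t1] tT HO.
pose K : set E := [set p | sqn (p.1 - x0) <= r ^+ 2 /\ t <= p.2 <= 2 * t].
have KQ : K `<=` Q.
  move=> p [/HO Op /andP[h1 h2]]; split => //=; rewrite in_itv /=.
  by rewrite (lt_le_trans t0)// (le_lt_trans h2).
have csq : continuous (fun p : E => sqn (p.1 - x0)) by exact: continuous_sqn.
have ctime : continuous (fun p : E => p.2) by move=> p; exact: cvg_snd.
have cK : compact K.
  apply: (@subclosed_compact _ _ (slab (`|x0| + r) t (2 * t))); last first.
  - move=> p [h1 h2]; split => //.
    have : `|p.1 - x0| <= r.
      by rewrite -(@ler_pXn2r _ 2) ?nnegrE ?(ltW r0)// (le_trans (norm_sqr_le_sqn _)).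
    by have := lerB_dist p.1 x0; lra.
  - exact: compact_slab.
  - rewrite (_ : K = (fun p : E => sqn (p.1 - x0)) @^-1` [set s : R | s <= r ^+ 2] `&`
       ((fun p : E => p.2) @^-1` `[t, 2 * t])).
      apply: closedI; apply: preimage_closed => //.
      exact: interval_closed.
    by apply/seteqP; split => p /=; rewrite in_itv.
pose P (p : E) := (p.2 - t) * (r ^+ 2 - sqn (p.1 - x0)) ^+ 2 * j0 U p `^ (q - 1).
have cP p : Q p -> {for p, continuous P}.
  move=> Qp; apply: cvgM; first apply: cvgM.
  - by apply: cvgB; [exact: ctime|exact: cvg_cst].
  - under eq_cvg do rewrite expr2; rewrite expr2.
    by apply: cvgM; apply: cvgB; try exact: cvg_cst; exact: csq.
  - apply: (@continuous_comp E R R (j0 U) (fun s => s `^ (q - 1))).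
      exact: (C21_c0 HU).
    by apply: continuous_powR_at; exact: U0.
have [p pK pmax] : exists2 p, p \in K & forall p', p' \in K -> P p' <= P p.
  apply: compact_EVT_max => //.
    exists (x0, 2 * t); split => /=; last by rewrite lexx andbT; lra.
    by rewrite /sqn big1 ?exprn_ge0 ?(ltW r0)// => i _; rewrite !mxE subrr expr0n.
  apply: continuous_in_subspaceT => p' /set_mem /KQ; exact: cP.
have {}pmax p' : K p' -> P p' <= P p by move=> /mem_set; exact: pmax.
move: pK => /set_mem pK; have Qp := KQ _ pK.
have sqn0 : sqn (x0 - x0) = 0 by rewrite /sqn big1// => i _; rewrite !mxE subrr expr0n.
have Kc : K (x0, 2 * t).
  by split; rewrite /= ?sqn0 ?exprn_ge0 ?(ltW r0)// lexx andbT; lra.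
have Pc : t * r ^+ 4 * j0 U (x0, 2 * t) `^ (q - 1) = P (x0, 2 * t).
  by rewrite /P /= sqn0 subr0 -exprM; congr (_ * _ * _); ring.
have Pc0 : 0 < P (x0, 2 * t).
  by rewrite -Pc !mulr_gt0 ?exprn_gt0// powR_gt0// U0//; exact: KQ.
have Pp0 : 0 < P p by exact: lt_le_trans (pmax _ Kc).
have [p1 /andP[p2 p3]] := pK.
set sg := p.2 - t; set et := r ^+ 2 - sqn (p.1 - x0).
have Up := U0 Qp.
have Uq0 : 0 < j0 U p `^ (q - 1) by exact: powR_gt0.
have et0 : 0 < et.
  rewrite lt_neqAle eq_sym subr_ge0 p1 andbT; apply/eqP => h.
  by move: Pp0; rewrite /P -/et h expr0n /= mulr0 mul0r ltxx.
have sg0 : 0 < sg.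
  rewrite lt_neqAle eq_sym subr_ge0 p2 andbT; apply/eqP => h.
  by move: Pp0; rewrite /P -/sg h !mul0r ltxx.
pose D : set E := [set p | Q p /\ t < p.2 /\ sqn (p.1 - x0) < r ^+ 2].
have oD : open D.
  rewrite (_ : D = Q `&` ((fun p : E => p.2) @^-1` [set s | t < s] `&`
     (fun p : E => sqn (p.1 - x0)) @^-1` [set s : R | s < r ^+ 2])) //.
  apply: openI; first exact: open_cylinder.
  apply: openI.
    by apply: open_comp; [move=> ? _; exact: ctime|exact: open_gt].
  by apply: open_comp; [move=> ? _; exact: csq|exact: open_lt].
have Dp : D p by split => //; split; [rewrite -subr_gt0|rewrite -subr_gt0].
pose H : @jet R N := jadd (jcst (r ^+ 2)) (jscl (-1) (jsq x0)).
have HE p' : j0 H p' = r ^+ 2 - sqn (p'.1 - x0) by rewrite -[LHS]/(r ^+ 2 + -1 * _) mulN1r.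
have HH : C21 D H by apply: C21_add; [exact: C21_cst|apply: C21_scl; exact: C21_sq].
pose S : @jet R N := jtime (fun s => ln (s - t)) (fun s => (s - t)^-1).
have HS : C21 D S.
  apply: C21_time => p' [_ [h _]]; have h0 : 0 < p'.2 - t by rewrite subr_gt0.
  have c1 : {for p'.2, continuous (fun s : R => s - t)}.
    by apply: cvgB; [exact: cvg_id|exact: cvg_cst].
  have d1 : is_derive p'.2 1 (fun s : R => s - t) 1.
    have := is_derive_affR 1 (- t) p'.2.
    by rewrite (_ : (fun s => _) = (fun s => s - t))//; apply/funext => s; rewrite mul1r.
  split.
  - by apply: (@continuous_comp R R R (fun s => s - t) (@ln R) _ c1); exact: continuous_ln.
  - by apply: cvgV => //; rewrite gt_eqF.
  - have := is_derive_lnR (f := fun s : R => s - t) h0 d1; by rewrite mul1r.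
pose X := jadd S (jadd (jscl 2 (jln H)) (jscl (q - 1) (jln U))).
have DQ : D `<=` Q by move=> ? [].
have HX : C21 D X.
  apply: C21_add => //; apply: C21_add; apply: C21_scl; apply: C21_ln => //.
  - by move=> p' [_ [_ h]]; rewrite HE subr_gt0.
  - exact: C21W HU.
  - by move=> p' /DQ /U0.
have XE p' : D p' -> j0 X p' = ln (P p').
  move=> [Qp' [h1 h2]].
  rewrite -[LHS]/(ln (p'.2 - t) + (2 * ln (j0 H p') + (q - 1) * ln (j0 U p'))) HE.
  have g1 : 0 < p'.2 - t by rewrite subr_gt0.
  have g2 : 0 < r ^+ 2 - sqn (p'.1 - x0) by rewrite subr_gt0.
  rewrite /P !lnM ?posrE ?mulr_gt0 ?exprn_gt0 ?powR_gt0 ?U0//.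
  by rewrite ln_powR; ring.
have XD p' : D p' -> K p' -> j0 X p' <= j0 X p.
  move=> Dp' Kp'; rewrite !XE// ler_ln ?posrE ?pmax//.
  have [Qp' [h1 h2]] := Dp'; rewrite /P !mulr_gt0 ?subr_gt0// ?exprn_gt0 ?subr_gt0//.
  by rewrite powR_gt0// U0.
have nD : \forall p' \near p, D p' by exact: open_nbhs_nbhs.
have nx i : \forall p' \near p, (exists s : R, p' = s *: dirx i + p) -> j0 X p' <= j0 X p.
  near=> p' => -[s ps]; have Dp' : D p' by near: p'.
  apply: XD => //; have [_ [_ h]] := Dp'; split; first exact: ltW.
  by rewrite ps snd_dirx p2.
have gx i : jx X i p = 0.
  apply: (@derive_line_max _ _ (j0 X) _ _ (dirx i)) (nx i).
    by apply: filterS nD => p' Dp'; exact: (C21_dx HX).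
  exact: (C21_cx HX).
have gxx i : jxx X i i p <= 0.
  apply: (@derive2_line_max _ _ (j0 X) (jx X i) _ _ (dirx i)) (nx i).
  - by apply: filterS nD => p' Dp'; exact: (C21_dx HX).
  - by apply: filterS nD => p' Dp'; exact: (C21_dxx HX).
  - exact: (C21_cx HX).
  - exact: (C21_cxx HX).
have gt : 0 <= jt X p.
  apply: (@derive_left_max _ _ (j0 X) _ _ dirt).
  - by apply: filterS nD => p' Dp'; exact: (C21_dt HX).
  - exact: (C21_ct HX).
  - have [d d0 Hd] := @line_near R N D p dirt nD.
    exists d => // s /andP[s1 s2].
    have Ds : D (s *: dirt + p) by apply: Hd; rewrite ler0_norm// lerNl.
    apply: XD => //; have [_ [h1 h2]] := Ds; split; first exact: ltW.
    by rewrite (ltW h1) /= [s *: _]mulr1 -[leRHS]add0r lerD.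
have {}gxx : jlap X p <= 0 by apply: sumr_le0 => i _; exact: gxx.
set u := j0 U p in Up Uq0.
have Lap : jlap X p = 2 * (- (et ^+ 2)^-1 * (4 * sqn (p.1 - x0)) + et^-1 * - (2 * N%:R)) +
   (q - 1) * (- (u ^+ 2)^-1 * (\sum_(i < N) jx U i p ^+ 2) + u^-1 * jlap U p).
  rewrite !jlap_add jlap_time add0r !jlap_scl !jlap_ln HE -/et -/u.
  rewrite (_ : \sum_(i < N) jx H i p ^+ 2 = 4 * sqn (p.1 - x0)); last first.
    rewrite -(sum_jsq x0 p); apply: eq_bigr => i _.
    rewrite -[jx H i p]/(0 + -1 * jx (jsq x0) i p); ring.
  rewrite (_ : jlap H p = - (2 * N%:R)) // jlap_add jlap_scl jlap_sq mulN1r.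
  by rewrite /jlap big1 ?add0r.
have Tim : jt X p = sg^-1 + (q - 1) * (u^-1 * jt U p).
  rewrite -[LHS]/(sg^-1 + (2 * ((j0 H p)^-1 * (0 + -1 * 0)) + (q - 1) * (u^-1 * jt U p))).
  by rewrite mulr0 addr0 !mulr0 add0r.
have Gra i : (q - 1) * (u^-1 * jx U i p) = 4 * (p.1 ord0 i - x0 ord0 i) / et.
  have := gx i.
  rewrite -[jx X i p]/(0 + (2 * ((j0 H p)^-1 * (0 + -1 * (2 * (p.1 ord0 i - x0 ord0 i)))) + (q - 1) * (u^-1 * jx U i p))).
  rewrite HE -/et add0r => /eqP; rewrite addrC addr_eq0 => /eqP ->.
  by field; rewrite gt_eqF.
have qm : 0 < q - 1 by rewrite subr_gt0.
(* The vanishing gradient trades [|grad u|^2 / u^2], which has the unfavourable sign in the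
   Laplacian of [ln u], for a quantity of the cutoff. *)
have Gra2 : (q - 1) ^+ 2 * ((u ^+ 2)^-1 * \sum_(i < N) jx U i p ^+ 2) = 16 * sqn (p.1 - x0) / et ^+ 2.
  transitivity (\sum_(i < N) (4 * (p.1 ord0 i - x0 ord0 i) / et) ^+ 2).
    by rewrite !mulr_sumr; apply: eq_bigr => i _; rewrite -Gra !exprMn exprVn.
  rewrite /sqn mulr_sumr mulr_suml; apply: eq_bigr => i _; rewrite !mxE.
  by field; rewrite gt_eqF.
have Eq : u^-1 * jt U p - u^-1 * jlap U p = - (p.2 `^ alpha * u `^ (q - 1)).
  rewrite -mulrBr -[jt U p - _]/(jfh U p) Ueq// -/u -(mulr_powRB1 (ltW Up)) ?(lt_trans ltr01)//.
  by field; rewrite gt_eqF.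
set G := (u ^+ 2)^-1 * \sum_(i < N) jx U i p ^+ 2 in Gra2.
set B := p.2 `^ alpha * u `^ (q - 1) in Eq.
have GE : (q - 1) * G = 16 / (q - 1) * (sqn (p.1 - x0) / et ^+ 2).
  by apply: (mulfI (lt0r_neq0 qm)); rewrite mulrA -expr2 Gra2; field; rewrite !gt_eqF.
have main : (q - 1) * B <= 16 / (q - 1) * (sqn (p.1 - x0) / et ^+ 2) + sg^-1 +
    8 * (sqn (p.1 - x0) / et ^+ 2) + 4 * N%:R * et^-1.
  have B1 : (q - 1) * B = (q - 1) * (u^-1 * jlap U p) - (q - 1) * (u^-1 * jt U p).
    by rewrite -mulrBr -[X in _ = _ * X]opprB Eq opprK.
  have L1 : (q - 1) * (u^-1 * jlap U p) = jlap X p + (q - 1) * G + 8 * (sqn (p.1 - x0) / et ^+ 2) + 4 * N%:R * et^-1.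
    by rewrite Lap /G; ring.
  have T1 : - ((q - 1) * (u^-1 * jt U p)) = sg^-1 - jt X p by rewrite Tim; ring.
  rewrite B1 T1 L1 GE; move: gxx gt; lra.
have PpE : P p = sg * et ^+ 2 * u `^ (q - 1) by [].
have sg1 : sg <= 1 by rewrite lerBlDr (le_trans p3)// mulr_natl mulr2n lerD2r.
have r21 : r ^+ 2 <= 1 by rewrite exprn_ile1// ltW.
have sq0 := sqn_ge0 (p.1 - x0).
have et1 : et <= 1 by rewrite lerBlDr (le_trans r21)// lerDl.
have sq1 : sqn (p.1 - x0) <= 1 by exact: le_trans p1 r21.
(* The factor [sg * et^2] contained in [P] cancels all negative powers of [main], which is why the
   spatial cutoff is squared; [9] collects 1 from the time cutoff and 8 from the gradient of the
   spatial one. *)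
have fin : (q - 1) * (p.2 `^ alpha * P p) <= 16 / (q - 1) + 9 + 4 * N%:R.
  have -> : (q - 1) * (p.2 `^ alpha * P p) = (q - 1) * B * (sg * et ^+ 2).
    by rewrite PpE /B; ring.
  have se0 : 0 <= sg * et ^+ 2 by rewrite mulr_ge0 ?sqr_ge0 ?(ltW sg0).
  apply: (le_trans (ler_wpM2r se0 main)).
  have -> : (16 / (q - 1) * (sqn (p.1 - x0) / et ^+ 2) + sg^-1 +
    8 * (sqn (p.1 - x0) / et ^+ 2) + 4 * N%:R * et^-1) * (sg * et ^+ 2) =
    16 / (q - 1) * (sg * sqn (p.1 - x0)) + et ^+ 2 + 8 * (sg * sqn (p.1 - x0)) + 4 * N%:R * (sg * et).
    by field; rewrite !gt_eqF.
  have b1 : sg * sqn (p.1 - x0) <= 1 by rewrite mulr_ile1// ltW.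
  have b2 : et ^+ 2 <= 1 by rewrite exprn_ile1// ltW.
  have b3 : sg * et <= 1 by rewrite mulr_ile1// ltW.
  have c1 : 0 <= 16 / (q - 1) by rewrite divr_ge0// ltW.
  have c2 : 0 <= 4 * N%:R :> R by rewrite mulr_ge0.
  have := ler_wpM2l c1 b1; have := ler_wpM2l c2 b3; rewrite !mulr1.
  move: (sg * sqn _) (et ^+ 2) (sg * et) (16 / _) b1 b2 => *; lra.
apply: le_trans fin.
rewrite -mulrA ler_wpM2l ?(ltW qm)// mulrA Pc; apply: ler_pM.
- by rewrite mulr_ge0 ?powR_ge0 ?(ltW c0).
- exact: ltW.
- by apply: Hc => //; rewrite p2.
- exact: pmax.
Unshelve. all: by end_near. Qed.

End interior_estimate.

Section near_point.
Context {R : realType} {N : nat}.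
Notation E := ('rV[R]_N * R)%type.
Variables (Omega : set 'rV[R]_N) (T alpha q : R) (U : @jet R N).
Notation Q := (cylinder Omega T).
Hypothesis oO : open Omega.
Hypothesis q1 : 1 < q.
Hypothesis al : -1 < alpha.
Hypothesis T0 : 0 < T.
Hypothesis HU : C21 Q U.
Hypothesis U0 : forall p, Q p -> 0 < j0 U p.
Hypothesis Ueq : forall p, Q p -> jfh U p = - (p.2 `^ alpha * j0 U p `^ q).

(** [local_bound] is used on the window [[t / 2, t]] with centre [x], in a ball of fixed radius, so
    the only dependence on [t] is the factor [t^alpha * t]. *)
Lemma near_bound (a : 'rV[R]_N) : Omega a -> exists r C, [/\ 0 < r,
  forall x, `|x - a| <= r -> Omega x &
  forall x t, `|x - a| <= r -> 0 < t < Num.min 1 T ->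
    j0 U (x, t) `^ (q - 1) <= C * t `^ (- (1 + alpha))].
Proof.
move=> Oa; have qm : 0 < q - 1 by rewrite subr_gt0.
have /nbhs_ballP[e /= e0 He] : nbhs a Omega by exact: open_nbhs_nbhs.
pose r := Num.min 1 (e / 4).
have r0 : 0 < r by rewrite lt_min ltr01 divr_gt0.
have re : r <= e / 4 by rewrite ge_min lexx orbT.
have r1 : 0 < r <= 1 by rewrite r0 ge_min lexx.
have inO x : `|x - a| <= 2 * r -> Omega x.
  move=> h; apply: He; rewrite -ball_normE /= distrC (le_lt_trans h)//; lra.
have [c c0 Hc] := powR_window alpha.
pose C0 := 16 / (q - 1) + 9 + 4 * N%:R.
exists r, (C0 / ((q - 1) * c * r ^+ 4) * 2 `^ (1 + alpha)); split => //.
  by move=> x h; apply: inO; rewrite (le_trans h)// ler_peMl ?(ltW r0)// ler1n.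
move=> x t xr /andP[t0]; rewrite lt_min => /andP[t1 tT].
have t2 : 0 < t / 2 <= 1 by rewrite divr_gt0//=; lra.
have tt : 2 * (t / 2) = t by field.
have tT2 : 2 * (t / 2) < T by rewrite tt.
have HO y : sqn (y - x) <= r ^+ 2 -> Omega y.
  move=> h; apply: inO; have -> : y - a = (y - x) + (x - a) by rewrite addrA subrK.
  rewrite (le_trans (ler_normD _ _))// mulr_natl mulr2n lerD//.
  by rewrite -(@ler_pXn2r _ 2) ?nnegrE ?(ltW r0)// (le_trans (norm_sqr_le_sqn _)).
have := local_bound oO q1 HU U0 Ueq c0 Hc r1 t2 tT2 HO; rewrite tt.
have pe : (t / 2) `^ alpha * (t / 2) = t `^ (1 + alpha) / 2 `^ (1 + alpha).
  rewrite mulrC -{1}[alpha](addrK 1) [alpha + 1]addrC mulr_powRB1; last 2 first.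
  - by rewrite ltW// divr_gt0.
  - by rewrite -ltrBlDl sub0r.
  rewrite powRM ?(ltW t0)// ?invr_ge0//; congr (_ * _).
  by rewrite -powR_inv1// -powRrM mulN1r powRN.
rewrite -(mulrA (t / 2)) (mulrA (_ `^ alpha)) pe.
have k0 : 0 < (q - 1) * c * r ^+ 4 by rewrite !mulr_gt0// exprn_gt0.
have w0 : 0 < 2 `^ (1 + alpha) :> R by exact: powR_gt0.
have u0 : 0 < t `^ (1 + alpha) by exact: powR_gt0.
rewrite powRN => H.
rewrite -/C0 in H; rewrite ler_pdivlMr// mulrAC ler_pdivlMr//.
rewrite -ler_pdivrMr//; apply: le_trans H; rewrite le_eqVlt; apply/orP; left; apply/eqP.
by field; rewrite gt_eqF.
Qed.

End near_point.

(** * Damped heat flows as subsolutions *)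

Section heat_flow.
Context {R : realType} {N : nat}.
Notation E := ('rV[R]_N * R)%type.
Notation EM := ('rV[R]_N * measurableTypeR R)%type.
Notation lam := (leb R N).
Variables (f : 'rV[R]_N -> R) (c : R).
Hypothesis If : intg lam f.
Hypothesis f0 : forall y, 0 <= f y.

(** The Gaussian has clock [s + c], so this is formally the heat flow that starts from [f] at time
    [- c]. *)
Definition flow : @jet R N :=
  jker lam (fun y : 'rV[R]_N => (y, 0) : E) f (jgauss 0 1 c).

Lemma flowE p : j0 flow p = Int lam (fun y => f y * heat (p.2 + c) (p.1 - y)).
Proof.
by apply: eq_Int => y; rewrite gaussE /= subr0 mul1r subr0.
Qed.

Let D (t0 : R) : set E := [set p | t0 < p.2 + c].

Let oD t0 : open (D t0).
Proof.
apply: (@open_comp E R (fun p => p.2 + c) [set s : R | t0 < s]); last exact: open_gt.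
by move=> p _; apply: cvgD; [exact: cvg_snd|exact: cvg_cst].
Qed.

Let msig : measurable_fun setT ((fun y : 'rV[R]_N => (y, 0) : E) : 'rV[R]_N -> EM).
Proof. by apply: measurable_fun_pair; [exact: measurable_id|exact: measurable_cst]. Qed.

Let Dsig t0 (e : E) (y : 'rV[R]_N) : D t0 e -> D t0 (e - (y, 0)).
Proof. by rewrite /D /= subr0. Qed.

Let C21k (t0 : R) : 0 < t0 -> C21 (D t0) (jgauss (0 : 'rV[R]_N) 1 c).
Proof.
by move=> t00; apply: C21W (C21_gauss 0 1 c) => p; rewrite /D /= mul1r; exact: lt_trans.
Qed.

Lemma C21_flow (t0 : R) : 0 < t0 -> C21 [set p : E | t0 < p.2 + c] flow.
Proof.
move=> t00; have [M M0 HM] := @gauss_bounded R N 0 1 c t0 t00.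
have := C21_ker msig If (@oD t0) (@Dsig t0) (C21k t00) (M := M); apply => x Dx.
by apply: HM; rewrite mul1r ltW.
Qed.

Lemma jfh_flow p : 0 < p.2 + c -> jfh flow p = 0.
Proof.
move=> p0; pose t0 := (p.2 + c) / 2.
have t00 : 0 < t0 by rewrite divr_gt0.
have Dp : D t0 p by rewrite /D /= /t0; lra.
have [M M0 HM] := @gauss_bounded R N 0 1 c t0 t00.
have key (k : @jet R N) : C21 (D t0) k -> (forall x, D t0 x -> jnorm k x <= M) ->
    (forall x, D t0 x -> jt k x = jlap k x) ->
    jfh (jker lam (fun y : 'rV[R]_N => (y, 0) : E) f k) p = 0.
  move=> Hk HM' Hh; rewrite /jfh /jlap /=; apply/eqP; rewrite subr_eq0; apply/eqP.
  rewrite /ker -Int_sum => [|i].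
    by apply: eq_Int => y; rewrite -mulr_sumr Hh//; exact: Dsig.
  have bd x : D t0 x -> `|jxx k i i x| <= M.
    by move=> Dx; have [_ _ _ h] := jnormP k x; rewrite (le_trans (h _ _))// HM'.
  have cx x : D t0 x -> {for x, continuous (jxx k i i)} by move=> Dx; exact: (C21_cxx Hk).
  exact: (intg_ker msig If (@oD t0) (@Dsig t0) cx Dp bd).
apply: key; first exact: C21k.
  by move=> x Dx; apply: HM; rewrite mul1r ltW.
move=> x Dx; rewrite jt_gauss mul1r//; exact: lt_trans Dx.
Qed.

Let hk_bounded (s : R) : 0 < s -> exists M, forall x : 'rV[R]_N, heat s x <= M.
Proof.
move=> s0; exists (expR (- (N%:R / 2) * ln (4 * pi * s))) => x.
have h : 0 < s <= s by rewrite s0 lexx.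
rewrite (le_trans (heat_le x h))// ler_piMr ?expR_ge0//.
by rewrite -[leRHS]expR0 ler_expR oppr_le0 divr_ge0 ?sqn_ge0// mulr_ge0 ?ltW.
Qed.

Let hkC (s : R) (x y : 'rV[R]_N) : heat s (x - y) = heat s (y - x).
Proof. by rewrite -heatN opprB. Qed.

Lemma measurable_heat (s : R) x : measurable_fun setT (fun y : 'rV[R]_N => heat s (x - y)).
Proof.
under eq_fun do rewrite hkC.
rewrite /heat; apply: measurableT_comp; first exact: measurable_expR.
by apply: measurable_funD => //; apply: measurable_funM => //; exact: measurable_sqn.
Qed.

Lemma intg_heat (s : R) x : 0 < s -> intg lam (fun y : 'rV[R]_N => heat s (x - y)) /\
  Int lam (fun y : 'rV[R]_N => heat s (x - y)) = 1.
Proof.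
move=> s0; have key := @integral_heat R N s x s0.
have E1 : (\int[lam]_y (heat s (x - y))%:E = 1)%E.
  by rewrite -key; apply: eq_integral => y _; rewrite hkC.
split; last by rewrite /Int /Rintegral E1.
apply/integrableP; split; first by apply/measurable_EFinP; exact: measurable_heat.
under eq_integral do rewrite /= gtr0_norm ?heat_gt0//.
by rewrite E1 ltry.
Qed.

Lemma intg_flow (s : R) x : 0 < s -> intg lam (fun y => f y * heat s (x - y)).
Proof.
move=> s0; have [M HM] := hk_bounded s0.
apply: (@intgM _ _ _ _ _ _ M) => //; first exact: measurable_heat.
by move=> y; rewrite gtr0_norm ?heat_gt0.
Qed.

Lemma flow_ge0 p : 0 <= j0 flow p.
Proof. by rewrite flowE; apply: Int_ge0 => y; rewrite mulr_ge0// ltW// heat_gt0. Qed.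

(** The flow is an average of the kernel over the support of [f], with total weight [Int lam f]; a
    datum concentrated near [a] thus flows like a multiple of the kernel at [a]. *)
Lemma flow_close p g d : 0 < p.2 + c ->
  (forall y, f y != 0 -> `|heat (p.2 + c) (p.1 - y) - g| <= d) ->
  `|j0 flow p - Int lam f * g| <= Int lam f * d.
Proof.
move=> p0 H; rewrite flowE.
have I1 := intg_flow p.1 p0.
rewrite -[Int lam f * g]mulrC -IntZ// -IntB//; last exact: intgZ.
apply: (le_trans (Int_abs (intgB I1 (intgZ _ If)))).
rewrite mulrC -IntZ//; apply: Int_le; [apply/intg_abs/intgB => //; exact: intgZ|exact: intgZ|].
move=> y; have [->|h] := eqVneq (f y) 0; first by rewrite !(mul0r, mulr0) subr0 normr0.
by rewrite [g * _]mulrC -mulrBr normrM ger0_norm// mulrC ler_wpM2r// H.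
Qed.

Lemma flow_le p B : 0 < p.2 + c ->
  (forall y, f y != 0 -> heat (p.2 + c) (p.1 - y) <= B) -> j0 flow p <= Int lam f * B.
Proof.
move=> p0 H; rewrite flowE mulrC -IntZ//; apply: Int_le; [exact: intg_flow|exact: intgZ|].
move=> y; have [->|h] := eqVneq (f y) 0; first by rewrite !(mul0r, mulr0).
by rewrite mulrC ler_wpM2r// H.
Qed.

(** Points within [r] contribute at most [b] because the kernel has mass 1; farther ones contribute
    at most [F] times the tail mass, which is proportional to the clock. *)
Lemma flow_le_local p b F r : 0 < p.2 + c -> 0 < r -> 0 <= b -> (forall y, f y <= F) ->
  (forall y, `|y - p.1| <= r -> f y <= b) ->
  j0 flow p <= b + F * (8 * (p.2 + c) / r ^+ 2 * expR (N%:R / 2 * ln 2)).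
Proof.
move=> p0 r0 b0 fF fb; set s := p.2 + c in p0 *.
have s2 : 0 < 2 * s by rewrite mulr_gt0.
have F0 : 0 <= F by exact: le_trans (f0 0) (fF 0).
pose kap := 8 * s / r ^+ 2 * expR (N%:R / 2 * ln 2).
have kap0 : 0 <= kap by rewrite mulr_ge0 ?expR_ge0// divr_ge0 ?mulr_ge0 ?exprn_ge0 ?ltW.
have [I1 E1] := intg_heat p.1 p0; have [I2 E2] := intg_heat p.1 s2.
rewrite flowE -/s -/kap.
have -> : b + F * kap = Int lam (fun y => b * heat s (p.1 - y) + F * kap * heat (2 * s) (p.1 - y)).
  by rewrite IntD; [rewrite !IntZ// E1 E2 !mulr1|exact: intgZ|exact: intgZ].
apply: Int_le; [exact: intg_flow|by apply: intgD; exact: intgZ|].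
move=> y; have h1 := heat_gt0 s (p.1 - y); have h2 := heat_gt0 (2 * s) (p.1 - y).
have [near|far] := leP `|y - p.1| r.
  rewrite -[leLHS]addr0; apply: lerD; first by rewrite ler_wpM2r ?(ltW h1) ?fb.
  by apply: mulr_ge0 (ltW h2); exact: mulr_ge0.
rewrite -[leLHS]add0r; apply: lerD; first exact: mulr_ge0 (ltW h1).
rewrite -mulrA; apply: ler_pM => //; first exact: ltW.
rewrite /kap; apply: heat_tail => //.
apply: le_trans (norm_sqr_le_sqn _); rewrite lerXn2r ?nnegrE ?(ltW r0)//.
by rewrite distrC ltW.
Qed.

End heat_flow.

Section heat_lipschitz.
Context {R : realType} {N : nat}.

Lemma heat_lipschitz (t : R) : 0 < t -> exists2 M : R, 0 <= M &
  forall s s' (x x' : 'rV[R]_N), t <= s -> t <= s' ->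
    `|heat s x - heat s' x'| <= M * (`|x - x'| + `|s - s'|).
Proof.
move=> t0; have [M M0 HM] := @gauss_bounded R N 0 1 0 t t0.
exists (N.+1%:R * M); first by rewrite mulr_ge0.
have H := @C21_gauss R N 0 1 0.
have HE s (x : 'rV[R]_N) : heat s x = j0 (jgauss 0 1 0) (x, s).
  by rewrite gaussE /= mul1r addr0 subr0.
have inD s (x : 'rV[R]_N) : t <= s -> 0 < 1 * (x, s).2 + 0 :> R.
  by rewrite /= mul1r addr0; exact: lt_le_trans.
have HM' s (x : 'rV[R]_N) : t <= s -> jnorm (jgauss (0 : 'rV[R]_N) 1 0) (x, s) <= M.
  by move=> ts; apply: HM; rewrite /= mul1r addr0.
move=> s s' x x' ts ts'.
have st a b : t <= a -> a <= b -> `|heat b x' - heat a x'| <= M * (b - a).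
  move=> ta ab.
  have key r : a <= r <= b -> (r *: dirt + (x', 0) : 'rV[R]_N * R) = (x', r).
    by move=> _; rewrite /dirt; congr pair; rewrite /= ?scaler0 ?add0r// [r *: _]mulr1 addr0.
  have [r rab|r rab] := @MVT_line R _ (j0 (jgauss 0 1 0)) (jt (jgauss 0 1 0)) (x', 0) dirt a b ab.
    apply: (C21_dt H); rewrite key//; apply: (inD r x'); have /andP[] := rab => h _; exact: le_trans h.
  rewrite !key ?lexx ?ab// => e; rewrite !HE e normrM (ger0_norm (_ : 0 <= b - a)) ?subr_ge0//.
  rewrite ler_wpM2r ?subr_ge0//; have [_ h _ _] := jnormP (jgauss 0 1 0) (x', r).
  rewrite (le_trans h)// HM'//; have /andP[] := rab => h' _; exact: le_trans h'.
have time : `|heat s x' - heat s' x'| <= M * `|s - s'|.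
  have [h|/ltW h] := leP s' s; first by rewrite [`|s - s'|]ger0_norm ?subr_ge0// st.
  by rewrite distrC [`|s - s'|]distrC [`|s' - s|]ger0_norm ?subr_ge0// st.
have space : `|heat s x - heat s x'| <= N%:R * M * `|x - x'|.
  rewrite !HE; apply: (@coord_lipschitz R N _ (jx (jgauss 0 1 0)) M s x' x M0).
    by move=> z i; apply: (C21_dx H); exact: inD.
  move=> z i; have [_ _ h _] := jnormP (jgauss 0 1 0) (z, s).
  by rewrite (le_trans (h i))// HM'.
have -> : heat s x - heat s' x' = (heat s x - heat s x') + (heat s x' - heat s' x').
  by rewrite addrA subrK.
rewrite (le_trans (ler_normD _ _))// mulrDr lerD//.
  apply: (le_trans space); rewrite ler_wpM2r// ler_wpM2r// ler_nat leqnSn//.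
by apply: (le_trans time); rewrite ler_wpM2r// ler_peMl// ler1n.
Qed.

End heat_lipschitz.

(** * A datum of prescribed mass below the solution *)

Section initial_mass.
Context {R : realType} {N : nat}.
Notation E := ('rV[R]_N * R)%type.
Notation lam := (leb R N).

Lemma intg_rV_bounded (f : 'rV[R]_N -> R) b (M : R) : measurable_fun setT f ->
  (forall x, `|f x| <= M) -> (forall x, b <= `|x| -> f x = 0) -> intg lam f.
Proof.
move=> mf fM f0; pose B := [set x : 'rV[R]_N | `|x| < b].
have mB : measurable B.
  apply: open_measurable_rV.
  apply: (@open_comp 'rV[R]_N R (fun p => `|p|) [set r : R | r < b]); last exact: open_lt.
  by move=> x _; exact: norm_continuous.
have H : lam.-integrable B (EFin \o f).
  apply: measurable_bounded_integrable => //; first exact: leb_ball_lty.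
    exact: measurable_funTS.
  exists M; split; first exact: num_real.
  by move=> M' /ltW MM' x _ /=; rewrite (le_trans (fM x)).
rewrite /intg; move/integrable_mkcond : H => /(_ mB).
apply: eq_integrable => // x _; rewrite /patch /=; case: ifPn => //.
by rewrite notin_setE /B /= => /negP; rewrite -leNgt => /f0 ->.
Qed.

Variables (Omega : set 'rV[R]_N) (T k : R) (a : 'rV[R]_N) (U : @jet R N).
Notation Q := (cylinder Omega T).
Hypothesis oO : open Omega.
Hypothesis k0 : 0 < k.
Hypothesis HU : C21 Q U.
Hypothesis U0 : forall p, Q p -> 0 < j0 U p.
Hypothesis Htr : forall B, open B -> B `<=` Omega -> B a ->
  (\int[lam]_(x in B) (j0 U (x, t))%:E)%E @[t --> 0^'+] --> +oo%E.

(** [f] is [u(t0)] times a cutoff around [a], rescaled to mass [k]. Since the mass of [u(t)] near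
    [a] is unbounded as [t] tends to 0, the scaling factor can be made as small as desired. *)
Lemma exists_mass (eps lam0 t1 : R) : 0 < eps ->
  (forall x, sqn (x - a) <= eps ^+ 2 -> Omega x) -> 0 < lam0 -> 0 < t1 -> t1 <= T ->
  exists t0 l (f : 'rV[R]_N -> R), [/\ 0 < t0 < t1, 0 < l <= lam0,
    intg lam f /\ Int lam f = k, forall y, 0 <= f y &
    forall y, f y != 0 -> sqn (y - a) < eps ^+ 2 /\ f y <= l * j0 U (y, t0)].
Proof.
move=> eps0 HO lam00 t10 t1T.
have e2 : 0 < eps ^+ 2 by rewrite exprn_gt0.
have s01 : eps ^+ 2 / 2 < eps ^+ 2 by lra.
have [P1 P2 P3 P4 P5] := plateauP a s01.
pose xi y := j0 (jplat a (eps ^+ 2 / 2) (eps ^+ 2)) (y, 0).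
pose B := [set x : 'rV[R]_N | sqn (x - a) < eps ^+ 2 / 2].
have csq : continuous (fun x : 'rV[R]_N => sqn (x - a)).
  move=> y; apply: (@continuous_comp 'rV[R]_N E R (fun y => (y, 0)) (fun p : E => sqn (p.1 - a))).
    exact: continuous_slice.
  exact: continuous_sqn.
have oB : open B by apply: (@open_comp _ R (fun x : 'rV[R]_N => sqn (x - a)) [set s : R | s < eps ^+ 2 / 2]); [move=> ? _; exact: csq|exact: open_lt].
have BO : B `<=` Omega by move=> x /= h; apply: HO; rewrite ltW// (lt_trans h).
have Ba : B a.
  by rewrite /B /= (_ : sqn _ = 0) ?divr_gt0// /sqn big1// => i _; rewrite !mxE subrr expr0n.
(* A mass of at least [k / lam0] is what makes the factor [l = k / Int lam g] at most [lam0]. *)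
have [t0 [/andP[t00 t0t] Hm]] : exists t0, 0 < t0 < t1 /\
    ((k / lam0)%:E <= \int[lam]_(x in B) (j0 U (x, t0))%:E)%E.
  have /cvgeyPger/(_ (k / lam0) (num_real _)) H := Htr oB BO Ba.
  have H2 : \forall t \near 0^'+, 0 < t < t1.
    near=> t; apply/andP; split; first by near: t; exact: nbhs_right_gt.
    by near: t; exact: nbhs_right_lt.
  have [t [h1 h2]] := @filter_ex _ (0^'+) _ _ (filterI H H2).
  by exists t.
have Qt x : Omega x -> Q (x, t0).
  by move=> Ox; split => //=; rewrite in_itv /= t00 (lt_le_trans t0t).
pose g y := j0 U (y, t0) * xi y.
have xi_out y : eps ^+ 2 <= sqn (y - a) -> xi y = 0 by move=> h; exact: P4.
have g0 y : 0 <= g y.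
  have [Oy|Oy] := pselect (Omega y); last first.
    rewrite /g xi_out ?mulr0// leNgt; apply/negP => h; apply: Oy; apply: HO; exact: ltW.
  by rewrite mulr_ge0 ?(ltW (U0 _))//; [exact: Qt|have /andP[] := P2 (y, 0)].
have cg : continuous g.
  have cxi : continuous xi.
    move=> x; apply: (@continuous_comp 'rV[R]_N E R (fun y => (y, 0)) (j0 (jplat a (eps ^+ 2 / 2) (eps ^+ 2)))).
      exact: continuous_slice.
    exact: (C21_c0 P1).
  move=> x; have [Ox|Ox] := pselect (Omega x).
    have cU : {for x, continuous (fun y => j0 U (y, t0))}.
      apply: (@continuous_comp 'rV[R]_N E R (fun y => (y, t0)) (j0 U)).
        exact: continuous_slice.
      exact: (C21_c0 HU (Qt _ Ox)).
    exact: (@continuousM R 'rV[R]_N _ _ x cU (cxi x)).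
  have hx : eps ^+ 2 < sqn (x - a) by rewrite ltNge; apply/negP => /HO.
  have oF : open [set x : 'rV[R]_N | eps ^+ 2 < sqn (x - a)].
    by apply: (@open_comp _ R (fun x : 'rV[R]_N => sqn (x - a)) [set s : R | eps ^+ 2 < s]); [move=> ? _; exact: csq|exact: open_gt].
  have E0 : \near x, cst 0 x = g x.
    near=> y; rewrite /g xi_out ?mulr0//; apply: ltW; near: y; exact: open_nbhs_nbhs.
  rewrite /continuous_at {2}/g xi_out ?(ltW hx)// mulr0.
  exact: cvg_trans (near_eq_cvg E0) (cvg_cst _).
have mg : measurable_fun setT g by apply: continuous_measurable_rV => [|x _]; [exact: openT|exact: cg].
have far x : `|a| + eps <= `|x| -> eps ^+ 2 <= sqn (x - a).
  move=> h; apply: le_trans (norm_sqr_le_sqn _); rewrite lerXn2r ?nnegrE ?(ltW eps0)//.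
  by have := lerB_dist x a; lra.
have [M M0 HM] := compact_bounded (@compact_ball_rV R N (`|a| + eps)) (continuous_subspaceT cg).
have Ig : intg lam g.
  apply: (@intg_rV_bounded _ (`|a| + eps) M) => // x.
    have [h|/ltW h] := leP `|x| (`|a| + eps); first exact: HM.
    by rewrite /g xi_out ?mulr0 ?normr0//; exact: far.
  by move=> /far h; rewrite /g xi_out ?mulr0.
have Hm2 : k / lam0 <= Int lam g.
  rewrite -lee_fin; apply: (le_trans Hm); rewrite /Int /Rintegral fineK; last first.
    exact: integrable_fin_num Ig.
  have mB : measurable B by exact: open_measurable_rV.
  rewrite [leLHS](_ : _ = \int[lam]_(x in B) (g x)%:E)%E; last first.
    apply: eq_integral => x /set_mem Bx; rewrite /g (_ : xi x = 1) ?mulr1//.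
    by apply: P3; apply: ltW.
  apply: ge0_subset_integral => //; first exact/measurable_EFinP.
  by move=> x _; rewrite lee_fin.
have g_gt0 : 0 < Int lam g by apply: lt_le_trans Hm2; rewrite divr_gt0.
pose l := k / Int lam g.
have l0 : 0 < l by rewrite divr_gt0.
exists t0, l, (fun y => l * g y); split.
- by rewrite t00.
- by rewrite l0 /l ler_pdivrMr// mulrC -ler_pdivrMr.
- by split; [exact: intgZ|rewrite IntZ// /l divfK// gt_eqF].
- by move=> y; rewrite mulr_ge0// ltW.
move=> y fy.
have hy : sqn (y - a) < eps ^+ 2.
  by rewrite ltNge; apply/negP => /xi_out h; move: fy; rewrite /g h !mulr0 eqxx.
split => //; rewrite ler_wpM2l ?(ltW l0)// /g ler_piMr//; last by have /andP[] := P2 (y, 0).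
by rewrite ltW// U0//; apply: Qt; apply: HO; exact: ltW.
Unshelve. all: by end_near. Qed.

End initial_mass.

(** * The damping factor *)

Section damping.
Context {R : realType} {N : nat}.
Notation E := ('rV[R]_N * R)%type.
Variables (alpha q k : R).
Hypothesis q1 : 1 < q.
Hypothesis k0 : 0 < k.

(** [s^alpha] times the power [q - 1] of a kernel peak [s^(-N/2)] is [s^(bet - 1)]; [bet > 0] is the
    subcriticality of [q]. *)
Definition bet : R := 1 + alpha - N%:R / 2 * (q - 1).
Hypothesis bet0 : 0 < bet.

(** Here [dampA * bet * s^(bet - 1)] equals [s^alpha] times the power [q - 1] of
    [k (2 pi s)^(-N/2)]. The [2 pi] in place of [4 pi] reflects a flow started at [t0 <= s / 2],
    whose age is at least [s / 2]. *)
Definition dampA : R := k `^ (q - 1) * expR (- (N%:R / 2) * (q - 1) * ln (2 * pi)) / bet.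

(* The damping turns a solution of the heat equation into a subsolution of the
   equation with absorption. *)
Definition damp (E0 t0 s : R) := expR (- (dampA * s `^ bet + E0 * (1 + - t0 * s^-1))).
Definition damp1 (E0 t0 s : R) := damp E0 t0 s *
  - (dampA * (bet * s `^ (bet - 1)) + E0 * (t0 / s ^+ 2)).

Lemma dampA_ge0 : 0 <= dampA.
Proof. by rewrite divr_ge0 ?(ltW bet0)// mulr_ge0 ?powR_ge0 ?expR_ge0. Qed.

Lemma C21_damp (E0 t0 : R) (D : set E) : (forall p, D p -> 0 < p.2) ->
  C21 D (@jtime R N (damp E0 t0) (damp1 E0 t0)).
Proof.
move=> D0; apply: C21_time => p /D0 p0; set s := p.2 in p0 *.
have sn : s != 0 by rewrite gt_eqF.
have d1 : is_derive s 1 (fun s : R => s `^ bet) (bet * s `^ (bet - 1)).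
  exact: is_derive1_powR.
have d2 : is_derive s 1 (fun s : R => s^-1) (- 1 / s ^+ 2).
  exact: (is_derive_invR (f := id) sn (is_derive_id _ _)).
have d3 : is_derive s 1 (fun s : R => dampA * s `^ bet + E0 * (1 + - t0 * s^-1))
    (dampA * (bet * s `^ (bet - 1)) + E0 * (t0 / s ^+ 2)).
  have e1 : is_derive s 1 (fun s : R => dampA * s `^ bet) (dampA * (bet * s `^ (bet - 1))).
    apply: is_derive_eqR (is_derive_mulR (is_derive_cst dampA _ _) d1) _.
    by rewrite /cst mul0r add0r.
  have e2 : is_derive s 1 (fun s : R => E0 * (1 + - t0 * s^-1)) (E0 * (t0 / s ^+ 2)).
    apply: is_derive_eqR (is_derive_mulR (is_derive_cst E0 _ _)
      (is_derive_addR (is_derive_cst (1 : R) _ _) (is_derive_mulR (is_derive_cst (- t0) _ _) d2))) _.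
    by rewrite /cst; field.
  exact: is_derive_addR e1 e2.
have d4 : is_derive s 1 (fun s : R => - (dampA * s `^ bet + E0 * (1 + - t0 * s^-1)))
    (- (dampA * (bet * s `^ (bet - 1)) + E0 * (t0 / s ^+ 2))).
  apply: is_derive_eqR (is_derive_eqR (is_deriveN d3) erefl) _ => //.
have d5 : is_derive s 1 (damp E0 t0) (damp1 E0 t0 s).
  exact: (@is_derive_compR R R^o (@expR R) _ s 1 (damp E0 t0 s) _ (is_derive_expR _) d4).
have dc : {for s, continuous (damp E0 t0)}.
  by apply: differentiable_continuous; apply/derivable1_diffP; have [] := d5.
split => //; apply: cvgM; first exact: dc.
apply: cvgN; apply: cvgD.
  by apply: cvgM; [exact: cvg_cst|apply: cvgM; [exact: cvg_cst|exact: continuous_powR_at]].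
apply: cvgM; first exact: cvg_cst.
apply: cvgM; first exact: cvg_cst.
apply: cvgV; first by rewrite expf_neq0.
by under eq_cvg do rewrite expr2; rewrite expr2; apply: cvgM; exact: cvg_id.
Qed.

Lemma damp_bounds (E0 t0 s : R) : 0 <= E0 -> 0 < t0 -> t0 <= s ->
  0 < damp E0 t0 s <= 1 /\ 1 - damp E0 t0 s <= dampA * s `^ bet + E0.
Proof.
move=> E00 t00 ts; have s0 : 0 < s by exact: lt_le_trans ts.
have q0 : 0 <= t0 / s by rewrite divr_ge0 ?ltW.
have q1' : t0 / s <= 1 by rewrite ler_pdivrMr// mul1r.
have a0 : 0 <= dampA * s `^ bet by rewrite mulr_ge0 ?dampA_ge0 ?powR_ge0.
have e0 : 0 <= E0 * (1 + - t0 * s^-1) by rewrite mulr_ge0// mulNr subr_ge0.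
have e1 : E0 * (1 + - t0 * s^-1) <= E0 by rewrite ler_piMr// mulNr lerBlDr lerDl.
rewrite /damp expR_gt0 -[X in _ <= X /\ _]expR0 ler_expR oppr_le0 addr_ge0//; split => //.
have := expR_ge1Dx (- (dampA * s `^ bet + E0 * (1 + - t0 * s^-1))); lra.
Qed.

(** The left-hand side is the absorption coefficient of a heat flow with value [h], the right-hand
    side the logarithmic rate of the damping. Up to [2 t0] the bound [F] on the datum and the term
    with [E0] are used, afterwards the kernel peak and the term with [dampA]. *)
Lemma damp_absorbs (c E0 L t0 s t h F : R) : 0 < c ->
  (forall t s, 0 < t -> t <= s <= 2 * t -> c * t `^ (- alpha) <= s `^ (- alpha)) ->
  0 < t0 -> t0 <= s -> 0 < t -> 0 <= h -> 0 <= E0 -> 4 / c * L <= E0 -> 0 <= L ->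
  h <= F -> F `^ (q - 1) <= L * t0 `^ (- (1 + alpha)) ->
  h <= k * expR (- (N%:R / 2) * ln (4 * pi * (s - t0 + t))) ->
  s `^ alpha * h `^ (q - 1) <= dampA * (bet * s `^ (bet - 1)) + E0 * (t0 / s ^+ 2).
Proof.
move=> c0 Hc t00 ts t_0 h0 E00 LE L0 hF FL hk.
have s0 : 0 < s by exact: lt_le_trans ts.
have qm : 0 <= q - 1 by rewrite subr_ge0 ltW.
have r1 : 0 <= dampA * (bet * s `^ (bet - 1)).
  by rewrite mulr_ge0 ?dampA_ge0// mulr_ge0 ?powR_ge0 ?ltW.
have r2 : 0 <= E0 * (t0 / s ^+ 2) by rewrite mulr_ge0// divr_ge0 ?exprn_ge0 ?ltW.
have [hs|hs] := leP s (2 * t0).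
  apply: (@le_trans _ _ (E0 * (t0 / s ^+ 2))); last by rewrite lerDr.
  have h1 : s `^ alpha <= c^-1 * t0 `^ alpha.
    have := Hc t0 s t00; rewrite ts hs => /(_ erefl).
    rewrite !powRN => H; rewrite -[s `^ alpha]invrK -[c^-1 * _]invrK lef_pV2 ?posrE ?invr_gt0 ?mulr_gt0 ?invr_gt0 ?powR_gt0//.
    by rewrite invfM invrK.
  have h2 : h `^ (q - 1) <= L * t0 `^ (- (1 + alpha)).
    by apply: le_trans FL; apply: ge0_ler_powR; rewrite ?nnegrE// (le_trans h0).
  apply: (@le_trans _ _ (c^-1 * t0 `^ alpha * (L * t0 `^ (- (1 + alpha))))).
    by apply: ler_pM => //; exact: powR_ge0.
  have -> : c^-1 * t0 `^ alpha * (L * t0 `^ (- (1 + alpha))) = c^-1 * L / t0.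
    rewrite mulrACA -powRD; last by rewrite (gt_eqF t00) implybT.
    by rewrite opprD addrCA subrr addr0 powR_inv1// ltW.
  (* This and [s^alpha <= t0^alpha / c] on the window produce the constant [4 / c] in the hypothesis
     on [E0]. *)
  have h3 : (4 * t0)^-1 <= t0 / s ^+ 2.
    rewrite ler_pdivlMr ?exprn_gt0// mulrC ler_pdivrMr ?mulr_gt0//.
    have -> : t0 * (4 * t0) = (2 * t0) ^+ 2 by ring.
    by rewrite lerXn2r ?nnegrE ?(ltW s0)// (le_trans (ltW s0)).
  apply: le_trans (ler_wpM2l E00 h3).
  have -> : c^-1 * L / t0 = 4 / c * L * (4 * t0)^-1 by field; rewrite !gt_eqF.
  by rewrite ler_wpM2r// invr_ge0 mulr_ge0 ?ltW.
apply: (@le_trans _ _ (dampA * (bet * s `^ (bet - 1)))); last by rewrite lerDl.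
have p2 : 0 < 2 * pi :> R by rewrite mulr_gt0 ?pi_gt0.
(* Since [s > 2 t0], the age [s - t0 + t] of the flow is at least [s / 2]. *)
have hk' : h <= k * expR (- (N%:R / 2) * (ln (2 * pi) + ln s)).
  apply: (le_trans hk); rewrite ler_wpM2l ?(ltW k0)// ler_expR !mulNr lerN2.
  rewrite ler_wpM2l ?divr_ge0 ?ler0n// -lnM ?posrE// ler_ln ?posrE ?mulr_gt0 ?pi_gt0//; last lra.
  have -> : 4 * pi * (s - t0 + t) = 2 * pi * (2 * (s - t0 + t)) by ring.
  by rewrite ler_wpM2l ?(ltW p2)//; lra.
apply: (@le_trans _ _ (s `^ alpha * (k * expR (- (N%:R / 2) * (ln (2 * pi) + ln s))) `^ (q - 1))).
  rewrite ler_wpM2l ?powR_ge0//; apply: ge0_ler_powR; rewrite ?nnegrE//.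
  by rewrite mulr_ge0 ?expR_ge0 ?ltW.
rewrite powRM ?expR_ge0 ?(ltW k0)// -expRM.
have -> : dampA * (bet * s `^ (bet - 1)) =
    k `^ (q - 1) * expR (- (N%:R / 2) * (q - 1) * ln (2 * pi)) * s `^ (bet - 1).
  by rewrite /dampA mulrA divfK// gt_eqF.
have -> r : s `^ r = expR (r * ln s) by rewrite /powR gt_eqF.
have -> r : s `^ r = expR (r * ln s) by rewrite /powR gt_eqF.
rewrite mulrCA -[leRHS]mulrA ler_wpM2l ?powR_ge0//.
rewrite -!expRD ler_expR /bet le_eqVlt; apply/orP; left; apply/eqP; ring.
Qed.

(** Where [m H > U] with [m <= 1], also [U <= H], hence [U^q <= m H * H^(q-1)]. The absorption of
    [U] is then at most [m H] times the coefficient that the damping rate dominates. *)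
Lemma damped_subsolution (E0 t0 : R) (H U : @jet R N) (p : E) : 0 < p.2 ->
  0 <= j0 H p -> jfh H p = 0 -> 0 < j0 U p ->
  0 < damp E0 t0 p.2 <= 1 ->
  jfh U p = - (p.2 `^ alpha * j0 U p `^ q) ->
  p.2 `^ alpha * j0 H p `^ (q - 1) <= dampA * (bet * p.2 `^ (bet - 1)) + E0 * (t0 / p.2 ^+ 2) ->
  let w := jadd (jmul (jtime (damp E0 t0) (damp1 E0 t0)) H) (jscl (-1) U) in
  0 < j0 w p -> jfh w p <= 0.
Proof.
move=> p0 H0 HH U0 /andP[m0 m1] HU Habs w.
rewrite -[j0 w p]/(damp E0 t0 p.2 * j0 H p + -1 * j0 U p) mulN1r subr_gt0 => wp.
rewrite /w jfh_add jfh_scl HU mulN1r opprK.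
have -> : jfh (jmul (jtime (damp E0 t0) (damp1 E0 t0)) H) p = damp1 E0 t0 p.2 * j0 H p.
  rewrite /jfh jlap_mul jlap_time mul0r add0r big1 ?mulr0 ?add0r; last first.
    by move=> i _; rewrite -[jx (jtime _ _) _ _]/(0 : R) mul0r.
  rewrite -[jt (jmul _ _) _]/(damp1 E0 t0 p.2 * j0 H p + damp E0 t0 p.2 * jt H p).
  rewrite -[j0 (jtime _ _) p]/(damp E0 t0 p.2) -addrA -mulrBr.
  by rewrite -[jt H p - _]/(jfh H p) HH mulr0 addr0.
set m := damp E0 t0 p.2 in m0 m1 wp *.
have qm : 0 < q - 1 by rewrite subr_gt0.
have Uq : j0 U p `^ q <= m * j0 H p * j0 H p `^ (q - 1).
  rewrite -(mulr_powRB1 (ltW U0)) ?(lt_trans ltr01)//.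
  apply: ler_pM; rewrite ?powR_ge0 ?(ltW U0) ?(ltW wp)//.
  apply: ge0_ler_powR; rewrite ?nnegrE ?(ltW U0) ?(ltW qm)//.
  by rewrite (le_trans (ltW wp))// ler_piMl.
apply: (@le_trans _ _ (damp1 E0 t0 p.2 * j0 H p + p.2 `^ alpha * (m * j0 H p * j0 H p `^ (q - 1)))).
  by rewrite lerD2l ler_wpM2l ?powR_ge0.
rewrite /damp1 -/m.
set X := dampA * _ + _ in Habs *.
have -> : m * - X * j0 H p + p.2 `^ alpha * (m * j0 H p * j0 H p `^ (q - 1)) =
  m * j0 H p * (p.2 `^ alpha * j0 H p `^ (q - 1) - X) by ring.
by rewrite mulr_ge0_le0 ?subr_le0// mulr_ge0// ltW.
Qed.

End damping.

(** * Vanishing of the excess *)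

Section near_kato.
Context {R : realType} {N : nat}.
Notation E := ('rV[R]_N * R)%type.
Notation EM := ('rV[R]_N * measurableTypeR R)%type.
Notation mu := (@spacetime_leb R N).

(** A Gaussian of unit mass thereby replaces the indicator of a ball, and window integrals reduce to
    [heat_time_int]. *)
Lemma heat_one (S : R) : exists2 C : R, 0 <= C & forall x : 'rV[R]_N, sqn x <= S -> 1 <= C * heat 1 x.
Proof.
exists (expR (S / 4 + N%:R / 2 * ln (4 * pi))) => [|x xS]; first exact: expR_ge0.
rewrite /heat -expRD -[leLHS]expR0 ler_expR !mulr1.
have : 4^-1 * sqn x <= 4^-1 * S by rewrite ler_wpM2l.
by rewrite !mulNr; lra.
Qed.

Lemma intg_rise_heat (a : 'rV[R]_N) (t d : R) : 0 < d ->
  intg mu (fun p => rise1 t d p.2 * heat 1 (p.1 - a)) /\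
  Int mu (fun p => rise1 t d p.2 * heat 1 (p.1 - a)) = 1.
Proof.
move=> d0; have [I0 E0] := Int_rise t d0; have [_ _ _ h _] := riseP t d0.
have := @heat_time_int R N (rise1 t d) (fun=> 1) a (measurable_cst _) _ _ I0.
rewrite E0; apply => // s; by have /andP[] := h s.
Qed.

Variables (T rho : R) (a : 'rV[R]_N).
Hypothesis rho0 : 0 < rho.
Notation psi := (jplat a (rho ^+ 2 / 2) (rho ^+ 2)).

(** Kato's inequality with a plateau in space and a time cutoff rising on [[t0, t0 + h]] and falling
    on [[t, 2 t]]: the fall gives the quantity to be bounded, the rise costs the initial bound [d],
    the edge of the plateau the bound [B]. The result is an integrable majorant [G], which can be
    added to other pointwise bounds before integrating. The constants depend on neither [w] nor the
    times. *)
Lemma near_kato : exists Ch Kv : R, [/\ 0 <= Ch, 0 <= Kv,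
  forall x, sqn (x - a) <= rho ^+ 2 -> 1 <= Ch * heat 1 (x - a) &
  forall (w : @jet R N) (D : set E) (t0 h t d B : R),
  let K : set E := [set x | `|x - a| <= rho] `*` `[t0, 2 * t] in
  [/\ 0 < t0, 0 < h, t0 + h <= t & 2 * t < T] -> K `<=` D -> C21 D w -> 0 <= d -> 0 <= B ->
  (forall p, K p -> 0 < j0 w p -> jfh w p <= 0) ->
  (forall p, K p -> p.2 <= t0 + h -> j0 w p <= d) ->
  (forall p, K p -> rho ^+ 2 / 2 <= sqn (p.1 - a) -> j0 w p <= B) ->
  exists G, [/\ intg mu G,
    forall p, pos (j0 w p) * (rise1 t t p.2 * j0 psi p) <= G p &
    Int mu G <= d * Ch + B * Kv]].
Proof.
have r2 : 0 < rho ^+ 2 by rewrite exprn_gt0.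
have s01 : rho ^+ 2 / 2 < rho ^+ 2 by rewrite ltr_pdivrMr// ltr_pMr// ltr1n.
have [P1 P2 P3 P4 P5] := plateauP a s01.
have [Ch Ch0 HCh] := heat_one (rho ^+ 2).
pose b := `|a| + rho.
have out (p : E) : ~ (`|p.1 - a| <= rho) -> rho ^+ 2 < sqn (p.1 - a).
  move=> /negP; rewrite -ltNge => h; apply: lt_le_trans (norm_sqr_le_sqn _).
  by rewrite ltrXn2r ?nnegrE ?(ltW rho0)// ltW.
have Pb (p : E) : b < `|p.1| -> j0 psi p = 0.
  move=> h; apply: P4; apply: ltW; apply: out => h2.
  by have := lerB_dist p.1 a; move: h; rewrite /b; lra.
have [M M0 HM] := @C21_bounded R N psi b 0 T P1 Pb.
pose b1 := b + `|T| + 1.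
pose F (p : EM) : R := \1_(cube b1) p.
have F0 p : 0 <= F p by rewrite /F indicE.
have IF : intg mu F.
  apply: (@intg_bounded R N _ b1 1).
  - by apply: (measurable_indic (D := setT) (U := cube b1 : set EM)); exact: measurable_cube.
  - by move=> p; rewrite /F indicE ger0_norm// lern1; case: (_ \in _).
  - by move=> p Hp; rewrite /F indicE memNset.
exists Ch, (N%:R * M * Int mu F); split => //.
  by rewrite !mulr_ge0//; apply: Int_ge0.
  by move=> x; exact: HCh.
move=> w D t0 h t d B K [t00 h0 t0h tT] KD Hw d0 B0 sub init far.
have t_0 : 0 < t by apply: lt_le_trans t0h; rewrite addr_gt0.
have cK : compact K.
  apply: compact_setX; last exact: segment_compact.
  apply: bounded_closed_compact.
    exists b; split; first exact: num_real.
    move=> M' bM x /= xr; rewrite (le_trans _ (ltW bM))// /b.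
    by have := lerB_dist x a; lra.
  apply: (@preimage_closed 'rV[R]_N R (fun x => `|x - a|) [set s : R | s <= rho]).
    by move=> x _; exact: (@continuous_dist R 'rV[R]_N).
  exact: closed_le.
have [u1 u2 u3 u4 u5] := riseP t0 h0.
have [v1 v2 v3 v4 v5] := riseP t t_0.
have Hs := sc2_mul (sc2_rise t0 h) (sc2_add (sc2_cst (1 : R)) (sc2_scale (-1) (sc2_rise t t))).
set eta := (X in sc2 X _ _) in Hs; set eta1 := (X in sc2 _ X _) in Hs.
have etaE s : eta s = rise t0 h s * (1 - rise t t s) by rewrite /eta /cst mulN1r.
(* The rise is over before the fall begins, because [t0 + h <= t]. *)
have eta1E s : eta1 s = rise1 t0 h s * (1 - rise t t s) - rise1 t t s.
  rewrite /eta1 /cst add0r !mulN1r; congr (_ + _); rewrite mulrN; congr (- _).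
  have [/v1[_ ->]|h1] := leP s t; first by rewrite mulr0.
  by rewrite (u2 s _).1 ?mul1r// (le_trans t0h)// ltW.
have eta01 s : 0 <= eta s <= 1.
  rewrite etaE; have /andP[a1 a2] := u3 s; have /andP[a3 a4] := v3 s.
  have b2 : 0 <= 1 - rise t t s by rewrite subr_ge0.
  have b3 : 1 - rise t t s <= 1 by rewrite lerBlDr lerDl.
  by apply/andP; split; [exact: mulr_ge0|exact: mulr_ile1].
have eta_out s : ~ (t0 <= s <= 2 * t) -> eta s = 0 /\ rise1 t t s = 0.
  move=> H; have [h1|h1] := leP s t0.
    rewrite etaE (u1 _ h1).1 mul0r; split => //; apply: (v1 s _).2.
    by rewrite (le_trans h1)// (le_trans _ t0h)// lerDl ltW.
  have h2 : t + t <= s.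
    rewrite leNgt; apply/negP => h2; apply: H; rewrite (ltW h1)/= ltW//.
    by rewrite mulr_natl mulr2n.
  by rewrite etaE (v2 _ h2).1 subrr mulr0 (v2 _ h2).2.
pose tau : @jet R N := jtime eta eta1.
have Htau : C21 setT tau by exact: C21_sc2_time Hs.
pose z := jmul psi tau.
have Hz : C21 setT z by exact: C21_mul.
have zE p : j0 z p = j0 psi p * eta p.2 by [].
have zK p : ~ K p -> j0 z p = 0.
  move=> Kp; rewrite zE; have [h1|/out h1] := pselect (`|p.1 - a| <= rho); last first.
    by rewrite P4 ?mul0r// ltW.
  have [h2|/eta_out[-> _]] := pselect (t0 <= p.2 <= 2 * t); last by rewrite mulr0.
  by exfalso; apply: Kp; split => //=; rewrite in_itv.
have z0 p : 0 <= j0 z p.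
  by rewrite zE mulr_ge0//; [have /andP[] := P2 p|have /andP[] := eta01 p.2].
have HK := kato cK KD Hw Hz zK z0 sub.
have oK : open (~` K) by exact: open_setC_compact.
have Jz : jets0 z (~` K) by apply: C21_jets0 Hz zK.
have Ik : intg mu (fun p => pos (j0 w p) * jbh z p).
  apply: (intg_cut cK KD) => p Dp; last by rewrite (jets0_jbh Jz)// mulr0.
  apply: cvgM; last exact: (continuous_jbh Hz).
  apply: (@continuous_comp E R R (j0 w) (@pos R)); first exact: (C21_c0 Hw).
  exact: continuous_pos.
have [I1 E1] := intg_rise_heat a t0 h0.
pose G p := pos (j0 w p) * jbh z p + (d * Ch) * (rise1 t0 h p.2 * heat 1 (p.1 - a)) + B * (N%:R * M) * F p.
have IG : intg mu G by apply: intgD; [apply: intgD => //; exact: intgZ|exact: intgZ].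
exists G; split => //; last first.
  rewrite /G IntD; [|by apply: intgD => //; exact: intgZ|exact: intgZ].
  rewrite IntD//; last exact: intgZ.
  rewrite !IntZ// E1 mulr1 -mulrA lerD2r -[leRHS]add0r lerD2r//.
have jb p : jbh z p = - jlap psi p * eta p.2 - j0 psi p * eta1 p.2.
  by rewrite jbh_mul_time /jbh P5 oppr0 sub0r.
have rs0 p : 0 <= rise1 t0 h p by have /andP[] := u4 p.
have hk0 p : 0 <= heat 1 (p - a) by rewrite ltW// heat_gt0.
have G2 p : 0 <= (d * Ch) * (rise1 t0 h p.2 * heat 1 (p.1 - a)).
  by apply: mulr_ge0; [exact: mulr_ge0|apply: mulr_ge0; [exact: rs0|exact: hk0]].
have G3 p : 0 <= B * (N%:R * M) * F p.
  by apply: mulr_ge0 => //; apply: mulr_ge0 => //; exact: mulr_ge0.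
move=> p; have [Kp|Kp] := pselect (K p); last first.
  have -> : rise1 t t p.2 * j0 psi p = 0.
    have [h1|/out h1] := pselect (`|p.1 - a| <= rho); last by rewrite P4 ?mulr0// ltW.
    have [h2|/eta_out[_ ->]] := pselect (t0 <= p.2 <= 2 * t); last by rewrite mul0r.
    by exfalso; apply: Kp; split => //=; rewrite in_itv.
  by rewrite mulr0 /G (jets0_jbh Jz)// mulr0 add0r addr_ge0.
have wp0 := pos_ge0 (j0 w p).
have /andP[q0 q1] := P2 p.
have /andP[e0 e1] := eta01 p.2.
have key : rise1 t t p.2 * j0 psi p = jbh z p + rise1 t0 h p.2 * (1 - rise t t p.2) * j0 psi p + jlap psi p * eta p.2.
  rewrite jb eta1E; ring.
rewrite key /G; set X := rise1 t0 h p.2 * _ * _; set Y := jlap psi p * _.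
rewrite -[leRHS]addrA; have -> : pos (j0 w p) * (jbh z p + X + Y) =
  pos (j0 w p) * jbh z p + (pos (j0 w p) * X + pos (j0 w p) * Y) by ring.
rewrite lerD2l /X /Y; apply: lerD.
  have [rz|rz] := eqVneq (rise1 t0 h p.2) 0; first by rewrite rz !mul0r !mulr0.
  have pt : p.2 <= t0 + h by rewrite leNgt; apply/negP => /ltW /u2[_ h2]; rewrite h2 eqxx in rz.
  have wd : pos (j0 w p) <= d by rewrite /pos ge_max init.
  have [ps|/ltW /P4 ->] := leP (sqn (p.1 - a)) (rho ^+ 2); last by rewrite !mulr0.
  have -> : d * Ch * (rise1 t0 h p.2 * heat 1 (p.1 - a)) =
    d * (rise1 t0 h p.2 * (Ch * heat 1 (p.1 - a))) by ring.
  have /andP[y0 y1] := v3 p.2.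
  have y5 : 0 <= 1 - rise t t p.2 by rewrite subr_ge0.
  have y6 : 1 - rise t t p.2 <= 1 by rewrite lerBlDr lerDl.
  have y2 : 0 <= (1 - rise t t p.2) * j0 psi p by exact: mulr_ge0.
  have y3 : (1 - rise t t p.2) * j0 psi p <= 1.
    exact: mulr_ile1.
  rewrite -(mulrA (rise1 t0 h p.2)); apply: ler_pM => //; first exact: mulr_ge0.
  by rewrite ler_wpM2l ?rs0// (le_trans y3)// HCh.
have Fp : F p = 1.
  rewrite /F indicE mem_set//; case: Kp => /= h1; rewrite in_itv /= => /andP[h2 h3].
  rewrite /b1 /b; split.
    have := lerB_dist p.1 a; have := normr_ge0 T; lra.
  rewrite ger0_norm ?(le_trans (ltW t00))// (le_lt_trans h3)// (lt_le_trans tT)//.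
  rewrite (le_trans (ler_norm T))//; have := rho0; have := normr_ge0 a; lra.
rewrite Fp mulr1; have [near|h1] := ltP (sqn (p.1 - a)) (rho ^+ 2 / 2).
  have -> : jlap psi p = 0.
    pose J := jadd psi (jcst (-1)).
    have HJ : C21 setT J by apply: C21_add => //; exact: C21_cst.
    have [_ _ _ hx] : jets0 J [set p | sqn (p.1 - a) < rho ^+ 2 / 2].
      apply: C21_jets0 HJ _ => //.
        apply: (@open_comp E R (fun p => sqn (p.1 - a)) [set s : R | s < rho ^+ 2 / 2]); last exact: open_lt.
        by move=> ? _; exact: continuous_sqn.
      by move=> p' /= h'; rewrite -[LHS]/(j0 psi p' + -1) P3 ?subrr// ltW.
    rewrite /jlap big1// => i _; have := hx p i i near.
    by rewrite -[jxx J i i p]/(jxx psi i i p + 0) addr0.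
  by rewrite mul0r mulr0; apply: mulr_ge0 => //; exact: mulr_ge0.
have wB : pos (j0 w p) <= B by rewrite /pos ge_max far.
have NM : 0 <= N%:R * M by rewrite mulr_ge0.
apply: (@le_trans _ _ (pos (j0 w p) * (N%:R * M))); last by rewrite ler_wpM2r.
rewrite ler_wpM2l// (le_trans (ler_norm _))// normrM (ger0_norm e0) -[leRHS]mulr1.
apply: ler_pM => //; apply: sum_le_bound => i.
have [_ _ _ hx] := jnormP psi p; rewrite (le_trans (hx i i))// HM//.
case: Kp => _; rewrite /= in_itv /= => /andP[h2 h3].
by rewrite (le_trans (ltW t00) h2) (le_trans h3 (ltW tT)).
Qed.

End near_kato.

Section arithmetic.
Context {R : realType}.
Implicit Types t h d r : R.

Lemma quarters_add t0 h t : t0 < t / 4 -> h <= t / 4 -> 0 < t ->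
  [/\ t0 + h <= t, 2 * t + h <= 3 * t & t / 2 + t0 <= t].
Proof. by move=> *; split; lra. Qed.

Lemma parallelogram_far (x y z r : R) : z <= 2 * x + 2 * y -> y <= r / 16 -> r / 2 <= z ->
  0 <= r -> r / 16 <= x.
Proof. lra. Qed.

Lemma two_thirds d : 0 < d -> d / 3 + d / 3 <= d.
Proof. lra. Qed.
End arithmetic.

(** * The damped flow near the singular point *)

Section near_estimate.
Context {R : realType} {N : nat}.
Notation E := ('rV[R]_N * R)%type.
Notation EM := ('rV[R]_N * measurableTypeR R)%type.
Notation mu := (@spacetime_leb R N).
Notation lam := (leb R N).
Variables (Omega : set 'rV[R]_N) (T k : R) (a : 'rV[R]_N) (V A : E -> R).
Hypothesis HW : weak Omega T k a V A.
Hypothesis hC2 : C2_boundary Omega.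
Variables (alpha q : R) (U : @jet R N).
Notation Q := (cylinder Omega T).
Hypothesis q1 : 1 < q.
Hypothesis al : -1 < alpha.
Hypothesis k0 : 0 < k.
Hypothesis T0 : 0 < T.
Hypothesis bet0 : 0 < @bet R N alpha q.
Hypothesis HU : C21 Q U.
Hypothesis U0 : forall p, Q p -> 0 < j0 U p.
Hypothesis Ueq : forall p, Q p -> jfh U p = - (p.2 `^ alpha * j0 U p `^ q).
Hypothesis Htr : forall B, open B -> B `<=` Omega -> B a ->
  (\int[lam]_(x in B) (j0 U (x, t))%:E)%E @[t --> 0^'+] --> +oo%E.
Notation W := (excess Omega T V U).
Notation bet := (@bet R N alpha q).
Notation dampA := (@dampA R N alpha q k).
Notation damp := (@damp R N alpha q k).
Notation damp1 := (@damp1 R N alpha q k).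

Lemma sqn_parallelogram (x y : 'rV[R]_N) : sqn x <= 2 * sqn (x - y) + 2 * sqn y.
Proof.
rewrite /sqn !mulr_sumr -big_split; apply: ler_sum => i _ /=; rewrite !mxE.
have := sqr_ge0 (x ord0 i - 2 * y ord0 i); rewrite !expr2; lra.
Qed.

Lemma flow_le_sup (f : 'rV[R]_N -> R) (c F : R) p : intg lam f ->
  (forall y, f y <= F) -> 0 < p.2 + c -> j0 (flow f c) p <= F.
Proof.
move=> If fF p0; have [I1 E1] := intg_heat p.1 p0.
rewrite flowE -[F]mulr1 -E1 -IntZ//; apply: Int_le; [exact: intg_flow|exact: intgZ|].
by move=> y; rewrite ler_wpM2r// ltW// heat_gt0.
Qed.

Lemma heat_le_peak (t : R) (x : 'rV[R]_N) : 0 < t ->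
  heat t x <= expR (- (N%:R / 2) * ln (4 * pi * t)).
Proof.
move=> t_0; have h : 0 < t <= t by rewrite t_0 lexx.
rewrite (le_trans (heat_le x h))// ler_piMr ?expR_ge0//.
by rewrite -[leRHS]expR0 ler_expR oppr_le0 divr_ge0 ?sqn_ge0// mulr_ge0 ?ltW.
Qed.

(** The choices are nested: first the radius [eps] of the support and the smallness [lam0] of the
    factor, then [t0] and the datum [f], then the scale [dd] of uniform continuity of [U] at time
    [t0], and last the smoothing time [h]. The same [d] serves as tolerance and as the constant [E0]
    of the damping. *)
Lemma exists_subsolution (rho M1 : R) : 0 < rho ->
  (forall x, `|x - a| <= rho -> Omega x) ->
  (forall t (x : 'rV[R]_N), 0 < t -> (rho / 4) ^+ 2 <= sqn x -> heat t x <= M1 * t) -> 0 <= M1 ->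
  (exists C, forall x t, `|x - a| <= rho -> 0 < t < Num.min 1 T ->
    j0 U (x, t) `^ (q - 1) <= C * t `^ (- (1 + alpha))) ->
  forall t d, 0 < t -> 2 * t < Num.min 1 T -> 0 < d ->
  exists t0 h (H : @jet R N) (D : set E),
  let w := jadd (jmul (jtime (damp d t0) (damp1 d t0)) H) (jscl (-1) U) in
  let K : set E := [set x | `|x - a| <= rho] `*` `[t0, 2 * t] in
  [/\ [/\ 0 < t0, 0 < h & t0 + h <= t], K `<=` D /\ C21 D w,
    [/\ forall p, K p -> 0 < j0 w p -> jfh w p <= 0,
     forall p, K p -> p.2 <= t0 + h -> j0 w p <= d &
     forall p, K p -> rho ^+ 2 / 2 <= sqn (p.1 - a) -> j0 w p <= k * (M1 * (3 * t))] &
    forall p, K p -> t <= p.2 -> `|k * heat p.2 (p.1 - a) - j0 H p| <= d].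
Proof.
move=> rho0 rhoO Hfar M10 [C KO] t d t_0 tT d0.
have qm : 0 < q - 1 by rewrite subr_gt0.
have oO := wk_open HW.
pose L0 := `|C|.
have L00 : 0 <= L0 by exact: normr_ge0.
have [cw cw0 Hcw] := powR_window (- alpha).
have t2 : 0 < t / 2 by rewrite divr_gt0.
have [M M0 HM] := @heat_lipschitz R N (t / 2) t2.
have kM0 : 0 <= k * M by rewrite mulr_ge0// ltW.
have kM1 : 0 < k * M + 1 by rewrite ltr_pwDr.
(* Kernels centred in a ball of radius [eps], or with clocks differing by [eps], differ by at most
   [M * eps], which costs [d / 3] after multiplication by [k]. *)
pose eps := Num.min (rho / 4) (d / 3 / (k * M + 1)).
have eps0 : 0 < eps by rewrite lt_min !divr_gt0.
have eps_rho : eps <= rho / 4 by rewrite ge_min lexx.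
have eps_d : k * M * eps <= d / 3.
  apply: (@le_trans _ _ ((k * M + 1) * eps)); first by rewrite ler_wpM2r ?(ltW eps0)// lerDl.
  by rewrite mulrC -ler_pdivlMr// /eps ge_min lexx orbT.
clearbody eps.
have rho4 : rho / 4 <= rho by rewrite ler_pdivrMr// ler_peMr ?(ltW rho0)// ler1n.
(* [lam0] is chosen so that [l^(q-1) * Lc <= d]; as the datum satisfies [F0^(q-1) <= l^(q-1) * L0 *
   t0^(-(1 + alpha))], the constant [d] is admissible in [damp_absorbs]. *)
pose Lc := 4 / cw * L0 + 1.
have Lc0 : 0 < Lc by rewrite ltr_pwDr// mulr_ge0// divr_ge0 ?(ltW cw0).
pose lam0 := Num.min 1 ((d / Lc) `^ (q - 1)^-1).
have lam00 : 0 < lam0 by rewrite lt_min ltr01 powR_gt0// divr_gt0.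
pose t1 := Num.min (t / 4) eps.
have t10 : 0 < t1 by rewrite lt_min eps0 divr_gt0.
have t1t : t1 <= t / 4 by rewrite ge_min lexx.
have t4 : t / 4 < t by rewrite ltr_pdivrMr// ltr_pMr// ltr1n.
have tt2 : t < 2 * t by rewrite ltr_pMl// ltr1n.
have [tT1 tTT] : 2 * t < 1 /\ 2 * t < T by move: tT; rewrite lt_min => /andP[].
have t1T : t1 <= T by rewrite (le_trans t1t)// (le_trans (ltW t4))// ltW// (lt_trans tt2).
have norm_sqn (r : R) (x : 'rV[R]_N) : 0 <= r -> sqn x <= r ^+ 2 -> `|x| <= r.
  by move=> r0 h; rewrite -(@ler_pXn2r _ 2) ?nnegrE// (le_trans (norm_sqr_le_sqn _)).
have epsO x : sqn (x - a) <= eps ^+ 2 -> Omega x.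
  move=> h; apply: rhoO; rewrite (le_trans (norm_sqn _ _ (ltW eps0) h))//.
  exact: le_trans eps_rho rho4.
have [t0 [l [f [/andP[t00 t0t1] /andP[l0 llam] [If Ef] f0 fsupp]]]] :=
  exists_mass k0 HU U0 Htr eps0 epsO lam00 t10 t1T.
have t0t : t0 < t / 4 by exact: lt_le_trans t1t.
have t0e : t0 <= eps by rewrite (le_trans (ltW t0t1))// /t1 ge_min lexx orbT.
have l1 : l <= 1 by rewrite (le_trans llam)// ge_min lexx.
have lq : l `^ (q - 1) <= d / Lc.
  have dL : 0 <= d / Lc by rewrite divr_ge0 ?ltW.
  apply: (@le_trans _ _ (((d / Lc) `^ (q - 1)^-1) `^ (q - 1))).
    apply: ge0_ler_powR; rewrite ?nnegrE ?(ltW qm) ?(ltW l0) ?powR_ge0//.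
    by rewrite (le_trans llam)// ge_min lexx orbT.
  by rewrite -powRrM mulVf ?gt_eqF// powRr1.
have t0min : 0 < t0 < Num.min 1 T.
  by rewrite t00 (lt_trans _ tT)// (lt_trans t0t)// (lt_trans t4).
have Qt0 x : Omega x -> Q (x, t0).
  move=> Ox; split => //=; rewrite in_itv /= t00.
  by have /andP[_] := t0min; rewrite lt_min => /andP[].
pose F0 := l * (L0 * t0 `^ (- (1 + alpha))) `^ (q - 1)^-1.
have Lt0 : 0 <= L0 * t0 `^ (- (1 + alpha)) by rewrite mulr_ge0 ?powR_ge0.
have F00 : 0 <= F0 by rewrite mulr_ge0 ?powR_ge0 ?(ltW l0).
have fF y : f y <= F0.
  have [->//|/fsupp[h1 h2]] := eqVneq (f y) 0.
  apply: (le_trans h2); rewrite ler_wpM2l ?(ltW l0)//.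
  have hy : `|y - a| <= rho.
    by rewrite (le_trans (norm_sqn _ _ (ltW eps0) (ltW h1)))// (le_trans eps_rho).
  have Uy := U0 (Qt0 y (rhoO y hy)).
  have -> : j0 U (y, t0) = (j0 U (y, t0) `^ (q - 1)) `^ (q - 1)^-1.
    by rewrite -powRrM divff ?gt_eqF// powRr1// ltW.
  apply: ge0_ler_powR; rewrite ?nnegrE ?powR_ge0 ?invr_ge0 ?(ltW qm)//.
  by rewrite (le_trans (KO y t0 hy t0min))// ler_wpM2r ?powR_ge0// ler_norm.
have F0q : F0 `^ (q - 1) <= l `^ (q - 1) * L0 * t0 `^ (- (1 + alpha)).
  by rewrite /F0 powRM ?powR_ge0 ?(ltW l0)// -powRrM mulVf ?gt_eqF// powRr1// mulrA.
have LE : 4 / cw * (l `^ (q - 1) * L0) <= d.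
  rewrite mulrCA; apply: (@le_trans _ _ (d / Lc * Lc)); last by rewrite divfK ?gt_eqF.
  have LLc : 4 / cw * L0 <= Lc by rewrite /Lc lerDl.
  have LL0 : 0 <= 4 / cw * L0 by rewrite mulr_ge0// divr_ge0 ?(ltW cw0).
  by apply: ler_pM => //; exact: powR_ge0.
have cK' : compact ([set x : 'rV[R]_N | `|x - a| <= rho] `*` [set t0]).
  apply: compact_setX; last exact: compact_set1.
  apply: bounded_closed_compact.
    exists (`|a| + rho); split; first exact: num_real.
    move=> M' bM x /= xr; rewrite (le_trans _ (ltW bM))//.
    by rewrite -lerBlDl (le_trans (lerB_dist _ _)).
  apply: (@preimage_closed 'rV[R]_N R (fun x => `|x - a|) [set s : R | s <= rho]).
    by move=> x _; exact: (@continuous_dist R 'rV[R]_N).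
  exact: closed_le.
have oQ : open (Q : set E) by exact: open_cylinder.
have d3 : 0 < d / 3 by rewrite divr_gt0.
have KQ : [set x : 'rV[R]_N | `|x - a| <= rho] `*` [set t0] `<=` (Q : set E).
  by move=> p' [/rhoO h4 ht0]; case: p' h4 ht0 => x s /= h4 ->; exact: Qt0.
have [r2 r20 Hr2] := @uniform_near R N Q _ (j0 U) (d / 3) oQ cK' KQ (C21_c0 HU) d3.
pose dd := r2 / 2.
have dd0 : 0 < dd by rewrite divr_gt0.
have ddr : dd < r2 by rewrite ltr_pdivrMr// ltr_pMr// ltr1n.
clearbody dd.
(* Up to time [t0 + h] the clock is at most [2 h], so the tail term of [flow_le_local] is at most
   [Kc * h], and [h] is taken below [d / 3 / Kc]. *)
pose Kc := F0 * (16 / dd ^+ 2 * expR (N%:R / 2 * ln 2)) + 1.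
have Kc0 : 0 < Kc by rewrite ltr_pwDr// mulr_ge0// mulr_ge0 ?expR_ge0// divr_ge0 ?exprn_ge0 ?(ltW dd0).
pose h := Num.min (Num.min dd eps) (Num.min (t / 4) (d / 3 / Kc)).
have h0 : 0 < h by rewrite !lt_min dd0 eps0 !divr_gt0.
have hdd : h <= dd by rewrite /h !ge_min lexx.
have heps : h <= eps by rewrite /h !ge_min lexx !orbT.
have ht : h <= t / 4 by rewrite /h !ge_min lexx !orbT.
have hK : h <= d / 3 / Kc by rewrite /h !ge_min lexx !orbT.
have [t0h p4t t02] := quarters_add t0t ht t_0.
clearbody h.
(* The clock reads [h] at time [t0]: the datum has already been smoothed for a short time, so [H] is
   regular on all of [K], bottom included. *)
pose H := flow f (h - t0).
pose D : set E := [set p | Q p /\ h / 2 < p.2 + (h - t0)].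
have h2 : 0 < h / 2 by rewrite divr_gt0.
have h2h : h / 2 < h by rewrite ltr_pdivrMr// ltr_pMr// ltr1n.
exists t0, h, H, D => w K.
have KP p : K p -> [/\ `|p.1 - a| <= rho, t0 <= p.2 <= 2 * t, Q p & h <= p.2 + (h - t0)].
  move=> [h1]; rewrite /= in_itv /= => /andP[h3 h4]; split => //; first by rewrite h3.
    split; first exact: rhoO.
    by rewrite /= in_itv /= (lt_le_trans t00 h3) (le_lt_trans h4 tTT).
  by rewrite addrCA lerDl subr_ge0.
have D0 p : D p -> 0 < p.2 by move=> [[_]]; rewrite /= in_itv /= => /andP[].
have HH : C21 D H.
  by apply: C21W (C21_flow (h - t0) If h2) => p [].
have Hw : C21 D w.
  apply: C21_add; first by apply: C21_mul => //; exact: C21_damp.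
  by apply: C21_scl; apply: C21W HU => p [].
have H0 p : 0 <= j0 H p by exact: flow_ge0.
have wE p : j0 w p = damp d t0 p.2 * j0 H p - j0 U p.
  by rewrite -[LHS]/(damp d t0 p.2 * j0 H p + -1 * j0 U p) mulN1r.
have wle p : K p -> j0 w p <= j0 H p - j0 U p.
  move=> /KP[_ /andP[pt _] _ _]; rewrite wE lerD2r ler_piMl//.
  by have [/andP[]] := @damp_bounds R N alpha q k bet0 d t0 p.2 (ltW d0) t00 pt.
split.
- by [].
- split => // p Kp; have [_ _ Qp hp] := KP p Kp; split => //; exact: lt_le_trans hp.
- split=> p Kp.
  + have [_ /andP[pt _] Qp hp] := KP p Kp.
    have sp0 : 0 < p.2 + (h - t0) by exact: lt_le_trans hp.
    have p20 : 0 < p.2 by exact: lt_le_trans pt.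
    have [dm _] := @damp_bounds R N alpha q k bet0 d t0 p.2 (ltW d0) t00 pt.
    apply: (damped_subsolution q1 p20 (H0 p) (jfh_flow If sp0) (U0 Qp) dm (Ueq Qp)).
    have L1 : 0 <= l `^ (q - 1) * L0 by rewrite mulr_ge0 ?powR_ge0.
    have HF : j0 H p <= F0 by exact: flow_le_sup.
    have Hk : j0 H p <= k * expR (- (N%:R / 2) * ln (4 * pi * (p.2 - t0 + h))).
      rewrite -Ef; apply: flow_le => // y _.
      by rewrite -addrA [- t0 + h]addrC heat_le_peak.
    exact: (damp_absorbs q1 k0 bet0 cw0 Hcw t00 pt h0 (H0 p) (ltW d0) LE L1 HF F0q Hk).
  + move=> pth; have [px /andP[pt _] Qp hp] := KP p Kp.
    have sp0 : 0 < p.2 + (h - t0) by exact: lt_le_trans hp.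
    apply: (le_trans (wle p Kp)).
    have Kx : ([set x : 'rV[R]_N | `|x - a| <= rho] `*` [set t0]) (p.1, t0) by split.
    have Ux := U0 (Qt0 _ (rhoO _ px)).
    have b0 : 0 <= j0 U (p.1, t0) + d / 3 by rewrite addr_ge0 ?ltW.
    have fb y : `|y - p.1| <= dd -> f y <= j0 U (p.1, t0) + d / 3.
      move=> hy; have [->//|/fsupp[h1 h3]] := eqVneq (f y) 0.
      have Sy : slab dd (- dd) dd ((y, t0) - (p.1, t0) : E).
        by split => //=; rewrite subrr oppr_le0 (ltW dd0).
      have [Qy Uy] := Hr2 dd dd0 ddr (p.1, t0) (y, t0) Kx Sy.
      apply: (le_trans h3); apply: (@le_trans _ _ (j0 U (y, t0))).
        by rewrite ler_piMl// ltW// U0.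
      by rewrite -lerBlDl (le_trans (ler_norm _)).
    have step1 := flow_le_local If f0 sp0 dd0 b0 fF fb.
    have step2 : F0 * (8 * (p.2 + (h - t0)) / dd ^+ 2 * expR (N%:R / 2 * ln 2)) <= d / 3.
      have sp2 : p.2 + (h - t0) <= 2 * h.
        by rewrite addrCA mulr_natl mulr2n lerD2l lerBlDl.
      apply: (@le_trans _ _ (Kc * h)); last by rewrite mulrC -ler_pdivlMr.
      rewrite /Kc [leRHS]mulrDl -[leLHS]addr0; apply: lerD; last by rewrite mul1r ltW.
      rewrite -(mulrA F0) ler_wpM2l//.
      have -> : 16 / dd ^+ 2 * expR (N%:R / 2 * ln 2) * h = 8 * (2 * h) / dd ^+ 2 * expR (N%:R / 2 * ln 2).
        by ring.
      rewrite ler_wpM2r ?expR_ge0// ler_wpM2r ?invr_ge0 ?exprn_ge0 ?(ltW dd0)//.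
      by rewrite ler_wpM2l.
    have Sp : slab dd (- dd) dd (p - (p.1, t0) : E).
      split; rewrite /= ?subrr ?normr0 ?(ltW dd0)//; apply/andP; split.
        by rewrite (@le_trans _ _ 0) ?oppr_le0 ?(ltW dd0)// subr_ge0.
      by rewrite lerBlDl (le_trans pth)// lerD2l.
    have [_ Us] := Hr2 dd dd0 ddr (p.1, t0) p Kx Sp.
    have Us' : j0 U (p.1, t0) <= j0 U p + d / 3.
      by rewrite -lerBlDl (le_trans (ler_norm _))// distrC.
    rewrite -/H in step1; rewrite lerBlDr (le_trans step1)//.
    have -> : d + j0 U p = j0 U p + d / 3 + d / 3 + d / 3 by field.
    by rewrite lerD// lerD2r.
  + move=> pr; have [px /andP[pt pt2] Qp hp] := KP p Kp.
    have sp0 : 0 < p.2 + (h - t0) by exact: lt_le_trans hp.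
    apply: (le_trans (wle p Kp)); rewrite -Ef lerBlDr -[leLHS]addr0 lerD ?(ltW (U0 Qp))//.
    apply: flow_le => // y /fsupp[h1 _].
    apply: (@le_trans _ _ (M1 * (p.2 + (h - t0)))).
      apply: Hfar => //.
      have e2 : eps ^+ 2 <= (rho / 4) ^+ 2.
        by rewrite lerXn2r ?nnegrE ?(ltW eps0)// (le_trans (ltW eps0)).
      have := sqn_parallelogram (p.1 - a) (y - a).
      rewrite opprB addrA subrK; move: (sqn (p.1 - y)) (sqn (y - a)) (sqn (p.1 - a)) h1 pr => A1 A2 A3 h1 pr h5.
      have h6 := le_trans (ltW h1) e2.
      have h7 : (rho / 4) ^+ 2 = rho ^+ 2 / 16 by field.
      rewrite h7 in h6 *; have h8 := sqr_ge0 rho.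
      exact: parallelogram_far h5 h6 pr h8.
    rewrite ler_wpM2l// (le_trans _ p4t)// addrA.
    by rewrite lerBlDr (le_trans (lerD pt2 (lexx h)))// lerDl ltW.
- move=> p Kp tp; have [px /andP[pt pt2] Qp hp] := KP p Kp.
  have sp0 : 0 < p.2 + (h - t0) by exact: lt_le_trans hp.
  have th : t / 2 <= p.2 + (h - t0).
    rewrite addrA lerBrDr (@le_trans _ _ t)//.
    by rewrite -[leLHS]addr0 lerD// ltW.
  have tp2 : t / 2 <= p.2.
    by rewrite (le_trans _ tp)// ler_pdivrMr// ler_peMr ?(ltW t_0)// ler1n.
  rewrite distrC -Ef; apply: (le_trans (flow_close (d := M * (eps + eps)) If f0 sp0 _)).
    move=> y /fsupp[h1 _].
    have := HM (p.2 + (h - t0)) p.2 (p.1 - y) (p.1 - a) th tp2.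
    move=> /le_trans; apply; rewrite ler_wpM2l// lerD//.
      rewrite opprB addrC addrA subrK distrC; exact: (norm_sqn _ _ (ltW eps0) (ltW h1)).
    rewrite [p.2 + _]addrC addrK ler_norml; apply/andP; split.
      by rewrite lerBrDl (@le_trans _ _ 0)// ?(ltW h0)// subr_le0.
    by rewrite lerBlDr (le_trans heps)// lerDl ltW.
  rewrite Ef mulrA mulrDr (le_trans (lerD eps_d eps_d))//.
  exact: two_thirds.
Qed.

End near_estimate.

Lemma damped_comparison (R : realType) (P m H g d v u : R) : m * H - u <= P ->
  (1 - m) * H <= (1 - m) * (g + d) -> (1 - m) * d <= d -> v <= g -> g - H <= d ->
  v - u <= 2 * d + (1 - m) * g + P.
Proof. lra. Qed.

Lemma add_quarters (R : realType) (x y z e : R) : x + z <= e / 4 -> y <= e / 4 -> 0 < e ->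
  x + y + e / 4 + z <= e.
Proof. lra. Qed.

Lemma sum_halves_lt (R : realType) (x y z c : R) : x <= 0 -> y <= c / 4 -> z <= c / 4 -> 0 < c ->
  c <= x + y + z -> False.
Proof. lra. Qed.

(** * The mass of the excess at small times *)

Section vanishing.
Context {R : realType} {N : nat}.
Notation E := ('rV[R]_N * R)%type.
Notation EM := ('rV[R]_N * measurableTypeR R)%type.
Notation mu := (@spacetime_leb R N).
Notation lam := (leb R N).
Variables (Omega : set 'rV[R]_N) (T k : R) (a : 'rV[R]_N) (V A : E -> R).
Hypothesis HW : weak Omega T k a V A.
Hypothesis hC2 : C2_boundary Omega.
Variables (alpha q : R) (U : @jet R N).
Notation Q := (cylinder Omega T).
Hypothesis q1 : 1 < q.
Hypothesis al : -1 < alpha.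
Hypothesis k0 : 0 < k.
Hypothesis T0 : 0 < T.
Hypothesis bet0 : 0 < @bet R N alpha q.
Hypothesis AE : forall p, Q p -> A p = p.2 `^ alpha * V p `^ q.
Hypothesis HU : C21 Q U.
Hypothesis U0 : forall p, Q p -> 0 < j0 U p.
Hypothesis Ueq : forall p, Q p -> jfh U p = - (p.2 `^ alpha * j0 U p `^ q).
Hypothesis Htr : forall B, open B -> B `<=` Omega -> B a ->
  (\int[lam]_(x in B) (j0 U (x, t))%:E)%E @[t --> 0^'+] --> +oo%E.
Notation W := (excess Omega T V U).
Notation bet := (@bet R N alpha q).

Let W0 p : 0 <= W p. Proof. exact: excess_ge0. Qed.
Let WV p : W p <= V p. Proof. exact: (excess_le HW). Qed.
Let IW : intg mu W. Proof. exact: (intg_excess HW HU U0). Qed.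
Let Wheat p : Q p -> W p <= k * heat p.2 (p.1 - a).
Proof. by move=> Qp; exact: le_trans (WV p) (weak_le_heat HW hC2 Qp). Qed.

Let intg_W_window (t d : R) (P : @jet R N) : 0 < d -> C21 setT P ->
  (forall p, 0 <= j0 P p <= 1) -> intg mu (fun p => W p * (rise1 t d p.2 * j0 P p)).
Proof.
move=> d0 HP P01; have [_ _ _ h _] := riseP t d0.
apply: (@intgM _ _ _ _ _ _ (9 / d)) => //.
  apply: measurable_E_continuous => p; apply: cvgM; last exact: (C21_c0 HP).
  by apply: continuous_time; have [_ c1 _ _ _] := sc2_rise t d; exact: c1.
move=> p; have /andP[h1 h2] := h p.2; have /andP[h3 h4] := P01 p.
by rewrite (ger0_norm (mulr_ge0 h1 h3)) -[leRHS]mulr1; exact: ler_pM.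
Qed.

(** With [g = k G] the Gaussian bound of [V], [V - U] is at most [(g - H) + (1 - m) H + (m H - U)].
    On the window the first term is at most the tolerance, the second yields [K2 * t^bet] from the
    damping, and the positive part of the third is bounded by [near_kato], where the edge of the
    plateau yields [K1 * t]. The constants do not depend on [e], so [e] may go to 0 at fixed [t]. *)
Lemma trace_near : exists rho K1 K2 ts, [/\ 0 < rho, 0 <= K1, 0 <= K2, 0 < ts &
  forall t e, 0 < t < ts -> 0 < e ->
  Int mu (fun p => W p * (rise1 t t p.2 * j0 (jplat a (rho ^+ 2 / 2) (rho ^+ 2)) p))
   <= K1 * t + K2 * t `^ bet + e].
Proof.
have oO := wk_open HW.
have [rho [C [rho0 rhoO KO]]] := near_bound oO q1 al HU U0 Ueq (wk_a HW).
have [M1 M10 Hfar] := @heat_far R N (rho / 4) (divr_gt0 rho0 (ltr0Sn _ _)).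
have [Ch [Kv [Ch0 Kv0 HCh Hkato]]] := @near_kato R N T rho a rho0.
have dA := @dampA_ge0 R N alpha q k bet0.
pose K1 := k * M1 * 3 * Kv; pose K2 := dampA (N := N) alpha q k * 2 `^ bet * k.
have kk := ltW k0.
exists rho, K1, K2, (Num.min 1 T / 2); split => //.
- by rewrite /K1 !mulr_ge0.
- by apply: mulr_ge0 kk; apply: mulr_ge0 dA _; exact: powR_ge0.
- by rewrite divr_gt0// lt_min ltr01.
move=> t e /andP[t_0 tts] e0.
have tT : 2 * t < Num.min 1 T by rewrite mulrC -ltr_pdivlMr.
have tT' : 2 * t < T by move: tT; rewrite lt_min => /andP[].
have L0 : 0 < 3 * Ch + k by rewrite ltr_wpDl// mulr_ge0.
(* [3 * Ch + k] is the total coefficient of [d]: twice [Ch] from the comparison, once from the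
   initial layer, and [k] from the damping. *)
pose d := e / (3 * Ch + k).
have d0 : 0 < d by rewrite divr_gt0.
have dE : d * (3 * Ch + k) = e by rewrite /d divfK// gt_eqF.
have [t0 [h [H [D]]]] := exists_subsolution HW q1 k0 bet0 HU U0 Ueq Htr rho0 rhoO Hfar M10
  (ex_intro _ C KO) t_0 tT d0.
set w := jadd _ _; set K := _ `*` _ => -[[t00 h0 t0h] [KD Hw] [Ksub Kinit Kfar] Kclose].
have B0 : 0 <= k * (M1 * (3 * t)) by rewrite !mulr_ge0// ltW.
have [G [IG HG EG]] := Hkato w D t0 h t d (k * (M1 * (3 * t)))
  (And4 t00 h0 t0h tT') KD Hw (ltW d0) B0 Ksub Kinit Kfar.
have t0t : t0 <= t by rewrite (le_trans _ t0h)// lerDl ltW.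
have r2 : 0 < rho ^+ 2 by rewrite exprn_gt0.
have s01 : rho ^+ 2 / 2 < rho ^+ 2 by rewrite ltr_pdivrMr// ltr_pMr// ltr1n.
have [P1 P2 P3 P4 P5] := plateauP a s01.
set psi := jplat _ _ _ in P1 P2 P3 P4 P5 HG *.
have [u1 u2 u3 u4 u5] := riseP t t_0.
have om0 s : 0 <= rise1 t t s by have /andP[] := u4 s.
have [I1 E1] := intg_rise_heat a t t_0.
have [Iom Eom] := Int_rise t t_0.
have sg s : rise1 t t s != 0 -> 0 < s.
  by move=> hs; rewrite (lt_le_trans t_0)// leNgt; apply/negP => /ltW /u1[_ h']; rewrite h' eqxx in hs.
have mid : measurable_fun setT ((fun s => s) : measurableTypeR R -> R) by exact: measurable_id.
have [I2 E2] := heat_time_int a mid om0 sg Iom.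
rewrite Eom in E2.
pose c1 := 2 * d * Ch; pose c2 := (dampA (N := N) alpha q k * (2 `^ bet * t `^ bet) + d) * k.
have c10 : 0 <= c1 by apply: mulr_ge0 Ch0; apply: mulr_ge0 (ltW d0).
have c20 : 0 <= c2.
  apply: mulr_ge0 kk; apply: addr_ge0 (ltW d0); apply: mulr_ge0 dA _.
  by apply: mulr_ge0; exact: powR_ge0.
apply: (@le_trans _ _ (Int mu (fun p => c1 * (rise1 t t p.2 * heat 1 (p.1 - a))
   + c2 * (rise1 t t p.2 * heat p.2 (p.1 - a)) + G p))); last first.
  rewrite IntD//; last by apply: intgD; exact: intgZ.
  rewrite IntD; [|exact: intgZ|exact: intgZ].
  rewrite !IntZ// E1 E2 !mulr1 (le_trans (lerD (lexx _) EG))//.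
  have -> : c1 + c2 + (d * Ch + k * (M1 * (3 * t)) * Kv) =
    K1 * t + K2 * t `^ bet + d * (3 * Ch + k) by rewrite /c1 /c2 /K1 /K2; ring.
  by rewrite dE.
apply: Int_le.
- exact: intg_W_window.
- by apply: intgD => //; apply: intgD; exact: intgZ.
move=> p; set om := rise1 t t p.2.
have /andP[q0 q1'] := P2 p.
have Om0 : 0 <= om := om0 _.
have hk1 : 0 <= heat 1 (p.1 - a) by rewrite ltW// heat_gt0.
have hk2 : 0 <= heat p.2 (p.1 - a) by rewrite ltW// heat_gt0.
have omp0 : 0 <= om * j0 psi p by exact: mulr_ge0.
have X1 : 0 <= c1 * (om * heat 1 (p.1 - a)) by apply: mulr_ge0 => //; exact: mulr_ge0.
have X2 : 0 <= c2 * (om * heat p.2 (p.1 - a)) by apply: mulr_ge0 => //; exact: mulr_ge0.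
have X3 : 0 <= G p by apply: le_trans (HG p); apply: mulr_ge0 => //; exact: pos_ge0.
have [z0|nz] := eqVneq (om * j0 psi p) 0.
  by rewrite z0 mulr0 addr_ge0// addr_ge0.
have omn : om != 0 by apply: contraNneq nz => ->; rewrite mul0r.
have psn : j0 psi p != 0 by apply: contraNneq nz => ->; rewrite mulr0.
have sp : sqn (p.1 - a) <= rho ^+ 2.
  by rewrite leNgt; apply/negP => /ltW /P4 h'; rewrite h' eqxx in psn.
have np : `|p.1 - a| <= rho.
  by rewrite -(@ler_pXn2r _ 2) ?nnegrE ?(ltW rho0)// (le_trans (norm_sqr_le_sqn _)).
have tp : t <= p.2 by rewrite leNgt; apply/negP => /ltW /u1[_ h']; rewrite /om h' eqxx in omn.
have pt : p.2 <= 2 * t.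
  rewrite mulr_natl mulr2n leNgt; apply/negP => /ltW /u2[_ h'].
  by rewrite /om h' eqxx in omn.
have Kp : K p by split => //=; rewrite in_itv /= (le_trans t0t tp) pt.
have p20 : 0 < p.2 by exact: lt_le_trans tp.
have Qp : Q p.
  by split; [exact: rhoO|rewrite /= in_itv /= p20 (le_lt_trans pt)].
have [/andP[m0 m1] mb] := @damp_bounds R N alpha q k bet0 d t0 p.2 (ltW d0) t00 (le_trans t0t tp).
set m := damp alpha q k d t0 p.2 in m0 m1 mb.
have mb' : 1 - m <= dampA (N := N) alpha q k * (2 `^ bet * t `^ bet) + d.
  apply: (le_trans mb); rewrite lerD2r ler_wpM2l// -powRM ?(ltW t_0)//.
  by apply: ge0_ler_powR; rewrite ?nnegrE ?(ltW bet0) ?(ltW p20)// mulr_ge0 ?ltW.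
have cl := Kclose p Kp tp; have Vh := weak_le_heat HW hC2 Qp.
have wE : j0 w p = m * j0 H p - j0 U p.
  by rewrite -[LHS]/(m * j0 H p + -1 * j0 U p) mulN1r.
set g := k * heat p.2 (p.1 - a) in cl Vh.
have g0 : 0 <= g by exact: mulr_ge0.
have Wp : W p <= 2 * d + (1 - m) * g + pos (j0 w p).
  have m2 : 0 <= 1 - m by rewrite subr_ge0.
  rewrite /excess patchE1// {1}/pos ge_max; apply/andP; split; last first.
    apply: addr_ge0 (pos_ge0 _); apply: addr_ge0; last exact: mulr_ge0.
    by apply: mulr_ge0 (ltW d0).
  have hw := ge_pos (j0 w p); rewrite wE in hw *.
  have /andP[cl1 cl2] : - d <= g - j0 H p <= d by rewrite -ler_norml.
  have h1 : (1 - m) * j0 H p <= (1 - m) * (g + d).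
    by rewrite ler_wpM2l ?subr_ge0// -lerBlDl -opprB lerNl.
  have h2 : (1 - m) * d <= d by rewrite ler_piMl ?(ltW d0)// lerBlDr lerDl ltW.
  exact: damped_comparison hw h1 h2 Vh cl2.
apply: (le_trans (ler_wpM2r omp0 Wp)).
rewrite 2!mulrDl; apply: lerD (HG p); apply: lerD.
  have -> : c1 * (om * heat 1 (p.1 - a)) = 2 * d * (om * (Ch * heat 1 (p.1 - a))) by rewrite /c1; ring.
  have d20 : 0 <= 2 * d by rewrite mulr_ge0 ?(ltW d0).
  by apply: ler_wpM2l => //; apply: ler_wpM2l => //; exact: le_trans q1' (HCh _ sp).
have -> : c2 * (om * heat p.2 (p.1 - a)) =
   (dampA (N := N) alpha q k * (2 `^ bet * t `^ bet) + d) * g * om by rewrite /c2 /g; ring.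
apply: ler_pM => //; first by rewrite mulr_ge0// subr_ge0.
  by rewrite ler_wpM2r.
by rewrite ler_piMr.
Qed.

(** Near [a] this is [trace_near]. Away from [a] the Gaussian bound gives [W <= k M1 * 2 t],
    integrated over a bounded region. *)
Lemma excess_window (r e t1 : R) : 1 <= r -> 0 < e -> 0 < t1 -> exists2 t, 0 < t < t1 &
  Int mu (fun p => W p * (rise1 t t p.2 * j0 (jplat a (r ^+ 2) (2 * r ^+ 2)) p)) <= e.
Proof.
move=> r1 e0 t10.
have [rho [K1 [K2 [ts [rho0 K10 K20 ts0 Hnear]]]]] := trace_near.
have [M1 M10 Hfar] := @heat_far R N (rho / 4) (divr_gt0 rho0 (ltr0Sn _ _)).
have [Ch Ch0 HCh] := @heat_one R N (2 * r ^+ 2).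
have kk := ltW k0.
pose K3 := k * M1 * 2 * Ch.
have K30 : 0 <= K3 by rewrite /K3 !mulr_ge0.
have e4 : 0 < e / 4 by rewrite divr_gt0.
have KK : 0 < K1 + K3 + 1 by rewrite ltr_wpDl// addr_ge0.
have K2' : 0 < K2 + 1 by rewrite ltr_wpDl.
(* [t <= tb] makes [K2 * t^bet] at most [e / 4]; this uses [bet > 0]. *)
pose tb := (e / 4 / (K2 + 1)) `^ bet^-1.
have tb0 : 0 < tb by rewrite powR_gt0// divr_gt0.
have [t [t_0 tt1 tts tT [tK ttb]]] : exists t, [/\ 0 < t, t < t1, t < ts, 2 * t < T &
    t * (K1 + K3 + 1) <= e / 4 /\ t <= tb].
  exists (Num.min (Num.min (t1 / 2) (ts / 2)) (Num.min (T / 4) (Num.min (e / 4 / (K1 + K3 + 1)) tb))).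
  set t := Num.min _ _.
  have b1 : t <= t1 / 2 by rewrite /t !ge_min lexx.
  have b2 : t <= ts / 2 by rewrite /t !ge_min lexx !orbT.
  have b3 : t <= T / 4 by rewrite /t !ge_min lexx !orbT.
  have b4 : t <= e / 4 / (K1 + K3 + 1) by rewrite /t !ge_min lexx !orbT.
  have b5 : t <= tb by rewrite /t !ge_min lexx !orbT.
  split.
  - by rewrite /t !lt_min tb0 !divr_gt0.
  - by rewrite (le_lt_trans b1)// ltr_pdivrMr// ltr_pMr// ltr1n.
  - by rewrite (le_lt_trans b2)// ltr_pdivrMr// ltr_pMr// ltr1n.
  - rewrite mulrC -ltr_pdivlMr// (le_lt_trans b3)// ltr_pM2l// ltf_pV2 ?posrE// ltr_nat//.
  - by split => //; rewrite -ler_pdivlMr.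
exists t; first by rewrite t_0.
have tbet : K2 * t `^ bet <= e / 4.
  apply: (@le_trans _ _ ((K2 + 1) * (e / 4 / (K2 + 1)))); last first.
    by rewrite mulrC divfK// gt_eqF.
  apply: ler_pM; rewrite ?powR_ge0 ?lerDl//.
  apply: (@le_trans _ _ (tb `^ bet)).
    by apply: ge0_ler_powR; rewrite ?nnegrE ?(ltW bet0) ?(ltW t_0) ?(ltW tb0).
  by rewrite /tb -powRrM mulVf ?gt_eqF// powRr1// ltW// divr_gt0.
have near := Hnear t (e / 4) (_ : 0 < t < ts) e4; rewrite t_0 tts in near.
have {}near := near erefl.
have r0 : 0 < r by exact: lt_le_trans r1.
have s01 : rho ^+ 2 / 2 < rho ^+ 2 by rewrite ltr_pdivrMr ?exprn_gt0// ltr_pMr ?exprn_gt0// ltr1n.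
have s02 : r ^+ 2 < 2 * r ^+ 2 by rewrite ltr_pMl ?exprn_gt0// ltr1n.
have [P1 P2 P3 P4 P5] := plateauP a s01.
have [S1 S2 S3 S4 S5] := plateauP a s02.
set psi := jplat a (rho ^+ 2 / 2) _ in near P1 P2 P3 P4 P5 *.
set chi := jplat a (r ^+ 2) _ in S1 S2 S3 S4 S5 *.
have [u1 u2 u3 u4 u5] := riseP t t_0.
have [I1 E1] := intg_rise_heat a t t_0.
have Ip := intg_W_window t t_0 P1 P2.
have c0 : 0 <= k * (M1 * (2 * t)) * Ch by rewrite !mulr_ge0// ltW.
apply: (@le_trans _ _ (Int mu (fun p => W p * (rise1 t t p.2 * j0 psi p) +
   k * (M1 * (2 * t)) * Ch * (rise1 t t p.2 * heat 1 (p.1 - a))))); last first.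
  rewrite IntD//; last exact: intgZ.
  rewrite IntZ// E1 mulr1 (le_trans (lerD near (lexx _)))//.
  have h1 : K1 * t + k * (M1 * (2 * t)) * Ch <= e / 4.
    apply: le_trans tK; have -> : K1 * t + k * (M1 * (2 * t)) * Ch = t * (K1 + K3) by rewrite /K3; ring.
    by rewrite ler_wpM2l ?(ltW t_0)// lerDl.
  exact: add_quarters h1 tbet e0.
apply: Int_le.
- exact: intg_W_window.
- by apply: intgD => //; exact: intgZ.
move=> p; have /andP[om0 _] := u4 p.2; set om := rise1 t t p.2 in om0 *.
have /andP[p0 p1] := P2 p; have /andP[x0 x1] := S2 p.
have hk : 0 <= heat 1 (p.1 - a) by rewrite ltW// heat_gt0.
have [near'|far] := leP (sqn (p.1 - a)) (rho ^+ 2 / 2).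
  rewrite (P3 p near') mulr1 -[leLHS]addr0 lerD//.
    by rewrite ler_wpM2l// ler_piMr.
  by apply: mulr_ge0 => //; exact: mulr_ge0.
rewrite -[leLHS]add0r lerD//; first by apply: mulr_ge0 => //; exact: mulr_ge0.
have [z0|nz] := eqVneq om 0; first by rewrite z0 !mul0r !mulr0.
have tp : t <= p.2 by rewrite leNgt; apply/negP => /ltW /u1[_ h']; rewrite /om h' eqxx in nz.
have pt : p.2 <= 2 * t.
  rewrite mulr_natl mulr2n leNgt; apply/negP => /ltW /u2[_ h'].
  by rewrite /om h' eqxx in nz.
have [h|] := ltP (2 * r ^+ 2) (sqn (p.1 - a)).
  by rewrite (S4 p (ltW h)) !mulr0; apply: mulr_ge0 => //; exact: mulr_ge0.
move=> /HCh chle.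
have -> : k * (M1 * (2 * t)) * Ch * (om * heat 1 (p.1 - a)) =
  k * (M1 * (2 * t)) * (om * (Ch * heat 1 (p.1 - a))) by ring.
have p20 : 0 < p.2 by exact: lt_le_trans tp.
have Wb : W p <= k * (M1 * (2 * t)).
  have [Qp|Qp] := pselect (Q p); last first.
    by rewrite /excess patchE0// !mulr_ge0// ltW.
  apply: (le_trans (Wheat Qp)); rewrite ler_wpM2l//.
  apply: (@le_trans _ _ (M1 * p.2)); last by rewrite ler_wpM2l.
  apply: Hfar => //; rewrite (le_trans _ (ltW far))// expr_div_n.
  rewrite ler_wpM2l ?exprn_ge0 ?(ltW rho0)// lef_pV2 ?posrE ?exprn_gt0//.
  by rewrite -natrX ler_nat.
apply: ler_pM => //; first exact: mulr_ge0.
by rewrite ler_wpM2l// (le_trans x1).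
Qed.

(** A positive value at [p] gives positive mass [c] on a later window. The subsolution inequality,
    tested with a plateau times a cutoff rising on [[t, 2 t]] and falling on that later window,
    bounds [c] by the mass on the early window plus an error [M / r] times the integral of [W]. Each
    is made at most [c / 4]. *)
Lemma excess_eq0 p : Q p -> W p = 0.
Proof.
move=> Qp; apply/eqP; rewrite eq_le W0 andbT leNgt; apply/negP => Wp.
have [/= Op] := Qp; rewrite /= in_itv /= => /andP[p20 p2T].
pose s1 := p.2 / 2; have s10 : 0 < s1 by rewrite divr_gt0.
have s1p : s1 < p.2 by rewrite ltr_pdivrMr// ltr_pMr// ltr1n.
pose d1 := (p.2 + T) / 2 - s1.
have s1d : s1 + d1 = (p.2 + T) / 2 by rewrite addrC subrK.
have pd : p.2 < s1 + d1 by rewrite s1d ltr_pdivlMr// mulrDr !mulr1 ltrD2l.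
have dT : s1 + d1 < T by rewrite s1d ltr_pdivrMr// mulrDr !mulr1 ltrD2r.
have d10 : 0 < d1 by rewrite -(ltrDl s1) (lt_trans s1p).
clearbody s1 d1.
have [u1 u2 u3 u4 u5] := riseP s1 d10.
have [M M0 HM] := @wide_plateau R N a.
pose r0 := N%:R * `|p.1 - a| + `|p.1 - a| + 1.
have r01 : 1 <= r0 by rewrite lerDr addr_ge0// mulr_ge0.
have sqr0 : sqn (p.1 - a) <= r0 ^+ 2.
  apply: (le_trans (sqn_le_norm _)).
  have h1 : N%:R * `|p.1 - a| <= r0 by rewrite /r0 -addrA lerDl addr_ge0.
  have h2 : `|p.1 - a| <= r0 by rewrite /r0 addrAC -[leLHS]add0r addrAC [X in _ <= X]addrAC lerD2r addr_ge0// mulr_ge0.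
  by rewrite expr2 mulrA [r0 ^+ 2]expr2; apply: ler_pM => //; rewrite mulr_ge0.
clearbody r0.
have plat (r : R) : 1 <= r -> r ^+ 2 < 2 * r ^+ 2.
  by move=> r1; rewrite ltr_pMl ?exprn_gt0 ?(lt_le_trans ltr01)// ltr1n.
have [S1 S2 S3 S4 S5] := plateauP a (plat _ r01).
set chi0 := jplat a (r0 ^+ 2) _ in S1 S2 S3 S4 S5.
pose g p := W p * (rise1 s1 d1 p.2 * j0 chi0 p).
have Ig : intg mu g by exact: intg_W_window.
have om0 s : 0 <= rise1 s1 d1 s by have /andP[] := u4 s.
have g0 p' : 0 <= g p'.
  by apply: mulr_ge0 => //; apply: mulr_ge0 => //; have /andP[] := S2 p'.
have cg : {for p, continuous g}.
  apply: cvgM; first exact: (continuous_excess HW HU Qp).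
  apply: cvgM; last exact: (C21_c0 S1).
  by apply: continuous_time; have [_ c1 _ _ _] := sc2_rise s1 d1; exact: c1.
have gp : 0 < g p by rewrite /g S3// mulr1 mulr_gt0// u5// s1p.
have := Int_gt0 Ig g0 cg gp; set c := Int mu g => c0.
have IW0 : 0 <= Int mu W by exact: Int_ge0.
(* The plateau of radius [r] must dominate the one of radius [r0] that defines [c], and [M / r]
   times the integral of [W] must be at most [c / 4]. *)
pose r := 2 * r0 + M * Int mu W / (c / 4).
have c4 : 0 < c / 4 by rewrite divr_gt0.
have rr : 2 * r0 <= r by rewrite lerDl divr_ge0 ?(ltW c4)// mulr_ge0.
have r1 : 1 <= r by rewrite (le_trans _ rr)// (le_trans r01)// ler_peMl ?(le_trans ler01)// ler1n.
have rpos : 0 < r by exact: lt_le_trans r1.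
have Mr : M / r * Int mu W <= c / 4.
  rewrite mulrAC ler_pdivrMr// [c / 4 * r]mulrC -ler_pdivrMr// /r lerDr mulr_ge0//.
  exact: le_trans r01.
have [t /andP[t_0 ts1] Hwin] := excess_window r1 c4 (divr_gt0 s10 (ltr0Sn _ 1)).
have t2s : t + t <= s1 by rewrite -mulr2n -mulr_natl mulrC -ler_pdivlMr// ltW.
have [v1 v2 v3 v4 v5] := riseP t t_0.
have [P1 P2 P3 P4 P5] := plateauP a (plat _ r1).
have [Ml _] := HM r p r1.
set chi := jplat a (r ^+ 2) _ in Hwin P1 P2 P3 P4 P5 Ml.
have Hs := sc2_mul (sc2_rise t t) (sc2_add (sc2_cst (1 : R)) (sc2_scale (-1) (sc2_rise s1 d1))).
set eta := (X in sc2 X _ _) in Hs; set eta1 := (X in sc2 _ X _) in Hs.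
have etaE s : eta s = rise t t s * (1 - rise s1 d1 s) by rewrite /eta /cst mulN1r.
have eta1E s : eta1 s = rise1 t t s - rise1 s1 d1 s.
  rewrite /eta1 /cst add0r !mulN1r mulrN; congr (_ - _).
    have [/ltW h|h] := ltP s (t + t); last by rewrite (v2 _ h).2 mul0r.
    by rewrite (u1 s _).1 ?subr0 ?mulr1// (le_trans h).
  have [/u1[_ ->]|h] := leP s s1; first by rewrite mulr0.
  by rewrite (v2 s _).1 ?mul1r// (le_trans t2s)// ltW.
have eta01 s : 0 <= eta s <= 1.
  rewrite etaE; have /andP[a1 a2] := v3 s; have /andP[a3 a4] := u3 s.
  have b2 : 0 <= 1 - rise s1 d1 s by rewrite subr_ge0.
  have b3 : 1 - rise s1 d1 s <= 1 by rewrite lerBlDr lerDl.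
  by apply/andP; split; [exact: mulr_ge0|exact: mulr_ile1].
pose z := jmul chi (@jtime R N eta eta1).
have Hz : C21 setT z by apply: C21_mul => //; exact: C21_sc2_time Hs.
have zE p' : j0 z p' = j0 chi p' * eta p'.2 by [].
have z0 p' : 0 <= j0 z p'.
  by rewrite zE mulr_ge0//; [have /andP[] := P2 p'|have /andP[] := eta01 p'.2].
pose b := `|a| + 2 * r.
have zb (p' : E) : b < `|p'.1| -> j0 z p' = 0.
  move=> hb; rewrite zE P4 ?mul0r//.
  apply: le_trans (norm_sqr_le_sqn _).
  have h1 : 2 * r <= `|p'.1 - a|.
    by rewrite (le_trans _ (lerB_dist _ _))// lerBrDl ltW.
  have : (2 * r) ^+ 2 <= `|p'.1 - a| ^+ 2 by rewrite lerXn2r ?nnegrE ?mulr_ge0 ?(ltW rpos).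
  by apply: le_trans; rewrite exprMn ler_wpM2r ?exprn_ge0 ?(ltW rpos)// -natrX ler_nat.
have zt1 (p' : E) : p'.2 < t -> j0 z p' = 0.
  by move=> /ltW /v1[h _]; rewrite zE etaE h mul0r mulr0.
have zt2 (p' : E) : s1 + d1 < p'.2 -> j0 z p' = 0.
  by move=> /ltW /u2[h _]; rewrite zE etaE h subrr !mulr0.
have main := excess_ineq HW hC2 (ltW q1) AE HU U0 Ueq t_0 dT Hz z0 zb zt1 zt2.
have Iz := intg_m_jbh HW (measurable_excess HW HU) W0 WV Hz zb.
have Iw := intg_W_window t t_0 P1 P2.
have : c <= Int mu (fun p => W p * jbh z p + W p * (rise1 t t p.2 * j0 chi p) + M / r * W p).
  apply: Int_le => //; first by apply: intgD; [exact: intgD|exact: intgZ].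
  move=> p'; have /andP[x0 x1] := P2 p'; have /andP[y0 y1] := S2 p'.
  have /andP[n0 n1] := eta01 p'.2.
  have jb : jbh z p' = - jlap chi p' * eta p'.2 - j0 chi p' * (rise1 t t p'.2 - rise1 s1 d1 p'.2).
    by rewrite jbh_mul_time -eta1E /jbh P5 oppr0 sub0r.
  have [Ml' _] := HM r p' r1.
  have J : jlap chi p' * eta p'.2 <= M / r.
    rewrite (le_trans (ler_norm _))// normrM (ger0_norm n0) -[leRHS]mulr1.
    by apply: ler_pM.
  have cc : j0 chi0 p' <= j0 chi p'.
    have [h|h] := leP (2 * r0 ^+ 2) (sqn (p'.1 - a)); first by rewrite S4.
    rewrite [j0 chi p']P3// (le_trans (ltW h))//.
    have r00 : 0 <= r0 by exact: le_trans r01.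
    apply: (@le_trans _ _ ((2 * r0) ^+ 2)); last by rewrite lerXn2r ?nnegrE ?mulr_ge0 ?(ltW rpos).
    by rewrite exprMn ler_wpM2r ?exprn_ge0// -natrX ler_nat.
  have -> : W p' * jbh z p' + W p' * (rise1 t t p'.2 * j0 chi p') + M / r * W p' =
    W p' * (rise1 s1 d1 p'.2 * j0 chi p' + (M / r - jlap chi p' * eta p'.2)) by rewrite jb; ring.
  rewrite /g ler_wpM2l// -[leLHS]addr0 lerD ?subr_ge0// ler_wpM2l//.
rewrite IntD; [|exact: intgD|exact: intgZ].
rewrite IntD// IntZ//.
exact: sum_halves_lt main Hwin Mr c0.
Qed.

End vanishing.

(** * The classical solution as a jet, and the conclusion *)

Section classical_jet.
Context {R : realType} {N : nat}.
Notation E := ('rV[R]_N * R)%type.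
Variables (Omega : set 'rV[R]_N) (T : R) (u : 'rV[R]_N -> R -> R).
Notation Q := (cylinder Omega T).

Definition classical_jet : @jet R N := Jet (fun p => u p.1 p.2)
  (fun p => derive1 (u p.1) p.2) (fun i p => partial i (u^~ p.2) p.1)
  (fun i j p => partial j (partial i (u^~ p.2)) p.1).

Lemma is_derive_slice (f : 'rV[R]_N -> R -> R) (p : E) i : derivable (f^~ p.2) p.1 (basis_vec i) ->
  is_derive p (dirx i) (fun p : E => f p.1 p.2) (partial i (f^~ p.2) p.1).
Proof.
move=> D; have : is_derive p.1 (basis_vec i) (f^~ p.2) (partial i (f^~ p.2) p.1).
  by split; [exact: D|].
move=> /is_derive_lineP H; apply/is_derive_lineP.
rewrite (_ : (fun h : R => _) = fun h : R => f (h *: basis_vec i + p.1) p.2)//.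
by apply/funext => h; rewrite /= scaler0 add0r.
Qed.

Lemma C21_classical_jet : open Omega -> class_C21 Omega T u -> C21 Q classical_jet.
Proof.
move=> oO [c0 [dt ct] dx dxx]; have oQ : open (Q : set E) by exact: open_cylinder.
split.
- by move=> p Qp; exact: (within_open_continuous oQ c0 Qp).
- by move=> p Qp; exact: (within_open_continuous oQ ct Qp).
- by move=> p Qp i; exact: (within_open_continuous oQ (dx i).2 Qp).
- by move=> p Qp i j; exact: (within_open_continuous oQ (dxx i j).2 Qp).
- move=> p Qp; have : is_derive p.2 1 (u p.1) (derive1 (u p.1) p.2).
    by rewrite derive1E; split; [exact: dt|].
  move=> /is_derive_lineP H; apply/is_derive_lineP.
  rewrite (_ : (fun h : R => _) = fun h : R => u p.1 (h *: 1 + p.2))//.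
  by apply/funext => h; rewrite /= scaler0 add0r.
- by move=> p Qp i; apply: is_derive_slice; exact: (dx i).1.
- move=> p Qp i j.
  by apply: (is_derive_slice (f := fun x t => partial i (u^~ t) x)); exact: (dxx i j).1.
Qed.

Lemma jfh_classical_jet (alpha q : R) : 1 < q -> (forall x t, Omega x -> 0 < t < T -> 0 < u x t) ->
  absorption_heat_eq Omega T alpha q u -> forall p, Q p ->
  jfh classical_jet p = - (p.2 `^ alpha * j0 classical_jet p `^ q).
Proof.
move=> q1 pos_u eq_u p [Op]; rewrite /= in_itv /= => tT.
have u0 := pos_u _ _ Op tT; have := eq_u _ _ Op tT.
rewrite -[jfh classical_jet p]/(derive1 (u p.1) p.2 - laplacian (u^~ p.2) p.1).
move=> /eqP; rewrite addr_eq0 => /eqP ->; rewrite gtr0_norm// -mulrA [_ * u p.1 p.2]mulrC.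
by rewrite mulr_powRB1 ?(ltW u0)// (lt_trans ltr01).
Qed.

End classical_jet.

Theorem theoremD (R : realType) (N : nat) (hN : (0 < N)%N)
    (Omega : set 'rV[R]_N) (hopen : open Omega) (hconn : connected Omega)
    (hbdry : compact (boundary Omega)) (hC2 : C2_boundary Omega)
    (T alpha q : R) (hT : 0 < T) (halpha : -1 < alpha)
    (hq : 1 < q < 1 + 2 * (1 + alpha) / N%:R)
    (u : 'rV[R]_N -> R -> R) (hu : class_C21 Omega T u)
    (hpos : forall x t, Omega x -> 0 < t < T -> 0 < u x t)
    (heq : absorption_heat_eq Omega T alpha q u)
    (S : set 'rV[R]_N) (mu : {measure set 'rV[R]_N -> \bar R})
    (htrace : initial_trace Omega u S mu)
    (a : 'rV[R]_N) (ha : S a)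
    (uk : R -> 'rV[R]_N -> R -> R)
    (huk : forall k, 0 < k -> dirac_solution Omega T alpha q a k (uk k)) :
  forall x t, Omega x -> 0 < t < T -> (u_infty uk x t <= (u x t)%:E)%E.
Proof.
move=> x t Ox tT; have /andP[q1 qN] := hq.
have [[F _ SF] _ _ blowup] := htrace.
have Oa : Omega a by move: ha; rewrite SF => -[].
have N0 : 0 < N%:R :> R by rewrite ltr0n.
have bet0 : 0 < @bet R N alpha q.
  (* Positivity of [bet] is the upper bound on [q], rearranged. *)
  rewrite /bet subr_gt0 mulrAC ltr_pdivrMr// mulrC -ltr_pdivlMr//.
  by rewrite ltrBlDl [(1 + alpha) * 2]mulrC.
have HU := C21_classical_jet hopen hu.
have U0 p : cylinder Omega T p -> 0 < j0 (classical_jet u) p.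
  by move=> [Op]; rewrite /= in_itv /=; exact: hpos.
have Ueq := jfh_classical_jet q1 hpos heq.
have Htr B : open B -> B `<=` Omega -> B a ->
    (\int[leb R N]_(x in B) (j0 (classical_jet u) (x, t))%:E)%E @[t --> 0^'+] --> +oo%E.
  by move=> oB BO Ba; apply: blowup => //; exists a.
have le_uk k : 0 < k -> uk k x t <= u x t.
  move=> k0; have HW := weak_of_dirac hopen Oa (ltW k0) (ltW q1) (huk k k0).
  have Qxt : cylinder Omega T (x, t) by split => //=; rewrite in_itv.
  have AE p : cylinder Omega T p ->
      ((fun p => p.2 `^ alpha * uk k p.1 p.2 `^ q) \_ (cylinder Omega T)) p =
      p.2 `^ alpha * ((fun p => uk k p.1 p.2) \_ (cylinder Omega T)) p `^ q.
    by move=> Qp; rewrite !patchE1.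
  have := excess_eq0 HW hC2 q1 halpha k0 hT bet0 AE HU U0 Ueq Htr Qxt.
  rewrite /excess !patchE1//= => h.
  by rewrite -subr_le0 -h ge_pos.
rewrite /u_infty; have [cv|ncv] := pselect (cvg ((uk k x t)%:E @[k --> +oo%R])).
  apply: lime_le => //; near=> k; rewrite lee_fin; apply: le_uk.
  by near: k; exact: nbhs_pinfty_gt.
(* [lim] is total: without convergence it takes the default value 0, which lies below [u x t] by
   positivity. *)
by rewrite (dvgP ncv) lee_fin ltW// hpos.
Unshelve. all: by end_near. Qed.
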